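(* Let $n \ge 3$ and $a, b, d$ be positive integers satisfying the following properties. (1) $a$ and $b$ are coprime. (2) $d$ is divisible by both $a$ and $b$, and $d/a \ge 2$, $d/b \ge 2$. (3) There is a prime number $p$ which divides $d/b$ but not $d/a$. (4) $n+a \le d < n + a + b$. Then a very general weighted hypersurface $X$ of degree $d$ in $\mathbb{P}(1^n,a,b)$, defined over $\mathbb{C}$, is a nonsingular Fano $n$-fold which is not stably rational.
   Context: $\mathbb{P}(1^n,a,b)$ denotes the weighted projective space of dimension $n+1$ with $n$ homogeneous coordinates of weight $1$, one of weight $a$ and one of weight $b$. A weighted hypersurface of degree $d$ is the zero locus of a weighted homogeneous polynomial of degree $d$. ''Very general'' means: for defining polynomials outside a countable union of proper closed subvarieties of the parameter space of weighted homogeneous polynomials of degree $d$. A variety $X$ is stably rational if $X\times\mathbb{P}^k$ is rational for some $k\ge0$. Fano means that the anticanonical divisor is ample. *)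

(* Defs.v *)
From HB Require Import structures.
From mathcomp Require Import all_boot all_order all_algebra.
From mathcomp Require Import mpoly complex.
From mathcomp Require Import boolp classical_sets reals.

Set Implicit Arguments.
Unset Strict Implicit.
Unset Printing Implicit Defensive.

Import GRing.Theory.
Local Open Scope ring_scope.
Local Open Scope classical_set_scope.

(** Varieties over an algebraically closed field [k] are treated classically:
    a variety is its set of closed points, with the Zariski topology and the
    sheaf of [k]-valued regular functions.  Functions on an open set [U] are
    represented by total functions, [regular U f] being a property of the
    restriction of [f] to [U]. *)

Record space (k : fieldType) := Space {
  point_of :> Type;
  zopen : set (set point_of);
  regular : set point_of -> set (point_of -> k);
  zopenT : zopen setT;
  zopenI : forall U V, zopen U -> zopen V -> zopen (U `&` V);
  zopen_bigcup : forall F : set (set point_of),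
    F `<=` zopen -> zopen (\bigcup_(U in F) U);
  regular_local : forall U f,
    (forall P, U P -> exists V g,
       [/\ zopen V, V P, regular V g & forall Q, U Q -> V Q -> f Q = g Q]) ->
    regular U f;
  regular_cst : forall U (c : k), zopen U -> regular U (fun=> c);
  regularD : forall U f g, zopen U -> regular U f -> regular U g ->
    regular U (fun P => f P + g P);
  regularM : forall U f g, zopen U -> regular U f -> regular U g ->
    regular U (fun P => f P * g P);
  regularV : forall U f, zopen U -> regular U f -> (forall P, U P -> f P != 0) ->
    regular U (fun P => (f P)^-1);
  zopen_neq0 : forall U f, zopen U -> regular U f ->
    zopen [set P | U P /\ f P != 0]
}.

Arguments zopen {k} X _ : rename.
Arguments regular {k} X _ _ : rename.

Section SpaceTheory.
Variables (k : fieldType) (X : space k).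
Implicit Types (U V : set X) (f g : X -> k).

Lemma zopen_locally U :
  (forall P, U P -> exists V, [/\ zopen X V, V P & V `<=` U]) -> zopen X U.
Proof.
move=> h.
have -> : U = \bigcup_(V in [set V | zopen X V /\ V `<=` U]) V.
  apply/seteqP; split=> [P /h [V [oV VP VU]]|P [V [_ VU] /VU]] //.
  by exists V.
by apply: zopen_bigcup => V [].
Qed.

Lemma regular_restrict U V f :
  zopen X V -> U `<=` V -> regular X V f -> regular X U f.
Proof. by move=> oV UV rf; apply: regular_local => P /UV VP; exists V, f. Qed.

End SpaceTheory.

Definition zclosed (k : fieldType) (X : space k) (Z : set X) : Prop :=
  zopen X (~` Z).

Section Subspace.
Variables (k : fieldType) (X : space k) (A : set X).

Let pt := {P : X | A P}.

Let sub_open : set (set pt) :=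
  [set W | exists2 U, zopen X U & W = [set P | U (sval P)]].

Let sub_regular (W : set pt) (f : pt -> k) : Prop :=
  forall P, W P -> exists U g,
    [/\ zopen X U, U (sval P), regular X U g &
        forall Q, W Q -> U (sval Q) -> f Q = g (sval Q)].

Fact sub_openT : sub_open setT.
Proof. by exists setT; first exact: zopenT. Qed.

Fact sub_openI W1 W2 : sub_open W1 -> sub_open W2 -> sub_open (W1 `&` W2).
Proof.
by move=> [U oU ->] [V oV ->]; exists (U `&` V); first exact: zopenI.
Qed.

Fact sub_open_bigcup (F : set (set pt)) :
  F `<=` sub_open -> sub_open (\bigcup_(U in F) U).
Proof.
move=> oF.
exists (\bigcup_(U in [set U | zopen X U /\ F [set P | U (sval P)]]) U).
  by apply: zopen_bigcup => U [].
apply/seteqP; split=> [P [W FW WP]|P [U [oU FU] UP]].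
  by have [U oU eW] := oF _ FW; subst W; exists U.
by exists [set Q | U (sval Q)].
Qed.

Fact sub_regular_local (W : set pt) f :
  (forall P, W P -> exists V g,
     [/\ sub_open V, V P, sub_regular V g &
         forall Q, W Q -> V Q -> f Q = g Q]) ->
  sub_regular W f.
Proof.
move=> h P WP; have [V [g [[U oU ->] UP rg fg]]] := h P WP.
have [U' [g' [oU' U'P rg' gg']]] := rg P UP.
exists (U `&` U'), g'; split; [exact: zopenI | by [] | | ].
  exact: (regular_restrict oU' (@subIsetr _ _ _)).
by move=> Q WQ [UQ U'Q]; rewrite fg // gg'.
Qed.

Fact sub_regular_cst W (c : k) : sub_open W -> sub_regular W (fun=> c).
Proof.
move=> _ P WP; exists setT, (fun=> c).
by split=> //; [exact: zopenT | exact/regular_cst/zopenT].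
Qed.

Fact sub_regularD W f g : sub_open W -> sub_regular W f -> sub_regular W g ->
  sub_regular W (fun P => f P + g P).
Proof.
move=> _ rf rg P WP.
have [U [f' [oU UP rf' ff']]] := rf P WP.
have [V [g' [oV VP rg' gg']]] := rg P WP.
have oUV := zopenI oU oV.
exists (U `&` V), (fun Q => f' Q + g' Q); split=> //.
- apply: regularD => //.
    exact: (regular_restrict oU (@subIsetl _ _ _)).
  exact: (regular_restrict oV (@subIsetr _ _ _)).
- by move=> Q WQ [UQ VQ]; rewrite ff' // gg'.
Qed.

Fact sub_regularM W f g : sub_open W -> sub_regular W f -> sub_regular W g ->
  sub_regular W (fun P => f P * g P).
Proof.
move=> _ rf rg P WP.
have [U [f' [oU UP rf' ff']]] := rf P WP.
have [V [g' [oV VP rg' gg']]] := rg P WP.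
have oUV := zopenI oU oV.
exists (U `&` V), (fun Q => f' Q * g' Q); split=> //.
- apply: regularM => //.
    exact: (regular_restrict oU (@subIsetl _ _ _)).
  exact: (regular_restrict oV (@subIsetr _ _ _)).
- by move=> Q WQ [UQ VQ]; rewrite ff' // gg'.
Qed.

Fact sub_regularV W f : sub_open W -> sub_regular W f ->
  (forall P, W P -> f P != 0) -> sub_regular W (fun P => (f P)^-1).
Proof.
move=> _ rf nz P WP; have [U [g [oU UP rg fg]]] := rf P WP.
have oU' := zopen_neq0 oU rg.
exists [set Q | U Q /\ g Q != 0], (fun Q => (g Q)^-1); split=> //.
- by split=> //; rewrite -fg ?nz.
- apply: regularV => //; last by move=> Q [].
  by apply: regular_restrict rg => // Q [].
- by move=> Q WQ [UQ _]; rewrite fg.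
Qed.

Fact sub_open_neq0 W f : sub_open W -> sub_regular W f ->
  sub_open [set P | W P /\ f P != 0].
Proof.
move=> [V oV ->] rf.
pose ok U := zopen X U /\
  (forall Q : pt, U (sval Q) -> V (sval Q) /\ f Q != 0).
exists (\bigcup_(U in [set U | ok U]) U); first by apply: zopen_bigcup => U [].
apply/seteqP; split=> [P [VP fP]|P [U [_ /(_ P) h] /h]] //.
have [U [g [oU UP rg fg]]] := rf P VP.
exists (V `&` [set Q | U Q /\ g Q != 0]); last first.
  by split=> //; split=> //; rewrite -fg.
split; first exact/zopenI/zopen_neq0.
by move=> Q [VQ [UQ gQ]]; split=> //; rewrite fg.
Qed.

Definition subspace : space k :=
  Space sub_openT sub_openI sub_open_bigcup sub_regular_local sub_regular_cst
        sub_regularD sub_regularM sub_regularV sub_open_neq0.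

End Subspace.

(** The topology and the regular functions of [X * Y] are generated by the
    functions [\sum_i g_i(x) h_i(y)] with [g_i] and [h_i] regular; in
    particular the topology is finer than the product topology. *)

Section Product.
Variables (k : fieldType) (X Y : space k).

Let pt := (X * Y)%type.

Definition tensor (U : set X) (V : set Y) (F : pt -> k) : Prop :=
  exists (I : finType) (g : I -> X -> k) (h : I -> Y -> k),
    [/\ forall i, regular X U (g i), forall i, regular Y V (h i) &
        forall q, F q = \sum_i g i q.1 * h i q.2].

Lemma tensor_restrict U U' V V' F : zopen X U -> zopen Y V ->
  U' `<=` U -> V' `<=` V -> tensor U V F -> tensor U' V' F.
Proof.
move=> oU oV sU sV [I [g [h [rg rh e]]]]; exists I, g, h; split=> // i.
  exact: (regular_restrict oU sU).
exact: (regular_restrict oV sV).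
Qed.

Lemma tensor_cst U V c : zopen X U -> zopen Y V -> tensor U V (fun=> c).
Proof.
move=> oU oV; exists unit, (fun _ _ => c), (fun _ _ => 1).
split=> [_|_|q]; [exact: regular_cst | exact: regular_cst | ].
by rewrite big_const card_unit /= mulr1 addr0.
Qed.

Lemma tensorD U V F G : tensor U V F -> tensor U V G ->
  tensor U V (fun q => F q + G q).
Proof.
move=> [I [g [h [rg rh e]]]] [J [g' [h' [rg' rh' e']]]].
exists (I + J)%type,
  (fun i => match i with inl i => g i | inr j => g' j end),
  (fun i => match i with inl i => h i | inr j => h' j end).
by split=> [[]|[]|q] //; rewrite big_sumType e e'.
Qed.

Lemma tensorM U V F G : zopen X U -> zopen Y V -> tensor U V F -> tensor U V G ->
  tensor U V (fun q => F q * G q).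
Proof.
move=> oU oV [I [g [h [rg rh e]]]] [J [g' [h' [rg' rh' e']]]].
exists (I * J)%type, (fun i P => g i.1 P * g' i.2 P),
  (fun i P => h i.1 P * h' i.2 P).
split=> [i|i|q]; [exact: regularM | exact: regularM | ].
rewrite e e' big_distrlr /= pair_big /=.
by apply: eq_bigr => i _; rewrite mulrACA.
Qed.

Let prod_open : set (set pt) := [set W | forall p, W p -> exists U V F,
  [/\ zopen X U, zopen Y V & tensor U V F] /\
  [/\ U p.1, V p.2, F p != 0 &
      forall q, U q.1 -> V q.2 -> F q != 0 -> W q]].

Let prod_regular (W : set pt) (f : pt -> k) : Prop :=
  forall p, W p -> exists U V F G,
    [/\ zopen X U, zopen Y V, tensor U V F & tensor U V G] /\
    [/\ U p.1, V p.2, G p != 0 &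
        forall q, W q -> U q.1 -> V q.2 -> G q != 0 -> f q = F q / G q].

Fact prod_openT : prod_open setT.
Proof.
move=> p _; exists setT, setT, (fun=> 1); split; last first.
  by split=> //; exact: oner_neq0.
by split; [exact: zopenT | exact: zopenT | apply: tensor_cst; exact: zopenT].
Qed.

Fact prod_openI W1 W2 : prod_open W1 -> prod_open W2 -> prod_open (W1 `&` W2).
Proof.
move=> o1 o2 p [W1p W2p].
have [U [V [F [[oU oV tF] [Up Vp Fp sW1]]]]] := o1 p W1p.
have [U' [V' [F' [[oU' oV' tF'] [U'p V'p F'p sW2]]]]] := o2 p W2p.
exists (U `&` U'), (V `&` V'), (fun q => F q * F' q); split; split=> //.
- exact: zopenI.
- exact: zopenI.
- apply: tensorM; [exact: zopenI | exact: zopenI | |].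
    exact: (tensor_restrict oU oV (@subIsetl _ _ _) (@subIsetl _ _ _)).
  exact: (tensor_restrict oU' oV' (@subIsetr _ _ _) (@subIsetr _ _ _)).
- by rewrite mulf_neq0.
- move=> q [Uq U'q] [Vq V'q]; rewrite mulf_eq0 negb_or => /andP[Fq F'q].
  by split; [exact: sW1 | exact: sW2].
Qed.

Fact prod_open_bigcup (S : set (set pt)) :
  S `<=` prod_open -> prod_open (\bigcup_(U in S) U).
Proof.
move=> oS p [W SW Wp].
have [U [V [F [h [Up Vp Fp sW]]]]] := oS W SW p Wp.
by exists U, V, F; split=> //; split=> // q *; exists W => //; exact: sW.
Qed.

Fact prod_regular_local (W : set pt) f :
  (forall p, W p -> exists V g,
     [/\ prod_open V, V p, prod_regular V g &
         forall q, W q -> V q -> f q = g q]) ->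
  prod_regular W f.
Proof.
move=> loc p Wp; have [W' [g [oW' W'p rg fg]]] := loc p Wp.
have [U [V [H [[oU oV tH] [Up Vp Hp sW']]]]] := oW' p W'p.
have [U' [V' [F [G [[oU' oV' tF tG] [U'p V'p Gp gE]]]]]] := rg p W'p.
have oUU := zopenI oU oU'; have oVV := zopenI oV oV'.
have tH' := tensor_restrict oU oV (@subIsetl _ U U') (@subIsetl _ V V') tH.
have tF' := tensor_restrict oU' oV' (@subIsetr _ U U') (@subIsetr _ V V') tF.
have tG' := tensor_restrict oU' oV' (@subIsetr _ U U') (@subIsetr _ V V') tG.
exists (U `&` U'), (V `&` V'), (fun q => F q * H q), (fun q => G q * H q).
split; split=> //.
- exact: tensorM.
- exact: tensorM.
- by rewrite mulf_neq0.
- move=> q Wq [Uq U'q] [Vq V'q]; rewrite mulf_eq0 negb_or => /andP[Gq Hq].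
  have W'q : W' q by exact: sW'.
  by rewrite fg // gE // -mulf_div divff // mulr1.
Qed.

Fact prod_regular_cst W (c : k) : prod_open W -> prod_regular W (fun=> c).
Proof.
move=> _ p Wp; exists setT, setT, (fun=> c), (fun=> 1).
split; split=> //; do ?[exact: zopenT | apply: tensor_cst; exact: zopenT].
  exact: oner_neq0.
by move=> *; rewrite divr1.
Qed.

Let prod_regular2 (op : k -> k -> k) W f g :
  (forall F F' G G' : pt -> k, (forall U V, zopen X U -> zopen Y V ->
     tensor U V F -> tensor U V F' -> tensor U V G -> tensor U V G' ->
     exists2 H, tensor U V H & forall q, G q != 0 -> G' q != 0 ->
       op (F q / G q) (F' q / G' q) = H q / (G q * G' q))) ->
  prod_regular W f -> prod_regular W g -> prod_regular W (fun p => op (f p) (g p)).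
Proof.
move=> hop rf rg p Wp.
have [U [V [F [G [[oU oV tF tG] [Up Vp Gp fE]]]]]] := rf p Wp.
have [U' [V' [F' [G' [[oU' oV' tF' tG'] [U'p V'p G'p gE]]]]]] := rg p Wp.
have oUU := zopenI oU oU'; have oVV := zopenI oV oV'.
have {}tF := tensor_restrict oU oV (@subIsetl _ U U') (@subIsetl _ V V') tF.
have {}tG := tensor_restrict oU oV (@subIsetl _ U U') (@subIsetl _ V V') tG.
have {}tF' := tensor_restrict oU' oV' (@subIsetr _ U U') (@subIsetr _ V V') tF'.
have {}tG' := tensor_restrict oU' oV' (@subIsetr _ U U') (@subIsetr _ V V') tG'.
have [H tH HE] := hop F F' G G' _ _ oUU oVV tF tF' tG tG'.
exists (U `&` U'), (V `&` V'), H, (fun q => G q * G' q).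
split; split=> //.
- exact: tensorM.
- by rewrite mulf_neq0.
- move=> q Wq [Uq U'q] [Vq V'q]; rewrite mulf_eq0 negb_or => /andP[Gq G'q].
  by rewrite fE // gE // HE.
Qed.

Fact prod_regularD W f g : prod_open W -> prod_regular W f -> prod_regular W g ->
  prod_regular W (fun p => f p + g p).
Proof.
move=> _; apply: (@prod_regular2 +%R) => F F' G G' U V oU oV tF tF' tG tG'.
exists (fun q => F q * G' q + F' q * G q).
  by apply: tensorD; exact: tensorM.
by move=> q Gq G'q; rewrite addf_div.
Qed.

Fact prod_regularM W f g : prod_open W -> prod_regular W f -> prod_regular W g ->
  prod_regular W (fun p => f p * g p).
Proof.
move=> _; apply: (@prod_regular2 *%R) => F F' G G' U V oU oV tF tF' tG tG'.
exists (fun q => F q * F' q); first exact: tensorM.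
by move=> q Gq G'q; rewrite mulf_div.
Qed.

Fact prod_regularV W f : prod_open W -> prod_regular W f ->
  (forall p, W p -> f p != 0) -> prod_regular W (fun p => (f p)^-1).
Proof.
move=> _ rf nz p Wp.
have [U [V [F [G [[oU oV tF tG] [Up Vp Gp fE]]]]]] := rf p Wp.
exists U, V, (fun q => G q * G q), (fun q => F q * G q); split; split=> //.
- exact: tensorM.
- exact: tensorM.
- have := nz p Wp; rewrite fE // mulf_eq0 negb_or => /andP[Fp _].
  by rewrite mulf_neq0.
- move=> q Wq Uq Vq; rewrite mulf_eq0 negb_or => /andP[Fq Gq].
  by rewrite fE // invf_div -mulf_div divff // mulr1.
Qed.

Fact prod_open_neq0 W f : prod_open W -> prod_regular W f ->
  prod_open [set p | W p /\ f p != 0].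
Proof.
move=> oW rf p [Wp fp].
have [U [V [H [[oU oV tH] [Up Vp Hp sW]]]]] := oW p Wp.
have [U' [V' [F [G [[oU' oV' tF tG] [U'p V'p Gp fE]]]]]] := rf p Wp.
have oUU := zopenI oU oU'; have oVV := zopenI oV oV'.
have {}tH := tensor_restrict oU oV (@subIsetl _ U U') (@subIsetl _ V V') tH.
have {}tF := tensor_restrict oU' oV' (@subIsetr _ U U') (@subIsetr _ V V') tF.
have {}tG := tensor_restrict oU' oV' (@subIsetr _ U U') (@subIsetr _ V V') tG.
exists (U `&` U'), (V `&` V'), (fun q => H q * (F q * G q)); split; split=> //.
- by apply: tensorM => //; exact: tensorM.
- have := fp; rewrite fE // mulf_eq0 negb_or => /andP[Fp _].
  by rewrite !mulf_neq0.
- move=> q [Uq U'q] [Vq V'q]; rewrite !mulf_eq0 !negb_or.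
  move=> /and3P[Hq Fq Gq]; have Wq : W q by exact: sW.
  by split=> //; rewrite fE // mulf_neq0 // invr_eq0.
Qed.

Definition prodspace : space k :=
  Space prod_openT prod_openI prod_open_bigcup prod_regular_local
        prod_regular_cst prod_regularD prod_regularM prod_regularV
        prod_open_neq0.

End Product.

Section WeightedDegree.
Variables (N : nat) (w : 'I_N -> nat).
Local Open Scope nat_scope.

Definition wdeg (m : 'X_{1..N}) : nat := \sum_i w i * m i.

Fact wdeg0 : wdeg 0%MM = 0.
Proof. by rewrite /wdeg big1 // => i _; rewrite mnm0E muln0. Qed.

Fact wdegD (m1 m2 : 'X_{1..N}) : wdeg (m1 + m2)%MM = wdeg m1 + wdeg m2.
Proof.
by rewrite /wdeg -big_split /=; apply: eq_bigr => i _; rewrite mnmDE mulnDr.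
Qed.

#[hnf] HB.instance Definition _ := isMeasure.Build N wdeg wdeg0 wdegD.

End WeightedDegree.

Section WeightedProjectiveSpace.
Variables (k : fieldType) (N : nat) (w : 'I_N -> nat).
Implicit Types (x : 'I_N -> k) (p g h : {mpoly k[N]}).

Definition whomog d p : Prop := p \is d.-homog for (wdeg w).

Definition worbit x : set ('I_N -> k) :=
  [set y | exists2 c : k, c != 0 & y = (fun i => c ^+ w i * x i)].

(* Points are the [k^*]-orbits on [k^N \ {0}]. *)
Definition wpoint :=
  {A : set ('I_N -> k) | exists2 x, (exists i, x i != 0) & A = worbit x}.

Definition vanishes p (P : wpoint) : Prop := forall x, sval P x -> p.@[x] = 0.

Lemma meval_worbit d p x c : whomog d p ->
  p.@[fun i => c ^+ w i * x i] = c ^+ d * p.@[x].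
Proof.
move=> /dhomogP hp; rewrite !mevalE mulr_sumr !big_seq; apply: eq_bigr => m mp.
rewrite mulrCA; congr (_ * _); rewrite -(hp m mp) /= /wdeg -prodrXr.
by rewrite -big_split /=; apply: eq_bigr => i _; rewrite exprMn exprM.
Qed.

Lemma wpoint_ex (P : wpoint) : exists x, sval P x.
Proof.
case: P => A [x _ eA] /=; rewrite eA; exists x, 1; first exact: oner_neq0.
by apply/funext => i; rewrite expr1n mul1r.
Qed.

Lemma wpoint_rel (P : wpoint) x y : sval P x -> sval P y ->
  exists2 c : k, c != 0 & y = (fun i => c ^+ w i * x i).
Proof.
case: P => A [z _ eA] /=; rewrite eA => -[c c0 ->] [e e0 ->]; exists (e / c).
  by rewrite mulf_neq0 // invr_eq0.
apply/funext => i; rewrite mulrA -exprMn divfK //.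
Qed.

Lemma vanishesP d p (P : wpoint) x : whomog d p -> sval P x ->
  vanishes p P <-> p.@[x] = 0.
Proof.
move=> hp Px; split=> [|px y Py]; first exact.
by have [c _ ->] := wpoint_rel Px Py; rewrite (meval_worbit _ _ hp) px mulr0.
Qed.

Lemma not_vanishesP d p (P : wpoint) x : whomog d p -> sval P x ->
  ~ vanishes p P <-> p.@[x] != 0.
Proof.
move=> hp Px; rewrite (vanishesP hp Px).
by split=> [/eqP|/eqP].
Qed.

Let wproj_open : set (set wpoint) := [set U | exists S : set {mpoly k[N]},
  (forall p, S p -> exists d, whomog d p) /\
  ~` U = [set P | forall p, S p -> vanishes p P]].

Let wproj_regular (U : set wpoint) (f : wpoint -> k) : Prop :=
  forall P, U P -> exists V d g h,
    [/\ wproj_open V, V P, whomog d g & whomog d h] /\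
    forall Q x, U Q -> V Q -> sval Q x ->
      h.@[x] != 0 /\ f Q = g.@[x] / h.@[x].

Let wproj_openP U : wproj_open U <->
  forall P, U P -> exists d p,
    [/\ whomog d p, ~ vanishes p P & forall Q, ~ U Q -> vanishes p Q].
Proof.
split=> [[S [hS eU]] P UP | h].
  have : ~ (~` U) P by [].
  rewrite {1}eU /= => /existsNP [p /not_implyP [Sp np]].
  have [d hp] := hS p Sp; exists d, p; split=> // Q nUQ.
  have : (~` U) Q by []. rewrite eU; exact.
exists [set p | (exists d, whomog d p) /\ forall Q, ~ U Q -> vanishes p Q].
split; first by move=> p [].
apply/seteqP; split=> [Q nUQ p [_]|P hP UP]; first exact.
have [d [p [hp np pU]]] := h P UP.
by apply: np; apply: hP; split=> //; exists d.
Qed.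

Fact whomogM d e g h : whomog d g -> whomog e h -> whomog (d + e) (g * h).
Proof. exact: dhomogM. Qed.

Fact wproj_openT : wproj_open setT.
Proof.
apply/wproj_openP => P _; exists 0%N, 1; split; [exact: dhomog1 | | by move=> Q /(_ I)].
have [x Px] := wpoint_ex P.
by move=> /(_ x Px); rewrite meval1 => /eqP; rewrite oner_eq0.
Qed.

Fact wproj_openI U V : wproj_open U -> wproj_open V -> wproj_open (U `&` V).
Proof.
move=> /wproj_openP oU /wproj_openP oV; apply/wproj_openP => P [UP VP].
have [d [p [hp np pU]]] := oU P UP; have [e [q [hq nq qV]]] := oV P VP.
have [x Px] := wpoint_ex P; have hpq := whomogM hp hq.
exists (d + e)%N, (p * q); split=> //.
  apply/(not_vanishesP hpq Px); rewrite mevalM mulf_neq0 //.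
    exact/(not_vanishesP hp Px).
  exact/(not_vanishesP hq Px).
move=> Q /not_andP [nU|nV] y Qy; rewrite mevalM.
  by rewrite (pU Q nU y Qy) mul0r.
by rewrite (qV Q nV y Qy) mulr0.
Qed.

Fact wproj_open_bigcup (F : set (set wpoint)) :
  F `<=` wproj_open -> wproj_open (\bigcup_(U in F) U).
Proof.
move=> oF; apply/wproj_openP => P [U FU UP].
have /wproj_openP /(_ P UP) [d [p [hp np pU]]] := oF U FU.
exists d, p; split=> // Q nQ; apply: pU => UQ; apply: nQ; by exists U.
Qed.

Fact wproj_regular_local (U : set wpoint) f :
  (forall P, U P -> exists V f',
     [/\ wproj_open V, V P, wproj_regular V f' &
         forall Q, U Q -> V Q -> f Q = f' Q]) ->
  wproj_regular U f.
Proof.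
move=> loc P UP; have [V [f' [oV VP rf' ff']]] := loc P UP.
have [V' [d [g [h [[oV' V'P hg hh] f'E]]]]] := rf' P VP.
exists (V `&` V'), d, g, h; split; first by split=> //; exact: wproj_openI.
by move=> Q x UQ [VQ V'Q] Qx; rewrite ff' //; exact: f'E.
Qed.

Fact wproj_regular_cst U (c : k) : wproj_open U -> wproj_regular U (fun=> c).
Proof.
move=> oU P UP; exists U, 0%N, c%:MP, 1; split.
  by split=> //; [rewrite /whomog -alg_mpolyC; apply: rpredZ|];
     exact: dhomog1.
by move=> Q x _ _ _; rewrite mevalC meval1 divr1; split=> //; exact: oner_neq0.
Qed.

Fact wproj_regularD U f f' : wproj_open U -> wproj_regular U f ->
  wproj_regular U f' -> wproj_regular U (fun P => f P + f' P).
Proof.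
move=> _ rf rf' P UP.
have [V [d [g [h [[oV VP hg hh] fE]]]]] := rf P UP.
have [V' [d' [g' [h' [[oV' V'P hg' hh'] f'E]]]]] := rf' P UP.
exists (V `&` V'), (d + d')%N, (g * h' + g' * h), (h * h'); split.
  split=> //; [exact: wproj_openI | | exact: whomogM].
  apply: rpredD; first exact: whomogM.
  by rewrite addnC; exact: whomogM.
move=> Q x UQ [VQ V'Q] Qx.
have [hx ->] := fE Q x UQ VQ Qx; have [h'x ->] := f'E Q x UQ V'Q Qx.
by rewrite mevalD !mevalM mulf_neq0 // addf_div.
Qed.

Fact wproj_regularM U f f' : wproj_open U -> wproj_regular U f ->
  wproj_regular U f' -> wproj_regular U (fun P => f P * f' P).
Proof.
move=> _ rf rf' P UP.
have [V [d [g [h [[oV VP hg hh] fE]]]]] := rf P UP.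
have [V' [d' [g' [h' [[oV' V'P hg' hh'] f'E]]]]] := rf' P UP.
exists (V `&` V'), (d + d')%N, (g * g'), (h * h'); split.
  by split=> //; [exact: wproj_openI | exact: whomogM | exact: whomogM].
move=> Q x UQ [VQ V'Q] Qx.
have [hx ->] := fE Q x UQ VQ Qx; have [h'x ->] := f'E Q x UQ V'Q Qx.
by rewrite !mevalM mulf_neq0 // mulf_div.
Qed.

Let wproj_D U d p : wproj_open U -> whomog d p ->
  wproj_open (U `&` [set P | ~ vanishes p P]).
Proof.
move=> oU hp; apply: wproj_openI => //; apply/wproj_openP => P nP.
by exists d, p; split=> // Q /contrapT.
Qed.

Fact wproj_regularV U f : wproj_open U -> wproj_regular U f ->
  (forall P, U P -> f P != 0) -> wproj_regular U (fun P => (f P)^-1).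
Proof.
move=> _ rf nz P UP; have [V [d [g [h [[oV VP hg hh] fE]]]]] := rf P UP.
exists V, d, h, g; split=> // Q x UQ VQ Qx.
have [hx fQ] := fE Q x UQ VQ Qx; rewrite fQ invf_div; split=> //.
by have := nz Q UQ; rewrite fQ mulf_eq0 negb_or => /andP[].
Qed.

Fact wproj_open_neq0 U f : wproj_open U -> wproj_regular U f ->
  wproj_open [set P | U P /\ f P != 0].
Proof.
move=> oU rf.
have -> : [set P | U P /\ f P != 0] =
    \bigcup_(V in [set V | wproj_open V /\ V `<=` [set P | U P /\ f P != 0]]) V.
  apply/seteqP; split=> [P [UP fP]|P [V [_ sV] /sV]] //.
  have [V [d [g [h [[oV VP hg hh] fE]]]]] := rf P UP.
  have [x Px] := wpoint_ex P; have [hx fPE] := fE P x UP VP Px.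
  exists (U `&` V `&` [set P | ~ vanishes g P]); last first.
    split=> //; apply/(not_vanishesP hg Px).
    by move: fP; rewrite fPE mulf_eq0 negb_or => /andP[].
  split; first by apply: wproj_D hg; exact: wproj_openI.
  move=> Q [[UQ VQ] nQ]; split=> //; have [y Qy] := wpoint_ex Q.
  have [hy ->] := fE Q y UQ VQ Qy.
  by rewrite mulf_neq0 ?invr_eq0 //; exact/(not_vanishesP hg Qy).
by apply: wproj_open_bigcup => V [].
Qed.

Definition wproj : space k :=
  Space wproj_openT wproj_openI wproj_open_bigcup wproj_regular_local
        wproj_regular_cst wproj_regularD wproj_regularM wproj_regularV
        wproj_open_neq0.

(* The zero locus of [p], with its reduced structure. *)
Definition hypersurface p : space k :=
  @subspace k wproj [set P : wpoint | vanishes p P].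

End WeightedProjectiveSpace.

Definition proj (k : fieldType) (r : nat) : space k :=
  @wproj k r.+1 (fun=> 1%N).

Definition morphism (k : fieldType) (X Y : space k) (phi : X -> Y) : Prop :=
  (forall U, zopen Y U -> zopen X (phi @^-1` U)) /\
  (forall U f, zopen Y U -> regular Y U f ->
     regular X (phi @^-1` U) (f \o phi)).

Definition isomorphism (k : fieldType) (X Y : space k) (phi : X -> Y) : Prop :=
  morphism phi /\
  exists psi : Y -> X, [/\ morphism psi, cancel phi psi & cancel psi phi].

Definition birational (k : fieldType) (X Y : space k) : Prop :=
  exists (U : set X) (V : set Y),
    [/\ zopen X U, U !=set0, zopen Y V & V !=set0] /\
    exists phi : subspace U -> subspace V, isomorphism phi.

Definition rational (k : fieldType) (X : space k) : Prop :=
  exists r, birational X (proj k r).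

Definition stably_rational (k : fieldType) (X : space k) : Prop :=
  exists r, rational (prodspace X (proj k r)).

Definition has_chain (T : Type) (Q : set (set T)) (r : nat) : Prop :=
  exists Z : nat -> set T,
    (forall i, (i <= r)%N -> Q (Z i)) /\
    (forall i, (i < r)%N -> Z i `<` Z i.+1).

(* [r] is the supremum of the lengths [l] of the chains
   [Z_0 `<` Z_1 `<` ... `<` Z_l] of members of [Q]: truncating a longer chain
   gives one of length [r.+1]. *)
Definition max_chain (T : Type) (Q : set (set T)) (r : nat) : Prop :=
  has_chain Q r /\ ~ has_chain Q r.+1.

Definition irreducible_closed (k : fieldType) (X : space k) (Z : set X) : Prop :=
  [/\ zclosed Z, Z !=set0 &
      forall A B : set X, zclosed A -> zclosed B ->
        Z `<=` A `|` B -> Z `<=` A \/ Z `<=` B].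

Definition irreducible (k : fieldType) (X : space k) : Prop :=
  irreducible_closed [set: X].

Definition dimension (k : fieldType) (X : space k) (r : nat) : Prop :=
  max_chain (@irreducible_closed k X) r.

(* The local ring at [P] is [stalk P] modulo [germ_eq P].  Its ideals are
   represented by their preimages in [stalk P]. *)
Section LocalRing.
Variables (k : fieldType) (X : space k) (P : X).

Definition stalk : set (X -> k) :=
  [set f | exists U, [/\ zopen X U, U P & regular X U f]].

Definition germ_eq (f g : X -> k) : Prop :=
  exists U, [/\ zopen X U, U P & forall Q, U Q -> f Q = g Q].

Definition ideal (I : set (X -> k)) : Prop :=
  [/\ I `<=` stalk,
      forall f g, germ_eq f g -> I f -> I g,
      I (fun=> 0),
      forall f g, I f -> I g -> I (fun Q => f Q + g Q) &
      forall f g, stalk f -> I g -> I (fun Q => f Q * g Q)].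

Definition prime_ideal (I : set (X -> k)) : Prop :=
  [/\ ideal I, ~ I (fun=> 1) &
      forall f g, stalk f -> stalk g -> I (fun Q => f Q * g Q) -> I f \/ I g].

Definition maximal_ideal : set (X -> k) := [set f | stalk f /\ f P = 0].

Definition maximal_ideal_sq : set (X -> k) :=
  [set f | exists (r : nat) (g h : 'I_r -> X -> k),
     (forall i, maximal_ideal (g i) /\ maximal_ideal (h i)) /\
     germ_eq f (fun Q => \sum_i g i Q * h i Q)].

Definition generates_maximal (r : nat) (t : 'I_r -> X -> k) : Prop :=
  (forall i, maximal_ideal (t i)) /\
  forall f, maximal_ideal f -> exists c : 'I_r -> X -> k,
    (forall i, stalk (c i)) /\ germ_eq f (fun Q => \sum_i c i Q * t i Q).

(* The local rings of a variety are Noetherian, so that regularity means that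
   the maximal ideal is generated by as many elements as the Krull
   dimension. *)
Definition regular_local_ring : Prop :=
  exists r, max_chain prime_ideal r /\
    exists t : 'I_r -> X -> k, generates_maximal t.

(* On a nonsingular variety of dimension [r]: the differentials of the [t i]
   form a basis of the cotangent space at [P]. *)
Definition local_coordinates (r : nat) (t : 'I_r -> X -> k) : Prop :=
  generates_maximal (fun i Q => t i Q - t i P).

(* The matrix of the partial derivatives at [P] of the [t i] with respect to the
   local coordinates [u j]. *)
Definition jacobian (r : nat) (t u : 'I_r -> X -> k) : 'M[k]_r :=
  xget 0 [set A : 'M[k]_r | forall i, maximal_ideal_sq (fun Q =>
    t i Q - t i P - \sum_j A i j * (u j Q - u j P))].

End LocalRing.

Definition nonsingular (k : fieldType) (X : space k) : Prop :=
  forall P : X, regular_local_ring P.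

(* A line bundle given by frames [e_i] on the open sets [chart i], with
   [e_j = trans i j * e_i]; a section is [s i * e_i] on [chart i]. *)
Record line_bundle (k : fieldType) (X : space k) := LineBundle {
  chart_index : Type;
  chart : chart_index -> set X;
  trans : chart_index -> chart_index -> X -> k
}.

Section LineBundle.
Variables (k : fieldType) (X : space k).
Implicit Type L : line_bundle X.

Definition lb_dual L := LineBundle (@chart _ _ L) (fun i j P => (trans i j P)^-1).

Definition lb_power L m := LineBundle (@chart _ _ L) (fun i j P => trans i j P ^+ m).

Definition lb_section L (s : chart_index L -> X -> k) : Prop :=
  (forall i, regular X (chart i) (s i)) /\
  (forall i j P, chart i P -> chart j P -> s i P = trans i j P * s j P).

Definition closed_embedding (Y : space k) (phi : X -> Y) : Prop :=
  exists A : set Y, zclosed A /\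
  exists psi : X -> subspace A,
    isomorphism psi /\ forall P, phi P = sval (psi P).

(* Some global sections [s_0, ..., s_N] of [L] define a closed embedding
   [P |-> [s_0(P) : ... : s_N(P)]]; as points of [proj k N] are orbits of nonzero
   vectors, the [s_j] have no common zero. *)
Definition very_ample L : Prop :=
  exists (N : nat) (s : 'I_N.+1 -> chart_index L -> X -> k) (phi : X -> proj k N),
    [/\ forall j, lb_section (s j),
        closed_embedding phi,
        forall P, exists i : chart_index L, chart i P &
        forall P (i : chart_index L), chart i P ->
          sval (phi P : wpoint k (fun=> 1%N)) (fun j => s j i P)].

Definition ample L : Prop := exists2 m, (0 < m)%N & very_ample (lb_power L m).

(* The sheaf of [r]-forms of a nonsingular variety of dimension [r]: each
   system [t] of local coordinates on an open set [U] gives the frame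
   [dt_1 /\ ... /\ dt_r], and
   [du_1 /\ ... /\ du_r = \det (du/dt) dt_1 /\ ... /\ dt_r]. *)
Definition canonical_bundle (r : nat) : line_bundle X :=
  @LineBundle k X
    {Ut : set X * ('I_r -> X -> k) |
       [/\ zopen X Ut.1, forall i, regular X Ut.1 (Ut.2 i) &
           forall P, Ut.1 P -> local_coordinates P Ut.2]}
    (fun Ut => (sval Ut).1)
    (fun Ut Vu P => \det (jacobian P (sval Vu).2 (sval Ut).2)).

Definition anticanonical_bundle (r : nat) : line_bundle X :=
  lb_dual (canonical_bundle r).

End LineBundle.

Definition nonsingular_Fano (k : fieldType) (X : space k) (r : nat) : Prop :=
  [/\ irreducible X, dimension X r, nonsingular X &
      ample (anticanonical_bundle X r)].

Section VeryGeneral.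
Variables (k : fieldType) (N : nat) (w : 'I_N -> nat) (d : nat).

(* [phi] is a polynomial in finitely many coefficients of its argument. *)
Definition coef_polynomial (phi : {mpoly k[N]} -> k) : Prop :=
  exists (r : nat) (m : 'I_r -> 'X_{1..N}) (F : {mpoly k[r]}),
    forall p, phi p = F.@[fun i => p@_(m i)].

(* The parameter space is the affine space of all weighted homogeneous
   polynomials of degree [d], with 0. *)
Definition param_closed (Z : set {mpoly k[N]}) : Prop :=
  exists S : set ({mpoly k[N]} -> k),
    S `<=` coef_polynomial /\
    Z = [set p | whomog w d p /\ forall phi, S phi -> phi p = 0].

Definition very_general (Q : {mpoly k[N]} -> Prop) : Prop :=
  exists Z : nat -> set {mpoly k[N]},
    (forall i, param_closed (Z i) /\ Z i `<` whomog w d) /\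
    forall p, whomog w d p -> ~ (\bigcup_i Z i) p -> Q p.

End VeryGeneral.

(* The weights of P(1^n, a, b). *)
Definition weights (n a b : nat) (i : 'I_n.+2) : nat :=
  if (i < n)%N then 1%N else if i == n :> nat then a else b.

(* Main.v *)
(** Since [d = b * (d %/ b)], a general [f] can be made monic of degree
    [m = d %/ b] in the last variable [y]. Its coefficients are algebraically
    independent over the integers, so there is a place of the ground field under
    which [f] becomes any prescribed equation [y^m = f0(w, x)] over a field of
    the residue characteristic chosen.

    Not stably rational: in characteristic [p], where [p %| m], the relation
    [f0 = y^m] makes [d f0] vanish on the cover, so that
    [w_0^(d - n - a) * dw /\ dx / df0] defines an [(n-1)]-form there (Kollar).
    For a suitable [f0] it is regular along curves even at the critical points
    of [f0], hence it takes the same value at the two ends of a rational curve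
    on the cover. If [X] is stably rational, then the identity of [X] factors
    through an affine space, and a line in that space joins a constant point of
    [X] to the generic point. The reductions of this curve at the successive
    vertices of its Newton polygon, with respect to the place, form a chain of
    rational curves on the cover from a constant point, where the form vanishes,
    to the generic point, where it does not.

    Fano: quasismoothness, and primality of the sections of [X] by
    [w_0 = ... = w_i = 0], are pulled back along places from a Fermat equation
    and from [y^m = w^(d - a) * x]. At a point of [X] a quotient [u = M1 / M2]
    of monomials has weight one, the functions [X_j / u^(w_j)] contain local
    coordinates, and a chain of primes of length [n] in the local ring comes
    from formal arcs; longer chains are excluded because [n + 1] elements of the
    local ring are algebraically dependent. For [q = n + a + b - d], a
    determinant [kappa] in the gradients of [f] and of the local coordinates
    identifies the anticanonical bundle with [O(q)]. Monomials of degree [q * d]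
    times [kappa^d] are thus sections of its [d]-th power; they separate points
    and generate the coordinate ring, hence give a closed embedding. *)

Require Import Defs.
From HB Require Import structures.
From mathcomp Require Import all_boot all_order all_algebra.
From mathcomp Require Import closed_field qfpoly fingroup perm.
From mathcomp Require Import mpoly complex.
From mathcomp Require Import boolp classical_sets reals.
From mathcomp Require Import zify ring.

Set Implicit Arguments.
Unset Strict Implicit.
Unset Printing Implicit Defensive.

Import GRing.Theory.
Local Open Scope ring_scope.

(** * Places *)

(** Since [p] divides [d = a (d/a)] but not [d/a], it divides [a]. So [d], [m] and [a] all vanish in
    the residue field: the first two make the gradient of [f0] a kernel vector of the matrix formed
    by the Euler field and the derivations, and the third makes [x - z w_0^a] a coordinate with
    constant coefficients. The bound [n + a <= d] is the nonnegativity of the exponent of [w_0].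

    Zorn's lemma gives no control over the value group of a place. Uniformizers are therefore
    replaced by dominant members of finite families, and slopes of the Newton polygon by roots,
    which exist because the ground field is algebraically closed.

    The cover is singular over the critical points of [f0] and is not resolved. Regularity along a
    curve is a divisibility of minors instead: two partial derivatives of [f0], independent by a
    Hessian minor, serve as coordinates there. The form is evaluated on derivations of the field [E]
    over which the rational curve is defined. Its value is then a polynomial in the parameter of the
    line, and also in the inverse parameter, hence a constant. *)

Section SubringType.
Variables (k : fieldType) (A : subringClosed k).

Definition subring_type := {x : k | x \in A}.
HB.instance Definition _ := [isSub of subring_type for @sval k (fun x => x \in A)].
HB.instance Definition _ := [Choice of subring_type by <:].
HB.instance Definition _ := [SubChoice_isSubComNzRing of subring_type by <:].
End SubringType.

(** A place is kept as its valuation ring with the two maps out of it. No value group appears: sizes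
    are compared by divisibility in [vring], so valuations of every rank are treated alike. The
    residue map need not be onto [F]. *)
Record place (k F : fieldType) := Place {
  vring : comNzRingType;
  pin : {rmorphism vring -> k};
  pres : {rmorphism vring -> F};
  pin_inj : injective pin;
  placeP : forall x : k,
    (exists v, x = pin v) \/ (exists2 v, x * pin v = 1 & pres v = 0);
  place_unit : forall v, pres v != 0 -> exists u, u * v = 1
}.

(* A maximal partial homomorphism from a field to an algebraically closed field
   is defined on a valuation ring; partial homomorphisms are represented by
   their graphs. *)
Section Extension.
Variables (k : fieldType) (F : closedFieldType).
Implicit Types (S : set (k * F)).
Local Open Scope classical_set_scope.

Definition graph_subring S :=
  [/\ S (1, 1),
      forall a b c d, S (a, b) -> S (c, d) -> S (a - c, b - d) &
      forall a b c d, S (a, b) -> S (c, d) -> S (a * c, b * d)].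

Definition partial_hom S := graph_subring S /\ forall z, S (0, z) -> z = 0.

Section Closure.
Variables (S : set (k * F)) (sS : graph_subring S).
Let S1 := let: And3 h _ _ := sS in h.
Let SB := let: And3 _ h _ := sS in h.
Let SM := let: And3 _ _ h := sS in h.

Lemma graph0 : S (0, 0). Proof. by have := SB S1 S1; rewrite !subrr. Qed.
Lemma graphN a b : S (a, b) -> S (- a, - b).
Proof. by move=> h; have := SB graph0 h; rewrite !sub0r. Qed.
Lemma graphD a b c d : S (a, b) -> S (c, d) -> S (a + c, b + d).
Proof. by move=> h /graphN h'; have := SB h h'; rewrite !opprK. Qed.
Lemma graphX a b i : S (a, b) -> S (a ^+ i, b ^+ i).
Proof. by move=> h; elim: i => [|i IH]; rewrite ?expr0 // !exprS; apply: SM. Qed.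
Lemma graph_sum (I : Type) (r : seq I) (P : pred I) (u : I -> k) (v : I -> F) :
  (forall i, P i -> S (u i, v i)) ->
  S (\sum_(i <- r | P i) u i, \sum_(i <- r | P i) v i).
Proof.
move=> h; apply: (big_ind2 (fun x y => S (x, y))) => //; first exact: graph0.
by move=> *; apply: graphD.
Qed.

Definition poly_graph (P : {poly k}) (Q : {poly F}) := forall i, S (P`_i, Q`_i).

Lemma poly_graphB P Q P' Q' : poly_graph P Q -> poly_graph P' Q' ->
  poly_graph (P - P') (Q - Q').
Proof. by move=> h h' i; rewrite !coefB; apply: SB. Qed.
Lemma poly_graphM P Q P' Q' : poly_graph P Q -> poly_graph P' Q' ->
  poly_graph (P * P') (Q * Q').
Proof. by move=> h h' i; rewrite !coefM; apply: graph_sum => j _; apply: SM. Qed.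
Lemma poly_graphC a b : S (a, b) -> poly_graph a%:P b%:P.
Proof. by move=> h i; rewrite !coefC; case: eqP => _ //; apply: graph0. Qed.
Lemma poly_graphXn i : poly_graph 'X^i 'X^i.
Proof. by move=> j; rewrite !coefXn; case: eqP => _ //=; apply: graph0. Qed.
End Closure.

Section Maximal.
Variables (S : set (k * F)) (hS : partial_hom S).
Hypothesis maxS : forall B, S `<` B -> ~ partial_hom B.
Let sS : graph_subring S := hS.1.
Let S1 := let: And3 h _ _ := sS in h.
Let SB := let: And3 _ h _ := sS in h.
Let SM := let: And3 _ _ h := sS in h.

Lemma maximal_graph B : S `<=` B -> partial_hom B -> B `<=` S.
Proof.
move=> SB' hB; apply: contrapT => nBS; apply: (maxS _ hB).
by split.
Qed.

Lemma graph_funct a b c : S (a, b) -> S (a, c) -> b = c.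
Proof.
move=> h h'; have := SB h h'; rewrite subrr => /hS.2 /eqP.
by rewrite subr_eq0 => /eqP.
Qed.

(** Localizing the domain of [S] at [a] still gives a partial homomorphism, because [b] is
    invertible; maximality puts the inverse of [a] in the domain. *)
Lemma maximal_unit a b : S (a, b) -> b != 0 -> S (a^-1, b^-1).
Proof.
move=> Sab b0.
have a0 : a != 0 by apply: contraNneq b0 => a0; apply/eqP/hS.2; rewrite -a0.
pose B : set (k * F) := fun q => exists i u v,
  [/\ S (u, v), q.1 = u / a ^+ i & q.2 = v / b ^+ i].
have SsubB : S `<=` B.
  by move=> [u v] Suv; exists 0%N, u, v; rewrite !expr0 !divr1.
apply: (maximal_graph SsubB); last first.
  exists 1%N, 1, 1; split=> //=; by rewrite expr1 div1r.
split; last first.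
  move=> z [i [u [v [Suv /= /esym/eqP]]]].
  rewrite mulf_eq0 invr_eq0 expf_eq0 (negPf a0) andbF orbF => /eqP u0 ->.
  by move: Suv; rewrite u0 => /hS.2 ->; rewrite mul0r.
split; first exact: SsubB.
- move=> _ _ _ _ [i [u [v [Suv /= -> ->]]]] [j [u' [v' [Suv' /= -> ->]]]].
  exists (i + j)%N, (u * a ^+ j - u' * a ^+ i), (v * b ^+ j - v' * b ^+ i).
  split; first by apply: SB; apply: SM => //; apply: graphX.
    by rewrite /= exprD; field; rewrite !expf_neq0.
  by rewrite /= exprD; field; rewrite !expf_neq0.
- move=> _ _ _ _ [i [u [v [Suv /= -> ->]]]] [j [u' [v' [Suv' /= -> ->]]]].
  exists (i + j)%N, (u * u'), (v * v'); split; first exact: SM.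
    by rewrite /= exprD; field; rewrite !expf_neq0.
  by rewrite /= exprD; field; rewrite !expf_neq0.
Qed.

(** A relation of [x] whose reduction is the constant 1: the maximal ideal of the domain of [S]
    generates the unit ideal once [x] is adjoined. This is the obstruction to extending [S] to
    [x]. *)
Definition collapses (x : k) := exists P, poly_graph S P 1 /\ P.[x] = 0.

(** The reductions of the relations of [x] form an ideal [J] of polynomials over the residue field.
    If [x] does not collapse, [J] is zero or has a nonconstant generator, and a root of the
    generator is an admissible value for [x]. *)
Lemma not_collapses_root x : ~ collapses x -> exists w, S (x, w).
Proof.
move=> nc.
pose J Q := exists P, poly_graph S P Q /\ P.[x] = 0.
have [w Jw] : exists w, forall Q, J Q -> Q.[w] = 0.
  have [[Q0 [JQ0 nz]]|J0] := pselect (exists Q, J Q /\ Q != 0); last first.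
    exists 0 => Q JQ; have [->|nQ] := eqVneq Q 0; first by rewrite horner0.
    by case: J0; exists Q.
  pose sz i := `[< exists Q, [/\ J Q, Q != 0 & size Q = i] >].
  have exsz : exists i, sz i by exists (size Q0); apply/asboolP; exists Q0.
  case: (ex_minnP exsz) => s /asboolP [Q [JQ nQ sQ]] mins.
  have JB Q1 Q2 : J Q1 -> J Q2 -> J (Q1 - Q2).
    move=> [P1 [h1 r1]] [P2 [h2 r2]]; exists (P1 - P2).
    by split; [apply: poly_graphB | rewrite !hornerE r1 r2 subrr].
  have JM Q1 Q2 P2 : poly_graph S P2 Q2 -> J Q1 -> J (Q2 * Q1).
    move=> h2 [P1 [h1 r1]]; exists (P2 * P1).
    by split; [apply: poly_graphM | rewrite hornerM r1 mulr0].
  have [P [hPQ rP]] := JQ.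
  have lQ : S (P`_(size Q).-1, lead_coef Q) by apply: hPQ.
  have lV := maximal_unit lQ; rewrite lead_coef_eq0 in lV.
  have sQ1 : size Q != 1%N.
    apply/eqP => /eqP/size_poly1P [c c0 eQ]; case: nc.
    have [P' [h' r']] := JM _ _ _ (poly_graphC sS (lV nQ)) JQ.
    exists P'; split=> //; move: h'; rewrite eQ lead_coefC -polyCM mulVf //.
  have [w /rootP rw] : exists w, root Q w by apply/closed_rootP.
  (* Euclidean division by [Q] inside [J], one leading term at a time; [maximal_unit] inverts the
     leading coefficient of [Q] without leaving the domain of [S]. *)
  exists w => Q1; move: (ubnP (size Q1)) => -[j]; elim: j Q1 => // j0 IH Q1 lti JQ1.
  have [->|nQ1] := eqVneq Q1 0; first by rewrite horner0.
  have leq_s : (size Q <= size Q1)%N by rewrite sQ; apply: mins; apply/asboolP; exists Q1.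
  have [P1 [h1 r1]] := JQ1.
  have l1 : S (P1`_(size Q1).-1, lead_coef Q1) by apply: h1.
  pose C := (lead_coef Q1 / lead_coef Q)%:P * 'X^(size Q1 - size Q).
  have JC : J (C * Q).
    apply: (JM _ _ ((P1`_(size Q1).-1 / P`_(size Q).-1)%:P * 'X^(size Q1 - size Q))) => //.
    apply: poly_graphM => //; last exact: poly_graphXn.
    by apply: poly_graphC => //; apply: SM => //; apply: lV.
  have := IH _ _ (JB _ _ JQ1 JC); rewrite !hornerE rw mulr0 subr0; apply.
  apply: leq_trans (_ : size Q1 <= j0)%N => //.
  have lC : lead_coef Q != 0 by rewrite lead_coef_eq0.
  have lcE : lead_coef (C * Q) = lead_coef Q1.
    by rewrite lead_coefM lead_coef_Mmonic ?monicXn // lead_coefC divfK.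
  have sC : size (C * Q) = size Q1.
    have nC : C != 0.
      by rewrite mulf_neq0 ?polyC_eq0 ?mulf_neq0 ?invr_eq0 ?lead_coef_eq0 // -size_poly_eq0 size_polyXn.
    rewrite size_mul // /C size_Cmul ?mulf_neq0 ?invr_eq0 ?lead_coef_eq0 //.
    rewrite size_polyXn addSn /= subnK //.
  have h0 : (0 < size Q1)%N by rewrite size_poly_gt0.
  rewrite -(prednK h0) ltnS; apply/leq_sizeP => j lej; rewrite coefB.
  move: lej; rewrite leq_eqVlt => /orP [/eqP <-|ltj].
    by rewrite -/(lead_coef Q1) -sC -/(lead_coef _) lcE subrr.
  by rewrite !nth_default ?sC ?subrr // -(prednK h0).
exists w.
pose B : set (k * F) := fun q => exists P Q, [/\ poly_graph S P Q, q.1 = P.[x] & q.2 = Q.[w]].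
have SsubB : S `<=` B.
  move=> [a b] Sab; exists a%:P, b%:P.
  by split; [apply: poly_graphC | rewrite hornerC | rewrite hornerC].
apply: (maximal_graph SsubB); last first.
  by exists 'X, 'X; split; [have := poly_graphXn sS 1; rewrite expr1 | rewrite hornerX..].
split; last by move=> z [P [Q [h /= /esym r ->]]]; apply: Jw; exists P.
split; first exact: SsubB.
- move=> _ _ _ _ [P [Q [h /= -> ->]]] [P' [Q' [h' /= -> ->]]].
  by exists (P - P'), (Q - Q'); split; [apply: poly_graphB | rewrite !hornerE..].
- move=> _ _ _ _ [P [Q [h /= -> ->]]] [P' [Q' [h' /= -> ->]]].
  by exists (P * P'), (Q * Q'); split; [apply: poly_graphM | rewrite !hornerE..].
Qed.

(** Chevalley's argument: by symmetry the relation of [x] is the longer one; the reversed relation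
    of [x^-1] shortens it, and the sum of the two sizes decreases. *)
Lemma not_collapses_both x : x != 0 -> ~ (collapses x /\ collapses x^-1).
Proof.
move=> x0 [[P [gP rP]] [P' [gP' rP']]].
have [N] := ubnP (size P + size P')%N.
elim: N x x0 P gP rP P' gP' rP' => // N IH x x0 P gP rP P' gP' rP' ltN.
wlog le : x x0 P gP rP P' gP' rP' ltN / (size P' <= size P)%N.
  move=> W; have [h|/ltnW h] := leqP (size P') (size P).
    exact: (W x x0 P gP rP P' gP' rP').
  apply: (W x^-1 _ P' gP' rP' P gP _ _ h); rewrite ?invr_eq0 ?invrK //.
  by rewrite addnC.
have c0 (T : {poly k}) : poly_graph S T 1 -> S (T`_0, 1).
  by move=> /(_ 0%N); rewrite coef1.
have ci (T : {poly k}) i : poly_graph S T 1 -> (0 < i)%N -> S (T`_i, 0).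
  by move=> /(_ i); rewrite coef1; case: i.
have p0 (T : {poly k}) : poly_graph S T 1 -> T`_0 != 0.
  move=> g; apply/eqP => e; have := c0 _ g; rewrite e => /hS.2 /eqP.
  by rewrite oner_eq0.
have s2 (T : {poly k}) z : poly_graph S T 1 -> T.[z] = 0 -> (1 < size T)%N.
  move=> g r; rewrite ltnNge; apply/negP => /size1_polyC e.
  by move: r (p0 _ g); rewrite e hornerC coefC => /= ->; rewrite eqxx.
pose p := (size P).-1; pose q := (size P').-1.
have sP := s2 _ _ gP rP; have sP' := s2 _ _ gP' rP'.
have qp : (q <= p)%N by rewrite /p /q; lia.
(* [R] is [X^q P'(1/X)]: it kills [x], its leading coefficient [P'_0] reduces to 1 and its other
   coefficients reduce to 0. *)
pose R := \poly_(i < q.+1) P'`_(q - i).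
have gR i : S (R`_i, (i == q)%:R).
  rewrite coef_poly; case: ltnP => [iq|iq]; last first.
    by rewrite (_ : i == q = false) ?(gtn_eqF iq) //; apply: graph0.
  have := gP' (q - i)%N; rewrite coef1 subn_eq0.
  by rewrite (_ : (q <= i)%N = (i == q)) //; lia.
have rR : R.[x] = 0.
  rewrite horner_poly (reindex_inj rev_ord_inj) /=.
  have -> : \sum_(i < q.+1) P'`_(q - (q.+1 - i.+1)) * x ^+ (q.+1 - i.+1) =
      x ^+ q * P'.[x^-1].
    have leq_q : (size P' <= q.+1)%N by rewrite /q prednK // ltnW.
    rewrite (horner_coef_wide _ leq_q) mulr_sumr.
    apply: eq_bigr => -[i /= li] _; rewrite ?subSS subKn // exprVn mulrCA.
    by congr (_ * _); rewrite -[in RHS](subnK (li : (i <= q)%N)) exprD mulfK // expf_neq0.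
  by rewrite rP' mulr0.
have RqE : R`_q = P'`_0 by rewrite coef_poly ltnSn subnn.
have SR : S ((R`_q)^-1, 1) by rewrite RqE -[1]invr1; apply: maximal_unit (oner_neq0 _); apply: c0.
have Rq0 : R`_q != 0 by rewrite RqE; exact: p0.
have Spp : S (P`_p, 0) by apply: ci => //; rewrite /p; lia.
(* The leading term of [P] is removed; as [P_p] reduces to 0, the difference still reduces to 1. *)
pose T := P - (P`_p / R`_q)%:P * 'X^(p - q) * R.
have gT : poly_graph S T 1.
  move=> i; rewrite /T coefB -mulrA coefCM coefXnM -[1]subr0 coefB coef0.
  apply: SB; first exact: gP.
  rewrite -[X in (_, X)](mul0r (if (i < p - q)%N then 0 else (i - (p - q) == q)%N%:R)).
  rewrite -[X in S (_, X * _)](mul0r 1).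
  apply: SM; first exact: SM.
  by case: ifP => _; [exact: graph0 | exact: gR].
have rT : T.[x] = 0 by rewrite !hornerE rP rR mulr0 subr0.
apply: (IH x x0 T gT rT P' gP' rP').
apply: leq_trans (_ : size P + size P' <= N)%N => //; rewrite -addSn leq_add2r.
rewrite -(prednK (ltnW sP)) ltnS; apply/leq_sizeP => j.
rewrite leq_eqVlt /T coefB -mulrA coefCM coefXnM => /orP [/eqP <-|pj].
  rewrite -/p ltnNge leq_subr /= subKn // divfK ?subrr //.
rewrite nth_default ?sub0r; last by rewrite -(prednK (ltnW sP)).
have pj' : (p < j)%N by [].
rewrite ltnNge (leq_trans (leq_subr _ _) (ltnW pj')) /=.
have big : (q.+1 <= j - (p - q))%N by clear -qp pj'; lia.
rewrite [R`_(j - _)]nth_default ?mulr0 ?oppr0 //.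
exact: leq_trans (size_poly _ _) big.
Qed.

Lemma maximal_valuation x : exists w,
  S (x, w) \/ [/\ x != 0, S (x^-1, w) & w = 0].
Proof.
have [->|x0] := eqVneq x 0; first by exists 0; left; apply: graph0.
have [/not_collapses_root [w h]|/not_collapses_root [w h]] :
    ~ collapses x \/ ~ collapses x^-1.
- by apply: contrapT => /not_orP [/contrapT h /contrapT h']; exact: (not_collapses_both x0).
- by exists w; left.
- have [w0|w0] := eqVneq w 0; first by exists w; right.
  by exists w^-1; left; rewrite -[x]invrK; apply: maximal_unit.
Qed.
End Maximal.

Lemma place_of_maximal S : partial_hom S ->
  (forall B, S `<` B -> ~ partial_hom B) ->
  exists pl : place k F, forall a b, S (a, b) ->
    exists2 v : vring pl, pin pl v = a & pres pl v = b.
Proof.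
move=> hS maxS; have [[S1 SB SM] S0] := hS.
pose A : {pred k} := [pred a | `[< exists b, S (a, b) >]].
have AP a : reflect (exists b, S (a, b)) (a \in A) by exact: asboolP.
have cA : subring_closed A.
  split; first by apply/AP; exists 1.
  - by move=> a c /AP [b h] /AP [e h']; apply/AP; exists (b - e); apply: SB.
  - by move=> a c /AP [b h] /AP [e h']; apply/AP; exists (b * e); apply: SM.
pose sA : subringClosed k := HB.pack A (GRing.isSubringClosed.Build k A cA).
pose V := subring_type sA.
have Vx (v : V) : exists b, S (val v, b) by apply/AP; exact: valP v.
pose th (v : V) : F := xget 0 [set b | S (val v, b)].
have thP v : S (val v, th v).
  by rewrite /th; case: xgetP => [b -> //|h]; have [b] := Vx v; move=> /h.
have thE v b : S (val v, b) -> th v = b by move=> /(graph_funct hS (thP v)).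
have thB : zmod_morphism th by move=> u v; apply: thE; rewrite rmorphB; apply: SB; exact: thP.
have thM : monoid_morphism th.
  split; first by apply: thE; rewrite rmorph1.
  by move=> u v; apply: thE; rewrite rmorphM; apply: SM; exact: thP.
pose thA := GRing.isZmodMorphism.Build V F th thB.
pose thA' := GRing.isMonoidMorphism.Build V F th thM.
pose thR : {rmorphism V -> F} := HB.pack th thA thA'.
pose io : {rmorphism V -> k} := (\val : V -> k).
have exV a b : S (a, b) -> exists2 v : V, val v = a & th v = b.
  move=> h; have Aa : a \in A by apply/AP; exists b.
  by exists (exist _ a Aa : V) => //; apply: thE.
have pl1 x : (exists v, x = io v) \/ (exists2 v, x * io v = 1 & thR v = 0).
  have [w [/exV [v <- _]|[x0 /exV [v ve vw] w0]]] := maximal_valuation hS maxS x.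
    by left; exists v.
  by right; exists v; rewrite /= ?ve ?divff // -w0.
have pl2 v : thR v != 0 -> exists u, u * v = 1.
  move=> v0; have /exV [u ue _] := maximal_unit hS maxS (thP v) v0.
  exists u; apply: val_inj; rewrite [RHS](_ : _ = 1) // [LHS](_ : _ = val u * val v) // ue mulVf //.
  apply: contraNneq v0 => v0; apply/eqP; apply: S0.
  by rewrite -v0; exact: thP.
exists (@Place k F V io thR val_inj pl1 pl2) => a b /exV [v va vb].
by exists v.
Qed.

Lemma partial_hom_place S : partial_hom S ->
  exists pl : place k F, forall a b, S (a, b) ->
    exists2 v : vring pl, pin pl v = a & pres pl v = b.
Proof.
move=> hS.
(* Zorn's lemma is applied to the sets whose union with [S] is a partial homomorphism, so that the
   empty chain is covered too. *)
pose Q B := partial_hom (S `|` B).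
have [C [QC maxC]] : exists A, Q A /\ forall B, A `<` B -> ~ Q B.
  apply: Zorn_bigcup => G GQ tot; rewrite /Q.
  have pick2 p q : (S `|` \bigcup_(B in G) B) p -> (S `|` \bigcup_(B in G) B) q ->
      exists B, [/\ partial_hom B, B p, B q & B `<=` S `|` \bigcup_(B in G) B].
    have sub B : G B -> S `|` B `<=` S `|` \bigcup_(B in G) B.
      by move=> GB z [|Bz]; [left | right; exists B].
    move=> [Sp|[B GB Bp]] [Sq|[B' GB' Bq]].
    - by exists S; split=> //; move=> z; left.
    - by exists (S `|` B'); split=> //; [exact: GQ | left | right | exact: sub].
    - by exists (S `|` B); split=> //; [exact: GQ | right | left | exact: sub].
    - have [BB|BB] := tot _ _ GB GB'.
        by exists (S `|` B'); split=> //; [exact: GQ | right; exact: BB | right | exact: sub].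
      by exists (S `|` B); split=> //; [exact: GQ | right | right; exact: BB | exact: sub].
  split; last first.
    by move=> z hz; have [B [[_ B0] Bz _ _]] := pick2 _ _ hz hz; exact: B0.
  split; first by left; case: hS => -[].
  - by move=> a b c d h h'; have [B [[[_ BB _] _] Bz Bw]] := pick2 _ _ h h'; apply; exact: BB.
  - by move=> a b c d h h'; have [B [[[_ _ BM] _] Bz Bw]] := pick2 _ _ h h'; apply; exact: BM.
have [pl hpl] : exists pl : place k F, forall a b, (S `|` C) (a, b) ->
    exists2 v : vring pl, pin pl v = a & pres pl v = b.
  apply: place_of_maximal => // B SB hB.
  have CB : C `<=` B by move=> z Cz; apply: SB.1; right.
  have eB : S `|` B = B by apply/setUidPr => z Sz; apply: SB.1; left.
  have nBC : ~ B `<=` C.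
    by move=> BC; apply: SB.2 => z /BC; right.
  by apply: (maxC B); [split | rewrite /Q eB].
by exists pl => a b Sab; apply: hpl; left.
Qed.

End Extension.

(** * Polynomials monic in the last variable *)

Lemma mpoly_morph_eq (n : nat) (R : comNzRingType) (S : nzRingType)
    (f g : {rmorphism {mpoly R[n]} -> S}) :
  (forall c, f c%:MP = g c%:MP) -> (forall i, f 'X_i = g 'X_i) -> f =1 g.
Proof.
move=> hC hX p; rewrite [p]mpolyE !raddf_sum /=; apply: eq_bigr => m _.
rewrite -mul_mpolyC !rmorphM hC; congr (_ * _).
by rewrite mpolyXE_id !rmorph_prod; apply: eq_bigr => i _; rewrite !rmorphXn /= hX.
Qed.

Section Divides.
Variable S : comNzRingType.
Implicit Types (f g h q : S).

Definition mdvd f g := exists q, g = q * f.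

Lemma mdvd0 f : mdvd f 0. Proof. by exists 0; rewrite mul0r. Qed.
Lemma mdvdD f g h : mdvd f g -> mdvd f h -> mdvd f (g + h).
Proof. by move=> [q ->] [q' ->]; exists (q + q'); rewrite mulrDl. Qed.
Lemma mdvdN f g : mdvd f g -> mdvd f (- g).
Proof. by move=> [q ->]; exists (- q); rewrite mulNr. Qed.
Lemma mdvdB f g h : mdvd f g -> mdvd f h -> mdvd f (g - h).
Proof. by move=> hg /mdvdN; apply: mdvdD. Qed.
Lemma mdvdMl f g h : mdvd f g -> mdvd f (h * g).
Proof. by move=> [q ->]; exists (h * q); rewrite mulrA. Qed.
Lemma mdvdMr f g h : mdvd f g -> mdvd f (g * h).
Proof. by rewrite mulrC; apply: mdvdMl. Qed.
Lemma mdvd_sum (I : Type) (r : seq I) (P : pred I) f (F : I -> S) :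
  (forall i, P i -> mdvd f (F i)) -> mdvd f (\sum_(i <- r | P i) F i).
Proof. by move=> h; apply: big_ind => //; [exact: mdvd0 | move=> *; exact: mdvdD]. Qed.

Lemma mdvd_congM f g h g' h' : mdvd f (g - g') -> mdvd f (h - h') ->
  mdvd f (g * h) -> mdvd f (g' * h').
Proof.
move=> dg dh d; have -> : g' * h' = g * h - (g * (h - h') + (g - g') * h') by ring.
by apply: mdvdB => //; apply: mdvdD; [apply: mdvdMl | apply: mdvdMr].
Qed.
Definition mprime f := forall g h, mdvd f (g * h) -> mdvd f g \/ mdvd f h.
End Divides.

Section MonicInLast.
Variables (n : nat) (R : comNzRingType).
Implicit Types (f g h q : {mpoly R[n.+1]}).

Definition ymonic m f := (muni f \is monic) /\ size (muni f) = m.+1.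

Local Notation widen := (widen_ord (leqnSn n)).

Lemma ord_widenP (i : 'I_n.+1) : i = ord_max \/ exists j, i = widen j.
Proof.
have [lin|ni] := ltnP i n; last by left; apply: val_inj; apply/eqP; rewrite /= eqn_leq ni andbT -ltnS.
by right; exists (Ordinal lin); apply: val_inj.
Qed.

Lemma muni_last : muni ('X_ord_max : {mpoly R[n.+1]}) = 'X.
Proof.
rewrite muniE msuppX big_seq1 mcoeffX eqxx scale1r mnm1E eqxx expr1.
rewrite (_ : [multinom _ | i < n] = 0%MM) ?mpolyX0 ?scale1r //.
apply/mnmP => i; rewrite mnmE mnm0E mnm1E.
by case: eqP => // /(congr1 val) /= e; have := ltn_ord i; rewrite -e ltnn.
Qed.

Lemma muni_var (j : 'I_n) : muni ('X_(widen j) : {mpoly R[n.+1]}) = ('X_j)%:P.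
Proof.
rewrite muniE msuppX big_seq1 mcoeffX eqxx scale1r mnm1E.
rewrite (_ : (widen j == ord_max) = false) ?expr0; last first.
  by apply/eqP => /(congr1 val) /= e; have := ltn_ord j; rewrite e ltnn.
rewrite alg_polyC; congr (_%:P); congr 'X_[_].
by apply/mnmP => i; rewrite mnmE !mnm1E; congr (nat_of_bool _); apply/eqP/eqP => [/(congr1 val) /= e|-> //]; apply: val_inj.
Qed.

Definition muniV (q : {poly {mpoly R[n]}}) : {mpoly R[n.+1]} :=
  (map_poly (@mwiden n R) q).['X_ord_max].

Lemma muniVB : zmod_morphism muniV.
Proof. by move=> p q; rewrite /muniV rmorphB !hornerE. Qed.
Lemma muniVM : monoid_morphism muniV.
Proof. by split=> [|p q]; rewrite /muniV ?rmorph1 ?hornerC // rmorphM hornerM. Qed.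
HB.instance Definition _ := GRing.isZmodMorphism.Build _ _ muniV muniVB.
HB.instance Definition _ := GRing.isMonoidMorphism.Build _ _ muniV muniVM.

Lemma muniVC (p : {mpoly R[n]}) : muniV p%:P = mwiden p.
Proof. by rewrite /muniV map_polyC hornerC. Qed.
Lemma muniVX : muniV 'X = 'X_ord_max.
Proof. by rewrite /muniV map_polyX hornerX. Qed.

Lemma muniK : cancel (@muni n R) muniV.
Proof.
apply: (mpoly_morph_eq (f := muniV \o @muni n R) (g := idfun)) => [c|i] /=.
  by rewrite muniC muniVC mwidenC.
have [->|[j ->]] := ord_widenP i; first by rewrite muni_last muniVX.
rewrite muni_var muniVC mwidenX; congr 'X_[_].
exact: mnmwiden1.
Qed.

Lemma muni_inj : injective (@muni n R). Proof. exact: can_inj muniK. Qed.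

Lemma muni_widen (p : {mpoly R[n]}) : muni (mwiden p) = p%:P.
Proof.
apply: (mpoly_morph_eq (f := @muni n R \o @mwiden n R) (g := polyC)) => [c|i] /=.
  by rewrite mwidenC muniC.
by rewrite mwidenX mnmwiden1 muni_var.
Qed.

Lemma muniVK : cancel muniV (@muni n R).
Proof.
elim/poly_ind => [|p c IH]; first by rewrite !rmorph0.
by rewrite !(rmorphD, rmorphM) /= IH muniVX muniVC muni_widen muni_last.
Qed.

(** The remainder of the division by [f] in the last variable. For [f] monic, divisibility by [f]
    becomes the vanishing of a remainder, which can be tested after injecting the coefficients into
    a larger ring. *)
Definition nform f g := muniV (Pdiv.CommonRing.rmodp (muni g) (muni f)).

Variables (m : nat) (f : {mpoly R[n.+1]}) (fm : ymonic m f).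
Let mf : muni f \is monic := fm.1.

Lemma nform_size g : (size (muni (nform f g)) <= m)%N.
Proof. by rewrite /nform muniVK -ltnS -fm.2 Pdiv.CommonRing.ltn_rmodpN0 ?monic_neq0. Qed.

Lemma nformP g : mdvd f (g - nform f g).
Proof.
exists (muniV (Pdiv.CommonRing.rdivp (muni g) (muni f))); apply: muni_inj.
rewrite muniB muniM !muniVK {1}(Pdiv.RingMonic.rdivp_eq mf (muni g)).
by rewrite addrK.
Qed.

Lemma nform_id g : (size (muni g) <= m)%N -> nform f g = g.
Proof. have [_ fs] := fm; move=> h; have lts : (size (muni g) < size (muni f))%N by apply: leq_ltn_trans h _; rewrite fs.
rewrite /nform (Pdiv.CommonRing.rmodp_small lts).
exact: muniK. Qed.

Lemma nform_dvd g : mdvd f g -> nform f g = 0.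
Proof.
move=> [q ->]; rewrite /nform muniM Pdiv.RingMonic.rmodp_mull //.
by rewrite rmorph0.
Qed.

Lemma nform0_dvd g : nform f g = 0 -> mdvd f g.
Proof. by move=> h; have := nformP g; rewrite h subr0. Qed.

Lemma mdvd_small g : (size (muni g) <= m)%N -> mdvd f g -> g = 0.
Proof. by move=> s /nform_dvd; rewrite nform_id. Qed.

End MonicInLast.

Opaque muni muniV nform.

Section MuniMap.
Variables (n : nat).
Local Notation widen := (widen_ord (leqnSn n)).

Lemma map_mpoly_var (l : nat) (R S : comNzRingType) (u : {rmorphism R -> S}) (i : 'I_l) :
  map_mpoly u 'X_i = 'X_i.
Proof. exact: map_mpolyX. Qed.

Lemma muni_map (R S : comNzRingType) (u : {rmorphism R -> S}) (p : {mpoly R[n.+1]}) :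
  muni (map_mpoly u p) = map_poly (map_mpoly u) (muni p).
Proof.
apply: (mpoly_morph_eq (f := @muni n S \o map_mpoly u)
                       (g := map_poly (map_mpoly u) \o @muni n R)) => [c|i] /=.
  by rewrite map_mpolyC !muniC map_polyC /= map_mpolyC.
have [->|[j ->]] := ord_widenP i.
  by rewrite map_mpoly_var !muni_last map_polyX.
by rewrite map_mpoly_var !muni_var map_polyC /= map_mpoly_var.
Qed.

Lemma ymonic_map (R S : comNzRingType) (u : {rmorphism R -> S}) m (p : {mpoly R[n.+1]}) :
  ymonic m p -> ymonic m (map_mpoly u p).
Proof.
move=> [/monicP mp sp]; rewrite /ymonic muni_map; split.
  by apply: monic_map; apply/monicP.
by rewrite size_map_poly_id0 // mp rmorph1 oner_neq0.
Qed.

Lemma meval_muni (R : comNzRingType) (x : 'I_n.+1 -> R) (p : {mpoly R[n.+1]}) :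
  p.@[x] = (map_poly (meval (x \o widen)) (muni p)).[x ord_max].
Proof.
apply: (mpoly_morph_eq (f := meval x)
  (g := horner_eval (x ord_max) \o map_poly (meval (x \o widen)) \o @muni n R)) => [c|i] /=.
  by rewrite mevalC muniC map_polyC /= mevalC /horner_eval hornerC.
rewrite mevalXU /horner_eval; have [->|[j ->]] := ord_widenP i.
  by rewrite muni_last map_polyX hornerX.
by rewrite muni_var map_polyC /= mevalXU hornerC.
Qed.

Lemma map_mpoly_inj (l : nat) (R S : comNzRingType) (u : {rmorphism R -> S}) :
  injective u -> injective (map_mpoly u : {mpoly R[l]} -> {mpoly S[l]}).
Proof.
move=> iu; apply: raddf_inj => p /mpolyP e; apply/mpolyP => m; apply: iu.
by have := e m; rewrite mcoeff_map_mpoly !mcoeff0 rmorph0.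
Qed.
End MuniMap.

Lemma mpoly_nonroot (k : closedFieldType) n (p : {mpoly k[n]}) :
  p != 0 -> exists x, p.@[x] != 0.
Proof.
elim: n p => [|n IH] p p0.
  exists (fun=> 0); apply: contraNneq p0 => e.
  have pE : p = (p@_0)%:MP.
    apply/mpolyP => m; rewrite (_ : m = 0%MM) ?mcoeffC ?eqxx ?mulr1 //.
    by apply/mnmP => -[].
  by rewrite pE in e *; rewrite mevalC in e; rewrite e.
have q0 : muni p != 0 by apply: contra_neq p0 => e; apply: muni_inj; rewrite e raddf0.
have /IH [x lx] : lead_coef (muni p) != 0 by rewrite lead_coef_eq0.
have /closed_nonrootP [y ry] : map_poly (meval x) (muni p) != 0.
  apply: contraNneq lx => /(congr1 (fun q : {poly k} => q`_(size (muni p)).-1)).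
  by rewrite coef_map coef0 => ->.
exists (fun i => if insub (val i) is Some j then x j else y).
rewrite meval_muni (_ : _ \o _ = x); last first.
  apply/funext => j /=; rewrite insubT //= => lj; congr (x _); exact: val_inj.
by rewrite insubF ?ltnn.
Qed.

(** * Gauss's lemma over a valuation ring *)

Section PlaceTransfer.
Variables (k : fieldType) (F : closedFieldType) (pl : place k F).
Local Notation V := (vring pl).
Local Notation io := (pin pl).
Local Notation th := (pres pl).

(** Divisibility in a valuation ring is total, so some member of a finite family divides all others.
    This stands in for an element of minimal valuation. *)
Lemma seq_dominant (I : eqType) (s : seq I) (u : I -> k) :
  (exists2 i, i \in s & u i != 0) ->
  exists i, [/\ i \in s, u i != 0 & forall j, j \in s -> exists v, u j = u i * io v].
Proof.
elim: s => [[i0] //|i0 s IH hex].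
have [[j js uj]|h] := pselect (exists2 j, j \in s & u j != 0); last first.
  have z j : j \in s -> u j = 0.
    by move=> js; apply/eqP/negPn/negP => uj; apply: h; exists j.
  have [ui|ui] := eqVneq (u i0) 0.
    have h0 j : j \in i0 :: s -> u j = 0 by rewrite inE => /predU1P [->|/z].
    by case: hex => j /h0 ->; rewrite eqxx.
  exists i0; split; rewrite ?mem_head // => j; rewrite inE => /predU1P [->|/z ->].
    by exists 1; rewrite rmorph1 mulr1.
  by exists 0; rewrite rmorph0 mulr0.
have [l [ls ul hl]] : exists i, [/\ i \in s, u i != 0 & forall j, j \in s -> exists v, u j = u i * io v].
  by apply: IH; exists j.
have [[v vE]|[v vE _]] := placeP pl (u i0 / u l).
  exists l; split=> //; first by rewrite inE ls orbT.
  move=> j'; rewrite inE => /predU1P [->|/hl //]; exists v.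
  by rewrite -vE mulrCA divff ?mulr1.
have vE' : u l = u i0 * io v by rewrite -[LHS]mulr1 -vE mulrA (mulrC (u l)) divfK.
exists i0; split; rewrite ?mem_head //.
  by apply: contraNneq ul => e; rewrite vE' e mul0r.
move=> j'; rewrite inE => /predU1P [->|/hl [v' ->]]; first by exists 1; rewrite rmorph1 mulr1.
by exists (v * v'); rewrite rmorphM mulrA -vE'.
Qed.

Lemma content n (g : {mpoly k[n]}) : g != 0 -> exists (c : k) (g' : {mpoly V[n]}),
  [/\ c != 0, map_mpoly io g' = c *: g & map_mpoly th g' != 0].
Proof.
move=> g0; have : exists2 m, m \in msupp g & g@_m != 0.
  by exists (mlead g); [exact: mlead_supp | rewrite mleadc_eq0].
move=> /seq_dominant [m [ms gm h]].
have /choice [v vE] : forall m', exists v, g@_m' = g@_m * io v.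
  move=> m'; have [/h //|/memN_msupp_eq0 ->] := boolP (m' \in msupp g).
  by exists 0; rewrite rmorph0 mulr0.
pose g' := \sum_(m' <- msupp g) v m' *: 'X_[m'].
have g'E : map_mpoly io g' = (g@_m)^-1 *: g.
  set c := g@_m in vE gm *; rewrite [in RHS](mpolyE g) raddf_sum scaler_sumr /=; apply: eq_bigr => m' _.
  by rewrite map_mpolyZ map_mpolyX scalerA vE mulKf.
exists (g@_m)^-1, g'; split=> //; first by rewrite invr_eq0.
apply/eqP => /(congr1 (mcoeff m)); rewrite mcoeff0 mcoeff_map_mpoly.
have -> : g'@_m = 1.
  apply: (@pin_inj _ _ pl); rewrite rmorph1 -mcoeff_map_mpoly g'E mcoeffZ.
  by rewrite mulVf.
by move=> /(etrans (esym (rmorph1 th)))/eqP; rewrite oner_eq0.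
Qed.

(** Remainders of the two factors are scaled to be primitive. Their reductions are nonzero of degree
    less than [m] in the last variable, yet the reduced equation, being prime, would divide one of
    them. Monicity of [f] lets the division take place over the valuation ring. *)
Lemma mprime_place n m (f : {mpoly V[n.+1]}) : ymonic m f ->
  mprime (map_mpoly th f) -> mprime (map_mpoly io f).
Proof.
move=> fm fp g h fgh.
have fmi := ymonic_map io fm; have fmt := ymonic_map th fm.
have [/(nform0_dvd fmi)|g0] := eqVneq (nform (map_mpoly io f) g) 0; first by left.
have [/(nform0_dvd fmi)|h0] := eqVneq (nform (map_mpoly io f) h) 0; first by right.
have [c [g' [c0 gE g'0]]] := content g0; have [e [h' [e0 hE h'0]]] := content h0.
have small (u : {mpoly k[n.+1]}) c' u' : map_mpoly io u' = c' *: nform (map_mpoly io f) u ->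
    (size (muni u') <= m)%N.
  move=> E; rewrite -(size_map_inj_poly (map_mpoly_inj (@pin_inj _ _ pl))) ?rmorph0 //.
  rewrite -muni_map E muniZ; apply: leq_trans (size_scale_leq _ _) _.
  exact: nform_size.
have smt u' : (size (muni u') <= m)%N -> (size (muni (map_mpoly th u')) <= m)%N.
  by rewrite muni_map => s; apply: leq_trans (size_poly _ _) s.
have dv : mdvd (map_mpoly io f) (map_mpoly io (g' * h')).
  rewrite rmorphM /= gE hE -scalerAl -scalerAr scalerA -mul_mpolyC; apply: mdvdMl.
  by apply: mdvd_congM fgh; [exact: nformP fmi g | exact: nformP fmi h].
have gh0 : nform f (g' * h') = 0.
  apply: (map_mpoly_inj (@pin_inj _ _ pl)); rewrite rmorph0.
  apply: (mdvd_small fmi).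
    rewrite muni_map (leq_trans (size_poly _ _)) //; exact: nform_size.
  rewrite -[nform f _](subKr (g' * h')) rmorphB; apply: mdvdB => //.
  have [q ->] := nformP fm (g' * h').
  by exists (map_mpoly io q); rewrite rmorphM.
have [q qE] := nform0_dvd fm gh0.
have [/(mdvd_small fmt)|/(mdvd_small fmt)] : mdvd (map_mpoly th f) (map_mpoly th g') \/
    mdvd (map_mpoly th f) (map_mpoly th h').
- by apply: fp; exists (map_mpoly th q); rewrite -!rmorphM qE.
- by move=> /(_ (smt _ _ (small _ _ _ gE)))/eqP; rewrite (negPf g'0).
- by move=> /(_ (smt _ _ (small _ _ _ hE)))/eqP; rewrite (negPf h'0).
Qed.
End PlaceTransfer.

(** The two cases are a nonzero and a zero resultant. In the second one the gcd is a proper factor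
    of [P], up to the constant [c] because [R] is only a domain. *)
Lemma bezout_or_factor (R : idomainType) (P Q : {poly R}) :
  P != 0 -> Q != 0 -> (size Q < size P)%N ->
  (exists (r : R) (u v : {poly R}), r != 0 /\ r%:P = u * P + v * Q) \/
  (exists (c : R) (A B : {poly R}), [/\ c != 0, A != 0, B != 0, c *: P = A * B &
     (size A < size P)%N && (size B < size P)%N]).
Proof.
move=> P0 Q0 sQ; have [s1|s1] := leqP (size Q) 1.
  left; exists Q`_0, 0, 1; rewrite mul0r add0r mul1r -size1_polyC //; split=> //.
  by rewrite -polyC_eq0 -size1_polyC.
have sP := ltn_trans s1 sQ.
have [res|res] := eqVneq (resultant P Q) 0; last first.
  by left; have [[u v] /= _ E] := resultant_in_ideal sP s1; exists (resultant P Q), u, v.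
right; move/eqP: res; rewrite resultant_eq0; set A := gcdp P Q => sA.
have A0 : A != 0 by rewrite -size_poly_gt0 ltnW.
have sAQ : (size A <= size Q)%N by apply: Pdiv.Idomain.dvdp_leq => //; exact: Pdiv.Idomain.dvdp_gcdr.
have := Pdiv.Idomain.dvdp_gcdl P Q; rewrite -/A => /Pdiv.Idomain.dvdpP [[c B] /= c0 E].
have cP : c *: P != 0 by rewrite -mul_polyC mulf_neq0 ?polyC_eq0.
have B0 : B != 0 by apply: contraNneq cP => B0; rewrite E B0 mul0r.
exists c, A, B; split=> //; first by rewrite mulrC.
rewrite (leq_ltn_trans sAQ sQ) /=.
have := congr1 (fun u : {poly _} => size u) E; rewrite size_scale // size_mul //.
by move=> ->; case: (size A) sA => [|[|s]] // _; rewrite !addnS /= ltnS leq_addr.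
Qed.

Lemma bezout_or_factor_mpoly (k : fieldType) n (P Q : {poly {mpoly k[n]}}) :
  P != 0 -> Q != 0 -> (size Q < size P)%N ->
  (exists (r : {mpoly k[n]}) (u v : {poly {mpoly k[n]}}), r != 0 /\ r%:P = u * P + v * Q) \/
  (exists (c : {mpoly k[n]}) (A B : {poly {mpoly k[n]}}),
     [/\ c != 0, A != 0, B != 0, c *: P = A * B &
     (size A < size P)%N && (size B < size P)%N]).
Proof. exact: bezout_or_factor. Qed.

(* If g is nonzero and reduced modulo f, its resultant with f in the last
   variable is a nonzero polynomial in the other ones; where it does not vanish,
   no root of f is a root of g. *)
Lemma vanish_dvd (k : closedFieldType) n m (f g : {mpoly k[n.+1]}) :
  ymonic m.+1 f -> mprime f ->
  (forall x, f.@[x] = 0 -> g.@[x] = 0) -> mdvd f g.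
Proof.
move=> fm fp van; apply: (nform0_dvd fm); apply/eqP/negPn/negP => g0.
have [q qE] := nformP fm g; have sr := nform_size fm g.
move: (nform f g) g0 qE sr => r g0 qE sr.
have van' x : f.@[x] = 0 -> r.@[x] = 0.
  move=> fx; have -> : r = g - q * f by rewrite -qE subKr.
  by rewrite mevalB mevalM fx mulr0 subr0 van.
have r0 : muni r != 0 by apply: contra_neq g0 => e; apply: muni_inj; rewrite e raddf0.
have sf : size (muni f) = m.+2 by case: fm.
have mf : muni f \is monic by case: fm.
have f0 := monic_neq0 mf.
have sr' : (size (muni r) < size (muni f))%N by rewrite [X in (_ < X)%N]sf ltnS.
have : (exists (R : {mpoly k[n]}) (u v : {poly {mpoly k[n]}}),
      R != 0 /\ R%:P = u * muni f + v * muni r) \/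
    (exists (c : {mpoly k[n]}) (A B : {poly {mpoly k[n]}}),
      [/\ c != 0, A != 0, B != 0, c *: muni f = A * B &
       (size A < size (muni f))%N && (size B < size (muni f))%N]).
  clear -f0 r0 sr'; move: (muni f) (muni r) f0 r0 sr' => P Q P0 Q0 sQ.
  exact: (bezout_or_factor_mpoly P0 Q0 sQ).
case; last first.
  move=> [c [A [B [c0 A0 B0 E /andP []]]]].
  rewrite [X in (_ < X)%N -> _]sf ltnS => sA.
  rewrite [X in (_ < X)%N -> _]sf ltnS => sB.
  have dv : mdvd f (muniV A * muniV B).
    exists (mwiden c); apply: muni_inj; rewrite !muniM !muniVK -E.
    by rewrite muni_widen mul_polyC.
  have nz (u : {poly {mpoly k[n]}}) : u != 0 -> (size u <= m.+1)%N -> ~ mdvd f (muniV u).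
    move=> u0 su /(mdvd_small fm); rewrite muniVK => /(_ su) /(congr1 (@muni n k)).
    by rewrite muniVK raddf0 => /eqP; rewrite (negPf u0).
  by have [/(nz _ A0 sA)|/(nz _ B0 sB)] := fp _ _ dv.
move=> [R [u [v [/mpoly_nonroot [x rx] E]]]].
pose ev := map_poly (meval x).
have [y fy] : exists y, root (ev (muni f)) y.
  apply/closed_rootP; rewrite size_map_poly_id0 ?sf // (monicP mf) meval1.
  exact: oner_neq0.
pose X (i : 'I_n.+1) := if insub (val i) is Some j then x j else y : k.
have XE p : p.@[X] = (ev (muni p)).[y].
  rewrite meval_muni (_ : X \o _ = x); last first.
    apply/funext => j; rewrite /X /= insubT //= => lj; congr (x _); exact: val_inj.
  by rewrite /X insubF ?ltnn.
have fX : f.@[X] = 0 by rewrite XE; apply/rootP.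
have rX := van' _ fX; rewrite XE in rX; rewrite XE in fX.
move/eqP: rx; apply; have := congr1 (fun p => (ev p).[y]) E.
have evD (a b c e : {poly {mpoly k[n]}}) : (ev b).[y] = 0 -> (ev e).[y] = 0 ->
    (ev (a * b + c * e)).[y] = 0.
  by move=> hb he; rewrite /ev rmorphD !rmorphM hornerD !hornerM hb he !mulr0 addr0.
move=> e1; move: (etrans e1 (evD u _ v _ fX rX)).
by rewrite /ev map_polyC hornerC.
Qed.

(** * Weighted homogeneous polynomials and differential calculus *)

Section Calculus.
Variables (l : nat).

Definition mev (R S : comNzRingType) (u : {rmorphism R -> S}) (x : 'I_l -> S)
  (p : {mpoly R[l]}) : S := mmap u x p.

Section Mev.
Variables (R S : comNzRingType) (u : {rmorphism R -> S}) (x : 'I_l -> S).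
Lemma mevB : zmod_morphism (mev u x). Proof. exact: raddfB. Qed.
Lemma mevM : monoid_morphism (mev u x). Proof. by split; [exact: rmorph1 | exact: rmorphM]. Qed.
HB.instance Definition _ := GRing.isZmodMorphism.Build _ _ (mev u x) mevB.
HB.instance Definition _ := GRing.isMonoidMorphism.Build _ _ (mev u x) mevM.
Lemma mevC c : mev u x c%:MP = u c. Proof. exact: mmapC. Qed.
Lemma mevX i : mev u x 'X_i = x i. Proof. by rewrite /mev mmapX mmap1U. Qed.
Lemma mevXm m : mev u x 'X_[m] = \prod_(i < l) x i ^+ m i. Proof. by rewrite /mev mmapX. Qed.
Lemma mevZ c p : mev u x (c *: p) = u c * mev u x p. Proof. by rewrite -mul_mpolyC rmorphM /= mevC. Qed.
Lemma mevE p : mev u x p = \sum_(m <- msupp p) u p@_m * \prod_(i < l) x i ^+ m i.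
Proof. by []. Qed.
End Mev.

Lemma mev_eq (R S : comNzRingType) (u : {rmorphism R -> S}) (x y : 'I_l -> S) p :
  x =1 y -> mev u x p = mev u y p.
Proof. by move=> /funext ->. Qed.

Lemma meval_mev (R : comNzRingType) (x : 'I_l -> R) p : p.@[x] = mev idfun x p.
Proof. by []. Qed.

Lemma mev_comp (R S T : comNzRingType) (u : {rmorphism R -> S}) (v : {rmorphism S -> T})
  (x : 'I_l -> S) p : v (mev u x p) = mev (v \o u) (v \o x) p.
Proof.
apply: (mpoly_morph_eq (f := v \o mev u x) (g := mev (v \o u) (v \o x))) => [c|i] /=.
  by rewrite !mevC.
by rewrite !mevX.
Qed.

Lemma mev_map (R S T : comNzRingType) (u : {rmorphism R -> S}) (v : {rmorphism S -> T})
  (x : 'I_l -> T) p : mev v x (map_mpoly u p) = mev (v \o u) x p.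
Proof.
apply: (mpoly_morph_eq (f := mev v x \o map_mpoly u) (g := mev (v \o u) x)) => [c|i] /=.
  by rewrite map_mpolyC !mevC.
by rewrite map_mpoly_var !mevX.
Qed.

Lemma mderiv_map (R S : comNzRingType) (u : {rmorphism R -> S}) i (p : {mpoly R[l]}) :
  (map_mpoly u p)^`M(i) = map_mpoly u p^`M(i).
Proof.
apply/mpolyP => m; rewrite mcoeff_map_mpoly !mcoeff_deriv mcoeff_map_mpoly.
by rewrite raddfMn.
Qed.

Lemma mderiv_var (R : comNzRingType) (i j : 'I_l) :
  ('X_j : {mpoly R[l]})^`M(i) = (i == j)%:R.
Proof.
rewrite mderivX mnm1E eq_sym; case: eqP => [->|_]; last by rewrite scale0r.
by rewrite scale1r -[X in (X - _)%MM]add0m addmK mpolyX0.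
Qed.

Definition derivation (A : comNzRingType) (D : A -> A) :=
  (forall x y, D (x + y) = D x + D y) /\ (forall x y, D (x * y) = D x * y + x * D y).

Section Deriv.
Variables (A : comNzRingType) (D : A -> A) (hD : derivation D).
Lemma der0 : D 0 = 0.
Proof. by apply: (@addrI _ (D 0)); rewrite -hD.1 !addr0. Qed.
Lemma derN x : D (- x) = - D x.
Proof. by apply: (@addrI _ (D x)); rewrite -hD.1 !subrr der0. Qed.
Lemma derB x y : D (x - y) = D x - D y. Proof. by rewrite hD.1 derN. Qed.
Lemma der1 : D 1 = 0.
Proof.
by have := hD.2 1 1; rewrite !mulr1 mul1r => /eqP; rewrite -subr_eq0 opprD addNKr oppr_eq0 => /eqP.
Qed.
Lemma der_sum (I : Type) (r : seq I) (P : pred I) (F : I -> A) :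
  D (\sum_(i <- r | P i) F i) = \sum_(i <- r | P i) D (F i).
Proof. exact: (big_morph D hD.1 der0). Qed.
Lemma derX x e : D (x ^+ e) = (x ^+ e.-1 * D x) *+ e.
Proof.
elim: e => [|[|e] IH]; first by rewrite expr0 der1 mulr0n.
  by rewrite expr1 expr0 mul1r mulr1n.
rewrite exprS hD.2 IH /= [RHS]mulrS; congr (_ + _); first by rewrite mulrC.
by rewrite -mulrnAr mulrA -exprS mulrnAr.
Qed.
End Deriv.

Lemma mpoly_alg_ind (R : comNzRingType) (P : {mpoly R[l]} -> Prop) :
  (forall c, P c%:MP) -> (forall i, P 'X_i) ->
  (forall p q, P p -> P q -> P (p + q)) -> (forall p q, P p -> P q -> P (p * q)) ->
  forall p, P p.
Proof.
move=> hC hX hD hM p; rewrite [p]mpolyE.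
apply: big_ind => [||m _]; [by rewrite -mpolyC0 | exact: hD |].
rewrite -mul_mpolyC; apply: (hM) => //; rewrite mpolyXE_id.
apply: big_ind => [||i _]; [by rewrite -mpolyC1 | exact: hM |].
by elim: (m i) => [|e IH]; [rewrite expr0 -mpolyC1 | rewrite exprS; apply: hM].
Qed.

Lemma chain_rule (R A : comNzRingType) (u : {rmorphism R -> A}) (D : A -> A) (x : 'I_l -> A) p :
  derivation D -> (forall c, D (u c) = 0) ->
  D (mev u x p) = \sum_i mev u x p^`M(i) * D (x i).
Proof.
move=> hD Du; elim/mpoly_alg_ind: p => [c|j|p q IHp IHq|p q IHp IHq].
- by rewrite mevC Du big1 // => i _; rewrite mderivC rmorph0 mul0r.
- rewrite mevX (bigD1 j) //= mderiv_var eqxx rmorph1 mul1r big1 ?addr0 // => i ij.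
  by rewrite mderiv_var (negPf ij) rmorph0 mul0r.
- rewrite rmorphD hD.1 IHp IHq -big_split /=; apply: eq_bigr => i _.
  by rewrite mderivD rmorphD mulrDl.
- rewrite rmorphM hD.2 IHp IHq mulr_suml mulr_sumr -big_split /=.
  by apply: eq_bigr => i _; rewrite mderivM rmorphD !rmorphM /=; ring.
Qed.

(** Hadamard's form of the Taylor formula: the [q i] depend on [x] and not on [y], and nothing is
    divided by a factorial, so it holds in every characteristic. *)
Lemma taylor1 (R S : comNzRingType) (u : {rmorphism R -> S}) (x : 'I_l -> S) p :
  exists q : 'I_l -> {mpoly S[l]}, forall y,
  (forall i, (q i).@[x] = mev u x p^`M(i)) /\
  mev u y p = mev u x p + \sum_i (y i - x i) * (q i).@[y].
Proof.
elim/mpoly_alg_ind: p => [c|j|p p' [q qE] [q' qE']|p p' [q qE] [q' qE']].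
- exists (fun=> 0) => y; split=> [i|]; first by rewrite meval0 mderivC rmorph0.
  by rewrite !mevC big1 ?addr0 // => i _; rewrite meval0 mulr0.
- exists (fun i => (i == j)%:R) => y; split=> [i|].
    by rewrite mderiv_var !rmorph_nat.
  rewrite !mevX (bigD1 j) //= eqxx rmorph1 mulr1 big1 ?addr0 ?subrKC // => i ij.
  by rewrite (negPf ij) rmorph0 mulr0.
- exists (fun i => q i + q' i) => y; have [dq eq] := qE y; have [dq' eq'] := qE' y.
  split=> [i|]; first by rewrite mevalD mderivD rmorphD /= dq dq'.
  rewrite !rmorphD /= eq eq'; under [in RHS]eq_bigr do rewrite mevalD mulrDr.
  by rewrite big_split /= addrACA.
- exists (fun i => q i * (mev u x p')%:MP + q' i * map_mpoly u p) => y.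
  have [dq eq] := qE y; have [dq' eq'] := qE' y.
  have evp z : (map_mpoly u p).@[z] = mev u z p by rewrite meval_mev mev_map.
  split=> [i|].
    by rewrite mevalD !mevalM mevalC evp mderivM rmorphD !rmorphM /= dq dq'; ring.
  rewrite !rmorphM /= eq'.
  under [in RHS]eq_bigr do rewrite mevalD !mevalM mevalC evp mulrDr !mulrA.
  rewrite big_split /= -!mulr_suml mulrDr addrA; congr (_ + _); last exact: mulrC.
  by rewrite {1}eq mulrDl.
Qed.
End Calculus.

Section Weighted.
Variables (N : nat) (w : 'I_N -> nat) (k : fieldType).
Implicit Types (p q : {mpoly k[N]}).

Lemma whomogP d p : whomog w d p <-> forall m, p@_m != 0 -> wdeg w m = d.
Proof.
split=> [/dhomogP h m|h]; first by rewrite -mcoeff_msupp => /h.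
by apply/dhomogP => m; rewrite mcoeff_msupp => /h.
Qed.

Lemma whomog0 d : whomog w d (0 : {mpoly k[N]}). Proof. exact: rpred0. Qed.
Lemma whomogC (c : k) : whomog w 0 c%:MP.
Proof. by rewrite /whomog -alg_mpolyC; apply: rpredZ; exact: dhomog1. Qed.
Lemma whomogD d p q : whomog w d p -> whomog w d q -> whomog w d (p + q).
Proof. exact: rpredD. Qed.
Lemma whomogN d p : whomog w d p -> whomog w d (- p).
Proof. by move=> h; rewrite /whomog rpredN. Qed.
Lemma whomogB d p q : whomog w d p -> whomog w d q -> whomog w d (p - q).
Proof. exact: rpredB. Qed.
Lemma whomogZ d c p : whomog w d p -> whomog w d (c *: p).
Proof. exact: rpredZ. Qed.
Lemma whomog_sum d (I : Type) (r : seq I) (P : pred I) (F : I -> {mpoly k[N]}) :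
  (forall i, P i -> whomog w d (F i)) -> whomog w d (\sum_(i <- r | P i) F i).
Proof. by move=> h; apply: rpred_sum. Qed.
Lemma whomogXm m : whomog w (wdeg w m) ('X_[m] : {mpoly k[N]}).
Proof. by apply/whomogP => m'; rewrite mcoeffX; case: (m =P m') => [->|_]; rewrite ?eqxx. Qed.
Lemma wdegU i : wdeg w U_(i) = w i.
Proof.
rewrite /wdeg (bigD1 i) //= mnm1E eqxx muln1 big1 ?addn0 // => j ji.
by rewrite mnm1E eq_sym (negPf ji) muln0.
Qed.
Lemma whomogX i : whomog w (w i) ('X_i : {mpoly k[N]}).
Proof. by rewrite -(wdegU i); exact: whomogXm. Qed.
Lemma whomog_prod (I : Type) (r : seq I) (P : pred I) (F : I -> {mpoly k[N]}) (e : I -> nat) :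
  (forall i, P i -> whomog w (e i) (F i)) ->
  whomog w (\sum_(i <- r | P i) e i)%N (\prod_(i <- r | P i) F i).
Proof.
move=> h; apply: (big_ind2 (fun (p : {mpoly k[N]}) (e : nat) => whomog w e p)) => //.
  by rewrite -mpolyC1; exact: whomogC.
by move=> *; exact: whomogM.
Qed.
Lemma whomogXn d p e : whomog w d p -> whomog w (d * e) (p ^+ e).
Proof.
move=> h; elim: e => [|e IH]; first by rewrite muln0 expr0 -mpolyC1; exact: whomogC.
by rewrite exprS mulnS; exact: whomogM.
Qed.

Lemma whomog_mderiv d p i : whomog w d p -> whomog w (d - w i) p^`M(i).
Proof.
move=> /whomogP h; apply/whomogP => m; rewrite mcoeff_deriv => nz.
have : p@_(m + U_(i)) != 0 by apply: contraNneq nz => ->; rewrite mul0rn.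
by move/h; rewrite wdegD wdegU => <-; rewrite addnK.
Qed.

Lemma mderiv_low d p i : whomog w d p -> (d < w i)%N -> p^`M(i) = 0.
Proof.
move=> /whomogP h lt; apply/mpolyP => m; rewrite mcoeff0 mcoeff_deriv.
have [->|/h] := eqVneq p@_(m + U_(i)) 0; first by rewrite mul0rn.
by rewrite wdegD wdegU => e; move: lt; rewrite -e ltnNge leq_addl.
Qed.

Lemma whomog_scale (S : comNzRingType) (u : {rmorphism k -> S}) d p (c : S) x : whomog w d p ->
  mev u (fun i => c ^+ w i * x i) p = c ^+ d * mev u x p.
Proof.
move=> /dhomogP hp; rewrite !mevE mulr_sumr !big_seq; apply: eq_bigr => m mp.
rewrite mulrCA; congr (_ * _); rewrite -(hp m mp) /= /wdeg -prodrXr.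
by rewrite -big_split /=; apply: eq_bigr => i _; rewrite exprMn exprM.
Qed.

Lemma euler_mpoly d p : whomog w d p ->
  \sum_i (w i)%:R *: ('X_i * p^`M(i)) = d%:R *: p.
Proof.
move=> /dhomogP hp; rewrite {2}[p]mpolyE scaler_sumr.
transitivity (\sum_(m <- msupp p) \sum_i (w i)%:R *: ('X_i * (p@_m *: ('X_[m])^`M(i)))).
  rewrite exchange_big /=; apply: eq_bigr => i _.
  rewrite -scaler_sumr -mulr_sumr; congr (_ *: (_ * _)).
  by rewrite {1}[p]mpolyE raddf_sum /=; apply: eq_bigr => m _; rewrite mderivZ.
apply: eq_big_seq => m mp; rewrite -(hp m mp) /= /wdeg natr_sum scaler_suml.
apply: eq_bigr => i _; rewrite mderivX -scalerAr -scalerAr !scalerA.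
have [-> |mi] := eqVneq (m i) 0%N; first by rewrite muln0 !mulr0 mul0r !scale0r.
rewrite -mpolyXD natrM; congr (_ *: 'X_[_]); first by ring.
by rewrite addmBA ?lep1mP // addmC addmK.
Qed.

Lemma euler (S : comNzRingType) (u : {rmorphism k -> S}) d p x : whomog w d p ->
  \sum_i (w i)%:R * (x i * mev u x p^`M(i)) = d%:R * mev u x p.
Proof.
move=> /euler_mpoly /(congr1 (mev u x)); rewrite mevZ rmorph_nat => <-.
rewrite rmorph_sum /=; apply: eq_bigr => i _.
by rewrite mevZ rmorph_nat rmorphM /= mevX.
Qed.

End Weighted.

(** * Maximal minors of a matrix with one more column than rows *)

Section Cofactors.
Variables (A : comNzRingType) (m : nat).
Implicit Types (M : 'M[A]_(m, m.+1)) (r : 'rV[A]_m.+1) (i j : 'I_m.+1).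

Definition bordered r M : 'M[A]_m.+1 :=
  \matrix_(a, b) if unlift ord0 a is Some c then M c b else r ord0 b.

(** The signed maximal minors of [M], written as cofactors of a square matrix so that the adjugate
    identities apply to them. *)
Definition cof M i : A := cofactor (bordered 0 M) ord0 i.

Lemma bordered0 r M j : bordered r M ord0 j = r ord0 j.
Proof. by rewrite mxE unlift_none. Qed.

Lemma borderedS r M (i : 'I_m) j : bordered r M (lift ord0 i) j = M i j.
Proof. by rewrite mxE liftK. Qed.

Lemma cof_bordered r M i : cofactor (bordered r M) ord0 i = cof M i.
Proof.
rewrite /cof /cofactor; congr (_ * \det _); apply/matrixP => a b.
by rewrite !mxE !liftK.
Qed.

Lemma cofE M i : cof M i = (-1) ^+ i * \det (col' i M).
Proof.
rewrite /cof /cofactor add0n; congr (_ * \det _); apply/matrixP => a b.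
by rewrite !mxE liftK.
Qed.

Lemma det_bordered r M : \det (bordered r M) = \sum_i r ord0 i * cof M i.
Proof.
rewrite (expand_det_row _ ord0); apply: eq_bigr => i _.
by rewrite bordered0 cof_bordered.
Qed.

Lemma det_bordered_delta M i : \det (bordered (delta_mx ord0 i) M) = cof M i.
Proof.
rewrite det_bordered (bigD1 i) //= mxE !eqxx mul1r big1 ?addr0 // => j ji.
by rewrite mxE (negPf ji) andbF mul0r.
Qed.

Lemma mul_bordered r M (v : 'cV[A]_m.+1) : M *m v = 0 ->
  bordered r M *m v = (r *m v) ord0 ord0 *: delta_mx ord0 ord0.
Proof.
move=> Mv; apply/matrixP => a b; rewrite !mxE ord1.
case: (unliftP ord0 a) => [c ->|->].
  under eq_bigr do rewrite borderedS.
  have := congr1 (fun X : 'cV_m => X c ord0) Mv; rewrite !mxE => ->.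
  by rewrite /= mulr0.
by under eq_bigr do rewrite bordered0; rewrite mulr1.
Qed.

(** The maximal minors are proportional to every kernel vector. [B *m v] has no entry but [v_i] in
    row 0; multiplying it by the adjugate of [B] gives the proportionality over any commutative
    ring. *)
Lemma cof_ker M (v : 'cV[A]_m.+1) i j : M *m v = 0 ->
  cof M i * v j ord0 = cof M j * v i ord0.
Proof.
move=> Mv; pose B := bordered (delta_mx ord0 i) M.
have /matrixP /(_ j ord0) : \adj B *m (B *m v) = \det B *: v.
  by rewrite mulmxA mul_adj_mx mul_scalar_mx.
rewrite mul_bordered // -scalemxAr !mxE det_bordered_delta => <-.
rewrite (bigD1 i) //= !mxE !eqxx mul1r big1 ?addr0; last first.
  by move=> a ai; rewrite mxE (negPf ai) andbF mul0r.
rewrite (bigD1 ord0) //= !mxE !eqxx mulr1 big1 ?addr0; last first.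
  by move=> a ai; rewrite !mxE (negPf ai) mulr0.
by rewrite cof_bordered mulrC.
Qed.

Lemma cof_mulr M (T : 'M[A]_m.+1) i :
  \sum_j T i j * cof (M *m T) j = \det T * cof M i.
Proof.
have e : bordered (delta_mx ord0 i *m T) (M *m T) = bordered (delta_mx ord0 i) M *m T.
  apply/matrixP => a j; case: (unliftP ord0 a) => [c ->|->];
    rewrite !mxE ?liftK ?unlift_none ?mxE; apply: eq_bigr => b _;
    by rewrite !mxE ?liftK ?unlift_none ?mxE.
have := congr1 determinant e; rewrite det_mulmx det_bordered_delta det_bordered mulrC => <-.
apply: eq_bigr => j _; congr (_ * _); rewrite mxE (bigD1 i) //= mxE !eqxx mul1r big1 ?addr0 // => a ai.
by rewrite mxE (negPf ai) andbF mul0r.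
Qed.

Lemma cof_mull M (P : 'M[A]_m) i : cof (P *m M) i = \det P * cof M i.
Proof.
rewrite !cofE mulrCA -det_mulmx; congr (_ * \det _).
by apply/matrixP => a b; rewrite !mxE; apply: eq_bigr => c _; rewrite !mxE.
Qed.

Lemma cof_colscale M (c : 'I_m.+1 -> A) i :
  cof (\matrix_(a, b) (M a b * c b)) i = cof M i * \prod_(j | j != i) c j.
Proof.
rewrite !cofE -mulrA; congr (_ * _).
have -> : col' i (\matrix_(a, b) (M a b * c b)) =
    col' i M *m diag_mx (\row_b c (lift i b)).
  by rewrite mul_mx_diag; apply/matrixP => a b; rewrite !mxE.
rewrite det_mulmx det_diag; congr (_ * _).
rewrite (reindex_omap (lift i) (unlift i)) /=; last first.
  by move=> j ji; case: unliftP ji => [b ->|->] //; rewrite ?eqxx.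
by apply: eq_big => [b|b _]; rewrite ?mxE // liftK eqxx andbT eq_sym neq_lift.
Qed.
End Cofactors.

Lemma cof_map (A B : comNzRingType) (u : {rmorphism A -> B}) m (M : 'M[A]_(m, m.+1)) i :
  u (cof M i) = cof (map_mx u M) i.
Proof.
rewrite !cofE rmorphM rmorph_sign -det_map_mx; congr (_ * \det _).
by apply/matrixP => a b; rewrite !mxE.
Qed.

(** The term in [b * d] would contain the row [B] twice, so it vanishes. When both rows are
    derivatives of multiples of powers of a prime, this saves one factor of the prime. *)
Lemma det_two_rows (A : comNzRingType) m (M : 'M[A]_m) i j (a b c d : A) (U V B : 'rV_m) :
  i != j -> row i M = a *: U + b *: B -> row j M = c *: V + d *: B ->
  exists x y z, \det M = a * c * x + a * d * y + b * c * z.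
Proof.
move=> ij Mi Mj.
pose R (u v : 'rV[A]_m) : 'M_m := \matrix_l (if l == i then u else if l == j then v else row l M).
have Ri u v : row i (R u v) = u by rewrite rowK eqxx.
have Rj u v : row j (R u v) = v by rewrite rowK eq_sym (negPf ij) eqxx.
have R' u v u' l : l != i -> row l (R u v) = row l (R u' v) by move=> li; rewrite !rowK (negPf li).
have E1 u v v' x y z : z = x *: v + y *: v' -> \det (R u z) = x * \det (R u v) + y * \det (R u v').
  move=> ->; apply: (determinant_multilinear (i0 := j)); rewrite ?Rj //;
    by apply/matrixP => p q; rewrite !mxE; have /negPf -> : lift j p != j by rewrite eq_sym neq_lift.
have E2 u u' v x y z : z = x *: u + y *: u' -> \det (R z v) = x * \det (R u v) + y * \det (R u' v).
  move=> ->; apply: (determinant_multilinear (i0 := i)); rewrite ?Ri //;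
    by apply/matrixP => p q; rewrite !mxE; have /negPf -> : lift i p != i by rewrite eq_sym neq_lift.
have -> : M = R (row i M) (row j M).
  by apply/row_matrixP => l; rewrite rowK; case: (l =P i) => [->//|_]; case: (l =P j) => [->|].
have alt : \det (R B B) = 0.
  by apply: (determinant_alternate ij) => l; have := congr1 (fun X : 'rV_m => X ord0 l) (etrans (Ri B B) (esym (Rj B B))); rewrite !mxE.
exists (\det (R U V)), (\det (R U B)), (\det (R B V)).
by rewrite (E2 _ _ _ _ _ _ Mi) !(E1 _ _ _ _ _ _ Mj) alt; ring.
Qed.

Section PrimeElement.
Variables (A : idomainType) (f : A).
Hypothesis f0 : f != 0.
Hypothesis fprime : mprime f.

Lemma mdvdX_le e i x : (i <= e)%N -> mdvd (f ^+ e) x -> mdvd (f ^+ i) x.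
Proof. by move=> le [q ->]; exists (q * f ^+ (e - i)); rewrite -mulrA -exprD subnK. Qed.

Lemma mdvdX_mull e x y : ~ mdvd f x -> mdvd (f ^+ e) (x * y) -> mdvd (f ^+ e) y.
Proof.
move=> nx; elim: e => [|e IH]; first by exists y; rewrite expr0 mulr1.
move=> h; have [q qE] := IH (mdvdX_le (leqnSn e) h); have [r rE] := h.
have e1 : x * q = r * f.
  by apply: (mulIf (expf_neq0 e f0)); rewrite -mulrA -qE rE -mulrA -exprS.
have [//|[t tE]] : mdvd f x \/ mdvd f q by apply: fprime; exists r.
by exists t; rewrite qE tE exprS mulrA.
Qed.

Lemma mdvdX_cancel e s x y : mdvd (f ^+ s) x -> ~ mdvd (f ^+ s.+1) x ->
  mdvd (f ^+ (s + e)) (x * y) -> mdvd (f ^+ e) y.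
Proof.
move=> [q ->] nx [r rE]; apply: (@mdvdX_mull e q).
  by move=> [t tE]; apply: nx; exists t; rewrite tE exprS mulrA.
exists r; apply: (mulfI (expf_neq0 s f0)).
by rewrite [RHS]mulrCA -exprD -rE; ring.
Qed.

Lemma mdvd_exact x : (exists e, ~ mdvd (f ^+ e) x) ->
  exists s, mdvd (f ^+ s) x /\ ~ mdvd (f ^+ s.+1) x.
Proof.
move=> [e]; elim: e => [[]|e IH h]; first by exists x; rewrite expr0 mulr1.
have [h'|/IH //] := pselect (mdvd (f ^+ e) x); by exists e.
Qed.

Lemma mdvd_exact_family (I : finType) (x : I -> A) :
  (exists i e, ~ mdvd (f ^+ e) (x i)) ->
  exists s, (forall i, mdvd (f ^+ s) (x i)) /\ (exists i, ~ mdvd (f ^+ s.+1) (x i)).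
Proof.
move=> [i0 [e]]; elim: e => [[]|e IH h]; first by exists (x i0); rewrite expr0 mulr1.
have [h'|nh] := pselect (forall i, mdvd (f ^+ e) (x i)); first by exists e; split=> //; exists i0.
have [/IH //|h1] := pselect (~ mdvd (f ^+ e) (x i0)).
have /existsNP [i hi] := nh.
move: {IH h i0 h1} e i hi {nh} => e i; elim: e i => [i []|e IH i hi]; first by exists (x i); rewrite expr0 mulr1.
have [h'|/existsNP [j hj]] := pselect (forall i, mdvd (f ^+ e) (x i)); first by exists e; split=> //; exists i.
exact: IH hj.
Qed.
End PrimeElement.

Section FormMatrix.
Variables (l : nat) (wt : 'I_l.+2 -> nat).

(* The rows are the Euler field and the derivations applied to q. *)
Definition formmx (A : comNzRingType) (D : 'I_l -> A -> A) (q : 'I_l.+2 -> A) :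
    'M[A]_(l.+1, l.+2) :=
  \matrix_(r, i) if unlift ord0 r is Some j then D j (q i) else (wt i)%:R * q i.

Section Local.
Variables (A : idomainType) (phi : A).
Hypothesis phi0 : phi != 0.
Hypothesis phi_prime : mprime phi.
Variables (D : 'I_l -> A -> A).
Hypothesis hD : forall j, derivation (D j).
Variables (M : 'M[A]_(l.+1, l.+2)) (g : 'I_l.+2 -> A).
Hypothesis Mg : M *m \col_i g i = 0.
Variables (T : 'M[A]_l.+2) (c h : 'I_l.+2 -> A).
Hypothesis MT0 : forall i, (M *m T) ord0 i = c i * h i.
Hypothesis MTS : forall j i, (M *m T) (lift ord0 j) i = D j (h i).
Variables (s : nat) (t1 t2 : 'I_l.+2).
Hypothesis s_gt0 : (0 < s)%N.
Hypothesis l_gt1 : (1 < l)%N.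
Hypothesis t12 : t1 != t2.
Hypothesis t1_0 : t1 != ord0.
Hypothesis t2_0 : t2 != ord0.
Hypothesis ch0 : ~ mdvd phi (c ord0 * h ord0).
Hypothesis hphi : forall i, i != ord0 -> mdvd phi (h i).
Hypothesis h1 : mdvd (phi ^+ s) (h t1).
Hypothesis h2 : mdvd (phi ^+ s) (h t2).
Hypothesis detT : ~ mdvd phi (\det T).
Hypothesis gs : forall i, mdvd (phi ^+ s) (g i).
Hypothesis gs1 : exists i, ~ mdvd (phi ^+ s.+1) (g i).

Let B : 'rV[A]_l.+1 := \row_r if unlift ord0 r is Some j then D j phi else 0.

(** By Leibniz's rule one factor [phi] is lost, but only along the fixed row of the [D j phi]. *)
Lemma col_decomp e i : mdvd (phi ^+ e.+1) (h i) -> exists U y,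
  (col i (M *m T))^T = phi ^+ e.+1 *: U + (phi ^+ e * y) *: B.
Proof.
move=> [x xE]; exists (\row_r if unlift ord0 r is Some j then D j x else c i * x), (x *+ e.+1).
apply/rowP => r; case: (unliftP ord0 r) => [j ->|->].
  rewrite [LHS]mxE [LHS]mxE MTS xE (hD j).2 (derX (hD j)) !mxE liftK /=; ring.
by rewrite [LHS]mxE [LHS]mxE MT0 xE !mxE unlift_none; ring.
Qed.

(** Deleting a column [t] leaves one column whose [h] is divisible by [phi ^+ s] and a further one
    whose [h] is divisible by [phi]. Differentiation costs a factor in each, but both losses are
    along the same row, so that only one of the [s + 1] factors is lost, and none if the derivations
    kill [phi]. *)
Lemma cof_divisible e t : t != ord0 ->
  (e = s \/ e = s.+1 /\ forall j, D j phi = 0) -> mdvd (phi ^+ e) (cof (M *m T) t).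
Proof.
move=> tn he.
have [t' [t't t'0 ht']] : exists t', [/\ t' != t, t' != ord0 & mdvd (phi ^+ s) (h t')].
  by have [e1|] := eqVneq t1 t; [exists t2; rewrite -e1 eq_sym|exists t1].
have [t3 [t3t t30 t3t']] : exists t3, [/\ t3 != t, t3 != ord0 & t3 != t'].
  (* At most three indices are excluded, and [l > 1] provides at least four. *)
  have : (#|[set t; ord0; t']| < #|[set: 'I_l.+2]|)%N.
    rewrite cardsT card_ord; apply: (@leq_ltn_trans 3); last by rewrite !ltnS.
    apply: leq_trans (leq_card_setU _ _) _; rewrite cards2 cards1.
    by case: (_ != _).
  rewrite ltnNge => /negP nle.
  case: (pickP (fun t3 => t3 \notin [set t; ord0; t'])) => [t3|al].
    by rewrite !inE !negb_or -andbA => /and3P [? ? ?]; exists t3.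
  by case: nle; apply/subset_leq_card/fintype.subsetP => x _; apply/negPn/negP; rewrite al.
rewrite cofE; apply: mdvdMl; rewrite -det_tr.
have [i' i'E] : exists i', t' = lift t i'.
  by case: (unliftP t t') => [i' ->|e1]; [exists i'|rewrite e1 eqxx in t't].
have [i3 i3E] : exists i', t3 = lift t i'.
  by case: (unliftP t t3) => [i4 ->|e1]; [exists i4|rewrite e1 eqxx in t3t].
have i'3 : i' != i3 by apply: contraNneq t3t' => e1; rewrite i'E i3E e1.
have rowE i : row i (col' t (M *m T))^T = (col (lift t i) (M *m T))^T.
  by apply/rowP => r; rewrite !mxE.
have [u0 uE] : exists u, s = u.+1 by exists s.-1; rewrite prednK.
rewrite uE in ht'; have [U [y yE]] := col_decomp ht'.
have h3 : mdvd (phi ^+ 1) (h t3) by rewrite expr1; apply: hphi.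
have [V [z zE]] := col_decomp h3.
have := det_two_rows i'3 (etrans (rowE i') (etrans (congr1 (fun x => (col x _)^T) (esym i'E)) yE))
  (etrans (rowE i3) (etrans (congr1 (fun x => (col x _)^T) (esym i3E)) zE)).
case: he => [->|[-> D0]].
  move=> [a1 [a2 [a3 ->]]]; exists (phi * a1 + z * a2 + y * a3).
  by rewrite uE !exprS expr0; ring.
have B0 : B = 0 by apply/rowP => r; rewrite !mxE; case: unlift.
move: yE zE; rewrite !B0 !scaler0 !addr0 => yE zE _.
have yE' : row i' (col' t (M *m T))^T = phi ^+ s *: U + 0 *: 0 by rewrite rowE -i'E yE uE scaler0 addr0.
have zE' : row i3 (col' t (M *m T))^T = phi ^+ 1 *: V + 0 *: 0 by rewrite rowE -i3E zE scaler0 addr0.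
have [a1 [a2 [a3 ->]]] := det_two_rows i'3 yE' zE'.
by exists a1; rewrite (exprS _ s) expr1; ring.
Qed.

(** In the coordinates [h] the gradient becomes [G], again divisible by exactly [phi ^+ s]. The
    first row of [M *m T] shows that this exactness is not reached at [ord0] alone, since
    [c ord0 * h ord0] is prime to [phi]. At another index of exactness the minor is divisible by
    [phi ^+ e], and the proportionality of the minors to [G] carries this to all of them. *)
Lemma local_cof e i :
  (e = s \/ e = s.+1 /\ forall j, D j phi = 0) -> mdvd (phi ^+ e) (cof M i).
Proof.
move=> he.
pose G := \adj T *m \col_i g i.
have TG : T *m G = \det T *: \col_i g i by rewrite mulmxA mul_mx_adj mul_scalar_mx.
have MTG : M *m T *m G = 0 by rewrite -mulmxA TG -scalemxAr Mg scaler0.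
have Gs t : mdvd (phi ^+ s) (G t ord0).
  by rewrite mxE; apply: mdvd_sum => j _; apply: mdvdMl; rewrite mxE.
have [t nGt] : exists t, ~ mdvd (phi ^+ s.+1) (G t ord0).
  apply: contrapT => /forallNP al; have [i0 ni0] := gs1; apply: ni0.
  apply: (mdvdX_mull phi0 phi_prime detT).
  have := congr1 (fun X : 'cV_l.+2 => X i0 ord0) TG; rewrite !mxE => <-.
  by apply: mdvd_sum => j _; apply: mdvdMl; apply: contrapT; exact: al.
have t0 : t != ord0.
  apply: contra_not_neq nGt => ->.
  apply: (mdvdX_mull phi0 phi_prime ch0).
  have := congr1 (fun X : 'cV_l.+1 => X ord0 ord0) MTG; rewrite [in RHS]mxE mxE.
  rewrite (bigD1 ord0) //= MT0 => /eqP; rewrite addr_eq0 => /eqP ->.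
  apply: mdvdN; apply: mdvd_sum => j j0; rewrite MT0 exprS.
  have [x ->] := hphi j0; have [y ->] := Gs j.
  by exists (c j * x * y); ring.
have Ct := cof_divisible t0 he.
have Cj j : mdvd (phi ^+ e) (cof (M *m T) j).
  apply: (mdvdX_cancel phi0 phi_prime (Gs t) nGt).
  rewrite mulrC (cof_ker j t MTG) exprD.
  have [x ->] := Ct; have [y ->] := Gs j; by exists (x * y); ring.
apply: (mdvdX_mull phi0 phi_prime detT).
by rewrite -cof_mulr; apply: mdvd_sum => j _; apply: mdvdMl.
Qed.
End Local.
End FormMatrix.

Section Relation.
Variables (l : nat) (wt : 'I_l.+2 -> nat) (k : fieldType) (A : comNzRingType).
Variables (u : {rmorphism k -> A}) (D : 'I_l -> A -> A).
Hypothesis hD : forall j, derivation (D j).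
Hypothesis Du : forall j c, D j (u c) = 0.

Lemma formmx_grad (q : 'I_l.+2 -> A) (h : {mpoly k[l.+2]}) e : whomog wt e h ->
  formmx wt D q *m \col_i mev u q h^`M(i) =
  \col_r if unlift ord0 r is Some j then D j (mev u q h) else e%:R * mev u q h.
Proof.
move=> hh; apply/colP => r; case: (unliftP ord0 r) => [j ->|->]; rewrite !mxE ?liftK ?unlift_none.
  rewrite (chain_rule q h (hD j) (Du j)); apply: eq_bigr => i _.
  by rewrite !mxE liftK mulrC.
rewrite -(euler u q hh); apply: eq_bigr => i _; rewrite !mxE unlift_none.
by rewrite mulrA.
Qed.

(* On the cover y^m = f0 with m = 0 in k, the polynomial f0 itself is such an h. *)
Lemma formmx_power (q : 'I_l.+2 -> A) (h : {mpoly k[l.+2]}) e m y : whomog wt e h ->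
  mev u q h = y ^+ m -> e%:R = 0 :> A -> m%:R = 0 :> A ->
  formmx wt D q *m \col_i mev u q h^`M(i) = 0.
Proof.
move=> hh hy e0 m0; rewrite (formmx_grad q hh); apply/colP => r; rewrite !mxE.
case: unlift => [j|]; last by rewrite e0 mul0r.
by rewrite hy (derX (hD j)) -mulr_natr m0 mulr0.
Qed.
End Relation.

(** * The differential form on a cyclic cover *)

(** A contributing permutation must fix [ord0], because of column [ord0], and then every index other
    than [t1] and [t2]. Only the identity and the transposition remain; the extra entries in row
    [ord0] never contribute. *)
Lemma det_two_cols (A : comNzRingType) N (T : 'M[A]_N.+1) (t1 t2 : 'I_N.+1) (z : 'I_N.+1 -> A) :
  t1 != t2 -> t1 != ord0 -> t2 != ord0 ->
  (forall i j, j != t1 -> j != t2 -> T i j = (i == j)%:R - (if (i == ord0) && (j != ord0) then z j else 0)) ->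
  \det T = T t1 t1 * T t2 t2 - T t1 t2 * T t2 t1.
Proof.
move=> t12 t10 t20 TE; pose s2 := tperm t1 t2.
have s21 : s2 != 1%g.
  by apply: contraNneq t12 => e; rewrite -[t1](perm1 t1) -e tpermL.
have TD i : i != t1 -> i != t2 -> T i i = 1.
  by move=> i1 i2; rewrite TE // eqxx; case: eqP => //= _; rewrite subr0.
have prodE (s : 'S_N.+1) : (forall i, i != t1 -> i != t2 -> s i = i) ->
    \prod_i T i (s i) = T t1 (s t1) * T t2 (s t2).
  move=> hs; rewrite (bigD1 t1) //= (bigD1 t2) 1?eq_sym //= big1 ?mulr1 //.
  by move=> i /andP [i1 i2]; rewrite hs // TD.
rewrite /determinant (bigD1 1%g) //= (bigD1 s2) //= [X in _ + (_ + X)]big1 ?addr0.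
- rewrite odd_perm1 expr0 mul1r odd_tperm t12 expr1 mulN1r !prodE.
  + by rewrite !perm1 tpermL tpermR.
  + by move=> i i1 i2; rewrite tpermD // eq_sym.
  + by move=> i _ _; rewrite perm1.
- move=> s /andP [s1 ns2].
  have [h|/forallPn] := boolP [forall i, T i (s i) != 0]; last first.
    move=> [i0]; rewrite negbK => /eqP Ti.
    by rewrite (bigD1 i0) //= Ti mul0r mulr0.
  move/forallP: h => h.
  have fix0 : s ord0 = ord0.
    have := h (s^-1 ord0)%g; rewrite permKV TE 1?eq_sym // eqxx andbF subr0.
    have [e _|ne] := eqVneq ((s^-1)%g ord0) ord0; first by rewrite -{1}e permKV.
    by rewrite eqxx.
  have fixj j : j != t1 -> j != t2 -> s j = j.
    have [->|j0] := eqVneq j ord0; first by [].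
    move=> j1 j2; have := h (s^-1 j)%g; rewrite permKV TE //.
    have [e|_] := eqVneq (s^-1 j)%g j; first by move=> _; rewrite -{1}e permKV.
    have -> : ((s^-1)%g j == ord0) = false.
      by apply/negP => /eqP e; move: j0; rewrite -fix0 -e permKV eqxx.
    by rewrite /= subrr eqxx.
  have [e1|n1] := eqVneq (s t1) t1.
    case/eqP: s1; apply/permP => i; rewrite perm1.
    have [->//|i1] := eqVneq i t1; have [->|i2] := eqVneq i t2; last exact: fixj.
    have [//|n2] := eqVneq (s t2) t2; have n1 : s t2 != t1.
      by apply: contra_neq t12 => e; apply: (@perm_inj _ s); rewrite e1 e.
    by apply: (@perm_inj _ s); apply: fixj.
  case/eqP: ns2.
  have e1 : s t1 = t2.
    have [//|n2] := eqVneq (s t1) t2.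
    by case/eqP: (n1); apply: (@perm_inj _ s); exact: fixj n1 n2.
  have e2 : s t2 = t1.
    have [//|n3] := eqVneq (s t2) t1; have n2 : s t2 != t2.
      by apply: contra_neq t12 => e; apply: (@perm_inj _ s); rewrite e1 e.
    by case/eqP: (n2); apply: (@perm_inj _ s); exact: fixj n3 n2.
  apply/permP => i; rewrite permE /=.
  have [->|i1] := eqVneq i t1; first by rewrite e1.
  by have [->|i2] := eqVneq i t2; [rewrite e2 | exact: fixj].
Qed.

(* Properties of the reduction y^m = f0(w, x) in characteristic p that make the
   (n-1)-form w_0^delta * dw /\ dx / df0 regular along curves, even at the
   critical points of f0. The variables of f0 are w_0, ..., w_l of weight 1 and
   x = X_(ord_max) of weight a. *)
Section GoodCover.
Variables (l a b d m : nat) (F : fieldType) (f0 : {mpoly F[l.+2]}).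

Definition wt1 (i : 'I_l.+2) : nat := if i == ord_max then a else 1%N.

Section Curve.
Variables (A : comNzRingType) (u : {rmorphism F -> A}).
Definition grad (q : 'I_l.+2 -> A) i : A := mev u q f0^`M(i).
Definition hess (q : 'I_l.+2 -> A) i j : A := mev u q f0^`M(i)^`M(j).
End Curve.

(** Over every extension field the critical points are, up to weighted scaling, defined over [F], so
    that derivations see them as constants; and the Hessian has a nonzero principal minor of size
    two away from [ord0]. *)
Definition critical_good (K : fieldType) (u : {rmorphism F -> K}) :=
  forall q : 'I_l.+2 -> K, (forall i, grad u q i = 0) -> (exists i, q i != 0) ->
  [/\ q ord0 != 0,
      forall i, i != ord_max -> exists z, q i = u z * q ord0,
      exists z, q ord_max = u z * q ord0 ^+ a &
      exists t1 t2, [/\ t1 != t2, t1 != ord0, t2 != ord0 &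
        hess u q t1 t1 * hess u q t2 t2 - hess u q t1 t2 * hess u q t2 t1 != 0]].

(** Clearing a common factor in weighted coordinates may call for a fractional power of [phi]: all
    coordinates can be divisible by [phi] while that of weight [a] is not divisible by [phi ^+ a].
    The property says that integral powers suffice on the cover. *)
Definition rescalable (A : idomainType) (u : {rmorphism F -> A}) (phi : A) :=
  forall (q : 'I_l.+2 -> A) y, y ^+ m = mev u q f0 -> (exists i, q i != 0) ->
  exists e q' y', [/\ forall i, q i = phi ^+ (e * wt1 i) * q' i, y = phi ^+ (e * b) * y',
    y' ^+ m = mev u q' f0 & exists i, ~ mdvd phi (q' i)].

Record good_cover : Prop := GoodCover {
  good_homog : whomog wt1 d f0;
  good_d0 : d%:R = 0 :> F;
  good_m0 : m%:R = 0 :> F;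
  good_a0 : a%:R = 0 :> F;
  good_critical : forall (K : fieldType) (u : {rmorphism F -> K}), critical_good u;
  good_rescale : forall (A : idomainType) (u : {rmorphism F -> A}) phi,
    phi != 0 -> mprime phi -> ~ mdvd phi 1 ->
    (forall x, x != 0 -> exists e, ~ mdvd (phi ^+ e) x) -> rescalable u phi
}.

Variable G : good_cover.

Section LocalCurve.
Variables (A : idomainType) (u : {rmorphism F -> A}) (D : 'I_l -> A -> A).
Hypothesis hD : forall j, derivation (D j).
Hypothesis Du : forall j c, D j (u c) = 0.
Hypothesis l_gt1 : (1 < l)%N.
Variable phi : A.
Hypothesis phi0 : phi != 0.
Hypothesis phi_prime : mprime phi.
Variables (K : fieldType) (res : {rmorphism A -> K}).
Hypothesis resP : forall x, res x = 0 <-> mdvd phi x.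

Let natA0 e : e%:R = 0 :> F -> e%:R = 0 :> A.
Proof. by move=> e0; rewrite -(rmorph_nat u) e0 rmorph0. Qed.

Lemma Mgrad q y : y ^+ m = mev u q f0 ->
  formmx wt1 D q *m \col_i grad u q i = 0.
Proof.
move=> yq; apply: (formmx_power hD Du (good_homog G) (esym yq)).
  exact: natA0 (good_d0 G).
exact: natA0 (good_m0 G).
Qed.

(** [local_cof] is applied in new coordinates: the partial derivatives at [t1] and [t2], which are
    divisible by [phi ^+ s] and independent by the Hessian minor, and the differences of the
    remaining coordinates from their constant values at the critical point. *)
Lemma critical_cof (q : 'I_l.+2 -> A) y s e i : y ^+ m = mev u q f0 ->
  (exists i, ~ mdvd phi (q i)) -> (forall i, mdvd phi (grad u q i)) ->
  (forall i, mdvd (phi ^+ s) (grad u q i)) -> (exists i, ~ mdvd (phi ^+ s.+1) (grad u q i)) ->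
  (e = s \/ e = s.+1 /\ forall j, D j phi = 0) ->
  mdvd (phi ^+ e) (cof (formmx wt1 D q) i).
Proof.
move=> yq prim crit gs gs1 he.
have s_gt0 : (0 < s)%N.
  by case: s gs1 {gs he} => // -[i0 []]; rewrite expr1; exact: crit.
have res_mev p : res (mev u q p) = mev (res \o u) (res \o q) p by exact: mev_comp.
have [||q0 hz [zx hzx] [t1 [t2 [t12 t10 t20 detH]]]] := good_critical G (u := res \o u) (q := res \o q).
- by move=> j; rewrite /grad -res_mev; apply/resP; exact: crit.
- by have [j nj] := prim; exists j; apply/eqP => /resP.
have {q0}q0 : ~ mdvd phi (q ord0) by move/resP/eqP; rewrite (negPf q0).
have {}hz j : j != ord_max -> exists z, mdvd phi (q j - u z * q ord0).
  by move=> /hz [z /= e1]; exists z; apply/resP; rewrite rmorphB rmorphM /= e1 subrr.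
have {}hzx : mdvd phi (q ord_max - u zx * q ord0 ^+ a).
  by rewrite /= in hzx; apply/resP; rewrite rmorphB rmorphM rmorphXn /= hzx subrr.
have {}detH : ~ mdvd phi (hess u q t1 t1 * hess u q t2 t2 - hess u q t1 t2 * hess u q t2 t1).
  by move/resP/eqP; rewrite rmorphB !rmorphM /hess !res_mev; apply/negP.
have /choice [z zE] : forall i, exists z, i != ord_max -> mdvd phi (q i - u z * q ord0).
  by move=> j; have [->|/hz [z hz']] := eqVneq j ord_max; [exists 0 | exists z].
(* The columns of [T] are the gradients of the functions [h] below. In the last coordinate
   [q ord0 ^+ a] has derivative 0, as [a] is 0 in [F]. *)
pose T : 'M[A]_l.+2 := \matrix_(i, j)
  if (j == t1) || (j == t2) then hess u q j i
  else (i == j)%:R - (if (i == ord0) && (j != ord0) then (if j == ord_max then 0 else u (z j)) else 0).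
pose c (j : 'I_l.+2) : A := if j == t1 then (d - wt1 t1)%:R else if j == t2 then (d - wt1 t2)%:R
  else (wt1 j)%:R.
pose h (j : 'I_l.+2) : A := if j == t1 then grad u q t1 else if j == t2 then grad u q t2
  else if j == ord_max then q ord_max - u zx * q ord0 ^+ a else
  if j == ord0 then q ord0 else q j - u (z j) * q ord0.
have nmax0 : (ord0 == ord_max :> 'I_l.+2) = false by [].
have aA : a%:R = 0 :> A := natA0 (good_a0 G).
have colH t r : (formmx wt1 D q *m \col_i hess u q t i) r 0 =
    if unlift ord0 r is Some j then D j (grad u q t) else (d - wt1 t)%:R * grad u q t.
  by rewrite (formmx_grad hD Du q (whomog_mderiv t (good_homog G))) mxE.
have MTcol r j : (formmx wt1 D q *m T) r j = (formmx wt1 D q *m \col_i T i j) r 0.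
  by rewrite !mxE; apply: eq_bigr => i0 _; rewrite !mxE.
have Tt (j : 'I_l.+2) : (j == t1) || (j == t2) -> \col_i T i j = \col_i hess u q j i.
  by move=> hj; apply/colP => i0; rewrite !mxE hj.
have MTg r j : j != t1 -> j != t2 -> (formmx wt1 D q *m T) r j =
    formmx wt1 D q r j - (if (j == ord0) || (j == ord_max) then 0 else formmx wt1 D q r ord0 * u (z j)).
  move=> j1 j2; rewrite mxE.
  under eq_bigr => i0 _ do rewrite [T i0 j]mxE (negPf j1) (negPf j2) /= mulrBr.
  rewrite sumrB; congr (_ - _).
    rewrite (bigD1 j) //= eqxx mulr1 big1 ?addr0 // => i0 /negPf ->.
    by rewrite mulr0.
  rewrite (bigD1 ord0) //= big1 ?addr0; last by move=> i0 /negPf ->; rewrite mulr0.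
  by case: eqP => [->|_] /=; [rewrite mulr0 | case: eqP => _ /=; rewrite ?mulr0].
apply: (@local_cof l A phi phi0 phi_prime D hD _ _ (Mgrad yq) T c h _ _ s t1 t2) => //.
- move=> j; rewrite /c /h; have [->|j1] := eqVneq j t1.
    by rewrite MTcol Tt ?eqxx // colH unlift_none.
  have [->|j2] := eqVneq j t2; first by rewrite MTcol Tt ?eqxx ?orbT // colH unlift_none.
  rewrite MTg // !mxE unlift_none /wt1 nmax0; have [->|jm] := eqVneq j ord_max.
    by rewrite orbT aA !mul0r subr0.
  have [->|j0] := eqVneq j ord0; first by rewrite subr0.
  by rewrite /= !mul1r mulrC.
- move=> r j; rewrite /h; have [->|j1] := eqVneq j t1.
    by rewrite MTcol Tt ?eqxx // colH liftK.
  have [->|j2] := eqVneq j t2; first by rewrite MTcol Tt ?eqxx ?orbT // colH liftK.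
  rewrite MTg // !mxE liftK; have [->|jm] := eqVneq j ord_max.
    rewrite orbT subr0 (derB (hD r)) (hD r).2 Du mul0r add0r (derX (hD r)).
    by rewrite -mulr_natr aA !mulr0 subr0.
  have [->|j0] := eqVneq j ord0; first by rewrite subr0.
  by rewrite /= (derB (hD r)) (hD r).2 Du mul0r add0r mulrC.
- rewrite /c /h eq_sym (negPf t10) eq_sym (negPf t20) nmax0 eqxx /wt1 nmax0 mul1r.
  exact: q0.
- move=> j j0; rewrite /h; case: eqP => [_|_]; first exact: crit.
  case: eqP => [_|_]; first exact: crit.
  by have [_|jm] := eqVneq j ord_max; rewrite ?(negPf j0) //; exact: zE.
- by rewrite /h eqxx; exact: gs.
- by rewrite /h eqxx eq_sym (negPf t12); exact: gs.
- rewrite (@det_two_cols _ _ T t1 t2 (fun j => if j == ord_max then 0 else u (z j))) //.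
    by rewrite !mxE !eqxx /= orbT; move: detH; rewrite (mulrC (hess u q t2 t1)).
  by move=> i0 j /negPf j1 /negPf j2; rewrite mxE j1 j2.
Qed.
End LocalCurve.
End GoodCover.

(** * Divisibility in polynomial rings over a field *)

Section PolyPrime.
Variable E : fieldType.
Implicit Types (p q phi : {poly E}).

Lemma mdvd_dvdp p q : mdvd p q <-> p %| q.
Proof. by split=> [[r ->]|/dvdpP [r ->]]; [exact: dvdp_mull | exists r]. Qed.

Lemma irredp_prime phi : irreducible_poly phi ->
  [/\ phi != 0, mprime phi & ~ mdvd phi 1].
Proof.
move=> [s1 irr]; have phi0 : phi != 0 by rewrite -size_poly_gt0 ltnW.
split=> //; last by move=> /mdvd_dvdp; rewrite dvdp1 => /eqP e; rewrite e in s1.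
move=> g h /mdvd_dvdp; have [dg|ndg] := boolP (phi %| g); first by left; apply/mdvd_dvdp.
rewrite Gauss_dvdpr => [?|]; first by right; apply/mdvd_dvdp.
rewrite /coprimep; apply/negPn/negP => s; have := irr _ s (dvdp_gcdl phi g).
by move=> /(eqp_dvdl g); rewrite dvdp_gcdr => e; rewrite -e in ndg.
Qed.

Lemma irredp_factor p : (1 < size p)%N -> exists phi, irreducible_poly phi /\ phi %| p.
Proof.
move: {2}(size p) (leqnn (size p)) => s; elim: s p => [|s IH] p les s1.
  by move: (leq_trans s1 les).
have [irr|nirr] := pselect (irreducible_poly p); first by exists p.
have [q [sq dq neq]] : exists q, [/\ size q != 1%N, q %| p & ~~ (q %= p)].
  apply: contrapT => /forallNP al; apply: nirr; split=> // q sq dq.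
  by apply/negPn/negP => neq; apply: (al q).
have p0 : p != 0 by rewrite -size_poly_gt0 ltnW.
have ltq : (size q < size p)%N.
  by rewrite ltn_neqAle dvdp_leq // andbT; apply: contra neq => /eqP e; rewrite -dvdp_size_eqp // e.
have q0 : q != 0 by apply: contraNneq p0 => q0; move: dq; rewrite q0 dvd0p.
have [||phi [irr dphi]] := IH q.
- by rewrite -ltnS (leq_trans ltq).
- by rewrite ltn_neqAle eq_sym sq size_poly_gt0.
by exists phi; split=> //; apply: dvdp_trans dq.
Qed.

Lemma dvdp_exp_bound phi p : irreducible_poly phi -> p != 0 -> ~ mdvd (phi ^+ size p) p.
Proof.
move=> [s1 _] p0 /mdvd_dvdp /(dvdp_leq p0); rewrite leqNgt => /negP; apply.
have phi0 : phi != 0 by rewrite -size_poly_gt0 ltnW.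
rewrite (polySpred (expf_neq0 _ phi0)) size_exp ltnS; case: (size phi) s1 => [|[|s]] // _ /=.
by rewrite leq_pmull.
Qed.

Lemma residue_field phi : irreducible_poly phi ->
  exists (K : fieldType) (res : {rmorphism {poly E} -> K}),
    (forall x, res x = 0 <-> mdvd phi x) /\ (forall z, exists x, res x = z).
Proof.
move=> irr; have phi0 : phi != 0 by have [] := irredp_prime irr.
pose psi := (lead_coef phi)^-1 *: phi.
have lc0 : (lead_coef phi)^-1 != 0 by rewrite invr_eq0 lead_coef_eq0.
have mpsi : psi \is monic by rewrite monicE lead_coefZ mulVf // lead_coef_eq0.
have ipsi : irreducible_poly psi.
  split; first by rewrite size_scale //; case: irr.
  move=> q sq dq; apply: (eqp_trans (y := phi)).
    by case: irr => _; apply=> //; rewrite -(dvdpZr _ _ lc0).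
  by rewrite eqp_sym; apply: eqp_scale.
have hI : monic_irreducible_poly psi by split.
exists {poly %/ psi with hI}, (in_qpoly psi : {rmorphism {poly E} -> {poly %/ psi}}).
have mk : mk_monic psi = psi by exact: mk_monicE.
split=> [x|z]; last first.
  exists ((z : {poly %/ psi}) : {poly E}); apply: val_inj; apply: in_qpoly_small.
  exact: size_mk_monic.
have -> : mdvd phi x <-> psi %| x by rewrite mdvd_dvdp dvdpZl.
split=> [/(congr1 (fun t : {poly %/ psi} => (t : {poly E}))) /=|dx].
  by rewrite mk => r0; apply/Pdiv.Field.modp_eq0P; rewrite -r0 Pdiv.IdomainMonic.modpE.
apply/val_inj; rewrite /= mk -Pdiv.IdomainMonic.modpE //; exact/Pdiv.Field.modp_eq0P.
Qed.

(** Let [b / a] be the common ratio in lowest terms. An irreducible factor [phi] of [a] is prime to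
    [b], so [phi ^+ s.+1] would divide every [g' i], against the local hypothesis. The exponents
    [e i] leave room for a weighted rescaling. *)
Lemma lambda_exists (I : finType) (g N : I -> {poly E}) i0 : g i0 != 0 ->
  (forall i j, N i * g j = N j * g i) ->
  (forall phi, irreducible_poly phi -> exists s (e : I -> nat) g' N',
    [/\ forall i, g i = phi ^+ e i * g' i, forall i, N i = phi ^+ e i * N' i,
        exists i, ~ mdvd (phi ^+ s.+1) (g' i) & forall i, mdvd (phi ^+ s) (N' i)]) ->
  exists lam, forall i, lam * g i = N i.
Proof.
move=> gi0 comm loc; pose dd := gcdp (g i0) (N i0).
have dd0 : dd != 0 by rewrite gcdp_eq0 (negPf gi0).
have /dvdpP [a aE] := dvdp_gcdl (g i0) (N i0); have /dvdpP [b bE] := dvdp_gcdr (g i0) (N i0).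
rewrite -/dd in aE bE.
have a0 : a != 0 by apply: contraNneq gi0 => a0; rewrite aE a0 mul0r.
have cop : coprimep a b.
  have := coprimep_div_gcd (p := g i0) (q := N i0); rewrite gi0 /= => /(_ isT).
  by rewrite -/dd {1}aE bE !mulpK.
have ab i : a * N i = b * g i.
  apply: (mulIf dd0); rewrite mulrAC -aE mulrAC -bE mulrC; exact: comm.
have [s1|] := leqP (size a) 1; last first.
  move=> /irredp_factor [phi [irr dphi]].
  have [phi0 pp pnu] := irredp_prime irr.
  have [s [e [g' [N' [gE NE [i ni] dN]]]]] := loc phi irr.
  case: ni; apply: (mdvdX_mull phi0 pp (x := b)).
    move=> /mdvd_dvdp db; apply: pnu; apply/mdvd_dvdp.
    have := dvdp_gcd phi a b; rewrite dphi db (eqp_dvdr _ (_ : gcdp a b %= 1)) ?gcdp_eqp1 //.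
  have <- : a * N' i = b * g' i.
    apply: (mulfI (expf_neq0 (e i) phi0)).
    by rewrite mulrCA -NE ab gE mulrCA.
  rewrite exprS; have [r ->] := dN i; have /dvdpP [t ->] := dphi.
  by exists (t * r); ring.
have [c cE] : exists c, a = c%:P by exists a`_0; exact: size1_polyC.
have c0 : c != 0 by rewrite -polyC_eq0 -cE.
exists (c^-1%:P * b) => i; rewrite -mulrA -ab cE mulrA -polyCM mulVf // mul1r.
by [].
Qed.
End PolyPrime.

Section DerPoly.
Variables (E : fieldType) (D : E -> E) (hD : derivation D).
Definition der_poly (p : {poly E}) : {poly E} := map_poly D p.
Lemma coef_der_poly p i : (der_poly p)`_i = D p`_i.
Proof. by rewrite coef_map_id0 // der0. Qed.
Lemma der_poly_der : derivation der_poly.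
Proof.
split=> p q; apply/polyP => i; first by rewrite coefD !coef_der_poly coefD hD.1.
rewrite coefD !coefM coef_der_poly coefM (der_sum hD) -big_split /=.
by apply: eq_bigr => j _; rewrite hD.2 !coef_der_poly.
Qed.
Lemma der_polyX : der_poly 'X = 0.
Proof.
by apply/polyP => i; rewrite coef_der_poly coefX coef0; case: (_ == _); rewrite ?(der1 hD) ?(der0 hD).
Qed.
Lemma der_polyC c : der_poly c%:P = (D c)%:P.
Proof. by apply/polyP => i; rewrite coef_der_poly !coefC; case: eqP => // _; exact: der0. Qed.
End DerPoly.

Section Scale.
Variables (l : nat) (wt : 'I_l.+2 -> nat) (A : idomainType) (D : 'I_l -> A -> A).
Hypothesis hD : forall j, derivation (D j).

(** Differentiating [c ^+ wt i] only adds multiples of the Euler row to the other rows. Multiplying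
    those rows by [c] avoids a denominator, and both triangular matrices have determinant
    [c ^+ l]. *)
Lemma cof_formmx_scale (c : A) q i : c != 0 ->
  cof (formmx wt D (fun i => c ^+ wt i * q i)) i =
  cof (formmx wt D q) i * \prod_(j | j != i) c ^+ wt j.
Proof.
move=> c0; rewrite -cof_colscale.
set M1 := formmx wt D _; set M2 := \matrix_(_, _) _.
pose L : 'M[A]_l.+1 := diag_mx (\row_r if unlift ord0 r is Some _ then c else 1).
pose P : 'M[A]_l.+1 := \matrix_(r, t) if unlift ord0 r is Some j then
   (if unlift ord0 t is Some j' then c *+ (j == j') else D j c) else (t == ord0)%:R.
have LM : L *m M1 = P *m M2.
  apply/matrixP => r t; rewrite mul_diag_mx !mxE big_ord_recl /= !mxE unlift_none eqxx.
  case: (unliftP ord0 r) => [j ->|->]; last first.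
    rewrite big1 => [|j' _]; first by rewrite !mul1r addr0; ring.
    by rewrite !mxE unlift_none eq_sym (negPf (neq_lift _ _)) mul0r.
  rewrite (bigD1 j) //= !mxE !liftK eqxx mulr1n big1 ?addr0; last first.
    by move=> j' jj; rewrite !mxE !liftK eq_sym (negPf jj) mulr0n mul0r.
  rewrite (hD j).2 (derX (hD j)) mulrDr.
  case: (wt t) => [|e] /=; first by rewrite mulr0n; ring.
  by rewrite exprS; ring.
have detP : \det P = c ^+ l.
  have -> : P = \matrix_(r, t) (if unlift ord0 r is Some j then P r t else (t == ord0)%:R).
    by apply/matrixP => r t; rewrite !mxE; case: unlift.
  rewrite det_trig; last first.
    apply/is_trig_mxP => r t rt; rewrite !mxE; case: unliftP => [j e|e].
      case: unliftP => [j' e'|e']; last by move: rt; rewrite e' ltn0.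
      by rewrite (_ : j == j' = false) //; apply/eqP => jj; move: rt; rewrite e e' jj ltnn.
    by move: rt; rewrite e; case: t => -[].
  rewrite big_ord_recl mxE unlift_none eqxx mul1r.
  by under eq_bigr do rewrite !mxE !liftK eqxx mulr1n; rewrite prodr_const card_ord.
have detL : \det L = c ^+ l.
  rewrite det_diag big_ord_recl mxE unlift_none mul1r.
  by under eq_bigr do rewrite mxE liftK; rewrite prodr_const card_ord.
apply: (mulfI (expf_neq0 l c0)).
by rewrite -{1}detL -cof_mull LM cof_mull detP.
Qed.
End Scale.

(** * Constancy of the form along rational curves *)

Section CurveConstancy.
Variables (l a b d m : nat) (F : fieldType) (f0 : {mpoly F[l.+2]}).
Hypothesis G : good_cover a b d m f0.
Hypothesis l_gt1 : (1 < l)%N.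
Hypothesis dla : (l.+1 + a <= d)%N.
Hypothesis dbm : d = (b * m)%N.
Local Notation wt := (wt1 a).
Local Notation delta := (d - (l.+1 + a))%N.

Lemma sum_wt1 : (\sum_(i < l.+2) wt i = l.+1 + a)%N.
Proof.
rewrite big_ord_recr /= /wt1 eqxx; congr (_ + _)%N.
transitivity (\sum_(i < l.+1) 1)%N; last by rewrite sum1_card card_ord.
by apply: eq_bigr => i _; rewrite -val_eqE /= ltn_eqF.
Qed.

(** Numerator and gradient scale by the same power, so the value of the form depends only on the
    weighted projective point. *)
Lemma form_weight (i : 'I_l.+2) : (delta + \sum_(j | j != i) wt j)%N = (d - wt i)%N.
Proof.
have := sum_wt1; rewrite (bigD1 i) //= => e.
have : (wt i <= l.+1 + a)%N by rewrite -e leq_addr.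
move: e dla; move: (\sum_(j | _) _)%N (wt i) => x y; lia.
Qed.

Section Form.
Variables (A : idomainType) (u : {rmorphism F -> A}) (D : 'I_l -> A -> A).

Definition numer (q : 'I_l.+2 -> A) i := q ord0 ^+ delta * cof (formmx wt D q) i.
Local Notation grad := (grad f0 u).

(* lam is the value at q on the derivations D of the form
   w_0^delta * dw /\ dx / df0, with value 0 where df0 = 0. *)
Definition form_value (q : 'I_l.+2 -> A) (lam : A) :=
  ((exists i, grad q i != 0) /\ forall i, lam * grad q i = numer q i) \/
  ((forall i, grad q i = 0) /\ lam = 0).

Lemma form_value_uniq q x y : form_value q x -> form_value q y -> x = y.
Proof.
move=> [[[i gi] h]|[g0 ->]] [[[j gj] h']|[g0' ->]] //.
- by apply: (mulIf gi); rewrite h h'.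
- by rewrite g0' eqxx in gi.
- by rewrite g0 eqxx in gj.
Qed.

Hypothesis hD : forall j, derivation (D j).

Lemma numer_scale (c : A) q i : c != 0 ->
  numer (fun i => c ^+ wt i * q i) i = c ^+ (d - wt i) * numer q i.
Proof.
move=> c0; rewrite /numer cof_formmx_scale // prodrXr.
rewrite {1}/wt1 -[ord0 == _]/false expr1 exprMn -form_weight exprD; ring.
Qed.

Lemma grad_scale (c : A) q i :
  grad (fun i => c ^+ wt i * q i) i = c ^+ (d - wt i) * grad q i.
Proof. exact: whomog_scale (whomog_mderiv i (good_homog G)). Qed.

Lemma form_value_scale (c : A) q x : c != 0 -> form_value q x ->
  form_value (fun i => c ^+ wt i * q i) x.
Proof.
move=> c0 [[[i gi] h]|[g0 ->]].
  left; split; first by exists i; rewrite grad_scale mulf_neq0 ?expf_neq0.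
  by move=> j; rewrite grad_scale numer_scale // mulrCA h.
by right; split=> // i; rewrite grad_scale g0 mulr0.
Qed.
End Form.

Section OnLine.
Variables (E : fieldType) (u : {rmorphism F -> E}) (D : 'I_l -> E -> E).
Hypothesis hD : forall j, derivation (D j).
Hypothesis Du : forall j c, D j (u c) = 0.
Local Notation uP := (polyC \o u : {rmorphism F -> {poly E}}).
Local Notation DP := (fun j => der_poly (D j)).

Let hDP j : derivation (DP j). Proof. exact: der_poly_der. Qed.
Let DPu j c : DP j (uP c) = 0. Proof. by rewrite /= der_polyC // Du. Qed.

Lemma numer_comm (q : 'I_l.+2 -> {poly E}) y i j : y ^+ m = mev uP q f0 ->
  numer DP q i * grad f0 uP q j = numer DP q j * grad f0 uP q i.
Proof.
move=> yq; have := cof_ker i j (Mgrad G hDP DPu yq).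
by rewrite !mxE /numer -!mulrA => ->.
Qed.

(** By [lambda_exists] one irreducible [phi] is considered at a time, after a rescaling that makes
    the curve primitive at [phi]; the residue field at [phi] is where critical points are tested. *)
Lemma curve_form (q : 'I_l.+2 -> {poly E}) y : y ^+ m = mev uP q f0 ->
  (exists i, grad f0 uP q i != 0) ->
  exists lam, forall i, lam * grad f0 uP q i = numer DP q i.
Proof.
move=> yq [i0 gi0]; apply: (lambda_exists gi0) => [i j|phi irr].
  exact: numer_comm yq.
have [phi0 pp pnu] := irredp_prime irr.
have qn0 : exists i, q i != 0.
  apply: contrapT => /forallNP al; move/eqP: gi0; apply.
  have q0 : q = (fun i => 0 ^+ wt i * q i).
    by apply/funext => i; move: (al i) => /negP/negPn/eqP ->; rewrite mulr0.
  rewrite q0 grad_scale expr0n; have -> : (d - wt i0 == 0)%N = false; last by rewrite mul0r.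
  by have := sum_wt1; rewrite (bigD1 i0) //=; move: dla; rewrite /wt1; case: (_ == _); lia.
have arch (x : {poly E}) : x != 0 -> exists e, ~ mdvd (phi ^+ e) x.
  by move=> x0; exists (size x); exact: dvdp_exp_bound.
have [K [res [resP _]]] := residue_field irr.
have [e [q' [y' [qE yE yq' prim]]]] := good_rescale G phi0 pp pnu arch yq qn0.
have qE' : q = (fun i => (phi ^+ e) ^+ wt i * q' i).
  by apply/funext => i; rewrite -exprM; exact: qE.
have ne0 : phi ^+ e != 0 by rewrite expf_neq0.
have gi0' : grad f0 uP q' i0 != 0.
  by move: gi0; rewrite qE' grad_scale mulf_eq0 negb_or => /andP [].
have [s [gs gs1]] : exists s, (forall i, mdvd (phi ^+ s) (grad f0 uP q' i)) /\
    (exists i, ~ mdvd (phi ^+ s.+1) (grad f0 uP q' i)).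
  apply: mdvd_exact_family; exists i0, (size (grad f0 uP q' i0)).
  exact: dvdp_exp_bound.
exists s, (fun i => (e * (d - wt i))%N), (grad f0 uP q'), (numer DP q'); split=> //.
- by move=> i; rewrite qE' grad_scale exprM.
- by move=> i; rewrite qE' numer_scale // exprM.
move=> i; rewrite /numer; apply: mdvdMl.
(* For [s = 0] the curve is not critical at [phi] and there is nothing to divide. *)
case: s gs gs1 => [|s] gs gs1; first by exists (cof (formmx wt DP q') i); rewrite expr0 mulr1.
have crit j : mdvd phi (grad f0 uP q' j).
  by have := mdvdX_le (isT : (1 <= s.+1)%N) (gs j); rewrite expr1.
have := critical_cof G hDP DPu l_gt1 phi0 pp resP i yq' prim crit gs gs1 (or_introl erefl).
by apply.
Qed.

Local Notation ev0 := (horner_eval (0 : E)).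
Lemma ev0E (p : {poly E}) : ev0 p = p`_0. Proof. by rewrite /horner_eval horner_coef0. Qed.

Lemma grad_at0 (q : 'I_l.+2 -> {poly E}) i :
  (grad f0 uP q i)`_0 = grad f0 u (fun i => (q i)`_0) i.
Proof.
rewrite -ev0E /grad mev_comp; rewrite /mev; congr (mmap _ _ _).
  by apply/funext => c /=; rewrite /horner_eval hornerC.
by apply/funext => j /=; rewrite ev0E.
Qed.

Lemma numer_at0 (q : 'I_l.+2 -> {poly E}) i :
  (numer DP q i)`_0 = numer D (fun i => (q i)`_0) i.
Proof.
rewrite -ev0E /numer rmorphM rmorphXn /= ev0E cof_map; congr (_ * cof _ _).
apply/matrixP => r j; rewrite !mxE /=; case: unlift => [t|]; first by rewrite ev0E coef_der_poly.
by rewrite rmorphM rmorph_nat /= ev0E.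
Qed.

(** At a critical point the value is 0 by convention, so [lam] must vanish there. The additional
    factor ['X] comes from the case [D phi = 0] of [critical_cof]: the parameter of the line is
    constant for the derivations of [E]. *)
Lemma form_at0 (q : 'I_l.+2 -> {poly E}) y lam : y ^+ m = mev uP q f0 ->
  (exists i, grad f0 uP q i != 0) -> (exists i, (q i)`_0 != 0) ->
  (forall i, lam * grad f0 uP q i = numer DP q i) ->
  form_value u D (fun i => (q i)`_0) lam`_0.
Proof.
move=> yq [i0 gi0] [i1 qi1] hl.
have [crit|nc] := pselect (forall i, grad f0 u (fun i => (q i)`_0) i = 0); last first.
  left; split; first by have /existsNP [i ni] := nc; exists i; apply/eqP.
  by move=> i; rewrite -grad_at0 -numer_at0 -hl coefM big_ord1.
right; split=> //.
have irrX : irreducible_poly ('X : {poly E}).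
  by have := irredp_XsubC (0 : E); rewrite subr0.
have [X0 pp pnu] := irredp_prime irrX.
have [K [res [resP _]]] := residue_field irrX.
have dvdX (p : {poly E}) : mdvd 'X p <-> p`_0 = 0.
  by rewrite mdvd_dvdp -['X]subr0 -polyC0 dvdp_XsubCl /root horner_coef0; split=> /eqP.
have [s [gs gs1]] : exists s, (forall i, mdvd ('X ^+ s) (grad f0 uP q i)) /\
    (exists i, ~ mdvd ('X ^+ s.+1) (grad f0 uP q i)).
  apply: mdvd_exact_family; exists i0, (size (grad f0 uP q i0)).
  exact: dvdp_exp_bound.
have prim : exists i, ~ mdvd 'X (q i) by exists i1; move=> /dvdX /eqP; rewrite (negPf qi1).
have crit' i : mdvd 'X (grad f0 uP q i) by apply/dvdX; rewrite grad_at0 crit.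
have [j nj] := gs1; apply/dvdX; rewrite -['X]expr1.
apply: (mdvdX_cancel X0 pp (gs j) nj); rewrite mulrC hl addn1; apply: mdvdMl.
have DX i : DP i 'X = 0 by rewrite der_polyX.
have := critical_cof G hDP DPu l_gt1 X0 pp resP j yq prim crit' gs gs1 (or_intror (conj erefl DX)).
by apply.
Qed.

(** [X^K p(1/X)] for [p] of degree at most [K]: the chart of the line at infinity. *)
Definition rev_at K (p : {poly E}) : {poly E} := \poly_(i < K.+1) p`_(K - i).

Section Inverse.
Variables (T : fieldType) (tof : {rmorphism {poly E} -> T}).
Hypothesis tof_inj : injective tof.
Local Notation Xf := (tof 'X).

Definition at_inv : {poly E} -> T :=
  horner_eval (Xf^-1) \o map_poly (tof \o polyC).
HB.instance Definition _ := GRing.RMorphism.on at_inv.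

Let tof0 p : tof p = 0 -> p = 0. Proof. by rewrite -(rmorph0 tof) => /tof_inj. Qed.
Let Xf0 : Xf != 0. Proof. by apply/eqP => /tof0 /eqP; rewrite polyX_eq0. Qed.

Lemma rev_atE K (p : {poly E}) : (size p <= K.+1)%N -> tof (rev_at K p) = Xf ^+ K * at_inv p.
Proof.
move=> sp; rewrite /rev_at poly_def rmorph_sum (reindex_inj rev_ord_inj) /=.
rewrite /at_inv /= /horner_eval (@horner_coef_wide _ K.+1); last first.
  by apply: leq_trans (size_poly _ _) sp.
rewrite mulr_sumr; apply: eq_bigr => -[j /= lj] _.
rewrite subSS subKn // -mul_polyC rmorphM rmorphXn /= coef_map /= mulrCA; congr (_ * _).
by rewrite exprVn -[in RHS](subnK (lj : (j <= K)%N)) exprD mulfK // expf_neq0.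
Qed.

Lemma der_rev K (p : {poly E}) j : DP j (rev_at K p) = rev_at K (DP j p).
Proof.
apply/polyP => i; rewrite coef_der_poly // ![(rev_at _ _)`_ _]coef_poly; case: ifP => _.
  by rewrite coef_der_poly.
exact: der0 (hD j).
Qed.

Lemma at_inv_inj : injective at_inv.
Proof.
apply: raddf_inj => p p0; have := @rev_atE (size p) p (leqnSn _).
rewrite p0 mulr0 => /tof0 r0.
apply/polyP => i; rewrite coef0; have [lt|ge] := ltnP i (size p); last by rewrite nth_default.
have := congr1 (fun q : {poly E} => q`_(size p - i)) r0; rewrite coef0 coef_poly.
by rewrite ltnS leq_subr subKn // ltnW.
Qed.

Section Reverse.
Variables (kap : nat) (q : 'I_l.+2 -> {poly E}) (y : {poly E}).
Hypothesis yq : y ^+ m = mev uP q f0.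
Hypothesis sq : forall i, (size (q i) <= (kap * wt i).+1)%N.
Hypothesis sy : (size y <= (kap * b).+1)%N.

Let qr i := rev_at (kap * wt i) (q i).
Let yr := rev_at (kap * b) y.

Let tofu : tof \o uP =1 at_inv \o uP.
Proof. by move=> c; rewrite /at_inv /= map_polyC /= /horner_eval hornerC. Qed.

Lemma mev_rev e p : whomog wt e p -> tof (mev uP qr p) = (Xf ^+ kap) ^+ e * at_inv (mev uP q p).
Proof.
move=> hp; rewrite !mev_comp -(whomog_scale _ _ _ hp) /mev.
congr (mmap _ _ _); first exact/funext.
by apply/funext => i; rewrite /= rev_atE // exprM.
Qed.

Lemma yqr : yr ^+ m = mev uP qr f0.
Proof.
apply: tof_inj; rewrite (mev_rev (good_homog G)) rmorphXn /= rev_atE // -yq rmorphXn.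
by rewrite exprMn -!exprM dbm mulnA.
Qed.

Lemma grad_rev i : tof (grad f0 uP qr i) = (Xf ^+ kap) ^+ (d - wt i) * at_inv (grad f0 uP q i).
Proof. exact: mev_rev (whomog_mderiv i (good_homog G)). Qed.

Lemma numer_rev i : tof (numer DP qr i) = (Xf ^+ kap) ^+ (d - wt i) * at_inv (numer DP q i).
Proof.
have cf : tof (cof (formmx wt DP qr) i) =
    at_inv (cof (formmx wt DP q) i) * \prod_(j | j != i) (Xf ^+ kap) ^+ wt j.
  rewrite !cof_map -cof_colscale; congr (cof _ _); apply/matrixP => r j; rewrite !mxE.
  case: unlift => [t|].
    rewrite /qr der_rev rev_atE; first by rewrite mulrC exprM.
    by apply: leq_trans (size_poly _ _) _.
  by rewrite !rmorphM !rmorph_nat /= rev_atE // exprM; ring.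
rewrite /numer (rmorphM tof) cf; move: (cof (formmx wt DP q) i) => cq.
rewrite (rmorphXn tof) (rmorphM at_inv) (rmorphXn at_inv) /= /qr rev_atE // prodrXr.
rewrite {1}/wt1 -[ord0 == _]/false muln1 -form_weight exprMn [in RHS]exprD; ring.
Qed.

(** The value of the form is a polynomial [lam] in [X]. The reversed curve has a polynomial value
    [lam'] with [lam'(X) = lam(1/X)], so both are constant. The ends of the curve are its constant
    and its top coefficients. *)
Lemma form_constant : (exists i, (q i)`_0 != 0) -> (exists i, (q i)`_(kap * wt i) != 0) ->
  exists lam, form_value u D (fun i => (q i)`_0) lam /\
              form_value u D (fun i => (q i)`_(kap * wt i)) lam.
Proof.
move=> q0 q1.
have qr0 i : (qr i)`_0 = (q i)`_(kap * wt i) by rewrite coef_poly /= subn0.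
have qr1 : exists i, (qr i)`_0 != 0 by have [i ni] := q1; exists i; rewrite qr0.
rewrite (_ : (fun i => (q i)`_(kap * wt i)) = (fun i => (qr i)`_0)); last first.
  by apply/funext => i; rewrite qr0.
have Xn0 e : (Xf ^+ kap) ^+ e != 0 by rewrite !expf_neq0.
(* On a curve consisting of critical points the value is 0 at both ends. *)
have [g0|/existsNP [i0 /eqP gi0]] := pselect (forall i, grad f0 uP q i = 0).
  exists 0; split; right; split=> // i; first by rewrite -grad_at0 g0 coef0.
  rewrite -grad_at0; suff -> : grad f0 uP qr i = 0 by rewrite coef0.
  by apply: tof0; rewrite grad_rev g0 rmorph0 mulr0.
have gri0 : grad f0 uP qr i0 != 0.
  apply/eqP => /(congr1 tof); rewrite grad_rev rmorph0 => /eqP.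
  rewrite mulf_eq0 (negPf (Xn0 _)) /= => /eqP e; move/eqP: gi0; apply.
  by apply: at_inv_inj; rewrite e rmorph0.
have [lam hl] := curve_form yq (ex_intro _ i0 gi0).
have [lam' hl'] := curve_form yqr (ex_intro _ i0 gri0).
have e1 : tof lam' = at_inv lam.
  have ag : at_inv (grad f0 uP q i0) != 0.
    by apply: contra_neq gi0 => e; apply: at_inv_inj; rewrite e rmorph0.
  apply: (mulIf ag); rewrite -rmorphM hl; apply: (mulfI (Xn0 (d - wt i0)%N)).
  by rewrite -numer_rev -hl' rmorphM grad_rev mulrCA.
have e2 : lam = (lam`_0)%:P /\ lam'`_0 = lam`_0.
  have [l0|l0] := eqVneq lam 0.
    by move: e1; rewrite l0 rmorph0 => /tof0 ->; rewrite !coef0 polyC0.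
  pose K := (size lam).-1.
  have sl : (size lam <= K.+1)%N by rewrite /K prednK // size_poly_gt0.
  have := rev_atE sl; rewrite -e1 -rmorphXn -rmorphM => /tof_inj e3.
  have K0 : K = 0%N.
    move: e3 {sl}; have lK : lam`_K != 0 by rewrite -/(lead_coef lam) lead_coef_eq0.
    case: K lK => [//|K' lK] /(congr1 (fun p : {poly E} => p`_0)).
    by rewrite exprS -mulrA coefXM coef_poly /= subn0 => e; rewrite e eqxx in lK.
  rewrite K0 in sl e3; split; first exact: size1_polyC.
  have := congr1 (fun p : {poly E} => p`_0) e3; rewrite expr0 mul1r => <-.
  by rewrite coef_poly.
exists (lam`_0); split; first exact: form_at0 yq (ex_intro _ i0 gi0) q0 hl.
by rewrite -e2.2; apply: form_at0 yqr (ex_intro _ i0 gri0) qr1 hl'.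
Qed.
End Reverse.
End Inverse.
End OnLine.
End CurveConstancy.

(** * A good cover in characteristic p *)

Section FieldFacts.
Variables (F : closedFieldType) (K : fieldType) (u : {rmorphism F -> K}).

Lemma root_in_closed (p : {poly F}) x : p != 0 -> root (map_poly u p) x -> exists z, x = u z.
Proof.
move=> p0; have [r rE] := closed_field_poly_normal p.
rewrite rE map_polyZ /root hornerZ mulf_eq0 fmorph_eq0 lead_coef_eq0 (negPf p0) /=.
rewrite rmorph_prod horner_prod; elim: r {rE} => [|z r IH].
  by rewrite big_nil oner_eq0.
rewrite big_cons mulf_eq0 => /orP [|/IH //].
by rewrite rmorphB /= map_polyX map_polyC !hornerE subr_eq0 => /eqP ->; exists z.
Qed.

Lemma unity_in_closed N x : (0 < N)%N -> x ^+ N = 1 -> exists z, x = u z.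
Proof.
move=> N0 xN; apply: (root_in_closed (p := 'X^N - 1)).
  by rewrite -size_poly_gt0 size_XnsubC.
by rewrite /root rmorphB /= map_polyXn rmorph1 !hornerE xN subrr.
Qed.
End FieldFacts.

Lemma ordS_ind l (P : 'I_l.+1 -> Prop) :
  (forall j, P j -> P (ordS j)) -> forall i, P i -> forall j, P j.
Proof.
move=> PS i Pi.
have up (i' : 'I_l.+1) t : P i' -> (i' + t <= l)%N -> P (inord (i' + t)).
  move=> Pi'; elim: t => [|t IH] le; first by rewrite addn0 inord_val.
  have le' : (i' + t <= l)%N by apply: leq_trans le; rewrite leq_add2l.
  have -> : inord (i' + t.+1) = ordS (inord (i' + t) : 'I_l.+1); last exact/PS/IH.
  apply: val_inj; rewrite /= addnS; rewrite addnS in le.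
  have le2 : ((i' + t).+1 < l.+1)%N by [].
  by rewrite (inordK le2) (inordK (leqW le)) modn_small.
have Pmax : P ord_max.
  have le : (i <= l)%N by rewrite -ltnS.
  have := up i (l - i)%N Pi; rewrite subnKC // leqnn => /(_ isT).
  by congr P; apply: val_inj; rewrite /= inordK.
have P0 : P ord0.
  by have := PS _ Pmax; congr P; apply: val_inj; rewrite /= modnn.
by move=> j; have := up ord0 j P0; rewrite add0n inord_val; apply; rewrite -ltnS.
Qed.

Section PrimeValuation.
Variables (A : idomainType) (phi : A).
Hypothesis phi0 : phi != 0.
Hypothesis phi_prime : mprime phi.
Hypothesis phi_nu : ~ mdvd phi 1.

Lemma mprimeX x n : ~ mdvd phi x -> ~ mdvd phi (x ^+ n).
Proof.
move=> nx; elim: n => [|n IH]; first by rewrite expr0.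
by rewrite exprS => /phi_prime [].
Qed.

Lemma valuation_unique s t x y : ~ mdvd phi x -> ~ mdvd phi y ->
  phi ^+ s * x = phi ^+ t * y -> s = t.
Proof.
have lt s' t' x' y' : ~ mdvd phi x' -> phi ^+ s' * x' = phi ^+ t' * y' -> (t' <= s')%N.
  move=> nx E; rewrite leqNgt; apply/negP => lt; apply: nx.
  exists (phi ^+ (t' - s').-1 * y'); apply: (mulfI (expf_neq0 s' phi0)); rewrite E.
  have -> : t' = (s' + (t' - s').-1.+1)%N by move: lt; lia.
  by rewrite addKn exprD exprS /=; ring.
move=> nx ny E; apply/eqP; rewrite eqn_leq; apply/andP; split.
  exact: lt ny (esym E).
exact: lt nx E.
Qed.

Lemma valuation_ex x : (exists e, ~ mdvd (phi ^+ e) x) ->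
  exists s x', x = phi ^+ s * x' /\ ~ mdvd phi x'.
Proof.
move=> /mdvd_exact [s [[x' xE] nx]]; exists s, x'; split; first by rewrite xE mulrC.
by move=> [t tE]; apply: nx; exists t; rewrite xE tE exprS mulrA.
Qed.
End PrimeValuation.

Section LoopCover.
Variables (l a b e m p : nat) (F : closedFieldType) (c1 c2 : F).
Local Notation d := (a * e)%N.
Hypothesis pchF : p \in [pchar F].
Hypothesis p_prime : prime p.
Hypothesis pa : (p %| a)%N.
Hypothesis pe : ~~ (p %| e)%N.
Hypothesis pm : (p %| m)%N.
Hypothesis a0 : (0 < a)%N.
Hypothesis e1 : (1 < e)%N.
Hypothesis m0 : (0 < m)%N.
Hypothesis ab : coprime a b.
Hypothesis dbm : d = (b * m)%N.
Hypothesis c2e : c2 != 0 -> (2 < e)%N.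
Hypothesis l_gt1 : (1 < l)%N.
Hypothesis dl : (l.+1 + a <= d)%N.
(* In characteristic 3 and for three variables of weight 1 the Hessian of the
   loop has rank 1, and a nondegenerate term in x is needed. *)
Hypothesis c12 : (p = 3 /\ l = 2)%N ->
  ((e %% 3 = 1)%N /\ c1 = 0 /\ c2 = 1) \/ ((e %% 3 = 2)%N /\ c1 = 1 /\ c2 = 0).

Notation ww := (widen_ord (leqnSn l.+1)).
Notation wt := (wt1 a : 'I_l.+2 -> nat).

Let wtw j : wt (ww j) = 1%N.
Proof. by rewrite /wt1 -val_eqE /= ltn_eqF. Qed.
Let wtx : wt ord_max = a. Proof. by rewrite /wt1 eqxx. Qed.

(** As [p] divides [d], a Fermat sum would have zero gradient. In the loop each exponent is [d - 1],
    which is -1 in [F]. *)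
Definition loop : {mpoly F[l.+2]} :=
  \sum_(i < l.+1) 'X_(ww i) ^+ d.-1 * 'X_(ww (ordS i)).
Definition xpart : {mpoly F[l.+2]} := 'X_ord_max ^+ e
  + c1 *: ('X_ord_max * 'X_ord0 ^+ (d - a)) + c2 *: ('X_ord_max ^+ 2 * 'X_ord0 ^+ (d - 2 * a)).
Definition cover := xpart + loop.

Let e0F : e%:R != 0 :> F. Proof. by rewrite -(dvdn_pcharf pchF). Qed.
Let d5 : (4 < d)%N.
Proof. by have := prime_gt1 p_prime; have := dvdn_leq a0 pa; move: dl l_gt1; lia. Qed.
Let natp q : (p %| q)%N -> q%:R = 0 :> F. Proof. by move=> h; apply/eqP; rewrite -(dvdn_pcharf pchF). Qed.
Let d0 : d%:R = 0 :> F. Proof. by apply: natp; exact: dvdn_mulr. Qed.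
Let da0 : (d - a)%:R = 0 :> F. Proof. by apply: natp; rewrite dvdn_sub // dvdn_mulr. Qed.
Let d2a0 : (d - 2 * a)%:R = 0 :> F. Proof. by apply: natp; apply: dvdn_sub; [exact: dvdn_mulr | exact: dvdn_mull]. Qed.
Let a2d : (2 * a <= d)%N. Proof. by rewrite mulnC leq_mul2l e1 orbT. Qed.

Lemma cover_homog : whomog wt d cover.
Proof.
have hx : whomog wt a ('X_ord_max : {mpoly F[l.+2]}) by have := @whomogX _ wt F ord_max; rewrite wtx.
have hw j : whomog wt 1 ('X_(ww j) : {mpoly F[l.+2]}) by have := @whomogX _ wt F (ww j); rewrite wtw.
have h0 : whomog wt 1 ('X_ord0 : {mpoly F[l.+2]}) by have := hw ord0; rewrite (_ : ww ord0 = ord0) //; exact: val_inj.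
apply: whomogD; first apply: whomogD; first apply: whomogD.
- exact: whomogXn.
- apply: whomogZ; have := whomogM hx (whomogXn (d - a) h0); rewrite mul1n subnKC //.
  by move: a2d; lia.
- by apply: whomogZ; have := whomogM (whomogXn 2 hx) (whomogXn (d - 2 * a) h0); rewrite mul1n mulnC subnKC.
- apply: whomog_sum => j _; have := whomogM (whomogXn d.-1 (hw j)) (hw (ordS j)).
  by rewrite mul1n addn1 prednK // (leq_trans _ d5).
Qed.

Section Eval.
Variables (A : comNzRingType) (u : {rmorphism F -> A}) (q : 'I_l.+2 -> A).
Local Notation w j := (q (ww j)).
Local Notation x := (q ord_max).

Let natA q' : q'%:R = 0 :> F -> q'%:R = 0 :> A.
Proof. by move=> h; rewrite -(rmorph_nat u) h rmorph0. Qed.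

Lemma mev_cover : mev u q cover = x ^+ e + u c1 * (x * q ord0 ^+ (d - a))
  + u c2 * (x ^+ 2 * q ord0 ^+ (d - 2 * a)) + \sum_(i < l.+1) w i ^+ d.-1 * w (ordS i).
Proof.
rewrite /cover /xpart !rmorphD /= !mevZ !rmorphM !rmorphXn /= !mevX; congr (_ + _).
by rewrite rmorph_sum; apply: eq_bigr => i _; rewrite rmorphM rmorphXn /= !mevX.
Qed.

Let wwx j : (ww j == ord_max) = false.
Proof. by apply/eqP => /(congr1 val) /= e'; have := ltn_ord j; rewrite e' ltnn. Qed.
Let xww j : (ord_max == ww j) = false. Proof. by rewrite eq_sym wwx. Qed.
Let wwE i j : (ww i == ww j) = (i == j). Proof. by rewrite -val_eqE. Qed.
Let x0 : (ord_max == ord0 :> 'I_l.+2) = false. Proof. by []. Qed.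

Lemma mderivXn (i j : 'I_l.+2) n : ('X_j ^+ n : {mpoly F[l.+2]})^`M(i) =
  (i == j)%:R * ('X_j ^+ n.-1) *+ n.
Proof.
have dm : derivation (@mderiv l.+2 F i) by split; [exact: mderivD | exact: mderivM].
by rewrite (derX dm) mderiv_var mulrC.
Qed.

Let fM : (false%:R : {mpoly F[l.+2]}) = 0. Proof. by []. Qed.
Let tM : (true%:R : {mpoly F[l.+2]}) = 1. Proof. by []. Qed.
Let natM (t : {mpoly F[l.+2]}) n : n%:R = 0 :> F -> t *+ n = 0.
Proof. by move=> n0; rewrite -mulr_natr -mpolyC_nat n0 mpolyC0 mulr0. Qed.

Lemma loop_deriv j : loop^`M(ww j) =
  d.-1%:R *: ('X_(ww j) ^+ d.-2 * 'X_(ww (ordS j))) + 'X_(ww (ord_pred j)) ^+ d.-1.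
Proof.
rewrite /loop raddf_sum /=.
under eq_bigr do rewrite mderivM mderivXn mderiv_var !wwE.
rewrite big_split /=; congr (_ + _).
  rewrite (bigD1 j) //= eqxx big1 ?addr0 => [|i /negPf ij]; last by rewrite eq_sym ij mul0r mul0rn mul0r.
  by rewrite mul1r mulrnAl -scaler_nat.
rewrite (bigD1 (ord_pred j)) //= ord_predK eqxx mulr1 big1 ?addr0 // => i ij.
by rewrite (_ : j == ordS i = false) ?mulr0 //; apply: contraNF ij => /eqP ->; rewrite ordSK.
Qed.

Lemma loop_derivx : loop^`M(ord_max) = 0.
Proof.
by rewrite /loop raddf_sum big1 //= => i _; rewrite mderivM mderivXn mderiv_var !xww !fM !mul0r mul0rn mulr0 mul0r addr0.
Qed.

Lemma xpart_derivw j : xpart^`M(ww j) = 0.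
Proof.
rewrite /xpart !mderivD !mderivZ !mderivM !mderivXn !mderiv_var !wwx.
rewrite (natM _ da0) (natM _ d2a0) !fM.
by rewrite !(mul0r, mul0rn, mulr0, addr0, scaler0).
Qed.

Lemma xpart_derivx : xpart^`M(ord_max) = e%:R *: 'X_ord_max ^+ e.-1
  + c1 *: 'X_ord0 ^+ (d - a) + c2 *: (2%:R *: ('X_ord_max * 'X_ord0 ^+ (d - 2 * a))).
Proof.
rewrite /xpart !mderivD !mderivZ !mderivM !mderivXn !mderiv_var x0 eqxx.
rewrite !fM !tM !(mul0r, mul0rn, mulr0, addr0, mul1r, mulr1) ; congr (_ + _ + _ *: _).
  by rewrite scaler_nat.
by rewrite scaler_nat mulrDl mulr2n.
Qed.

Lemma grad_w j : grad cover u q (ww j) = w (ord_pred j) ^+ d.-1 - w j ^+ d.-2 * w (ordS j).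
Proof.
rewrite /grad /cover mderivD xpart_derivw add0r loop_deriv rmorphD /= mevZ !rmorphM !rmorphXn /= !mevX.
rewrite (_ : u d.-1%:R = -1) ?mulN1r 1?addrC //.
by rewrite -subn1 natrB ?(leq_trans _ d5) // d0 sub0r rmorphN rmorph1.
Qed.

Lemma grad_x : grad cover u q ord_max = e%:R * x ^+ e.-1 + u c1 * q ord0 ^+ (d - a)
  + u c2 * (2%:R * (x * q ord0 ^+ (d - 2 * a))).
Proof.
rewrite /grad /cover mderivD xpart_derivx loop_derivx addr0 !rmorphD /= !mevZ !rmorphM !rmorphXn /= !mevX.
by rewrite !rmorph_nat.
Qed.

Lemma hess_ww j t : hess cover u q (ww j) (ww t) =
  (j == t)%:R * (2%:R * w j ^+ d.-2.-1 * w (ordS j)) - (t == ordS j)%:R * w j ^+ d.-2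
  - (t == ord_pred j)%:R * w (ord_pred j) ^+ d.-2.
Proof.
rewrite /hess /cover mderivD xpart_derivw add0r loop_deriv mderivD mderivZ mderivM !mderivXn mderiv_var !wwE.
rewrite rmorphD /= mevZ rmorphD !rmorphM !raddfMn /= !rmorphM !rmorphXn /= !mevX !rmorph_nat.
have dm1 : d.-1%:R = -1 :> A by rewrite -subn1 natrB ?(leq_trans _ d5) // (natA d0) sub0r.
have dm2 : d.-2%:R = - 2%:R :> A.
  by rewrite -subn2 natrB ?(leq_trans _ d5) // (natA d0) sub0r.
have M1 (z : A) : z *+ d.-1 = - z by rewrite -mulr_natr dm1 mulrN1.
have M2 (z : A) : z *+ d.-2 = - (z *+ 2) by rewrite -mulr_natr dm2 mulrN mulr_natr.
rewrite !M1 !M2 (eq_sym t j) !rmorph1.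
move: (w j ^+ d.-2.-1) (w j ^+ d.-2) (w (ord_pred j) ^+ d.-2) (w (ordS j)) => x1 x2 x3 x4.
by case: (j == t); case: (t == ordS j); case: (t == ord_pred j); rewrite ?mulr1n ?mulr0n; ring.
Qed.

Lemma hess_xw t : hess cover u q ord_max (ww t) = 0.
Proof.
rewrite /hess /cover mderiv_comm mderivD xpart_derivw add0r loop_deriv.
rewrite mderivD mderivZ mderivM !mderivXn mderiv_var !xww.
by rewrite !fM !(mul0r, mul0rn, mulr0, addr0, scaler0) rmorph0.
Qed.

Lemma mev_derivXn (i j : 'I_l.+2) n : mev u q ('X_j ^+ n)^`M(i) = (i == j)%:R * q j ^+ n.-1 *+ n.
Proof.
rewrite mderivXn -mulr_natr !rmorphM !rmorph_nat rmorphXn /= mevX.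
by rewrite mulr_natr.
Qed.

Lemma hess_xx : hess cover u q ord_max ord_max =
  (e * e.-1)%:R * x ^+ e.-2 + u c2 * (2%:R * q ord0 ^+ (d - 2 * a)).
Proof.
rewrite /hess /cover mderivD xpart_derivx loop_derivx addr0 !mderivD !mderivZ mderivM mderiv_var.
have h4 k : mev u q ('X_ord0 ^+ k) = q ord0 ^+ k by rewrite rmorphXn /= mevX.
have h5 (s t : {mpoly F[l.+2]}) : mev u q (s * t) = mev u q s * mev u q t by rewrite rmorphM.
have h6 (s t : {mpoly F[l.+2]}) : mev u q (s + t) = mev u q s + mev u q t by rewrite rmorphD.
rewrite !(h6, h5, mevZ) !mev_derivXn mevX h4 x0 eqxx.
have -> : mev u q (true%:R) = 1 by rewrite rmorph1.
have -> : true%:R = 1 :> A by [].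
have -> : false%:R = 0 :> A by [].
rewrite (rmorph_nat u e) (rmorph_nat u 2) !(mul0r, mul0rn, mulr0, addr0, mul1r) natrM.
by rewrite -(mulr_natr (x ^+ _) e.-1); ring.
Qed.
End Eval.

(** At a critical point all products [w_j^(d-1) w_(j+1)] have the same value [U]. Hence the ratios
    [r_j = w_(j+1) / w_j] satisfy [r_(j+1) = r_j^-(d-1)], and following them round the loop shows
    that they are roots of unity. These lie in the algebraically closed [F], as does the root [xi]
    of the equation in [x]. *)
Lemma cover_critical (K : fieldType) (u : {rmorphism F -> K}) : critical_good a cover u.
Proof.
move=> q crit qn0; pose D := d.-1; pose w j := q (ww j); pose x := q ord_max.
have gw j : w (ord_pred j) ^+ D = w j ^+ d.-2 * w (ordS j).
  by apply/eqP; rewrite -subr_eq0 /w /D -(grad_w u q j) crit.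
have gx := grad_x u q; rewrite crit in gx.
have w0 : q ord0 = w ord0 by rewrite /w; congr q; exact: val_inj.
have [D2 DS] : (2 < d.-2)%N /\ D = d.-2.+1.
  by rewrite /D; have := d5; case: (a * e)%N => [|[|[|[|[|dd]]]]].
have D0 : (0 < d.-2)%N by exact: ltn_trans D2.
have nzS j : w j != 0 -> w (ordS j) != 0.
  apply: contra_neq => wj; have := gw (ordS j); rewrite ordSK wj expr0n (gtn_eqF D0) mul0r => /eqP.
  by rewrite expf_eq0 => /andP [_ /eqP].
have x00 i : (0 < i)%N -> (forall j, w j = 0) -> q ord0 ^+ i = 0.
  by move=> i0 h; rewrite w0 h expr0n (gtn_eqF i0).
have dad : (0 < d - a)%N by rewrite subn_gt0 -{1}[a]muln1 ltn_mul2l a0.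
have c2d : u c2 * q ord0 ^+ (d - 2 * a) = 0 \/ (0 < d - 2 * a)%N.
  have [->|/c2e e2] := eqVneq c2 0; first by left; rewrite rmorph0 mul0r.
  by right; rewrite subn_gt0 mulnC ltn_mul2l a0.
have [j0 wj0] : exists j, w j != 0.
  apply: contrapT => /forallNP al; have al' j : w j = 0 by apply/eqP/negPn/negP; exact: al.
  have x0 : x = 0.
    have h2 : u c2 * (2%:R * (x * q ord0 ^+ (d - 2 * a))) = 0.
      case: c2d => [h|h]; last by rewrite (x00 _ h al') !mulr0.
      have -> : u c2 * (2%:R * (x * q ord0 ^+ (d - 2 * a))) = 2%:R * x * (u c2 * q ord0 ^+ (d - 2 * a)) by ring.
      by rewrite h mulr0.
    have := gx; rewrite (x00 _ dad al') h2 mulr0 !addr0 => /esym/eqP; rewrite mulf_eq0 expf_eq0.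
    by rewrite -(rmorph_nat u) fmorph_eq0 (negPf e0F) /= => /andP [_ /eqP].
  have [i qi] := qn0; case/eqP: qi; have [->//|[j ->]] := ord_widenP i; exact: al'.
have wn0 j : w j != 0 by exact: (ordS_ind nzS wj0).
pose U := w ord0 ^+ D * w (ordS ord0).
have uU j : w j ^+ D * w (ordS j) = U.
  suff h i : w i ^+ D * w (ordS i) = U -> w (ordS i) ^+ D * w (ordS (ordS i)) = U.
    exact: (@ordS_ind l (fun j => w j ^+ D * w (ordS j) = U) h ord0 (erefl U)).
  move=> Pi; by rewrite -Pi; have := gw (ordS i); rewrite ordSK => ->; rewrite DS exprS; ring.
have U0 : U != 0 by rewrite mulf_neq0 // expf_neq0.
pose r j := w (ordS j) / w j.
have rS j : r (ordS j) = (r j ^+ D)^-1.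
  have := uU (ordS j); rewrite -(uU j) => h.
  have nD : w (ordS j) ^+ D != 0 by rewrite expf_neq0.
  rewrite /r expr_div_n invf_div; apply: (mulIf (wn0 (ordS j))); rewrite divfK //.
  by apply: (mulfI nD); rewrite h mulrA mulrCA divff // mulr1.
have rSS j : r (ordS (ordS j)) = r j ^+ (D * D) by rewrite rS rS exprVn invrK exprM.
have rF j : exists z, r j = u z.
  (* Steps of two keep the exponents positive; [l + 1] of them go twice round the loop and return to
     [j]. *)
  have it i : r (iter i (fun t => ordS (ordS t)) j) = r j ^+ ((D * D) ^ i).
    by elim: i => [|i IH]; rewrite ?expn0 ?expr1 //= rSS IH -exprM expnSr.
  have := it l.+1; have -> : iter l.+1 (fun t => ordS (ordS t)) j = j.
    have SS (t : 'I_l.+1) : (ordS (ordS t) : nat) = ((t + 2) %% l.+1)%N.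
      by rewrite /= -(addn1 (t.+1 %% l.+1)) modnDml; congr (_ %% _)%N; rewrite addn1 addn2.
    have it2 i : (iter i (fun t : 'I_l.+1 => ordS (ordS t)) j : nat) = ((j + 2 * i) %% l.+1)%N.
      elim: i => [|i IH]; first by rewrite muln0 addn0 /= modn_small.
      by rewrite iterS SS IH modnDml; congr (_ %% _)%N; lia.
    by apply: ord_inj; rewrite it2 addnC modnMDl modn_small.
  have rj0 : r j != 0 by rewrite mulf_neq0 ?invr_eq0.
  move=> E; apply: (@unity_in_closed F K u ((D * D) ^ l.+1).-1).
    have : (1 < (D * D) ^ l.+1)%N.
      apply: (@leq_trans (2 ^ 1)) => //; rewrite -(prednK (isT : 0 < 1)%N).
      apply: leq_trans (_ : 2 ^ l.+1 <= _)%N; first by rewrite leq_exp2l.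
      by rewrite leq_exp2r // DS; move: D2; case: (d.-2) => [|[|]].
    by case: ((D * D) ^ l.+1)%N => [|[|]].
  apply: (mulIf rj0); rewrite mul1r -exprSr prednK ?expn_gt0 //.
  by rewrite DS muln_gt0.
have wF j : exists z, w j = u z * q ord0.
  apply: (@ordS_ind l (fun j => exists z, w j = u z * q ord0) _ ord0).
    move=> i [z zE]; have [y yE] := rF i; exists (y * z).
    by rewrite rmorphM -yE -mulrA -zE /r divfK.
  by exists 1; rewrite rmorph1 mul1r w0.
have q00 : q ord0 != 0 by rewrite w0.
pose xi := x / q ord0 ^+ a.
have xE : x = xi * q ord0 ^+ a by rewrite divfK // expf_neq0.
have gxi : e%:R * xi ^+ e.-1 + u c1 + u c2 * (2%:R * xi) = 0.
  pose Q := q ord0 ^+ a.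
  have Q0 : Q != 0 by rewrite expf_neq0.
  have [k [ek1 ek2]] : exists k, e.-1 = k.+1 /\ e.-2 = k by move: e1; case: (e) => [|[|k]] // _; exists k.
  have h1 : q ord0 ^+ (d - a) = Q ^+ e.-1 by rewrite -exprM -subn1 mulnBr muln1.
  have h2 : q ord0 ^+ (d - 2 * a) = Q ^+ e.-2 by rewrite -exprM -subn2 mulnBr (mulnC 2).
  apply: (mulIf (expf_neq0 e.-1 Q0)); rewrite mul0r [RHS]gx -/x xE -/Q h1 h2.
  rewrite ek2 ek1; have key (E X Y c c' : K) : (E * X ^+ k.+1 + c + c' * (2%:R * X)) * Y ^+ k.+1 =
    E * (X * Y) ^+ k.+1 + c * Y ^+ k.+1 + c' * (2%:R * (X * Y * Y ^+ k)).
    by rewrite exprMn !exprS; ring.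
  exact: key.
have xiF : exists z, xi = u z.
  pose P : {poly F} := e%:R *: 'X^(e.-1) + c1%:P + (c2 * 2%:R) *: 'X.
  have rP (X : K) : e%:R * X ^+ e.-1 + u c1 + u c2 * (2%:R * X) = 0 -> root (map_poly u P) X.
    move=> h; rewrite /P /root !rmorphD /= !map_polyZ map_polyXn map_polyX map_polyC /= !hornerE.
    by rewrite rmorphM !rmorph_nat -mulrA; apply/eqP.
  have := @root_in_closed F K u P xi; apply; last exact: rP.
  apply/eqP => /(congr1 (fun s : {poly F} => s`_e.-1)).
  rewrite !coefD !coefZ coefXn coefC coefX coef0 eqxx mulr1.
  have -> : (e.-1 == 0)%N = false by move: e1; case: (e) => [|[]].
  have [E2|_] := eqVneq e.-1 1%N; last by rewrite mulr0 !addr0; apply/eqP.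
  have -> : c2 = 0 by apply/eqP/negPn/negP => /c2e; move: E2; case: (e) => [|[|[]]].
  by rewrite mul0r mul0r !addr0; apply/eqP.
have natK t : ~~ (p %| t)%N -> t%:R != 0 :> K.
  by rewrite -(rmorph_nat u) fmorph_eq0 -(dvdn_pcharf pchF).
have p3 : p != 3%N -> ~~ (p %| 3)%N by rewrite (dvdn_prime2 p_prime).
have UE j : w j ^+ d.-2.-1 * w (ordS j) * w j ^+ 2 = U.
  rewrite -(uU j) DS; case: (d.-2) D0 => // t _ /=; rewrite !exprS; ring.
have in1 : (1 < l.+1)%N by rewrite ltnS ltnW.
have in2 : (2 < l.+1)%N by rewrite ltnS.
pose i1 : 'I_l.+1 := inord 1; pose i2 : 'I_l.+1 := inord 2.
have i1v : val i1 = 1%N by rewrite /= inordK.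
have i2v : val i2 = 2%N by rewrite /= inordK.
have ne (i j : 'I_l.+1) : val i != val j -> (i == j) = false by move/negbTE; rewrite val_eqE.
have neP (i j : 'I_l.+1) : val (ord_pred i) != val j -> (i == ordS j) = false.
  by move/ne => h; rewrite -(can_eq (@ord_predK l.+1)) ordSK.
have S1 : ordS i1 = i2 by apply: val_inj; rewrite /= i1v i2v modn_small.
have P2 : ord_pred i2 = i1 by rewrite -S1 ordSK.
have P1 : ord_pred i1 = ord0 by rewrite (_ : i1 = ordS ord0) ?ordSK //; apply: val_inj; rewrite /= i1v modn_small.
have hw i j : hess cover u q (ww i) (ww j) =
  (i == j)%:R * (2%:R * w i ^+ d.-2.-1 * w (ordS i)) - (j == ordS i)%:R * w i ^+ d.-2
  - (j == ord_pred i)%:R * w (ord_pred i) ^+ d.-2 := hess_ww u q i j.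
split=> //.
- move=> i im; have [e'|[j ->]] := ord_widenP i; first by rewrite e' eqxx in im.
  exact: wF.
- by have [z zE] := xiF; exists z; rewrite -zE -/x xE.
(* With rows and columns scaled by the [w_j], the Hessian of the loop is [U] times the cyclic matrix
   with 2 on the diagonal and -1 next to it. An adjacent pair gives [3 U^2], which settles every
   characteristic but 3. *)
have [ep|np] := eqVneq p 3%N; last first.
  exists (ww i1), (ww i2); split; rewrite -?val_eqE /= ?i1v ?i2v //.
  rewrite !hw P2 S1 P1 !eqxx.
  have -> : (i1 == ord0) = false by apply: ne; rewrite i1v.
  have -> : (i1 == i2) = false by apply: ne; rewrite i1v i2v.
  have -> : (i2 == ord0) = false by apply: ne; rewrite i2v.
  have -> : (i2 == i1) = false by apply: ne; rewrite i1v i2v.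
  have -> : (i1 == ordS i2) = false.
    by apply: neP; rewrite P1 i2v.
  rewrite (_ : (i2 == ordS i2) = false); last first.
    by apply: neP; rewrite P2 i1v i2v.
  rewrite !mul0r !mul1r !subr0 !sub0r.
  apply: contraNneq (mulf_neq0 (natK 3 (p3 np)) (mulf_neq0 U0 U0)) => E.
  have -> : 3%:R * (U * U) = 0 * (w i1 * w i2) ^+ 2; last by rewrite mul0r.
  rewrite -E; have := UE i1; have := UE i2; rewrite S1 => h2 h1.
  have h3 : w i1 ^+ d.-2 * w i1 * w i2 = U by rewrite -(uU i1) S1 DS exprSr.
  rewrite exprMn mulrBl.
  have -> : 2 * w i1 ^+ d.-2.-1 * w i2 * (2 * w i2 ^+ d.-2.-1 * w (ordS i2)) * (w i1 ^+ 2 * w i2 ^+ 2) =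
    4%:R * (w i1 ^+ d.-2.-1 * w i2 * w i1 ^+ 2) * (w i2 ^+ d.-2.-1 * w (ordS i2) * w i2 ^+ 2) by ring.
  rewrite h1 h2; have -> : - w i1 ^+ d.-2 * - w i1 ^+ d.-2 * (w i1 ^+ 2 * w i2 ^+ 2) = U * U.
    by rewrite -h3; ring.
  by ring.
have n2 : 2%:R != 0 :> K by apply: natK; rewrite ep.
(* In characteristic 3 a nonadjacent pair gives [4 U^2]; it needs four variables of weight one. *)
have [l3|l2] := ltnP 2 l.
  have in3 : (3 < l.+1)%N by rewrite ltnS.
  pose i3 : 'I_l.+1 := inord 3; have i3v : val i3 = 3%N by rewrite /= inordK.
  have P3 : ord_pred i3 = i2 by rewrite (_ : i3 = ordS i2) ?ordSK //; apply: val_inj; rewrite /= i2v i3v modn_small.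
  exists (ww i1), (ww i3); split; rewrite -?val_eqE /= ?i1v ?i3v //.
  rewrite !hw S1 P1 P3 !eqxx.
  have -> : (i1 == i3) = false by apply: ne; rewrite i1v i3v.
  have -> : (i3 == i1) = false by apply: ne; rewrite i1v i3v.
  have -> : (i1 == i2) = false by apply: ne; rewrite i1v i2v.
  have -> : (i1 == ord0) = false by apply: ne; rewrite i1v.
  have -> : (i3 == i2) = false by apply: ne; rewrite i2v i3v.
  have -> : (i3 == ord0) = false by apply: ne; rewrite i3v.
  have -> : (i3 == ordS i3) = false.
    by apply: neP; rewrite P3 i2v i3v.
  have -> : (i1 == ordS i3) = false.
    by apply: neP; rewrite P1 i3v.
  rewrite !mul0r !mul1r !subr0 ?mul0r ?subr0.
  by rewrite !mulf_neq0 ?expf_neq0.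
have l2E : l = 2%N by apply/eqP; rewrite eqn_leq l2 l_gt1.
exists (ww i1), ord_max; split.
- by apply/eqP => /(congr1 val) /= E; have := ltn_ord i1; rewrite E ltnn.
- by rewrite -val_eqE /= i1v.
- by [].
have -> : hess cover u q (ww i1) ord_max = 0 by rewrite /hess mderiv_comm; exact: hess_xw.
rewrite mul0r subr0 mulf_neq0 //.
  rewrite hw S1 P1 eqxx.
  have -> : (i1 == i2) = false by apply: ne; rewrite i1v i2v.
  have -> : (i1 == ord0) = false by apply: ne; rewrite i1v.
  by rewrite !mul0r !subr0 mul1r !mulf_neq0 ?expf_neq0.
(* The second derivative in [x] completes the minor. If [e] is 1 modulo 3 only the term in [c2]
   survives; if [e] is 2, the term in [c1] keeps [x] away from 0. *)
rewrite hess_xx; have [[em [c1E c2E]]|[em [c1E c2E]]] := c12 (conj ep l2E).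
  rewrite natrM; have -> : e.-1%:R = 0 :> K.
    rewrite -(rmorph_nat u) natp ?rmorph0 // ep /dvdn -subn1.
    by rewrite {1}(divn_eq e 3) em addnK modnMl.
  by rewrite c2E rmorph1 mulr0 mul0r add0r mul1r mulf_neq0 ?expf_neq0.
rewrite c2E rmorph0 mul0r addr0 mulf_neq0 //.
  apply: natK; rewrite ep Euclid_dvdM // negb_or; move: (pe); rewrite ep => -> /=.
  by rewrite /dvdn -subn1 {1}(divn_eq e 3) em -addnBA // modnMDl.
rewrite -/x xE expf_neq0 // mulf_neq0 ?expf_neq0 //.
apply: contraNneq (oner_neq0 K) => xi0; move: gxi; rewrite c1E c2E xi0 rmorph0 mul0r addr0 rmorph1.
rewrite expr0n; have -> : (e.-1 == 0)%N = false by move: e1; case: (e) => [|[]].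
by rewrite mulr0 add0r => ->.
Qed.

(** Remove the largest integral weighted power of [phi]. If all coordinates are still divisible by
    [phi], then [x] has an order [v] with [0 < v < a], and [x ^+ e] is the only term of lowest order
    in the equation. So [e v] is [m] times the order of [y]; with [a e = b m] and [a], [b] coprime,
    [a] divides [v], which is absurd. *)
Lemma cover_rescale (A : idomainType) (u : {rmorphism F -> A}) phi : phi != 0 -> mprime phi ->
  ~ mdvd phi 1 -> (forall x, x != 0 -> exists e, ~ mdvd (phi ^+ e) x) -> rescalable a b m cover u phi.
Proof.
move=> phi0 ppr pnu fin q y yq [i0 qi0].
have wt0 i : (0 < wt i)%N by have [->|[j ->]] := ord_widenP i; rewrite ?wtx ?wtw.
have [E [q' [q'E qn]]] : exists E (q' : 'I_l.+2 -> A), (forall i, q i = phi ^+ (E * wt i) * q' i) /\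
    ~ (forall i, mdvd (phi ^+ wt i) (q' i)).
  pose P E := forall i, mdvd (phi ^+ (E * wt i)) (q i).
  have [E [PE nPE]] : exists E, P E /\ ~ P E.+1.
    have P0 : P 0%N by move=> i; rewrite mul0n expr0; exists (q i); rewrite mulr1.
    have [N nN] : exists N, ~ P N.
      have [N nN] := fin _ qi0; exists N => PN; apply: nN; apply: mdvdX_le (PN i0).
      by rewrite leq_pmulr.
    elim: N nN => [//|N IH] nN; have [PN|/IH //] := pselect (P N); by exists N.
  have /choice [q' q'E] : forall i, exists z, q i = phi ^+ (E * wt i) * z.
    by move=> i; have [z ->] := PE i; exists z; rewrite mulrC.
  exists E, q'; split=> // al; apply: nPE => i; have [z zE] := al i; exists z.
  by rewrite q'E zE mulSn exprD; ring.
have cE : mev u q cover = phi ^+ (E * d) * mev u q' cover.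
  rewrite exprM -(whomog_scale u _ _ cover_homog); apply: mev_eq => i.
  by rewrite q'E exprM.
have [y' y'E] : exists y', y = phi ^+ (E * b) * y'.
  have [->|yn0] := eqVneq y 0; first by exists 0; rewrite mulr0.
  have [s [y1 [y1E ny1]]] := valuation_ex (fin _ yn0).
  have [le|lt] := leqP (E * b) s; first by exists (phi ^+ (s - E * b) * y1); rewrite mulrA -exprD subnKC.
  case: (mprimeX (n := m) ppr pnu ny1); move: yq; rewrite y1E cE exprMn -exprM => h.
  exists (phi ^+ ((E * b - s) * m).-1 * mev u q' cover); apply: (mulfI (expf_neq0 (s * m) phi0)).
  rewrite h dbm; have -> : (E * (b * m) = s * m + ((E * b - s) * m).-1.+1)%N.
    by rewrite prednK ?muln_gt0 ?subn_gt0 ?lt // mulnBl mulnA subnKC // leq_mul2r ltnW ?orbT.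
  by rewrite exprD exprS; ring.
have y'm : y' ^+ m = mev u q' cover.
  apply: (mulfI (expf_neq0 (E * d) phi0)); rewrite -cE -yq y'E exprMn -exprM.
  by rewrite dbm mulnA.
exists E, q', y'; split=> //; apply: contrapT => /forallNP al.
have {}al i : mdvd phi (q' i) by apply: contrapT; exact: al.
have nx : ~ mdvd (phi ^+ a) (q' ord_max).
  move=> h; apply: qn => i; have [->|[j ->]] := ord_widenP i; first by rewrite wtx.
  by rewrite wtw expr1.
have x0 : q' ord_max != 0 by apply: contra_not_neq nx => ->; exact: mdvd0.
have [v [x1 [x1E nx1]]] := valuation_ex (fin _ x0).
have va : (v < a)%N.
  by rewrite ltnNge; apply/negP => le; apply: nx; rewrite x1E; exists (phi ^+ (v - a) * x1); rewrite mulrAC -exprD subnK.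
have v0 : (0 < v)%N.
  case: v x1E va => // x1E _; case: nx1; have := al ord_max; by rewrite x1E expr0 mul1r.
have big t z : (e * v < t)%N -> mdvd (phi ^+ (e * v).+1) (phi ^+ t * z).
  by move=> lt; apply: (mdvdX_le lt); exists z; rewrite mulrC.
(* Trading a factor [x] for [w_0 ^+ a] raises the order by at least [a - v], and a term of the loop
   has order at least [a e]. *)
have [r rE] : mdvd (phi ^+ (e * v).+1) (mev u q' cover - q' ord_max ^+ e).
  have E4 (x2 x3 x4 x5 : A) : x2 + x3 + x4 + x5 - x2 = x3 + (x4 + x5) by ring.
  rewrite mev_cover E4; have [z0 z0E] := al ord0.
  have lt1 : (e * v < v + (d - a))%N.
    have -> : (d - a = a * e.-1)%N by rewrite -subn1 mulnBr muln1.
    have -> : (e * v = v + v * e.-1)%N by rewrite -mulnS prednK ?(ltnW e1) // mulnC.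
    by rewrite ltn_add2l ltn_mul2r va -ltnS prednK ?(ltnW e1) // e1.
  apply: mdvdD; last apply: mdvdD.
  - apply: mdvdMl; rewrite z0E x1E exprMn.
    have -> : phi ^+ v * x1 * (z0 ^+ (d - a) * phi ^+ (d - a)) = phi ^+ (v + (d - a)) * (x1 * z0 ^+ (d - a)).
      by rewrite exprD; ring.
    exact: big.
  - have [->|/c2e e2] := eqVneq c2 0; first by rewrite rmorph0 mul0r; exact: mdvd0.
    apply: mdvdMl; rewrite z0E x1E !exprMn.
    have -> : (phi ^+ v) ^+ 2 * x1 ^+ 2 * (z0 ^+ (d - 2 * a) * phi ^+ (d - 2 * a)) =
        phi ^+ (v * 2 + (d - 2 * a)) * (x1 ^+ 2 * z0 ^+ (d - 2 * a)).
      by rewrite exprD exprM; ring.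
    apply: big; have -> : (d - 2 * a = a * (e - 2))%N by rewrite mulnBr (mulnC 2).
    have -> : (e * v = v * 2 + v * (e - 2))%N by rewrite -mulnDr subnKC ?(mulnC v) // ltnW.
    by rewrite ltn_add2l ltn_mul2r va subn_gt0 e2.
  - apply: mdvd_sum => i _; have [z1 ->] := al (ww i); have [z2 ->] := al (ww (ordS i)).
    have -> : (z1 * phi) ^+ d.-1 * (z2 * phi) = phi ^+ d * (z1 ^+ d.-1 * z2).
      have -> : phi ^+ d = phi ^+ d.-1 * phi by rewrite -exprSr prednK // (leq_trans _ d5).
      by rewrite exprMn; ring.
    by apply: big; rewrite mulnC ltn_mul2r va ltnW.
have y'0 : y' != 0.
  apply: contra_not_neq (mprimeX (n := e) ppr pnu nx1) => y0; exists (- r).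
  apply: (mulfI (expf_neq0 (e * v) phi0)).
  move: rE; rewrite -y'm y0 expr0n (gtn_eqF m0) x1E exprMn -exprM (mulnC v) sub0r => /eqP.
  by rewrite eqr_oppLR => /eqP ->; rewrite exprS; ring.
have [s [y1 [y1E ny1]]] := valuation_ex (fin _ y'0).
have sm : (s * m = e * v)%N.
  apply: (@valuation_unique A phi phi0 (s * m) (e * v) (y1 ^+ m) (x1 ^+ e + r * phi)).
  - exact: mprimeX.
  - move=> [z zE]; apply: (mprimeX (n := e) ppr pnu nx1); exists (z - r).
    by rewrite mulrBl -zE addrK.
  - move/eqP: rE; rewrite subr_eq => /eqP; rewrite -y'm y1E x1E !exprMn -!exprM (mulnC v) => ->.
    by rewrite exprS; ring.
have : (a %| b * v)%N.
  apply/dvdnP; exists s; apply/eqP; rewrite -(eqn_pmul2r m0); apply/eqP.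
  by rewrite mulnAC -dbm -mulnA -sm mulnA (mulnC a).
by rewrite Gauss_dvdr // => /(dvdn_leq v0); rewrite leqNgt va.
Qed.

Lemma cover_good : good_cover a b d m cover.
Proof.
split.
- exact: cover_homog.
- exact: d0.
- exact: natp.
- exact: natp.
- by move=> K u; exact: cover_critical.
- by move=> A u phi *; exact: cover_rescale.
Qed.
End LoopCover.

(** * Primality and generic points of cyclic covers *)

Lemma mvar_neq0 (n : nat) (R : nzRingType) (i : 'I_n) : ('X_i : {mpoly R[n]}) != 0.
Proof. by rewrite -msupp_eq0 msuppX. Qed.

Lemma mev_muni (n : nat) (R S : comNzRingType) (u : {rmorphism R -> S}) (x : 'I_n.+1 -> S) (p : {mpoly R[n.+1]}) :
  mev u x p = (map_poly (mev u (x \o widen_ord (leqnSn n))) (muni p)).[x ord_max].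
Proof.
apply: (mpoly_morph_eq (f := mev u x)
  (g := horner_eval (x ord_max) \o map_poly (mev u (x \o widen_ord (leqnSn n))) \o @muni n R)) => [c|i] /=.
  by rewrite mevC muniC map_polyC /= mevC /horner_eval hornerC.
rewrite mevX /horner_eval; have [->|[j ->]] := ord_widenP i.
  by rewrite muni_last map_polyX hornerX.
by rewrite muni_var map_polyC /= mevX hornerC.
Qed.

Section JoinPoint.
Variables (n : nat) (S : Type) (x : 'I_n -> S) (y : S).
Definition join_pt (i : 'I_n.+1) := if insub (val i) is Some j then x j else y.

Lemma join_widen i : join_pt (widen_ord (leqnSn n) i) = x i.
Proof. by rewrite /join_pt /= insubT //= => lt; congr x; exact: val_inj. Qed.

Lemma join_max : join_pt ord_max = y.
Proof. by rewrite /join_pt insubF ?ltnn. Qed.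
End JoinPoint.

Section CyclicCover.
Variables (n m : nat) (R : comNzRingType).
Hypothesis m0 : (0 < m)%N.
Implicit Type g : {mpoly R[n]}.

Definition cyclic g : {mpoly R[n.+1]} := 'X_ord_max ^+ m - mwiden g.

Lemma muni_cyclic g : muni (cyclic g) = 'X^m - g%:P.
Proof. by rewrite /cyclic rmorphB rmorphXn /= muni_last muni_widen. Qed.

Lemma cyclic_ymonic g : ymonic m (cyclic g).
Proof. by split; rewrite muni_cyclic ?monicXnsubC ?size_XnsubC. Qed.
End CyclicCover.

Lemma map_cyclic (n m : nat) (R S : comNzRingType) (u : {rmorphism R -> S}) (g : {mpoly R[n]}) :
  map_mpoly u (cyclic m g) = cyclic m (map_mpoly u g).
Proof.
apply: (can_inj (@muniK _ _)).
by rewrite muni_map !muni_cyclic rmorphB /= map_polyXn map_polyC.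
Qed.

(** A map to a domain that kills [f] and is injective on remainders has kernel generated by [f], and
    such a kernel is prime. *)
Lemma nform_prime (n m : nat) (R : comNzRingType) (B : idomainType) (f : {mpoly R[n.+1]})
    (th : {rmorphism {mpoly R[n.+1]} -> B}) : ymonic m f -> th f = 0 ->
  (forall g, (size (muni g) <= m)%N -> th g = 0 -> g = 0) ->
  (forall g, th g = 0 -> mdvd f g) /\ mprime f.
Proof.
move=> fm thf inj.
have ker g : th g = 0 -> mdvd f g.
  move=> tg; apply: (nform0_dvd fm); apply: inj; first exact: nform_size fm g.
  have [q qE] := nformP fm g; have -> : nform f g = g - q * f by rewrite -qE subKr.
  by rewrite rmorphB rmorphM thf tg mulr0 subr0.
split=> // g h [q qE]; have /eqP : th g * th h = 0 by rewrite -rmorphM qE rmorphM thf mulr0.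
by rewrite mulf_eq0 => /orP [] /eqP /ker; [left | right].
Qed.

Section Binomial.
Variables (n m c : nat) (F : fieldType) (i j : 'I_n).
Hypothesis m0 : (0 < m)%N.
Hypothesis ij : i != j.

Let mu (M : 'X_{1..n}) (s : nat) : 'X_{1..n} :=
  [multinom ((if (t == i) || (t == j) then m * M t else M t) + (t == i) * (c * s) + (t == j) * s)%N | t < n].

Let mu_inj M s M' s' : (s < m)%N -> (s' < m)%N -> mu M s = mu M' s' -> M = M' /\ s = s'.
Proof.
move=> sm sm' /mnmP E.
have ss : s = s'.
  have := E j; rewrite !mnmE eqxx orbT (eq_sym j) (negPf ij) !mul0n !addn0 !mul1n => /(congr1 (modn^~ m)).
  by rewrite ![(m * _)%N]mulnC !modnMDl !modn_small.
split=> //; apply/mnmP => t; have := E t; rewrite !mnmE ss => /addIn /addIn.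
by case: ifP => // _ /eqP; rewrite eqn_pmul2l // => /eqP.
Qed.

(** The cover [y^m = X_i^c X_j] is parametrized by putting [m]-th powers for [X_i] and [X_j].
    Reduced monomials have distinct images: the exponent of [X_j] modulo [m] recovers that of
    [y]. *)
Lemma binomial_prime : mprime (cyclic m ('X_i ^+ c * 'X_j) : {mpoly F[n.+1]}).
Proof.
pose z t : {mpoly F[n]} := if (t == i) || (t == j) then 'X_t ^+ m else 'X_t.
pose y : {mpoly F[n]} := 'X_i ^+ c * 'X_j.
pose x (t : 'I_n.+1) := if insub (val t) is Some t' then z t' else y.
pose u : {rmorphism F -> {mpoly F[n]}} := @mpolyC n F.
have xw : x \o widen_ord (leqnSn n) = z.
  by apply/funext => t; rewrite /x /= insubT //= => lt; congr (z _); exact: val_inj.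
have xm : x ord_max = y by rewrite /x insubF ?ltnn.
have thE g : mev u x g = (map_poly (mev u z) (muni g)).[y] by rewrite mev_muni xw xm.
suff [_ //] : (forall g, mev u x g = 0 -> mdvd (cyclic m ('X_i ^+ c * 'X_j)) g) /\ mprime (cyclic m ('X_i ^+ c * 'X_j) : {mpoly F[n.+1]}).
apply: (@nform_prime n m F _ _ (mev u x)); first exact: cyclic_ymonic.
  apply: etrans (thE _) _; rewrite muni_cyclic rmorphB /= map_polyXn map_polyC !hornerE /=.
  by rewrite rmorphM rmorphXn /= !mevX /z !eqxx orbT /= -exprM mulnC exprM -exprMn subrr.
move=> g sg /(etrans (esym (thE g))) /eqP tg0; apply: (can_inj (@muniK _ _)); rewrite (rmorph0 (@muni n F)).
move: (muni g) sg tg0 => G sg /eqP tg0; apply/polyP => s; rewrite coef0.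
have [ms|sm] := leqP m s; first by rewrite nth_default // (leq_trans sg).
apply/mpolyP => M; rewrite mcoeff0.
have zM M' s' : mev u z 'X_[M'] * y ^+ s' = 'X_[mu M' s'].
  rewrite mevXm /y exprMn -!exprM [RHS]mpolyXE_id.
  have -> : 'X_i ^+ (c * s') = \prod_(t < n) ('X_t : {mpoly F[n]}) ^+ ((t == i) * (c * s')).
    rewrite (bigD1 i) //= eqxx mul1n big1 ?mulr1 // => t /negPf ->.
    by rewrite mul0n expr0.
  have -> : 'X_j ^+ s' = \prod_(t < n) ('X_t : {mpoly F[n]}) ^+ ((t == j) * s').
    rewrite (bigD1 j) //= eqxx mul1n big1 ?mulr1 // => t /negPf ->.
    by rewrite mul0n expr0.
  rewrite -!big_split; apply: eq_bigr => t _ /=; rewrite mnmE !exprD /z mulrA.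
  by case: ifP => // _; rewrite -exprM.
have := congr1 (mcoeff (mu M s)) tg0; rewrite mcoeff0 horner_poly raddf_sum /= => <-.
have E s' : (s' < m)%N -> (mev u z G`_s' * y ^+ s')@_(mu M s) = (s' == s)%:R * (G`_s)@_M.
  move=> s'm; rewrite {1}[G`_s']mpolyE raddf_sum /= mulr_suml raddf_sum /=.
  under eq_bigr => M' _ do rewrite mevZ -mulrA zM mcoeffCM mcoeffX.
  have [->|ns] := eqVneq s' s; last first.
    rewrite mul0r big1 // => M' _; case: eqP => [/(mu_inj s'm sm) [_ e]|]; last by rewrite mulr0.
    by rewrite e eqxx in ns.
  rewrite mul1r; have [iM|nM] := boolP (M \in msupp G`_s).
    rewrite (bigD1_seq M) ?msupp_uniq //= eqxx mulr1 big1 ?addr0 // => M' nM.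
    by case: eqP => [/(mu_inj sm sm) [e _]|]; [rewrite e eqxx in nM | rewrite mulr0].
  rewrite (memN_msupp_eq0 nM) big_seq big1 // => M' iM'.
  by case: eqP => [/(mu_inj sm sm) [e _]|]; [rewrite -e iM' in nM | rewrite mulr0].
have [sG|Gs] := ltnP s (size G); last first.
  rewrite (nth_default _ Gs) mcoeff0 big1 // => s' _.
  by rewrite E ?(leq_trans (ltn_ord s')) // (nth_default _ Gs) mcoeff0 mulr0.
rewrite (bigD1 (Ordinal sG)) //= E // eqxx mul1r big1 ?addr0 // => s' ns.
rewrite E ?(leq_trans (ltn_ord s')) //.
by rewrite (_ : (s' : nat) == s = false) ?mul0r //; apply/negbTE; move: ns; rewrite -val_eqE.
Qed.
End Binomial.

(** * One-parameter degenerations of cyclic covers *)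

Section Degeneration.
Variables (n m : nat) (F : closedFieldType) (nu : 'I_n -> nat) (f0 : {mpoly F[n]}).
Variable P : {mpoly {poly F}[n]}.
Hypothesis m0 : (0 < m)%N.
Hypothesis PE : mev ((@mpolyC n _) \o (@polyC F)) (fun i => 'X ^+ nu i *: 'X_i) f0 = 'X ^+ m *: P.
Hypothesis P0 : mprime (cyclic m (map_mpoly (horner_eval 0) P)).

Local Notation K := {fraction {poly F}}.
Local Notation tof := (@FracField.tofrac {poly F}).
Local Notation T := (tof 'X).

Let T0 : T != 0. Proof. by rewrite tofrac_eq0 polyX_eq0. Qed.

Let place_prime : mprime (cyclic m (map_mpoly tof P)).
Proof.
pose S : set (K * F) := fun x : K * F => exists2 p : {poly F}, tof p = x.1 & horner_eval 0 p = x.2.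
have pS : partial_hom S.
  split; last by move=> z [p /= /eqP]; rewrite tofrac_eq0 => /eqP -> <-; rewrite rmorph0.
  split; [by exists 1; rewrite /= rmorph1 | move=> x y x' y' | move=> x y x' y'];
    move=> [p px pe] [q qx qe].
    by exists (p - q); rewrite /= rmorphB /= ?px ?qx ?pe ?qe.
  by exists (p * q); rewrite /= rmorphM /= ?px ?qx ?pe ?qe.
have [pl plP] := partial_hom_place pS.
have /choice [v vP] : forall p : {poly F}, exists v : vring pl, pin pl v = tof p /\ pres pl v = horner_eval 0 p.
  by move=> p; have [|v v1 v2] := plP (tof p) (horner_eval 0 p); [exists p | exists v].
have v0 : v 0 = 0 by apply: (@pin_inj _ _ pl); rewrite (vP 0).1 !rmorph0.
pose PV : {mpoly (vring pl)[n]} := \sum_(M <- msupp P) v P@_M *: 'X_[M].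
have mapE (S' : comNzRingType) (g : {rmorphism vring pl -> S'}) (h : {rmorphism {poly F} -> S'}) :
    (forall p, g (v p) = h p) -> map_mpoly g PV = map_mpoly h P.
  move=> gh; rewrite /PV (raddf_sum (map_mpoly g)) [in RHS](mpolyE P) (raddf_sum (map_mpoly h)); apply: eq_bigr => M _.
  apply: etrans (map_mpolyZ _ _ _) _; apply: etrans _ (esym (map_mpolyZ _ _ _)).
  by rewrite gh; congr (_ *: _); apply: etrans (map_mpolyX _ _) (esym (map_mpolyX _ _)).
have := @mprime_place _ _ pl n m (cyclic m PV) (cyclic_ymonic m0 _).
rewrite !map_cyclic (mapE _ (pin pl) tof) => [|p]; last exact: (vP p).1.
by rewrite (mapE _ (pres pl) (horner_eval 0)) => [|p]; [apply | exact: (vP p).2].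
Qed.

(** Over the fraction field of [{poly F}] the substitution with weights [nu] is invertible and turns
    the cover by [f0] into the cover by [P]. Primality for [P] lifts along a place at the value 0 of
    the parameter. *)
Lemma degenerate_prime : mprime (cyclic m f0).
Proof.
pose j : {rmorphism F -> K} := tof \o polyC.
pose N (i : 'I_n.+1) := if insub (val i) is Some i' then nu i' else 1%N.
have Nw i : N (widen_ord (leqnSn n) i) = nu i.
  by rewrite /N insubT //= => lt; congr nu; exact: val_inj.
have Nm : N ord_max = 1%N by rewrite /N insubF ?ltnn.
pose sc (t : K) (p : {mpoly K[n.+1]}) := mev (@mpolyC n.+1 K) (fun i => t ^+ N i *: 'X_i) p.
have scK t p : t != 0 -> sc t (sc t^-1 p) = p.
  move=> t0; have := @mpoly_morph_eq n.+1 K _ (mev (@mpolyC n.+1 K) (fun i => t ^+ N i *: 'X_i) \o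
    mev (@mpolyC n.+1 K) (fun i => t^-1 ^+ N i *: 'X_i)) idfun; apply=> [c|i] /=.
    by rewrite !mevC.
  by rewrite mevX mevZ mevX mul_mpolyC scalerA -exprMn mulVf // expr1n scale1r.
have scM t p q : sc t (p * q) = sc t p * sc t q by rewrite /sc rmorphM.
have scf : sc T (cyclic m (map_mpoly j f0)) = T ^+ m *: cyclic m (map_mpoly tof P).
  rewrite /sc /cyclic rmorphB rmorphXn /= mevX Nm expr1 exprZn scalerBr; congr (_ - _).
  pose lhs : {rmorphism {mpoly F[n]} -> {mpoly K[n.+1]}} :=
    mev (@mpolyC n.+1 K) (fun i => T ^+ N i *: 'X_i) \o @mwiden n K \o map_mpoly j.
  pose rhs : {rmorphism {mpoly F[n]} -> {mpoly K[n.+1]}} :=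
    @mwiden n K \o map_mpoly tof \o mev (@mpolyC n _ \o @polyC F) (fun i => 'X ^+ nu i *: 'X_i).
  have := @mpoly_morph_eq n F _ lhs rhs _ _ f0; rewrite /lhs /rhs /= PE map_mpolyZ mwidenZ => -> //.
  - by rewrite rmorphXn.
  - by move=> c; rewrite mevC map_mpolyC mwidenC mevC /= map_mpolyC mwidenC.
  - by move=> i; rewrite mevX map_mpolyX map_mpolyZ map_mpolyX mwidenZ mwidenX mnmwiden1 mevX Nw rmorphXn.
move=> g h [q qE].
have dv (p : {mpoly F[n.+1]}) : mdvd (cyclic m (map_mpoly tof P)) (sc T (map_mpoly j p)) -> mdvd (cyclic m f0) p.
  move=> [r rE].
  have jinj : injective j by exact: fmorph_inj.
  have fm := cyclic_ymonic m0 f0; apply: (nform0_dvd fm).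
  apply: (@map_mpoly_inj _ _ _ j jinj); rewrite rmorph0.
  apply: (mdvd_small (ymonic_map j fm)).
    by rewrite muni_map; apply: leq_trans (size_poly _ _) (nform_size fm p).
  have [s sE] := nformP fm p.
  have -> : nform (cyclic m f0) p = p - s * cyclic m f0 by rewrite -sE subKr.
  have -> : map_mpoly j (p - s * cyclic m f0) = map_mpoly j p - map_mpoly j s * map_mpoly j (cyclic m f0).
    by rewrite (raddfB (map_mpoly j)); congr (_ - _); exact: (rmorphM (map_mpoly j)).
  apply: mdvdB; last by exists (map_mpoly j s).
  exists (sc T^-1 ((T ^- m) *: r)).
  rewrite -[LHS](scK T^-1) ?invr_eq0 // invrK rE -[X in _ = _ * X](scK T^-1) ?invr_eq0 // invrK map_cyclic scf.
  have Tm0 : T ^+ m != 0 by rewrite expf_neq0.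
  rewrite -scM; congr (sc _ _); move: (cyclic m _) (T ^+ m) Tm0 => C t t0.
  by rewrite -scalerAr -scalerAl scalerA mulfV // scale1r.
have /place_prime : mdvd (cyclic m (map_mpoly tof P)) (sc T (map_mpoly j g) * sc T (map_mpoly j h)).
  exists (T ^+ m *: sc T (map_mpoly j q)); rewrite -scM -rmorphM qE rmorphM /= map_cyclic scM scf.
  by rewrite -scalerAr -scalerAl.
by move=> [] /dv; [left | right].
Qed.
End Degeneration.

Lemma cover_prime (l a e m : nat) (F : closedFieldType) (c1 c2 : F) : (1 < l)%N -> (0 < m)%N -> (0 < a)%N ->
  (1 < e)%N -> (4 < a * e)%N -> mprime (cyclic m (cover l a e c1 c2)).
Proof.
move=> l1 m0 a0 e1 d5; set d := (a * e)%N.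
have l0 : (1 < l.+1)%N by exact: ltnW.
pose i0 : 'I_l.+2 := ord0; pose i1 : 'I_l.+2 := widen_ord (leqnSn l.+1) (Ordinal l0).
(* With weights 0, [m] and [m + 1], the monomial [w_0^(d-1) w_1] is the only one of weight [m], and
   all others have larger weight. *)
pose nu (i : 'I_l.+2) := if i == i0 then 0%N else if i == i1 then m else m.+1.
pose T : {mpoly {poly F}[l.+2]} := 'X%:MP.
pose q (i : 'I_l.+2) : {mpoly {poly F}[l.+2]} := 'X ^+ nu i *: 'X_i.
pose X i : {mpoly {poly F}[l.+2]} := 'X_i.
have qT i : q i = T ^+ nu i * X i by rewrite /q -mul_mpolyC rmorphXn.
have [R RE] : mdvd (T ^+ m.+1) (mev (@mpolyC _ _ \o @polyC F) q (cover l a e c1 c2) - T ^+ m * (X i0 ^+ d.-1 * X i1)).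
  have dv (i : 'I_l.+2) : i != i0 -> i != i1 -> mdvd (T ^+ m.+1) (q i).
    by move=> /negPf h0 /negPf h1; exists (X i); rewrite qT /nu h0 h1 mulrC.
  have dX i k : i != i0 -> i != i1 -> (0 < k)%N -> mdvd (T ^+ m.+1) (q i ^+ k).
    by case: k => // k h0 h1 _; rewrite (exprS (q i)); apply: mdvdMr; exact: dv.
  have x0 : ord_max != i0 :> 'I_l.+2 by [].
  have x1 : ord_max != i1 :> 'I_l.+2 by rewrite -val_eqE /= eqSS; move: l1; case: (l) => [|[]].
  rewrite (mev_cover a e c1 c2 (@mpolyC _ _ \o @polyC F) q).
  pose ww := widen_ord (leqnSn l.+1).
  have w0 : ww ord0 = i0 by exact: val_inj.
  have w1 : ww (ordS ord0) = i1 by apply: val_inj; rewrite /= modn_small.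
  have key (x2 x3 x4 y z : {mpoly {poly F}[l.+2]}) : x2 + x3 + x4 + (y + z) - y = x2 + (x3 + (x4 + z)) by ring.
  rewrite (bigD1 ord0) //= -/ww w0 w1.
  have -> : T ^+ m * (X i0 ^+ d.-1 * X i1) = q i0 ^+ d.-1 * q i1.
    by rewrite !qT /nu eqxx (_ : i1 == i0 = false) // eqxx expr0 mul1r; ring.
  rewrite key; apply: mdvdD; [|apply: mdvdD; [|apply: mdvdD]].
  - by apply: dX => //; exact: ltnW.
  - by apply/mdvdMl/mdvdMr/dv.
  - by apply/mdvdMl/mdvdMr/dX.
  apply: mdvd_sum => i ni; have [i1E|n1] := eqVneq (ww i) i1; last first.
    have n0 : ww i != i0 by apply: contra ni => /eqP /(congr1 val) /= i0E; rewrite -val_eqE /= i0E.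
    by apply: mdvdMr; apply: (dX _ _ n0 n1); rewrite -/d; move: d5; rewrite -/d; case: (d) => [|[]].
  have i1v : (i : nat) = 1%N by have := congr1 val i1E.
  have Sv : (i.+1 %% l.+1 = 2)%N by rewrite i1v modn_small.
  by apply: mdvdMl; apply: dv; rewrite -val_eqE /= Sv.
have PE : mev (@mpolyC _ _ \o @polyC F) q (cover l a e c1 c2) = 'X ^+ m *: (X i0 ^+ d.-1 * X i1 + T * R).
  have -> : 'X ^+ m = 'X ^+ m :> {poly F} by [].
  rewrite -mul_mpolyC rmorphXn /= -/T mulrDr; move/eqP: RE; rewrite subr_eq => /eqP ->.
  by rewrite exprS; ring.
apply: (degenerate_prime m0 PE).
have -> : map_mpoly (horner_eval 0) (X i0 ^+ d.-1 * X i1 + T * R) = 'X_i0 ^+ d.-1 * 'X_i1.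
  rewrite rmorphD !rmorphM /= rmorphXn /= /X !map_mpolyX /T map_mpolyC /= /horner_eval.
  by rewrite hornerX mpolyC0 mul0r addr0.
exact: binomial_prime.
Qed.

Lemma poly_morphE (R S : comNzRingType) (g : {rmorphism {poly R} -> S}) p :
  g p = (map_poly (g \o polyC) p).[g 'X].
Proof.
elim/poly_ind: p => [|p c IH]; first by rewrite !rmorph0 horner0.
by rewrite !rmorphD !rmorphM /= {1}IH map_polyX map_polyC !hornerE.
Qed.

Section FieldOfFractions.
Variables (A : idomainType) (K : fieldType) (j : {rmorphism A -> K}).
Hypothesis j_inj : injective j.
Hypothesis jK : forall z, exists n d, d != 0 /\ z = j n / j d.

Lemma der_fraction (D : A -> A) : derivation D ->
  exists2 D' : K -> K, derivation D' & forall x, D' (j x) = j (D x).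
Proof.
move=> hD; pose v n d := (j (D n) * j d - j n * j (D d)) / j d ^+ 2.
have jn d : d != 0 -> j d != 0 by apply: contra_neq => e; apply: j_inj; rewrite e rmorph0.
have ind n d n' d' : d != 0 -> d' != 0 -> j n / j d = j n' / j d' -> v n d = v n' d'.
  move=> d0 d'0; have [jd jd'] := (jn _ d0, jn _ d'0) => E.
  have E1 : n * d' = n' * d.
    by apply: j_inj; rewrite !rmorphM; apply/eqP; rewrite -eqr_div ?E.
  have := congr1 D E1; rewrite !hD.2 => E2.
  rewrite /v; apply/eqP; rewrite eqr_div ?expf_neq0 //; apply/eqP; rewrite -!rmorphM -!rmorphB -!rmorphXn -!rmorphM.
  congr (j _).
  have -> : (D n * d - n * D d) * d' ^+ 2 = (D n * d' + n * D d') * (d * d') - (n * d') * (D d' * d + d' * D d) by ring.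
  rewrite E2 E1; ring.
have /choice [D' D'P] : forall z, exists x, forall n d, d != 0 -> z = j n / j d -> x = v n d.
  by move=> z; have [n [d [d0 ->]]] := jK z; exists (v n d) => n' d' d'0; apply: ind.
have D'v n d : d != 0 -> D' (j n / j d) = v n d by move=> d0; exact: D'P.
exists D'; last first.
  move=> x; rewrite -[j x]divr1 -(rmorph1 j) D'v ?oner_neq0 // /v.
  by rewrite rmorph1 (der1 hD) rmorph0 mulr0 subr0 mulr1 expr1n divr1.
have jM x y : j (x * y) = j x * j y by exact: rmorphM.
have jA x y : j (x + y) = j x + j y by exact: rmorphD.
have jD x y : j (D (x * y)) = j (D x) * j y + j x * j (D y) by rewrite hD.2 jA !jM.
have jDD x y : j (D (x + y)) = j (D x) + j (D y) by rewrite hD.1 jA.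
split=> x y; have [n [d [d0 ->]]] := jK x; have [n' [d' [d'0 ->]]] := jK y; have [jd jd'] := (jn _ d0, jn _ d'0).
  have E : j n / j d + j n' / j d' = j (n * d' + n' * d) / j (d * d') by rewrite addf_div // !(jA, jM).
  rewrite E !D'v ?mulf_neq0 // /v !(jDD, jD, jA, jM).
  by field; rewrite jd jd'.
have E : j n / j d * (j n' / j d') = j (n * n') / j (d * d') by rewrite mulf_div !jM.
rewrite E !D'v ?mulf_neq0 // /v !(jD, jM).
by field; rewrite jd jd'.
Qed.

Let jpM (P Q : {poly A}) : map_poly j (P * Q) = map_poly j P * map_poly j Q.
Proof. exact: rmorphM. Qed.

Let jpD (P Q : {poly A}) : map_poly j (P + Q) = map_poly j P + map_poly j Q.
Proof. exact: rmorphD. Qed.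

Lemma clear_den (P : {poly K}) : exists c (Q : {poly A}), c != 0 /\ (j c)%:P * P = map_poly j Q.
Proof.
elim/poly_ind: P => [|P z [c [Q [c0 E]]]]; first by exists 1, 0; rewrite oner_neq0 mulr0 rmorph0.
have [n [t [t0 zE]]] := jK z.
exists (c * t), (t%:P * Q * 'X + (c * n)%:P); split; first by rewrite mulf_neq0.
rewrite jpD !jpM map_polyX !map_polyC /= mulrDr !rmorphM -E; congr (_ + _); first by ring.
have tt0 : j t != 0 by apply: contra_neq t0 => e; apply: j_inj; rewrite e rmorph0.
by rewrite -!polyCM zE -mulrA (mulrCA (j t)) divff ?mulr1.
Qed.

(** After clearing denominators [p] divides one of the two factors over [A], which then has full
    degree; the other one is constant. *)
Lemma monic_prime_irreducible (p : {poly A}) : p \is monic -> (1 < size p)%N -> mprime p ->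
  irreducible_poly (map_poly j p).
Proof.
move=> pm s1 pp; have p0 : p != 0 by exact: monic_neq0.
have sp : size (map_poly j p) = size p by rewrite size_map_inj_poly // rmorph0.
have jp0 : map_poly j p != 0 by rewrite -size_poly_gt0 sp size_poly_gt0.
split=> [|Q sQ]; first by rewrite sp.
move=> /dvdpP [P PQ].
have [P0 Q0] : P != 0 /\ Q != 0 by apply/andP; rewrite -negb_or -mulf_eq0 -PQ.
have [c [P' [c0 cE]]] := clear_den P; have [c' [Q' [c'0 c'E]]] := clear_den Q.
have E : P' * Q' = (c * c')%:P * p.
  apply: (@map_inj_poly _ _ j j_inj); first exact: rmorph0.
  by rewrite !jpM -cE -c'E PQ !map_polyC /= rmorphM polyCM; ring.
have dv : mdvd p (P' * Q') by exists (c * c')%:P.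
have sz (R : {poly K}) r R' : r != 0 -> R != 0 -> (j r)%:P * R = map_poly j R' ->
    mdvd p R' -> (size p <= size R)%N.
  move=> r0 R0 rE [s sE]; have tr : j r != 0 by apply: contra_neq r0 => e; apply: j_inj; rewrite e rmorph0.
  have -> : size R = size ((j r)%:P * R) by rewrite mul_polyC size_scale.
  have : (j r)%:P * R != 0 by rewrite mulf_neq0 ?polyC_eq0.
  rewrite rE sE jpM => n0; have s0 : map_poly j s != 0 by apply: contraNneq n0 => ->; rewrite mul0r.
  rewrite size_mul // sp; have := s0; rewrite -size_poly_gt0; case: (size (map_poly j s)) => // t _.
  by rewrite addSn /= leq_addl.
have sPQ : (size P + size Q = (size p).+1)%N.
  by have := size_mul P0 Q0; rewrite -PQ sp; have := P0; rewrite -size_poly_gt0; case: (size P) => // sP _ /= ->.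
have [/(sz _ _ _ c0 P0 cE) lt|/(sz _ _ _ c'0 Q0 c'E) lt] := pp _ _ dv.
  case/negP: sQ; rewrite eqn_leq size_poly_gt0 Q0 andbT -(leq_add2l (size P)) sPQ addn1.
  by rewrite ltnS.
rewrite PQ -{1}[Q]mul1r eqp_mul2r // eqp_sym -size_poly_eq1 eqn_leq size_poly_gt0 P0 andbT.
by rewrite -(leq_add2r (size Q)) sPQ add1n ltnS.
Qed.
End FieldOfFractions.

Lemma der_quotient (A B : comNzRingType) (res : {rmorphism A -> B}) (D : A -> A) :
  (forall z, exists x, res x = z) -> derivation D -> (forall x, res x = 0 -> res (D x) = 0) ->
  exists2 D' : B -> B, derivation D' & forall x, D' (res x) = res (D x).
Proof.
move=> sur hD ker.
have /choice [D' D'P] : forall z, exists w, forall x, res x = z -> w = res (D x).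
  move=> z; have [x <-] := sur z; exists (res (D x)) => y E; apply/eqP.
  by rewrite -subr_eq0 -rmorphB -(derB hD) ker // rmorphB E subrr.
have D'E x : D' (res x) = res (D x) by exact: D'P.
exists D' => //; split=> x y; have [x' <-] := sur x; have [y' <-] := sur y.
  by rewrite -rmorphD !D'E hD.1 rmorphD.
by rewrite -rmorphM !D'E hD.2 rmorphD !rmorphM.
Qed.

Lemma tofrac_ex (A : idomainType) (z : {fraction A}) :
  exists n d, d != 0 /\ z = FracField.tofrac n / FracField.tofrac d.
Proof.
elim/quotW: z => x; exists \n_x, \d_x; split; first exact: denom_ratioP.
have d0 : FracField.tofrac \d_x != 0 by rewrite tofrac_eq0 denom_ratioP.
apply: (mulIf d0); rewrite divfK //; unlock FracField.tofrac.
rewrite -[LHS]FracField.pi_mul; apply/eqmodP; rewrite /= FracField.equivfE /FracField.mulf.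
by rewrite !numden_Ratio ?mulf_neq0 ?oner_eq0 ?denom_ratioP // !mulr1 mulrC.
Qed.

(* A generic point of the affine cone over the cover, with derivations that
   together with the Euler vector field span its tangent space. *)
Record generic_point (l a d m : nat) (F : fieldType) (f0 : {mpoly F[l.+2]}) := GenericPoint {
  gp_field : fieldType;
  gp_base : {rmorphism F -> gp_field};
  gp_der : 'I_l -> gp_field -> gp_field;
  gp_w : 'I_l.+2 -> gp_field;
  gp_y : gp_field;
  gp_form : gp_field;
  gp_derP : forall j, derivation (gp_der j);
  gp_der_base : forall j c, gp_der j (gp_base c) = 0;
  gp_eq : gp_y ^+ m = mev gp_base gp_w f0;
  gp_generic : forall g, mev gp_base (join_pt gp_w gp_y) g = 0 -> mdvd (cyclic m f0) g;
  gp_value : form_value a d f0 gp_base gp_der gp_w gp_form;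
  gp_form0 : gp_form != 0
}.

Section Generic.
Variables (l a b d m : nat) (F : closedFieldType) (f0 : {mpoly F[l.+2]}).
Hypothesis G : good_cover a b d m f0.
Hypothesis m0 : (0 < m)%N.
Hypothesis f0_prime : mprime (cyclic m f0).
Hypothesis fx : f0^`M(ord_max) != 0.
Local Notation A := {mpoly F[l.+2]}.
Local Notation wt := (wt1 a : 'I_l.+2 -> nat).
Variables (Phi : fieldType) (j : {rmorphism A -> Phi}).
Hypothesis j_inj : injective j.
Hypothesis jK : forall z, exists n d, d != 0 /\ z = j n / j d.
Local Notation ww i := (widen_ord (leqnSn l.+1) i).

Lemma muni_cyclic_prime : mprime (muni (cyclic m f0)).
Proof.
move=> P Q [q qE]; have : mdvd (cyclic m f0) (muniV P * muniV Q).
  by exists (muniV q); rewrite -rmorphM qE rmorphM /= muniK.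
by move=> /f0_prime [] [s sE]; [left | right]; exists (muni s); rewrite -rmorphM -sE /= muniVK.
Qed.

(** Hamiltonian fields of [f0] in the pairs [(w_t, x)] with [t] from 1 to [l]. They annihilate [f0],
    hence extend to the cover with value 0 on [y]. *)
Let Dpol (t : 'I_l) (p : A) : A :=
  f0^`M(ord_max) * p^`M(ww (lift ord0 t)) - f0^`M(ww (lift ord0 t)) * p^`M(ord_max).

Let Dpol_der t : derivation (Dpol t).
Proof.
by split=> p q; rewrite /Dpol ?mderivD ?mderivM; ring.
Qed.

Let Dpol_f0 t : Dpol t f0 = 0.
Proof. by rewrite /Dpol mulrC subrr. Qed.

(** The field is [Phi[y]/(y^m - f0)]. The form is nonzero there because the minor without the column
    of [x] is triangular, with diagonal entries [w_0] and copies of the derivative of [f0] in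
    [x]. *)
Lemma generic_point_ex : exists gp : generic_point a d m f0, True.
Proof.
have [fmon fsz] := cyclic_ymonic m0 f0.
have irr : irreducible_poly (map_poly j (muni (cyclic m f0))).
  by apply: monic_prime_irreducible => //; [rewrite fsz ltnS | exact: muni_cyclic_prime].
have phiE : map_poly j (muni (cyclic m f0)) = 'X^m - (j f0)%:P.
  by rewrite muni_cyclic rmorphB /= map_polyXn map_polyC.
have [K [res [ker sur]]] := residue_field irr; rewrite phiE in irr ker.
have /choice [D1 D1P] : forall t, exists D' : Phi -> Phi, derivation D' /\ forall x, D' (j x) = j (Dpol t x).
  by move=> t; have [D' ? ?] := der_fraction j_inj jK (Dpol_der t); exists D'.
have D1d t : derivation (D1 t) := (D1P t).1.
have /choice [D DP] : forall t, exists D' : K -> K, derivation D' /\ forall x, D' (res x) = res (der_poly (D1 t) x).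
  move=> t; have [|D' ? ?] := der_quotient (res := res) sur (der_poly_der (D1d t)); last by exists D'.
  move=> x /ker [q ->]; rewrite (der_poly_der (D1d t)).2 rmorphD !rmorphM.
  have -> : res ('X^m - (j f0)%:P) = 0 by apply/ker; exists 1; rewrite mul1r.
  have -> : der_poly (D1 t) ('X^m - (j f0)%:P) = 0.
    rewrite (derB (der_poly_der (D1d t))) (derX (der_poly_der (D1d t))) der_polyX //.
    by rewrite mulr0 mul0rn der_polyC // (D1P t).2 Dpol_f0 rmorph0 polyC0 subr0.
  by rewrite rmorph0 !mulr0 addr0.
pose jj : {rmorphism A -> K} := res \o polyC \o j.
have Djj t p : D t (jj p) = jj (Dpol t p) by rewrite /jj /= (DP t).2 der_polyC // (D1P t).2.
have jj_inj : injective jj.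
  apply: raddf_inj => p /ker [q qE]; apply: j_inj; rewrite rmorph0; apply: polyC_inj; rewrite polyC0 qE.
  apply/eqP; apply/negPn/negP => n0; move: (qE) => /(congr1 (fun s : {poly Phi} => size s)).
  have q0 : q != 0 by apply: contraNneq n0 => ->; rewrite mul0r.
  rewrite size_mul //; last by rewrite -size_poly_gt0 size_XnsubC.
  rewrite size_XnsubC // size_polyC; have := q0; rewrite -size_poly_gt0; case: (size q) => // t _.
  by case: (_ != _) => /= E; move: m0 E; clear; lia.
pose u : {rmorphism F -> K} := jj \o @mpolyC _ _.
pose w i : K := jj 'X_i.
have mevE' p : mev u w p = jj p by exact: (@mpoly_morph_eq _ _ _ (mev u w) jj (fun c => mevC u w c) (fun i => mevX u w i)).
have wM t : Dpol t 'X_(ord_max) = - f0^`M(ww (lift ord0 t)).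
  rewrite /Dpol !mderiv_var eqxx mulr1 (_ : _ == _ = false) ?mulr0 ?sub0r //.
  by apply/eqP => /(congr1 val) /= e; have := ltn_ord (lift ord0 t); rewrite /= e ltnn.
have wW t i : Dpol t 'X_(ww i) = (lift ord0 t == i)%:R * f0^`M(ord_max).
  rewrite /Dpol !mderiv_var (_ : ord_max == ww i = false) ?mulr0 ?subr0 1?mulrC //.
  by apply/eqP => /(congr1 val) /= e; have := ltn_ord i; rewrite -e ltnn.
pose gx := jj f0^`M(ord_max).
have gx0 : gx != 0 by rewrite /gx -(rmorph0 jj) (inj_eq jj_inj).
have gE i : grad f0 u w i = jj f0^`M(i) by rewrite /grad mevE'.
have gpE i t : D t (w i) = jj (Dpol t 'X_i) by rewrite /w Djj.
have cofx : cof (formmx wt D w) ord_max != 0.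
  have lw t : lift ord_max t = ww t :> 'I_l.+2 by apply: ord_inj; rewrite lift_max.
  have wt1w t : wt (ww t) = 1%N by rewrite /wt1 -val_eqE /= ltn_eqF.
  rewrite cofE mulf_neq0 ?signr_eq0 // -det_tr det_trig; last first.
    apply/is_trig_mxP => r t rt; rewrite !mxE lw; case: unliftP => [s e|e]; last by rewrite e in rt.
    rewrite gpE wW (_ : lift ord0 s == r = false) ?mul0r ?rmorph0 //.
    by apply/negP => /eqP e'; rewrite e e' ltnn in rt.
  apply/prodf_neq0 => r _; rewrite !mxE lw; case: unliftP => [s e|e].
    by rewrite gpE wW e eqxx mul1r.
  by rewrite wt1w mul1r /w -(rmorph0 jj) (inj_eq jj_inj) mvar_neq0.
have cyc : res 'X ^+ m = mev u w f0.
  apply/eqP; rewrite mevE' /jj /= -subr_eq0 -rmorphXn -rmorphB; apply/eqP/ker; exists 1; by rewrite mul1r.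
have Du t c : D t (u c) = 0.
  by rewrite /u /= Djj /Dpol !mderivC !mulr0 subr0; exact: rmorph0.
have fv : form_value a d f0 u D w (numer a d D w ord_max / gx).
  left; split; first by exists ord_max; rewrite gE.
  have gxE : gx = grad f0 u w ord_max by rewrite gE.
  move=> i; apply: (mulIf gx0); rewrite mulrAC divfK // gxE /numer.
  have Dd t : derivation (D t) := (DP t).1.
  have := cof_ker i ord_max (Mgrad G Dd Du cyc).
  by rewrite !mxE -!mulrA => ->.
unshelve eexists (@GenericPoint l a d m F f0 K u D w (res 'X) _ _ _ cyc _ fv _) => //.
- by move=> t; exact: (DP t).1.
- move=> g g0; have fm := cyclic_ymonic m0 f0; apply: (nform0_dvd fm).
  have [q qE] := nformP fm g; have {}qE : nform (cyclic m f0) g = g - q * cyclic m f0 by rewrite -qE subKr.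
  have mE N : mev u (join_pt w (res 'X)) N = (map_poly (mev u w) (muni N)).[res 'X].
    rewrite mev_muni join_max; congr (map_poly (mev u _) _).[_]; apply/funext => i; exact: join_widen.
  have cy0 : mev u (join_pt w (res 'X)) (cyclic m f0) = 0.
    by rewrite mE muni_cyclic rmorphB /= map_polyXn map_polyC !hornerE cyc subrr.
  have : mev u (join_pt w (res 'X)) (nform (cyclic m f0) g) = 0.
    by rewrite qE (rmorphB (mev u _)) (rmorphM (mev u _)) /= cy0 g0 mulr0 subr0.
  rewrite mE.
  have := nform_size fm g; move: (nform _ g) => N sN.
  have -> : (map_poly (mev u w) (muni N)).[res 'X] = res (map_poly j (muni N)).
    have -> : map_poly (mev u w) (muni N) = map_poly (res \o polyC) (map_poly j (muni N)).
      by apply/polyP => i; rewrite !coef_map /= mevE'.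
    exact/esym/poly_morphE.
  move=> /ker [s sE]; apply: (can_inj (@muniK _ _)); rewrite rmorph0.
  apply: (@map_inj_poly _ _ j j_inj); rewrite ?rmorph0 //.
  apply/eqP/negPn/negP => n0; have s0 : s != 0 by apply: contraNneq n0 => s0; rewrite sE s0 mul0r.
  have : (size (map_poly j (muni N)) <= m)%N by apply: leq_trans (size_poly _ _) sN.
  rewrite sE size_mul // -?size_poly_gt0 size_XnsubC // addnS /= leqNgt => /negP; apply.
  by rewrite -add1n leq_add2r size_poly_gt0.
- by rewrite mulf_neq0 ?invr_eq0 // /numer mulf_neq0 // expf_neq0 // /w -(rmorph0 jj) (inj_eq jj_inj) mvar_neq0.
Qed.
End Generic.

(** * The Newton polygon of a curve *)

Lemma mev_cyclic (n m : nat) (R S : comNzRingType) (v : {rmorphism R -> S}) (x : 'I_n.+1 -> S) (g : {mpoly R[n]}) :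
  mev v x (cyclic m g) = x ord_max ^+ m - mev v (x \o widen_ord (leqnSn n)) g.
Proof.
by rewrite mev_muni muni_cyclic rmorphB /= map_polyXn map_polyC !hornerE.
Qed.

Lemma mev_eqfun (n : nat) (R S : comNzRingType) (u v : {rmorphism R -> S}) (x : 'I_n -> S) p :
  u =1 v -> mev u x p = mev v x p.
Proof. by move=> uv; rewrite !mevE; apply: eq_bigr => M _; rewrite uv. Qed.

Lemma mev0 (n : nat) (w : 'I_n -> nat) (k : fieldType) (S : comNzRingType) (u : {rmorphism k -> S}) d p :
  (forall i, 0 < w i)%N -> (0 < d)%N -> whomog w d p -> mev u (fun=> 0) p = 0.
Proof.
move=> w0 d0 hp; rewrite -(@mev_eq _ _ _ u (fun i => 0 ^+ w i * 0)) => [|i]; last by rewrite mulr0.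
by rewrite (whomog_scale u _ _ hp) expr0n (gtn_eqF d0) mul0r.
Qed.

Section PlaceValues.
Variables (k : closedFieldType) (F : closedFieldType) (pl : place k F).
Local Notation V := (vring pl).
Local Notation io := (pin pl).
Local Notation th := (pres pl).

(** Valuation rings are integrally closed: otherwise the inverse of [x] would be in the maximal
    ideal and have a unit as its [n]-th power. *)
Lemma pin_root x n v : (0 < n)%N -> x ^+ n = io v -> exists v', x = io v'.
Proof.
move=> n0 xn; have [//|[w xw w0]] := placeP pl x.
have : v * w ^+ n = 1 by apply: (@pin_inj _ _ pl); rewrite rmorphM rmorphXn rmorph1 -xn -exprMn xw expr1n.
move/(congr1 th); rewrite rmorphM rmorphXn rmorph1 w0 expr0n (gtn_eqF n0) mulr0 => /eqP.
by rewrite eq_sym oner_eq0.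
Qed.

(** The choice of a slope: [rho] has the largest of the sizes of [p_t] to the power [1 / e_t]. The
    powers [D / e_t] make coefficients of different [t] comparable, and the dominant one has a
    [D]-th root in the algebraically closed field [k]. *)
Lemma poly_dominant n (I : eqType) (s : seq I) (p : I -> {mpoly k[n]}) (e : I -> nat) :
  (forall t, t \in s -> (0 < e t)%N) -> (exists2 t, t \in s & p t != 0) ->
  exists (rho : k) (g : I -> {mpoly V[n]}), [/\ rho != 0,
    forall t, t \in s -> p t = rho ^+ e t *: map_mpoly io (g t) &
    exists2 t, t \in s & map_mpoly th (g t) != 0].
Proof.
move=> e0 [t1 t1s pt1]; pose D := \prod_(t <- s) e t.
have eD t : t \in s -> (e t %| D)%N.
  by move=> ts; rewrite /D (big_rem t) //= dvdn_mulr.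
have D0 : (0 < D)%N by rewrite /D big_seq prodn_cond_gt0.
pose s' := [seq (t, M) | t <- s, M <- msupp (p t)].
pose beta (x : I * 'X_{1..n}) := (p x.1)@_x.2 ^+ (D %/ e x.1).
have De t : t \in s -> (0 < D %/ e t)%N by move=> ts; rewrite divn_gt0 ?e0 // dvdn_leq ?eD.
have bs x : x \in s' -> x.1 \in s /\ (p x.1)@_x.2 != 0.
  by move=> /allpairsPdep [t [M [ts Ms ->]]] /=; rewrite -mcoeff_msupp.
have [[t0 M0] [/bs [/= t0s _] b0 dom]] : exists x, [/\ x \in s', beta x != 0 &
    forall y, y \in s' -> exists v, beta y = beta x * io v].
  apply: seq_dominant; exists (t1, mlead (p t1)).
    by apply/allpairsPdep; exists t1, (mlead (p t1)); split=> //; exact: mlead_supp.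
  by rewrite /beta expf_neq0 // mleadc_eq0.
have [rho rhoE] : exists rho : k, rho ^+ D = beta (t0, M0).
  have /closed_rootP [r] : size ('X^D - (beta (t0, M0))%:P : {poly k}) != 1%N by rewrite size_XnsubC // eqSS -lt0n.
  by rewrite /root !hornerE subr_eq0 => /eqP; exists r.
have rho0 : rho != 0 by apply: contraNneq b0 => r0; rewrite -rhoE r0 expr0n (gtn_eqF D0).
have /choice [v vE] : forall x, exists v, x.1 \in s -> (p x.1)@_x.2 = rho ^+ e x.1 * io v.
  move=> [t M] /=; have [ts|] := boolP (t \in s); last by exists 0.
  have [z|nz] := eqVneq (p t)@_M 0; first by exists 0; rewrite z rmorph0 mulr0.
  have [v vE] : exists v, beta (t, M) = beta (t0, M0) * io v.
    by apply: dom; apply/allpairsPdep; exists t, M; split=> //; rewrite mcoeff_msupp.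
  have [|v' v'E] := @pin_root ((p t)@_M / rho ^+ e t) (D %/ e t) v (De _ ts).
    rewrite expr_div_n -exprM mulnC divnK ?eD // rhoE.
    by apply: (mulIf b0); rewrite divfK // mulrC -vE.
  by exists v' => _; rewrite -v'E mulrC divfK // expf_neq0.
pose g t : {mpoly V[n]} := \sum_(M <- msupp (p t)) v (t, M) *: 'X_[M].
have gE t : t \in s -> p t = rho ^+ e t *: map_mpoly io (g t).
  move=> ts; rewrite [LHS]mpolyE /g (raddf_sum (map_mpoly io)) scaler_sumr; apply: eq_bigr => M _ /=.
  by rewrite map_mpolyZ map_mpolyX scalerA -(vE (t, M)).
exists rho, g; split=> //; exists t0 => //.
apply/eqP => /(congr1 (mcoeff M0)); rewrite mcoeff0 mcoeff_map_mpoly => th0.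
have E : rho ^+ e t0 * io (g t0)@_M0 = (p t0)@_M0 by rewrite [in RHS](gE _ t0s) mcoeffZ mcoeff_map_mpoly.
have : (g t0)@_M0 ^+ (D %/ e t0) = 1.
  apply: (@pin_inj _ _ pl); rewrite rmorphXn rmorph1.
  apply: (mulfI b0); rewrite mulr1 -{1}rhoE -{1}(divnK (eD _ t0s)) mulnC exprM -exprMn E.
  by [].
move/(congr1 th); rewrite rmorphXn rmorph1 [th _]th0 expr0n (gtn_eqF (De _ t0s)) => /eqP.
by rewrite eq_sym oner_eq0.
Qed.

Lemma mdvd_pin n m (f g : {mpoly V[n.+1]}) : ymonic m f ->
  mdvd (map_mpoly io f) (map_mpoly io g) -> mdvd f g.
Proof.
move=> fm dv; apply: (nform0_dvd fm); apply: (@map_mpoly_inj _ _ _ io (@pin_inj _ _ pl)); rewrite rmorph0.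
apply: (mdvd_small (ymonic_map io fm)).
  by rewrite muni_map; apply: leq_trans (size_poly _ _) (nform_size fm g).
have [s sE] := nformP fm g.
have -> : nform f g = g - s * f by rewrite -sE subKr.
have -> : map_mpoly io (g - s * f) = map_mpoly io g - map_mpoly io s * map_mpoly io f.
  by rewrite (raddfB (map_mpoly io)); congr (_ - _); exact: (rmorphM (map_mpoly io)).
by apply: mdvdB => //; exists (map_mpoly io s).
Qed.
End PlaceValues.

Section ScalePoly.
Variables (R : comNzRingType) (t : R).
Lemma coef_scale (p : {poly R}) i : (p \Po (t *: 'X))`_i = t ^+ i * p`_i.
Proof.
elim/poly_ind: p i => [|p c IH] i; first by rewrite comp_poly0 !coef0 mulr0.
rewrite comp_poly_MXaddC coefD coefC [RHS]mulrC coefD coefC mulrDl -scalerAr coefZ coefMX coefMX.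
case: i => [|i] /=; first by rewrite !mulr0 !mul0r !add0r expr0 mulr1.
by rewrite mul0r !addr0 IH exprS; ring.
Qed.
End ScalePoly.

(** Scaling by [c] and [tau] multiplies the [j]-th coefficient of the equation along [A] by a
    scalar. These coefficients need only vanish modulo an equation; [kill] says that their integral
    multiples reduce to 0. *)
Lemma rescaled_curve (V M L E : comNzRingType) (k : fieldType) (cV : {rmorphism V -> M}) (ck : {rmorphism k -> L})
    (io : {rmorphism V -> k}) (mu : {rmorphism M -> L}) (ev : {rmorphism M -> E})
    (N d : nat) (w : 'I_N -> nat) (fV : {mpoly V[N]}) (A : 'I_N -> {poly L}) (B : 'I_N -> {poly M}) (c tau : L) :
  (forall v, mu (cV v) = ck (io v)) -> whomog w d (map_mpoly io fV) ->
  (forall i j, mu (B i)`_j = c ^+ w i * tau ^+ j * (A i)`_j) ->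
  (forall p j z, mu p = z * (mev (polyC \o ck) A (map_mpoly io fV))`_j -> ev p = 0) ->
  mev (polyC \o (ev \o cV)) (fun i => map_poly ev (B i)) fV = 0.
Proof.
move=> hmu hf BE kill.
pose sc : {rmorphism {poly L} -> {poly L}} := comp_poly (tau *: 'X).
pose Z := mev (polyC \o cV) B fV.
have E0 : map_poly mu Z = mev (map_poly mu \o (polyC \o cV)) (map_poly mu \o B) fV by exact: mev_comp.
have E1 : map_poly mu Z = mev (polyC \o ck) (map_poly mu \o B) (map_mpoly io fV).
  by rewrite E0 mev_map; apply: mev_eqfun => x /=; rewrite map_polyC /= hmu.
have E2 : mev (polyC \o ck) (map_poly mu \o B) (map_mpoly io fV) =
    c%:P ^+ d * sc (mev (polyC \o ck) A (map_mpoly io fV)).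
  move: (map_mpoly io fV) hf => f hf.
  have E3 : sc (mev (polyC \o ck) A f) = mev (sc \o (polyC \o ck)) (sc \o A) f by exact: mev_comp.
  rewrite E3 -(whomog_scale _ _ _ hf) (@mev_eqfun _ _ _ (polyC \o ck) (sc \o (polyC \o ck))); last first.
    by move=> x /=; rewrite comp_polyC.
  apply: mev_eq => i /=; apply/polyP => t.
  by rewrite coef_map /= BE -rmorphXn /= coefCM coef_scale mulrA.
have : map_poly ev Z = 0.
  apply/polyP => j; rewrite coef_map coef0; apply: (kill _ j (c ^+ d * tau ^+ j)).
  by rewrite -(coef_map mu) E1 E2 -rmorphXn coefCM coef_scale mulrA.
have -> : map_poly ev Z = mev (map_poly ev \o (polyC \o cV)) (map_poly ev \o B) fV by exact: mev_comp.
by move=> <-; apply: mev_eqfun => x /=; rewrite map_polyC.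
Qed.

(** * The value of the form at successive vertices *)

Section Zoom.
Variables (l a b d m : nat) (F : closedFieldType) (f0 : {mpoly F[l.+2]}).
Hypothesis G : good_cover a b d m f0.
Hypothesis l_gt1 : (1 < l)%N.
Hypothesis dla : (l.+1 + a <= d)%N.
Hypothesis dbm : d = (b * m)%N.
Hypothesis m0 : (0 < m)%N.
Hypothesis d0 : (0 < d)%N.
Hypothesis a0 : (0 < a)%N.
Hypothesis b0 : (0 < b)%N.
Variable gp : generic_point a d m f0.
Local Notation E := (gp_field gp).
Local Notation u := (gp_base gp).
Local Notation D := (@gp_der _ _ _ _ _ _ gp).
Local Notation pt := (join_pt (gp_w gp) (gp_y gp)).
Local Notation form := (form_value a d f0 u D).

Variables (k : closedFieldType) (pl : place k F).
Local Notation V := (vring pl).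
Local Notation io := (pin pl).
Local Notation th := (pres pl).
Variable w0 : V.
Hypothesis w0n : w0 != 0.
Hypothesis thw0 : th w0 = 0.
Variable fV : {mpoly V[l.+3]}.
Hypothesis fVm : ymonic m fV.
Hypothesis fVE : map_mpoly th fV = cyclic m f0.
Local Notation f := (map_mpoly io fV).
Definition wtn (i : 'I_l.+3) : nat := join_pt (wt1 a) b i.
Hypothesis f_homog : whomog wtn d f.

Variables (kap : nat) (A : 'I_l.+3 -> {poly {mpoly k[l.+3]}}).
Hypothesis kap0 : (0 < kap)%N.
Hypothesis A_small : forall i j, (size (muni (A i)`_j) <= m)%N.
Hypothesis A_size : forall i, (size (A i) <= (kap * wtn i).+1)%N.
Hypothesis A_wt : forall i j, (A i)`_j != 0 -> (wtn i %| j)%N.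
Hypothesis A_eq : forall j, mdvd f (mev (polyC \o @mpolyC _ _) A f)`_j.
Hypothesis A_low : forall i, exists c, (A i)`_0 = c%:MP.
Hypothesis A_low0 : exists i, (A i)`_0 != 0.
Hypothesis A_high : forall i,
  mdvd f ((A i)`_(kap * wtn i) * 'X_ord0 ^+ wtn i - 'X_i * (A ord0)`_kap ^+ wtn i).
Hypothesis A_high0 : (A ord0)`_kap != 0.

Local Notation ww i := (widen_ord (leqnSn l.+2) i).

Let wtnw i : wtn (ww i) = wt1 a i. Proof. exact: join_widen. Qed.
Let wtnm : wtn ord_max = b. Proof. exact: join_max. Qed.
Let wtn0 : wtn ord0 = 1%N.
Proof. by rewrite (_ : ord0 = ww ord0) ?wtnw //; exact: val_inj. Qed.
Let wt1_gt0 (i : 'I_l.+2) : (0 < wt1 a i)%N. Proof. by rewrite /wt1; case: ifP. Qed.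
Let wtn_gt0 i : (0 < wtn i)%N.
Proof. by have [->|[j ->]] := ord_widenP i; rewrite ?wtnm // wtnw. Qed.

Variable ev : {rmorphism {mpoly V[l.+3]} -> E}.
Hypothesis evE : forall p, ev p = mev u pt (map_mpoly th p).

Let ev_f : ev fV = 0.
Proof.
rewrite evE fVE mev_cyclic join_max (gp_eq gp) [X in _ - X](_ : _ = mev u (gp_w gp) f0) ?subrr //.
by apply: mev_eq => i; exact: join_widen.
Qed.

Let ev_dvd p : mdvd f (map_mpoly io p) -> ev p = 0.
Proof. by move=> /(mdvd_pin fVm) [q ->]; rewrite rmorphM ev_f mulr0. Qed.

Let ev_small p : (size (muni p) <= m)%N -> ev p = 0 -> map_mpoly th p = 0.
Proof.
move=> sp; rewrite evE => /(@gp_generic _ _ _ _ _ _ gp) dv; apply: mdvd_small dv; first exact: cyclic_ymonic.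
by rewrite muni_map; apply: leq_trans (size_poly _ _) sp.
Qed.

Let pin_eq0 (p : {mpoly V[l.+3]}) : map_mpoly io p = 0 -> p = 0.
Proof.
move=> p0; apply: (@map_mpoly_inj _ _ _ io (@pin_inj _ _ pl)).
by rewrite p0 rmorph0.
Qed.

Section Scaled.
Variables (c tau : k) (B : 'I_l.+3 -> nat -> {mpoly V[l.+3]}).
Hypothesis BE : forall i j, map_mpoly io (B i j) = (c ^+ wtn i * tau ^+ j) *: (A i)`_j.

Lemma B_small i j : (size (muni (B i j)) <= m)%N.
Proof.
have -> : size (muni (B i j)) = size (muni (map_mpoly io (B i j))).
  rewrite muni_map size_map_inj_poly ?rmorph0 //; exact: (@map_mpoly_inj _ _ _ io (@pin_inj _ _ pl)).
rewrite BE -mul_mpolyC rmorphM /= muniC mul_polyC.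
by apply: leq_trans (size_scale_leq _ _) (A_small i j).
Qed.

Lemma B_big i j : (kap * wtn i < j)%N -> B i j = 0.
Proof.
move=> lt; apply: pin_eq0; rewrite BE nth_default ?scaler0 //.
exact: leq_trans (A_size i) lt.
Qed.

Lemma B_wt i j : B i j != 0 -> (wtn i %| j)%N.
Proof.
move=> n0; apply: A_wt; apply: contraNneq n0 => z; apply/eqP/pin_eq0.
by rewrite BE z scaler0.
Qed.

Definition curve i : {poly E} := \poly_(j < (kap * wtn i).+1) ev (B i j).

Lemma coef_curve i j : (curve i)`_j = ev (B i j).
Proof.
rewrite coef_poly; case: ltnP => // lt; rewrite B_big ?rmorph0 //.
Qed.

Lemma curve_eq : curve ord_max ^+ m = mev (polyC \o u) (fun i => curve (ww i)) f0.
Proof.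
pose BP i : {poly {mpoly V[l.+3]}} := \poly_(j < (kap * wtn i).+1) B i j.
have BPc i j : (BP i)`_j = B i j.
  by rewrite coef_poly; case: ltnP => // lt; rewrite B_big.
have curveE i : map_poly ev (BP i) = curve i.
  by apply/polyP => j; rewrite coef_map coef_curve BPc.
have E0 := @rescaled_curve V {mpoly V[l.+3]} {mpoly k[l.+3]} E k (@mpolyC _ V) (@mpolyC _ k) io (map_mpoly io) ev
  _ d wtn fV A BP c%:MP tau%:MP (map_mpolyC _ io) f_homog.
have E1 : mev (polyC \o (ev \o @mpolyC _ V)) (fun i => map_poly ev (BP i)) fV = 0.
  apply: E0 => [i j|p j z pE].
    by rewrite BPc; apply: etrans (BE i j) _; rewrite -!rmorphXn -rmorphM /= mul_mpolyC.
  by apply: ev_dvd; rewrite pE; apply/mdvdMl/A_eq.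
have E2 : mev (polyC \o u) curve (map_mpoly th fV) = 0.
  rewrite -E1 mev_map (@mev_eqfun _ _ _ _ (polyC \o (ev \o @mpolyC _ V))).
    by apply: mev_eq => i; rewrite curveE.
  by move=> x /=; rewrite evE map_mpolyC mevC.
by move: E2; rewrite fVE mev_cyclic => /eqP; rewrite subr_eq0 => /eqP.
Qed.
End Scaled.

(* A vertex of the Newton polygon of the curve: a rescaling over the valuation
   ring whose reduction has leading part in weighted degree kp, with value lam
   of the form there. *)
Definition vertex (kp : nat) (lam : E) := exists c tau (B : 'I_l.+3 -> nat -> {mpoly V[l.+3]}),
  [/\ c != 0, tau != 0, forall i j, map_mpoly io (B i j) = (c ^+ wtn i * tau ^+ j) *: (A i)`_j,
      forall i j, (kp * wtn i < j)%N -> map_mpoly th (B i j) = 0 &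
      (exists i, map_mpoly th (B i (kp * wtn i)%N) != 0) /\ form (fun i => ev (B (ww i) (kp * wt1 a i)%N)) lam].

(** At the first vertex the reduced point has coordinates in [F], which the derivations kill, so the
    form has value 0. *)
Lemma vertex0 : vertex 0 0.
Proof.
have [i0 Ai0] := A_low0; have /choice [r rE] := A_low.
have [||rho [g [rho0 gE [i1 _ gi1]]]] := @poly_dominant k F pl l.+3 _ (enum 'I_l.+3) (fun i => (A i)`_0) wtn.
- by move=> i _; exact: wtn_gt0.
- by exists i0; rewrite ?mem_enum.
have {}gE i : (A i)`_0 = rho ^+ wtn i *: map_mpoly io (g i) by apply: gE; rewrite mem_enum.
pose s := [seq (i, j) | i <- enum 'I_l.+3, j <- iota 1 (kap * wtn i)].
have sP i j : (0 < j <= kap * wtn i)%N -> (i, j) \in s.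
  by move=> h; apply/allpairsPdep; exists i, j; rewrite mem_enum mem_iota add1n ltnS.
have [||sig [h [sig0 hE _]]] := @poly_dominant k F pl l.+3 _ s (fun t => rho ^- wtn t.1 *: (A t.1)`_t.2) snd.
- by move=> t /allpairsPdep [i [j [_]]]; rewrite mem_iota => /andP [j0 _] ->.
- exists (ord0, kap); first by apply: sP; rewrite wtn0 muln1 kap0 leqnn.
  by rewrite scaler_eq0 negb_or invr_eq0 expf_neq0 //= A_high0.
have pw0 : io w0 != 0 by apply: contraNneq w0n => e; apply/eqP/(@pin_inj _ _ pl); rewrite e rmorph0.
(* [rho] makes the constant coefficients primitive, [sig] makes the others integral, and the factor
   [w0] then makes the latter reduce to 0. *)
pose B i j := if j == 0%N then g i else if (j <= kap * wtn i)%N then w0 ^+ j *: h (i, j) else 0.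
exists rho^-1, (io w0 / sig), B; split.
- by rewrite invr_eq0.
- by rewrite mulf_neq0 ?invr_eq0.
- move=> i j; rewrite /B; have [->|j0] := eqVneq j 0%N.
    by rewrite gE expr0 mulr1 scalerA -exprMn mulVf // expr1n scale1r.
  case: leqP => [le|lt]; last by rewrite rmorph0 nth_default ?scaler0 // (leq_trans (A_size i)).
  have hij := hE (i, j) (sP _ _ _); rewrite /= in hij; rewrite lt0n j0 le in hij.
  rewrite map_mpolyZ rmorphXn /= exprVn mulrC -scalerA hij // scalerA; congr (_ *: _).
  by rewrite expr_div_n divfK ?expf_neq0.
- move=> i j; rewrite mul0n /B => j0; rewrite (gtn_eqF j0); case: ifP => _; last by rewrite rmorph0.
  by rewrite map_mpolyZ rmorphXn /= thw0 expr0n (gtn_eqF j0) scale0r.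
split; first by exists i1; rewrite mul0n /B.
have cst i : exists z : F, ev (B (ww i) (0 * wt1 a i)%N) = u z.
  rewrite mul0n /B /= evE.
  suff [z ->] : exists z, map_mpoly th (g (ww i)) = z%:MP by exists z; rewrite mevC.
  have : map_mpoly io (g (ww i)) = (rho ^- wtn (ww i) * r (ww i))%:MP.
    by rewrite mpolyCM mul_mpolyC -rE gE scalerA mulVf ?scale1r // expf_neq0.
  move: (g _) (_ * _) => p x pE; exists (th p@_0%MM).
  rewrite -map_mpolyC; congr (map_mpoly th _); apply: (@map_mpoly_inj _ _ _ io (@pin_inj _ _ pl)).
  by rewrite map_mpolyC pE -mcoeff_map_mpoly pE mcoeffC eqxx mulr1.
pose v i := ev (B (ww i) (0 * wt1 a i)%N).
(* The row of a derivation is zero and belongs to every maximal minor. *)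
have numer0 i : numer a d D v i = 0.
  have l0 : (0 < l)%N by exact: ltnW.
  rewrite /numer cofE; set M := col' _ _.
  suff -> : \det M = 0 by rewrite !mulr0.
  rewrite (expand_det_row _ (lift ord0 (Ordinal l0))) big1 // => t _.
  rewrite !mxE liftK /v; have [z ->] := cst (lift i t).
  by rewrite gp_der_base mul0r.
rewrite -/v; have [crit|nc] := pselect (forall i, grad f0 u v i = 0); first by right.
left; split; first by have /existsNP [i ni] := nc; exists i; apply/eqP.
by move=> i; rewrite mul0r numer0.
Qed.

Let ev0 p : map_mpoly th p = 0 -> ev p = 0.
Proof. by rewrite evE => ->; rewrite rmorph0. Qed.

(** The next edge of the Newton polygon, with slope given by [rho]. In the new scaling the reduction
    lives in weighted degrees from [kp] to [kp']: it is a rational curve from the old vertex to the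
    new one, and [form_constant] applies to it. *)
Lemma vertex_step kp lam : vertex kp lam -> (kp < kap)%N ->
  exists2 kp', (kp < kp' <= kap)%N & vertex kp' lam.
Proof.
move=> [c [tau [B [c0 tau0 BE Bhi [[i1 Bi1] fl]]]]] lt.
pose s := [seq (i, j) | i <- enum 'I_l.+3, j <- iota (kp * wtn i).+1 ((kap - kp) * wtn i)].
have sP i j : (kp * wtn i < j <= kap * wtn i)%N -> (i, j) \in s.
  move=> h; apply/allpairsPdep; exists i, j; rewrite mem_enum mem_iota; split=> //.
  by rewrite addSn ltnS -mulnDl subnKC // ltnW.
have sQ t : t \in s -> (kp * wtn t.1 < t.2)%N.
  by move=> /allpairsPdep [i [j [_]]]; rewrite mem_iota => /andP [j0 _] ->.
have [|| rho [g [rho0 gE [[i2 j2] s2 gi2]]]] := @poly_dominant k F pl l.+3 _ s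
    (fun t => map_mpoly io (B t.1 t.2)) (fun t => t.2 - kp * wtn t.1)%N.
- by move=> t /sQ; rewrite subn_gt0.
- exists (ord0, kap); first by apply: sP; rewrite wtn0 !muln1 lt leqnn.
  by rewrite /= BE scaler_eq0 negb_or mulf_neq0 ?expf_neq0.
have ij2 := sQ _ s2; rewrite /= in ij2.
(* [rho] lies in the maximal ideal: the coefficient at [(i2, j2)], where the slope is attained,
   reduces to 0 in the old scaling. *)
have [r rE thr] : exists2 r, io r = rho & th r = 0.
  have e0 : (0 < j2 - kp * wtn i2)%N by rewrite subn_gt0.
  have [M gM] : exists M, th (g (i2, j2))@_M != 0.
    by exists (mlead (map_mpoly th (g (i2, j2)))); rewrite -mcoeff_map_mpoly mleadc_eq0.
  have [x xE] := place_unit gM.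
  have E1 : io (B i2 j2)@_M = rho ^+ (j2 - kp * wtn i2) * io (g (i2, j2))@_M.
    by rewrite -!mcoeff_map_mpoly (gE _ s2) mcoeffZ.
  have [|r rE] := @pin_root _ _ pl rho _ ((B i2 j2)@_M * x) e0.
    by rewrite rmorphM E1 -mulrA -rmorphM (mulrC _ x) xE rmorph1 mulr1.
  exists r => //; have : r ^+ (j2 - kp * wtn i2) * (g (i2, j2))@_M = (B i2 j2)@_M.
    by apply: (@pin_inj _ _ pl); rewrite E1 rmorphM rmorphXn rE.
  move/(congr1 th); rewrite rmorphM rmorphXn -[th (B _ _)@_M]mcoeff_map_mpoly Bhi // mcoeff0 => /eqP.
  by rewrite mulf_eq0 (negPf gM) orbF expf_eq0 => /andP [_ /eqP].
(* Coefficients beyond [kp] are divided by powers of [rho], those before it are multiplied, and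
   those at [kp] are kept, so that the old vertex survives. *)
pose B' i j := if (kp * wtn i < j)%N then (if (j <= kap * wtn i)%N then g (i, j) else 0)
  else r ^+ (kp * wtn i - j) *: B i j.
pose c' := c * rho ^+ kp; pose tau' := tau / rho.
have c'0 : c' != 0 by rewrite mulf_neq0 ?expf_neq0.
have tau'0 : tau' != 0 by rewrite mulf_neq0 ?invr_eq0.
have B'E i j : map_mpoly io (B' i j) = (c' ^+ wtn i * tau' ^+ j) *: (A i)`_j.
  rewrite /B' /c' /tau' exprMn -exprM expr_div_n; case: ltnP => [lj|jl].
    case: leqP => [le|lt']; last by rewrite rmorph0 nth_default ?scaler0 // (leq_trans (A_size i)).
    apply: (scalerI (expf_neq0 (j - kp * wtn i) rho0)).
    have := gE (i, j); rewrite sP ?lj ?le //= => <- //; rewrite BE scalerA; congr (_ *: _).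
    have -> : rho ^+ j = rho ^+ (j - kp * wtn i) * rho ^+ (kp * wtn i) by rewrite -exprD subnK // ltnW.
    have := expf_neq0 (j - kp * wtn i) rho0; have := expf_neq0 (kp * wtn i) rho0.
    move: (rho ^+ _) (rho ^+ (kp * _)) (c ^+ _) (tau ^+ _) => X Y C T Y0 X0.
    by field; rewrite X0 Y0.
  rewrite map_mpolyZ BE scalerA rmorphXn rE; congr (_ *: _).
  have -> : rho ^+ (kp * wtn i) = rho ^+ (kp * wtn i - j) * rho ^+ j by rewrite -exprD subnK.
  have := expf_neq0 j rho0; move: (rho ^+ _) (rho ^+ j) (c ^+ _) (tau ^+ _) => X Y C T Y0.
  by field.
have B'lo i j : (j < kp * wtn i)%N -> map_mpoly th (B' i j) = 0.
  move=> lj; rewrite /B' ltnNge (ltnW lj) /= map_mpolyZ rmorphXn thr expr0n.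
  by rewrite subn_eq0 leqNgt lj scale0r.
have B'at i : B' i (kp * wtn i)%N = B i (kp * wtn i)%N by rewrite /B' ltnn subnn expr0 scale1r.
have evn i j : map_mpoly th (B' i j) != 0 -> ev (B' i j) != 0.
  by apply: contra_neq => /(ev_small (B_small B'E i j)).
pose P e := [exists i, ev (B' i (e * wtn i)%N) != 0].
have exP : exists e, P e by exists kp; apply/existsP; exists i1; rewrite evn // B'at.
have bP e : P e -> (e <= kap)%N.
  move=> /existsP [i ei]; rewrite leqNgt; apply: contra ei => le.
  by rewrite (B_big B'E) ?rmorph0 // ltn_pmul2r.
case: (ex_maxnP exP bP) => kp' Pk' maxk'.
have Pk : exists i, ev (B' i (kp' * wtn i)%N) != 0 by move: Pk' => /existsP.
(* Coordinate [i] only has coefficients in degrees divisible by its weight, so every vertex has an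
   integral abscissa [e]. *)
have wt_of i j : map_mpoly th (B' i j) != 0 -> exists2 e, j = (e * wtn i)%N & P e.
  move=> n0; have /dvdnP [e eE] : (wtn i %| j)%N.
    by apply: (B_wt B'E); apply: contraNneq n0 => ->; rewrite rmorph0.
  by exists e => //; apply/existsP; exists i; rewrite -eE evn.
have ltk : (kp < kp')%N.
  have [|e j2E Pe] := wt_of i2 j2.
    by rewrite /B' ij2; move: s2 => /allpairsPdep [i [j [_ + [iE jE]]]]; rewrite -iE -jE mem_iota addSn ltnS -mulnDl subnKC ?(ltnW lt) // => /andP [_ ->].
  by apply: leq_trans (maxk' _ Pe); rewrite j2E ltn_pmul2r in ij2.
have hi' i j : (kp' * wtn i < j)%N -> map_mpoly th (B' i j) = 0.
  move=> lj; apply/eqP/negPn/negP => /wt_of [e jE /maxk']; rewrite leqNgt => /negP; apply.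
  by rewrite jE ltn_pmul2r in lj.
(* Division by the weighted power of ['X^kp] puts the old vertex at degree 0. *)
pose q i : {poly E} := \poly_(j < ((kp' - kp) * wtn i).+1) ev (B' i (kp * wtn i + j)%N).
have QE i : curve B' i = 'X^(kp * wtn i) * q i.
  apply/polyP => t; rewrite (coef_curve B'E) coefXnM; case: ltnP => [/B'lo /ev0 //|le].
  rewrite coef_poly subnKC //; case: ltnP => // lt'; apply/ev0/hi'.
  have := leq_mul (ltnW ltk) (leqnn (wtn i)); move: lt' le; rewrite mulnBl.
  by move=> h1 h2 h3; rewrite ltn_subRL subnKC in h1.
have Xk0 : ('X^kp : {poly E}) != 0 by rewrite expf_neq0 ?polyX_eq0.
have qeq : q ord_max ^+ m = mev (polyC \o u) (fun i => q (ww i)) f0.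
  apply: (mulfI (expf_neq0 d Xk0)); rewrite -(whomog_scale _ _ _ (good_homog G)).
  have -> : mev (polyC \o u) (fun i => 'X^kp ^+ wt1 a i * q (ww i)) f0 = mev (polyC \o u) (fun i => curve B' (ww i)) f0.
    by apply: mev_eq => i; rewrite QE wtnw exprM.
  apply: etrans (curve_eq B'E); rewrite QE wtnm exprMn -!exprM; congr (_ * _); congr (_ ^+ _).
  by rewrite -mulnA; congr (_ * _)%N; exact: dbm.
(* Where the coordinates other than [y] vanish, so does [y]. Hence a nonzero vertex has a nonzero
   coordinate among the arguments of [f0]. *)
have at0 (q' : 'I_l.+2 -> {poly E}) y : y ^+ m = mev (polyC \o u) q' f0 -> (forall i, (q' i)`_0 = 0) -> y`_0 = 0.
  move=> E0 z; have hE p : horner_eval (0 : E) p = p`_0 by rewrite /horner_eval horner_coef0.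
  have E1 : horner_eval (0 : E) (y ^+ m) = mev (horner_eval 0 \o (polyC \o u)) (horner_eval 0 \o q') f0.
    by rewrite E0; exact: mev_comp.
  have : y`_0 ^+ m = 0.
    rewrite -hE -rmorphXn; apply: etrans E1 _; apply: etrans (mev0 (horner_eval 0 \o (polyC \o u)) wt1_gt0 d0 (good_homog G)).
    by apply: mev_eq => i; apply: etrans (hE (q' i)) (z i).
  by move=> /eqP; rewrite expf_eq0 => /andP [_ /eqP].
have tof_inj : injective (@FracField.tofrac {poly E}) by move=> p1 p2 /eqP; rewrite tofrac_eq => /eqP.
have sq i : (size (q (ww i)) <= ((kp' - kp) * wt1 a i).+1)%N by rewrite -wtnw; exact: size_poly.
have sy : (size (q ord_max) <= ((kp' - kp) * b).+1)%N by rewrite -wtnm; exact: size_poly.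
have q0 i : (q i)`_0 = ev (B i (kp * wtn i)%N) by rewrite coef_poly ltn0Sn addn0 B'at.
have qk i : (q i)`_((kp' - kp) * wtn i) = ev (B' i (kp' * wtn i)%N).
  by rewrite coef_poly ltnSn -mulnDl subnKC // ltnW.
have [||lam' [f1 f2]] := form_constant G l_gt1 dla dbm (@gp_derP _ _ _ _ _ _ gp) (@gp_der_base _ _ _ _ _ _ gp) tof_inj qeq sq sy.
- apply: contrapT => /forallNP al; have {}al i : (q (ww i))`_0 = 0 by apply/eqP/negPn/negP; exact: al.
  have y0 := at0 _ _ qeq al; have : ev (B i1 (kp * wtn i1)%N) != 0 by rewrite -B'at evn // B'at.
  by rewrite -q0; have [->|[j ->]] := ord_widenP i1; rewrite ?y0 ?al eqxx.
- apply: contrapT => /forallNP al; have {}al i : (q (ww i))`_((kp' - kp) * wt1 a i) = 0 by apply/eqP/negPn/negP; exact: al.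
  have rv0 K (p : {poly E}) : (rev_at K p)`_0 = p`_K by rewrite coef_poly ltn0Sn subn0.
  have y0 := at0 _ _ (yqr G dbm tof_inj qeq sq sy) (fun i => etrans (rv0 _ _) (al i)); rewrite rv0 in y0.
  have [i' +] := Pk; rewrite -qk; have [->|[j ->]] := ord_widenP i'.
    by rewrite wtnm y0 eqxx.
  by rewrite wtnw al eqxx.
exists kp'; first by rewrite ltk bP.
have lamE : lam' = lam.
  apply: form_value_uniq f1 _; move: fl; congr form_value.
  by apply/funext => i; rewrite q0 wtnw.
exists c', tau', B'; split=> //; split.
  have [i ei] := Pk; by exists i; apply: contra_neq ei => /ev0.
rewrite -lamE; move: f2; congr form_value; apply/funext => i.
by rewrite -!wtnw qk.
Qed.

(** At the last vertex the point is a weighted multiple of the generic point, where the form is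
    nonzero, although its value has been 0 since the first vertex. *)
Lemma zoom_absurd : False.
Proof.
have [c [tau [B [c0 tau0 BE _ [[i1 Bi1] fl]]]]] : vertex kap 0.
  have reach n kp : (kap - kp <= n)%N -> (kp <= kap)%N -> vertex kp 0 -> vertex kap 0.
    elim: n kp => [|n IH] kp; first by rewrite leqn0 subn_eq0 => h h'; rewrite (@anti_leq kp kap) // h h'.
    move=> h; rewrite leq_eqVlt => /predU1P [-> //|lt /vertex_step /(_ lt) [kp' /andP [lt1 le1]]].
    by apply: IH => //; lia.
  exact: reach (leqnn _) (leq0n _) vertex0.
pose be i := B i (kap * wtn i)%N.
have beE i : map_mpoly io (be i) = (c * tau ^+ kap) ^+ wtn i *: (A i)`_(kap * wtn i).
  by rewrite BE exprMn -exprM.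
have evX i : ev 'X_i = pt i by rewrite evE map_mpolyX mevX.
have rel i : ev (be i) * pt ord0 ^+ wtn i = pt i * ev (be ord0) ^+ wtn i.
  apply/eqP; rewrite -subr_eq0 -!evX -!rmorphXn -!rmorphM -rmorphB; apply/eqP/ev_dvd.
  have ioM (p q : {mpoly V[l.+3]}) : map_mpoly io (p * q) = map_mpoly io p * map_mpoly io q by exact: rmorphM.
  have ioX (p : {mpoly V[l.+3]}) e : map_mpoly io (p ^+ e) = map_mpoly io p ^+ e by exact: rmorphXn.
  rewrite (raddfB (map_mpoly io)) /= !ioM !ioX !map_mpolyX !beE wtn0 expr1 muln1 exprZn.
  by rewrite -scalerAl -scalerAr -scalerBr -mul_mpolyC; apply/mdvdMl/A_high.
have pt0 : pt ord0 != 0.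
  have : mev u pt 'X_ord0 = pt ord0 by rewrite mevX.
  move=> <-; apply/eqP => /(@gp_generic _ _ _ _ _ _ gp) dv.
  have := mdvd_small (cyclic_ymonic m0 f0) _ dv; rewrite (_ : ord0 = ww ord0); last exact: val_inj.
  rewrite muni_var; have -> : (size (('X_ord0 : {mpoly F[l.+2]})%:P) <= m)%N.
    by apply: leq_trans (size_polyC_leq1 _) m0.
  by move=> /(_ isT) /eqP; rewrite (negPf (mvar_neq0 _ _)).
have be0 : ev (be ord0) != 0.
  have : ev (be i1) != 0 by apply: contra_neq Bi1 => /(ev_small (B_small BE _ _)).
  apply: contra_neq => z; have := rel i1; rewrite z expr0n (gtn_eqF (wtn_gt0 i1)) mulr0 => /eqP.
  by rewrite mulf_eq0 expf_eq0 (negPf pt0) andbF orbF => /eqP.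
pose t := ev (be ord0) / pt ord0.
have t0 : t != 0 by rewrite mulf_neq0 ?invr_eq0.
have vE i : ev (B (ww i) (kap * wt1 a i)%N) = t ^+ wt1 a i * gp_w gp i.
  have := rel (ww i); rewrite /be wtnw join_widen -/(be ord0) => E1.
  apply: (mulIf (expf_neq0 (wt1 a i) pt0)); rewrite E1 /t expr_div_n mulrAC divfK ?expf_neq0 //.
  by rewrite mulrC.
have := form_value_scale G l_gt1 dla dbm (@gp_derP _ _ _ _ _ _ gp) t0 (@gp_value _ _ _ _ _ _ gp).
have {}fl : form (fun i => t ^+ wt1 a i * gp_w gp i) 0.
  by move: fl; congr form_value; apply/funext.
move=> /(form_value_uniq fl) /esym/eqP; apply/negP; exact: gp_form0.
Qed.
End Zoom.

(** * Regular functions on hypersurfaces *)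

Section Fractions.
Variable k : closedFieldType.

Lemma closed_pow_neq (n1 n2 : nat) : n1 != n2 -> exists2 c : k, c != 0 & c ^+ n1 != c ^+ n2.
Proof.
move=> n12; have p0 : 'X * ('X^n1 - 'X^n2) != 0 :> {poly k}.
  rewrite mulf_neq0 ?polyX_eq0 //; apply/eqP => /(congr1 (fun p : {poly k} => p`_n1)).
  by rewrite coefB !coefXn eqxx (negPf n12) subr0 coef0 => /eqP; rewrite oner_eq0.
have /closed_nonrootP [c] := p0; rewrite /root !hornerE mulf_eq0 negb_or => /andP [c0 c12].
by exists c => //; rewrite -subr_eq0.
Qed.

Variables (N : nat) (w : 'I_N -> nat).
Local Notation W := (wproj k w).
Implicit Types (P Q : W) (g h p : {mpoly k[N]}).

Definition rep P : 'I_N -> k := projT1 (cid (wpoint_ex P)).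
Lemma repP P : sval P (rep P). Proof. by rewrite /rep; case: cid. Qed.

Lemma rep_neq0 P x : sval P x -> exists i, x i != 0.
Proof.
case: P => A /= [z [i zi] ->] [c c0 ->]; exists i.
by rewrite mulf_neq0 ?expf_neq0.
Qed.

Lemma wpoint_of x : (exists i, x i != 0) -> exists P : W, sval P x.
Proof.
move=> nx; have hx : exists2 z, (exists i, z i != 0) & worbit w x = worbit w z by exists x.
exists (exist _ (worbit w x) hx); exists 1; first exact: oner_neq0.
by apply/funext => i; rewrite expr1n mul1r.
Qed.

Lemma wpoint_inj P Q x : sval P x -> sval Q x -> P = Q.
Proof.
case: P => A [y y0 yE]; case: Q => B [z z0 zE] /= Ax Bx; apply: eq_exist.
have orb (t : 'I_N -> k) : worbit w t x -> worbit w t = worbit w x.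
  move=> [c c0 ->]; apply/seteqP; split=> s [e e0 ->].
    exists (e / c); first by rewrite mulf_neq0 ?invr_eq0.
    by apply/funext => i; rewrite mulrA -exprMn divfK.
  exists (e * c); first by rewrite mulf_neq0.
  by apply/funext => i; rewrite mulrA -exprMn.
by move: Ax Bx; rewrite yE zE => /orb -> /orb ->.
Qed.

Lemma horbit P x y d p : whomog w d p -> sval P x -> sval P y -> p.@[x] != 0 -> p.@[y] != 0.
Proof.
move=> hp Px /(wpoint_rel Px) [c c0 ->] nz.
by rewrite (meval_worbit _ _ hp) mulf_neq0 ?expf_neq0.
Qed.

Lemma open_basic U P : zopen W U -> U P -> exists d p, [/\ whomog w d p,
  forall x, sval P x -> p.@[x] != 0 & forall Q x, sval Q x -> p.@[x] != 0 -> U Q].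
Proof.
move=> [S [hS eU]] UP; have : ~ (~` U)%classic P by [].
rewrite {1}eU /= => /existsNP [p /not_implyP [Sp np]].
have [d hp] := hS p Sp; exists d, p; split=> // [x Px|Q x Qx px].
  exact/(not_vanishesP hp Px).
apply: contrapT => nU; have : (~` U)%classic Q by [].
by rewrite eU => /(_ p Sp x Qx) /eqP; rewrite (negPf px).
Qed.

Definition nonzero_locus p : set W := fun P => forall x, sval P x -> p.@[x] != 0.

Lemma nonzero_locusP d p P x : whomog w d p -> sval P x -> p.@[x] != 0 -> nonzero_locus p P.
Proof. by move=> hp Px px y Py; exact: (horbit hp Px Py px). Qed.

Lemma basic_open d p : whomog w d p -> zopen W (nonzero_locus p).
Proof.
move=> hp; exists [set p]%classic; split; first by move=> _ ->; exists d.
apply/seteqP; split=> P /=.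
  move=> nP q -> x Px; apply/eqP/negPn/negP => px; apply: nP.
  exact: (nonzero_locusP hp Px px).
by move=> /(_ p erefl) vp h; have [x Px] := wpoint_ex P; have := h x Px; rewrite vp ?eqxx.
Qed.

(** Multiplying numerator and denominator by the equation [p] of a basic neighbourhood makes
    nonvanishing of the denominator imply membership in the domain. *)
Lemma regular_frac U phi P : zopen W U -> regular W U phi -> U P -> exists d g p,
  [/\ whomog w d g, whomog w d p, forall x, sval P x -> p.@[x] != 0 &
      forall Q x, sval Q x -> p.@[x] != 0 -> U Q /\ phi Q = g.@[x] / p.@[x]].
Proof.
move=> oU /(_ P) rphi UP; have [O [d [g [h [[oO OP hg hh] ghE]]]]] := rphi UP.
have [e [p [hp pP pU]]] := open_basic (zopenI oU oO) (conj UP OP).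
have phh : whomog w (e + d) (p * g) by exact: whomogM.
have [e1 hh'] : exists e1, whomog w e1 h by move: hh => ?; eexists; eassumption.
have {}ghE Q x : sval Q x -> p.@[x] != 0 -> [/\ U Q, h.@[x] != 0 & phi Q = g.@[x] / h.@[x]].
  by move=> Qx /(pU _ _ Qx) [UQ OQ]; have [? ?] := ghE Q x UQ OQ Qx.
have pvE Q x : sval Q x -> (p * h).@[x] != 0 -> U Q /\ phi Q = (p * g).@[x] / (p * h).@[x].
  rewrite !mevalM mulf_eq0 negb_or => Qx /andP [px hx]; have [UQ _ ->] := ghE Q x Qx px.
  by split=> //; rewrite -mulf_div divff // mul1r.
have hP x : sval P x -> (p * h).@[x] != 0.
  by move=> Px; rewrite mevalM mulf_neq0 ?pP //; have [] := ghE P x Px (pP x Px).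
have [dE|dn] := eqVneq d e1.
  by exists (e + d)%N, (p * g), (p * h); split=> //; apply: whomogM => //; rewrite dE.
exists (e + e1)%N, 0, (p * h); split=> //; [exact: dhomog0 | exact: whomogM|].
move=> Q x Qx phx; have [UQ E] := pvE Q x Qx phx; split=> //; rewrite E meval0 mul0r !mevalM.
have [c c0 cn] := closed_pow_neq dn.
have Qcx : sval Q (fun i => c ^+ w i * x i).
  case: Q {E UQ} Qx => A /= [z _ ->] [t t0 ->]; exists (c * t); first by rewrite mulf_neq0.
  by apply/funext => i; rewrite exprMn mulrA.
move: phx; rewrite mevalM mulf_eq0 negb_or => /andP [px hx].
have [_ _ E1] := ghE Q x Qx px; have [_ _] := ghE Q _ Qcx (horbit hp Qx Qcx px).
rewrite E1 (meval_worbit _ _ hg) (meval_worbit _ _ hh') => /eqP.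
rewrite eqr_div ?mulf_neq0 ?expf_neq0 // => E2.
have : g.@[x] * h.@[x] * (c ^+ e1 - c ^+ d) = 0 by apply/eqP; rewrite mulrBr subr_eq0; apply/eqP; move/eqP: E2 => E2; rewrite mulrAC -mulrA [RHS]mulrC mulrA [RHS]mulrC -mulrA; move: E2; rewrite mulrCA => ->; ring.
move=> /eqP; rewrite !mulf_eq0 (negPf hx) orbF subr_eq0 [c ^+ e1 == _]eq_sym (negPf cn) orbF => /eqP ->.
by rewrite mulr0 mul0r.
Qed.

Definition wfrac g p (P : W) : k := g.@[rep P] / p.@[rep P].

Lemma wfracE d g p P x : whomog w d g -> whomog w d p -> sval P x -> wfrac g p P = g.@[x] / p.@[x].
Proof.
move=> hg hp Px; have [c c0 ->] := wpoint_rel (repP P) Px.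
by rewrite (meval_worbit _ _ hg) (meval_worbit _ _ hp) -mulf_div divff ?mul1r // expf_neq0.
Qed.

Lemma wfrac_regular d g p U : whomog w d g -> whomog w d p -> (U `<=` nonzero_locus p)%classic ->
  regular W U (wfrac g p).
Proof.
move=> hg hp Up; intros P UP; exists setT, d, g, p; split; first by split=> //; exact: (zopenT (wproj k w)).
by move=> Q x UQ _ Qx; rewrite (wfracE hg hp Qx); split=> //; exact: Up UQ x Qx.
Qed.
End Fractions.

Section RegularSums.
Variables (k : fieldType) (X : Defs.space k).

Lemma regular_sum (I : Type) (s : seq I) (P : pred I) U (g : I -> X -> k) : zopen X U ->
  (forall i, P i -> regular X U (g i)) -> regular X U (fun Q => \sum_(i <- s | P i) g i Q).
Proof.
move=> oU rg; elim: s => [|i s IH].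
  rewrite (_ : (fun Q => _) = fun=> 0); first exact: regular_cst.
  by apply/funext => Q; rewrite big_nil.
rewrite (_ : (fun Q => _) = fun Q => (if P i then g i Q else 0) + \sum_(j <- s | P j) g j Q); last first.
  by apply/funext => Q; rewrite big_cons; case: ifP => // _; rewrite add0r.
by apply: regularD => //; case E: (P i); [exact: rg | exact: regular_cst].
Qed.

Lemma regular_eq U f g : zopen X U -> regular X U f -> (forall Q, U Q -> f Q = g Q) -> regular X U g.
Proof.
by move=> oU rf fg; apply: regular_local => P UP; exists U, f; split=> // Q UQ _; rewrite fg.
Qed.

Lemma tensor_slice (Y : Defs.space k) U V (F : X * Y -> k) R0 : zopen X U -> tensor U V F ->
  regular X U (fun Q => F (Q, R0)).
Proof.
move=> oU [I [g [h [rg rh FE]]]]; rewrite (_ : (fun Q => _) = fun Q => \sum_i g i Q * h i R0).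
  by apply: regular_sum => // i _; apply: regularM => //; exact: regular_cst.
by apply/funext => Q; rewrite FE.
Qed.
End RegularSums.

Section HypersurfaceLocal.
Variables (k : closedFieldType) (N : nat) (w : 'I_N -> nat) (f : {mpoly k[N]}).
Local Notation X := (hypersurface w f).

Lemma hyp_vanish (P : X) x : sval (sval P) x -> f.@[x] = 0.
Proof. by case: P => P /= vP; exact: vP. Qed.

Lemma hyp_point_of d x : whomog w d f -> (exists i, x i != 0) -> f.@[x] = 0 -> exists P : X, sval (sval P) x.
Proof.
move=> hf /(@wpoint_of k N w) [P Px] fx.
have vP : vanishes f P by apply/(vanishesP hf Px).
by exists (exist _ P vP).
Qed.

Lemma hyp_inj (P Q : X) x : sval (sval P) x -> sval (sval Q) x -> P = Q.
Proof. by move=> Px Qx; apply: eq_sig_hprop => [? ? ?|]; [exact: Prop_irrelevance | exact: wpoint_inj Px Qx]. Qed.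

Lemma hyp_open_basic U (P : X) : zopen X U -> U P -> exists d p, [/\ whomog w d p,
  forall x, sval (sval P) x -> p.@[x] != 0 & forall (Q : X) x, sval (sval Q) x -> p.@[x] != 0 -> U Q].
Proof.
move=> [O oO ->] OP; have [d [p [hp pP pO]]] := open_basic oO OP.
by exists d, p; split=> // Q x Qx px; exact: pO Qx px.
Qed.

Lemma hyp_basic_open d p : whomog w d p -> zopen X [set P : X | nonzero_locus p (sval P)]%classic.
Proof. by move=> hp; exists (nonzero_locus p) => //; exact: basic_open hp. Qed.

Lemma hyp_regular_frac U phi (P : X) : zopen X U -> regular X U phi -> U P -> exists d g p,
  [/\ whomog w d g, whomog w d p, forall x, sval (sval P) x -> p.@[x] != 0 &
      forall (Q : X) x, sval (sval Q) x -> p.@[x] != 0 -> U Q /\ phi Q = g.@[x] / p.@[x]].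
Proof.
move=> [O oO UE] rphi UP; have [O1 [g1 [oO1 O1P rg1 g1E]]] := rphi P UP.
have OP : O (sval P) by move: UP; rewrite UE.
have oI := zopenI oO oO1.
have [d [g [p [hg hp pP pE]]]] := regular_frac oI (regular_restrict oO1 (@subIsetr _ _ _) rg1) (conj OP O1P).
exists d, g, p; split=> // Q x Qx px; have [[OQ O1Q] E] := pE _ _ Qx px.
have UQ : U Q by rewrite UE.
by split=> //; rewrite g1E.
Qed.

Lemma hyp_frac_regular d g p U : whomog w d g -> whomog w d p ->
  (forall P : X, U P -> nonzero_locus p (sval P)) -> regular X U (fun P => wfrac g p (sval P)).
Proof.
move=> hg hp Up; intros P UP; exists (nonzero_locus p), (wfrac g p); split=> //.
- exact: basic_open hp.
- exact: Up.
- exact: wfrac_regular hg hp (fun _ h => h).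
Qed.
End HypersurfaceLocal.

Section Slices.
Variables (k : fieldType) (X Y Z : Defs.space k).
Local Notation XY := (prodspace X Y).
Variables (U : set XY) (V : set Z) (phi : subspace U -> subspace V).
Hypothesis oU : zopen XY U.
Hypothesis phim : morphism phi.

(* Restriction of a regular function, pulled back by phi, to a slice. *)
Lemma slice_regular (O : set Z) (chi : Z -> k) (Q0 : X) (R0 : Y) (U0 : U (Q0, R0)) :
  zopen Z O -> regular Z O chi -> O (sval (phi (exist _ (Q0, R0) U0))) ->
  exists (T : set X) (g : X -> k), [/\ zopen X T, T Q0, regular X T g &
    forall Q, T Q -> exists UQ : U (Q, R0),
      O (sval (phi (exist _ (Q, R0) UQ))) /\ g Q = chi (sval (phi (exist _ (Q, R0) UQ)))].
Proof.
move=> oO rchi OP; have [phio phir] := phim.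
pose S : set (subspace V) := fun P => O (sval P).
have oS : zopen (subspace V) S by exists O.
have rS : regular (subspace V) S (fun P => chi (sval P)) by intros P SP; exists O, chi.
have [W1 oW1 W1E] := phio S oS.
have W1P : W1 (Q0, R0).
  have : (phi @^-1` S)%classic (exist _ (Q0, R0) U0) by [].
  by rewrite W1E.
have [W2 [g [oW2 W2P rg gE]]] := phir S _ oS rS (exist _ (Q0, R0) U0) OP.
have [U1 [V1 [F1 [[oU1 oV1 tF1] [U1P V1P F1P sub1]]]]] := zopenI (zopenI oU oW1) oW2 (Q0, R0) (conj (conj U0 W1P) W2P).
have [U2 [V2 [F2 [G2 [[oU2 oV2 tF2 tG2] [U2P V2P G2P gFG]]]]]] := rg _ W2P.
rewrite /= in U1P V1P U2P V2P.
have o1 := zopen_neq0 oU1 (tensor_slice R0 oU1 tF1).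
have o2 := zopen_neq0 oU2 (tensor_slice R0 oU2 tG2).
have o12 := zopenI o1 o2.
exists ([set Q | U1 Q /\ F1 (Q, R0) != 0] `&` [set Q | U2 Q /\ G2 (Q, R0) != 0])%classic,
  (fun Q => F2 (Q, R0) * (G2 (Q, R0))^-1); split=> //.
- apply: regularM => //.
    apply: (regular_restrict oU2 _ (tensor_slice R0 oU2 tF2)) => Q [_ []] //.
  apply: regularV => //; last by move=> Q [_ []].
  by apply: (regular_restrict oU2 _ (tensor_slice R0 oU2 tG2)) => Q [_ []].
move=> Q [[U1Q F1Q] [U2Q G2Q]]; have [[UQ W1Q] W2Q] := sub1 (Q, R0) U1Q V1P F1Q.
exists UQ; have OQ : (phi @^-1` S)%classic (exist _ (Q, R0) UQ) by rewrite W1E.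
by split=> //; rewrite -(gFG (Q, R0)) // -(gE (exist _ (Q, R0) UQ)).
Qed.
End Slices.

Section Projections.
Variables (k : fieldType) (X Y Z : Defs.space k).
Local Notation XY := (prodspace X Y).
Variables (U : set XY) (V : set Z) (psi : subspace V -> subspace U).
Hypothesis oV : zopen Z V.
Hypothesis psim : morphism psi.

Lemma projection_regular (O : set X) (chi : X -> k) (z0 : Z) (V0 : V z0) :
  zopen X O -> regular X O chi -> O (sval (psi (exist _ z0 V0))).1 ->
  exists (T : set Z) (g : Z -> k), [/\ zopen Z T, T z0, regular Z T g &
    forall z, T z -> exists Vz : V z,
      O (sval (psi (exist _ z Vz))).1 /\ g z = chi (sval (psi (exist _ z Vz))).1].
Proof.
move=> oO rchi OP; have [psio psir] := psim.
pose O1 : set XY := fun q => O q.1.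
have oT : zopen Y setT := zopenT Y.
have t1 : tensor O (setT : set Y) (fun=> 1 : k) by exact: tensor_cst.
have tc : tensor O (setT : set Y) (fun q => chi q.1).
  exists unit, (fun _ => chi), (fun _ _ => 1); split=> // [_|q]; first exact: regular_cst.
  by rewrite big_const card_unit /= mulr1 addr0.
have oO1 : zopen XY O1.
  by intros q Oq; exists O, setT, (fun=> 1); split; split=> //; exact: oner_neq0.
have rO1 : regular XY O1 (fun q => chi q.1).
  intros q Oq; exists O, setT, (fun q => chi q.1), (fun=> 1); split; split=> //; first exact: oner_neq0.
  by move=> q' _ _ _ _; rewrite divr1.
pose S : set (subspace U) := fun P => O1 (sval P).
have oS : zopen (subspace U) S by exists O1.
have rS : regular (subspace U) S (fun P => chi (sval P).1) by intros P SP; exists O1, (fun q => chi q.1).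
have [W1 oW1 W1E] := psio S oS.
have W1z : W1 z0.
  have : (psi @^-1` S)%classic (exist _ z0 V0) by [].
  by rewrite W1E.
have [W2 [g [oW2 W2P rg gE]]] := psir S _ oS rS (exist _ z0 V0) OP.
have oT' := zopenI (zopenI oV oW1) oW2.
exists ((V `&` W1) `&` W2)%classic, g; split=> //.
  by apply: (regular_restrict oW2 _ rg) => z [].
move=> z [[Vz W1z'] W2z]; exists Vz.
have OQ : (psi @^-1` S)%classic (exist _ z Vz) by rewrite W1E.
by split=> //; rewrite -(gE (exist _ z Vz)).
Qed.
End Projections.

(** * Retractions from affine space *)

Section Density.
Variables (k : closedFieldType) (n m : nat) (f : {mpoly k[n.+1]}).
Hypothesis fm : ymonic m.+1 f.
Hypothesis fp : mprime f.

Lemma ndvd_point p : ~ mdvd f p -> exists2 x, f.@[x] = 0 & p.@[x] != 0.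
Proof.
move=> np; apply: contrapT => h; apply: np; apply: (vanish_dvd fm fp) => x fx.
by apply/eqP/negPn/negP => px; apply: h; exists x.
Qed.

Lemma point_ndvd p x : f.@[x] = 0 -> p.@[x] != 0 -> ~ mdvd f p.
Proof. by move=> fx px [q qE]; move: px; rewrite qE mevalM fx mulr0 eqxx. Qed.

Lemma ndvdM p q : ~ mdvd f p -> ~ mdvd f q -> ~ mdvd f (p * q).
Proof. by move=> np nq /fp []. Qed.

Lemma dense_dvd q g : ~ mdvd f q -> (forall x, f.@[x] = 0 -> q.@[x] != 0 -> g.@[x] = 0) -> mdvd f g.
Proof.
move=> nq h; have /fp [//|] : mdvd f (g * q); last by [].
apply: (vanish_dvd fm fp) => x fx; rewrite mevalM.
by have [->|/(h x fx) ->] := eqVneq q.@[x] 0; rewrite ?mulr0 ?mul0r.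
Qed.
End Density.

Lemma sig_eta (T : Type) (P : T -> Prop) (s : {x | P x}) : exist P (sval s) (svalP s) = s.
Proof. by case: s => x px; apply: eq_exist. Qed.

Lemma mevalXn (k : comNzRingType) (n e : nat) (p : {mpoly k[n]}) x : (p ^+ e).@[x] = p.@[x] ^+ e.
Proof. exact: rmorphXn. Qed.

Lemma meval_common_den (k : fieldType) (n s : nat) (g : {mpoly k[n]}) (p : 'I_s -> {mpoly k[n]}) x i :
  (\prod_i' p i').@[x] != 0 ->
  (g * \prod_(i' | i' != i) p i').@[x] = (\prod_i' p i').@[x] * (g.@[x] / (p i).@[x]).
Proof.
have E : (\prod_i' p i').@[x] = (p i).@[x] * (\prod_(i' | i' != i) p i').@[x].
  by rewrite (bigD1 i) //= mevalM.
rewrite mevalM E mulf_eq0 negb_or => /andP [p0 _].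
by move: (\prod_(_ | _) _).@[x] (g.@[x]) ((p i).@[x]) p0 => u v t t0; field.
Qed.

Section Retraction.
Variables (k : closedFieldType) (n m d : nat) (w : 'I_n.+1 -> nat) (f : {mpoly k[n.+1]}).
Hypothesis fm : ymonic m.+1 f.
Hypothesis fp : mprime f.
Hypothesis fh : whomog w d f.
Hypothesis w0 : w ord0 = 1%N.
Hypothesis w_gt0 : forall i, (0 < w i)%N.
Hypothesis nX0 : ~ mdvd f 'X_ord0.
Local Notation X := (hypersurface w f).

Let meval_subst (r : nat) (s : nat) (H : 'I_r -> {mpoly k[s]}) (p : {mpoly k[r]}) x :
  (mev (@mpolyC s k) H p).@[x] = p.@[fun i => (H i).@[x]].
Proof.
apply: (@mpoly_morph_eq r k _ (meval x \o mev (@mpolyC s k) H) (meval (fun i => (H i).@[x])) _ _ p) => [c|i] /=.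
  by rewrite mevC !mevalC.
by rewrite mevX mevalXU.
Qed.

Let homX (N : nat) (v : 'I_N -> nat) i : whomog v (v i) ('X_i : {mpoly k[N]}).
Proof. exact: whomogX. Qed.

(** The birational map is restricted to a slice of [X] times a projective space at a fixed [R0]; its
    inverse followed by the projection to [X] is a left inverse. [H] and [G] are these maps in
    homogeneous coordinates, and [zs] is the image of a point of [X], which shows that they can be
    composed. *)
Lemma stably_rational_retraction : stably_rational X ->
  exists r e (H : 'I_r -> {mpoly k[n.+1]}) (G : 'I_n.+1 -> {mpoly k[r]}) (zs : 'I_r -> k),
  [/\ (0 < e)%N, forall i, whomog (fun=> 1%N) (w i * e) (G i), mev (@mpolyC r k) G f = 0,
    forall i, mdvd f (mev (@mpolyC _ k) H (G i) * 'X_ord0 ^+ w i - 'X_i * mev (@mpolyC _ k) H (G ord0) ^+ w i) &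
    ~ mdvd f (mev (@mpolyC _ k) H (G ord0)) /\ (G ord0).@[zs] != 0].
Proof.
move=> [r1 [r2 [U [V [[oU [[Q1 R0] UQ1] oV _] [phi [phim [psi [psim phiK _]]]]]]]]].
(* A point of the slice off [w_0 = 0]: the coordinates [x_i / x_0^(w_i)] are regular near it. *)
have [Q0 [U0 Q0X]] : exists (Q0 : X) (U0 : U (Q0, R0)), forall x, sval (sval Q0) x -> x ord0 != 0.
  have [U1 [V1 [F1 [[oU1 oV1 tF1] [U1P V1P F1P sub1]]]]] := oU _ UQ1; rewrite /= in U1P V1P.
  have oT := zopen_neq0 oU1 (tensor_slice R0 oU1 tF1).
  have [d1 [p1 [hp1 p1P p1T]]] := hyp_open_basic oT (conj U1P F1P).
  have [x1 Px1] := wpoint_ex (sval Q1).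
  have [x fx] := ndvd_point fm fp (ndvdM fp (point_ndvd (hyp_vanish Px1) (p1P _ Px1)) nX0).
  rewrite mevalM mulf_eq0 negb_or mevalXU => /andP [p1x x0].
  have [Q0 Q0x] : exists P : X, sval (sval P) x by apply: (hyp_point_of fh) => //; exists ord0.
  have [U1Q F1Q] := p1T _ _ Q0x p1x; have U0 := sub1 (Q0, R0) U1Q V1P F1Q.
  exists Q0, U0 => y yP; have := horbit (homX w ord0) Q0x yP; rewrite !mevalXU; exact.
pose z0 := phi (exist _ (Q0, R0) U0).
have [x0 Q0x0] := wpoint_ex (sval Q0).
have [j xzj] := rep_neq0 (repP (sval z0 : wproj k (fun=> 1%N))).
pose Z := proj k r2.
pose Oj : set Z := nonzero_locus ('X_j : {mpoly k[r2.+1]}).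
have oOj : zopen Z Oj by exact: (basic_open (homX (fun=> 1%N) j)).
have OjP (z : Z) x : sval z x -> x j != 0 -> Oj z.
  by move=> zx xj; apply: (nonzero_locusP (homX (fun=> 1%N) j) zx); rewrite mevalXU.
have rOj i : regular Z Oj (wfrac 'X_i 'X_j).
  exact: (wfrac_regular (homX (fun=> 1%N) i) (homX (fun=> 1%N) j) (fun _ h => h)).
have Ojz0 : Oj (sval z0) by exact: OjP (repP _) xzj.
have /choice [gp gpP] : forall i, exists gp : {mpoly k[n.+1]} * {mpoly k[n.+1]},
    (forall x, sval (sval Q0) x -> gp.2.@[x] != 0) /\
    forall (Q : X) x, sval (sval Q) x -> gp.2.@[x] != 0 -> exists UQ : U (Q, R0),
      Oj (sval (phi (exist _ (Q, R0) UQ))) /\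
      gp.1.@[x] / gp.2.@[x] = wfrac 'X_i 'X_j (sval (phi (exist _ (Q, R0) UQ))).
  move=> i; have [T [g [oT TQ rg gE]]] := slice_regular oU phim oOj (rOj i) Ojz0.
  have [e [g' [p' [_ _ pP pE]]]] := hyp_regular_frac oT rg TQ; exists (g', p'); split=> // Q x Qx px.
  by have [TQ' <-] := pE Q x Qx px; have [UQ [? ?]] := gE Q TQ'; exists UQ.
(* [D] is a common denominator of the coordinate ratios in the chart [X_j] of the projective space,
   and [H] their numerators over it. *)
pose D : {mpoly k[n.+1]} := \prod_i (gp i).2; pose H i : {mpoly k[n.+1]} := (gp i).1 * \prod_(i' | i' != i) (gp i').2.
have DP x : D.@[x] != 0 -> forall i, (gp i).2.@[x] != 0.
  by rewrite /D rmorph_prod => /prodf_neq0 h i; exact: h.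
have HE x i : D.@[x] != 0 -> (H i).@[x] = D.@[x] * ((gp i).1.@[x] / (gp i).2.@[x]).
  exact: meval_common_den.
have HP (Q : X) x : sval (sval Q) x -> D.@[x] != 0 -> exists UQ : U (Q, R0),
    sval (sval (phi (exist _ (Q, R0) UQ))) (fun i => (H i).@[x]).
  move=> Qx Dx; have [UQ [Oz _]] := (gpP ord0).2 Q x Qx (DP _ Dx ord0); exists UQ.
  set z := sval (phi _) in Oz *; have [t zt] := wpoint_ex z.
  have tj : t j != 0 by have := Oz t zt; rewrite mevalXU.
  have tE i : (H i).@[x] = (D.@[x] / t j) * t i.
    rewrite HE //; have [UQ' [_ ->]] := (gpP i).2 Q x Qx (DP _ Dx i).
    rewrite (Prop_irrelevance UQ' UQ) -/z (wfracE (homX (fun=> 1%N) i) (homX (fun=> 1%N) j) zt) !mevalXU.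
    by rewrite mulrA mulrAC.
  have c0 : D.@[x] / t j != 0 by rewrite mulf_neq0 ?invr_eq0.
  case: z {Oz} zt => A /= [y _ ->] [c cn tc]; exists (D.@[x] / t j * c); first by rewrite mulf_neq0.
  by apply/funext => i; rewrite tE tc !expr1 mulrA.
pose hX i := whomogXn (w i) (homX w ord0).
have hX0 i : whomog w (w i) ('X_ord0 ^+ w i : {mpoly k[n.+1]}) by have := hX i; rewrite w0 mul1n.
pose O0 : set X := fun P => nonzero_locus ('X_ord0 : {mpoly k[n.+1]}) (sval P).
have oO0 : zopen X O0 by exact: (hyp_basic_open f (homX w ord0)).
have O0P (P : X) x : O0 P -> sval (sval P) x -> x ord0 != 0 by move=> h /h; rewrite mevalXU.
have rO0 i : regular X O0 (fun P => wfrac 'X_i ('X_ord0 ^+ w i) (sval P)).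
  apply: (hyp_frac_regular (homX w i) (hX0 i)) => P OP x Px.
  by rewrite mevalXn expf_neq0 // mevalXU (O0P P).
have OQ0 : O0 Q0 by move=> x Px; rewrite mevalXU Q0X.
have z0K : psi (exist _ (sval z0) (svalP z0)) = exist _ (Q0, R0) U0 by rewrite sig_eta /z0 phiK.
have OQ0' : O0 (sval (psi (exist _ (sval z0) (svalP z0)))).1 by rewrite z0K.
have /choice [ab abP] : forall i, exists ab : nat * ({mpoly k[r2.+1]} * {mpoly k[r2.+1]}),
    [/\ whomog (fun=> 1%N) ab.1 ab.2.1, whomog (fun=> 1%N) ab.1 ab.2.2,
     (forall x, sval (sval z0) x -> ab.2.2.@[x] != 0) &
     forall (z : Z) x, sval z x -> ab.2.2.@[x] != 0 -> exists Vz : V z,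
      O0 (sval (psi (exist _ z Vz))).1 /\
      ab.2.1.@[x] / ab.2.2.@[x] = wfrac 'X_i ('X_ord0 ^+ w i) (sval (sval (psi (exist _ z Vz))).1)].
  move=> i; have [T [g [oT Tz rg gE]]] := projection_regular oV psim oO0 (rO0 i) OQ0'.
  have [e [g' [p' [hg hp pP pE]]]] := regular_frac oT rg Tz.
  exists (e, (g', p')); split=> // z x zx px.
  by have [Tz' <-] := pE z x zx px; have [Vz [? ?]] := gE z Tz'; exists Vz.
pose e := ((\sum_i (ab i).1) + 1)%N.
(* The factor ['X_j] confines nonvanishing of [B] to the chart and makes the degree [e] positive. *)
pose B : {mpoly k[r2.+1]} := (\prod_i (ab i).2.2) * 'X_j.
pose A i : {mpoly k[r2.+1]} := (ab i).2.1 * (\prod_(i' | i' != i) (ab i').2.2) * 'X_j.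
have hB : whomog (fun=> 1%N) e B.
  apply: whomogM; last exact: (homX (fun=> 1%N) j).
  by apply: whomog_prod => i _; have [] := abP i.
have hA i : whomog (fun=> 1%N) e (A i).
  rewrite /e (bigD1 i) //=; apply: whomogM; last exact: (homX (fun=> 1%N) j).
  apply: whomogM; first by have [] := abP i.
  by apply: whomog_prod => i' _; have [] := abP i'.
have BP x : B.@[x] != 0 -> x j != 0 /\ forall i, (ab i).2.2.@[x] != 0.
  rewrite /B mevalM mulf_eq0 negb_or mevalXU => /andP [+ xj]; split=> // i; move: a.
  by rewrite rmorph_prod => /prodf_neq0 h; exact: h.
have AE x i : B.@[x] != 0 -> (A i).@[x] = B.@[x] * ((ab i).2.1.@[x] / (ab i).2.2.@[x]).
  rewrite /A /B !mevalM mulf_eq0 negb_or -mevalM => /andP [Bx _].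
  have E := @meval_common_den k _ _ (ab i).2.1 (fun i => (ab i).2.2) x i Bx.
  apply: etrans (congr1 (fun t => t * ('X_j).@[x]) E) _; exact: mulrAC.
have xiP (z : Z) x i : sval z x -> B.@[x] != 0 -> exists Vz : V z, O0 (sval (psi (exist _ z Vz))).1 /\
    forall y, sval (sval (sval (psi (exist _ z Vz))).1) y -> (A i).@[x] = B.@[x] * (y i / y ord0 ^+ w i).
  move=> zx Bx; have [_ nz] := BP _ Bx; have [_ _ _ h] := abP i.
  have [Vz [Oz E]] := h z x zx (nz i); exists Vz; split=> // y Py.
  by rewrite AE // E (wfracE (homX w i) (hX0 i) Py) mevalXn !mevalXU.
(* [A i / B] is [x_i / x_0^(w_i)]; weighted scaling by [B] clears the denominators and gives
   [G ord0 = B]. *)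
pose G i := if i == ord0 then B else A i * B ^+ (w i).-1.
have G0 : G ord0 = B by rewrite /G eqxx.
exists r2.+1, e, H, G, (fun i => (H i).@[x0]).
have D0 : D.@[x0] != 0 by rewrite /D rmorph_prod; apply/prodf_neq0 => i _; exact: (gpP i).1.
have B0 : B.@[fun i => (H i).@[x0]] != 0.
  have [UQ zH] := HP Q0 x0 Q0x0 D0; rewrite (Prop_irrelevance UQ U0) -/z0 in zH.
  rewrite /B mevalM mevalXU; apply: mulf_neq0; last by have := Ojz0 _ zH; rewrite mevalXU.
  by rewrite rmorph_prod; apply/prodf_neq0 => i _; have [_ _ + _] := abP i; apply.
have nB : ~ mdvd f (mev (@mpolyC _ k) H B).
  by apply: (point_ndvd (hyp_vanish Q0x0)); rewrite meval_subst.
have nD : ~ mdvd f D by exact: point_ndvd (hyp_vanish Q0x0) D0.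
rewrite !G0; split=> //.
- by rewrite /e addn1.
- move=> i; rewrite /G; case: eqP => [->|_]; first by rewrite w0 mul1n.
  have := whomogM (hA i) (whomogXn (w i).-1 hB).
  by rewrite -mulnS prednK // (mulnC e).
- apply/eqP/negPn/negP => nz; have Bn : B != 0 by apply: contraNneq B0 => ->; rewrite meval0.
  have [t] := mpoly_nonroot (mulf_neq0 nz Bn); rewrite mevalM mulf_eq0 negb_or meval_subst => /andP [ft Bt].
  case/eqP: ft; have [tj _] := BP _ Bt.
  have [z zt] : exists z : Z, sval z t by apply: wpoint_of; exists j.
  have [Vz [Oz _]] := xiP z t ord0 zt Bt; have [y Py] := wpoint_ex (sval (sval (psi (exist _ z Vz))).1).
  have y0 : y ord0 != 0 by exact: O0P Oz Py.
  have GE i : (G i).@[t] = (B.@[t] / y ord0) ^+ w i * y i.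
    rewrite /G; case: eqP => [->|_]; first by rewrite w0 expr1 divfK.
    have [Vz' [_ E]] := xiP z t i zt Bt; rewrite (Prop_irrelevance Vz' Vz) in E.
    have bE : B.@[t] ^+ w i = B.@[t] * B.@[t] ^+ (w i).-1 by rewrite -exprS prednK.
    rewrite mevalM mevalXn (E y Py) expr_div_n bE.
    have := expf_neq0 (w i) y0; move: (y ord0 ^+ w i) (B.@[t]) (B.@[t] ^+ _) (y i) => s1 s2 s3 s4 s10.
    by field.
  rewrite (_ : (fun i => _) = fun i => (B.@[t] / y ord0) ^+ w i * y i); last exact/funext.
  by rewrite (meval_worbit _ _ fh) (hyp_vanish Py) mulr0.
- move=> i; apply: (dense_dvd fm fp (ndvdM fp (ndvdM fp nD nB) nX0)) => x fx.
  rewrite mevalM mevalM !mulf_eq0 !negb_or meval_subst mevalXU -andbA => /and3P [Dx Bx x0n].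
  rewrite mevalB !mevalM !mevalXn !mevalXU !meval_subst; apply/eqP; rewrite subr_eq0; apply/eqP.
  rewrite /G; case: eqP => [->|_]; first by rewrite w0 !expr1 mulrC.
  have xn : exists i, x i != 0 by exists ord0.
  have [Q Qx] := hyp_point_of fh xn fx; have [UQ zH] := HP Q x Qx Dx.
  have [Vz [Oz E]] := xiP _ _ i zH Bx; move: Oz E; rewrite (Prop_irrelevance Vz (svalP _)) sig_eta phiK /= => OQ E.
  have xx0 := O0P _ _ OQ Qx.
  have bE b : b ^+ w i = b * b ^+ (w i).-1 :> k by rewrite -exprS prednK.
  rewrite mevalM mevalXn (E x Qx) (bE B.@[_]).
  have := expf_neq0 (w i) xx0; move: (x ord0 ^+ w i) (B.@[_]) (B.@[_] ^+ _) (x i) => s1 s2 s3 s4 s10.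
  by field.
Qed.
End Retraction.

Lemma mev_congr (n : nat) (R S : comNzRingType) (u : {rmorphism R -> S}) (g : S) (x y : 'I_n -> S) p :
  (forall i, mdvd g (x i - y i)) -> mdvd g (mev u x p - mev u y p).
Proof.
move=> h; have hp (P Q P' Q' : S) : mdvd g (P - P') -> mdvd g (Q - Q') -> mdvd g (P * Q - P' * Q').
  move=> d1 d2; have -> : P * Q - P' * Q' = (P - P') * Q + P' * (Q - Q') by ring.
  by apply: mdvdD; [apply: mdvdMr | apply: mdvdMl].
rewrite !mevE -sumrB; apply: mdvd_sum => M _; rewrite -mulrBr; apply: mdvdMl.
apply: (big_ind2 (fun P Q => mdvd g (P - Q))); first by rewrite subrr; exact: mdvd0.
  by move=> *; exact: hp.
move=> i _; elim: (M i) => [|e IH]; first by rewrite !expr0 subrr; exact: mdvd0.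
by rewrite !exprS; exact: hp.
Qed.

Lemma mdvd_coef (R : comNzRingType) (f : R) (P : {poly R}) :
  mdvd f%:P P <-> forall j, mdvd f P`_j.
Proof.
split=> [[q ->] j|/choice [q qE]]; first by rewrite coefMC; exists q`_j.
exists (\poly_(j < size P) q j); apply/polyP => j; rewrite coefMC coef_poly.
by case: ltnP => [_|le]; [exact: qE | rewrite nth_default // mul0r].
Qed.

Section Line.
Variables (n : nat) (k : fieldType) (R : comNzRingType) (u : {rmorphism k -> R}) (z h : 'I_n -> R).

Let top (P : {poly R}) D c := (size P <= D.+1)%N /\ P`_D = c.

Let topM P D c P' D' c' : top P D c -> top P' D' c' -> top (P * P') (D + D') (c * c').
Proof.
move=> [s <-] [s' <-]; split.
  apply: leq_trans (size_polyMleq _ _) _; apply: (@leq_trans (D.+1 + D'.+1).-1).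
    by rewrite -!subn1 leq_sub2r // leq_add.
  by rewrite addSn addnS.
rewrite coefM (bigD1 (Ordinal (leq_addr D' D : D < (D + D').+1)%N)) //= addKn big1 ?addr0 // => j jD.
have [lt|gt|e] := ltngtP j D; last by case/eqP: jD; exact: val_inj.
  by rewrite [P'`__]nth_default ?mulr0 // (leq_trans s') // ltn_subRL addnC addnC -addnS; move: lt (ltn_ord j); clear; lia.
by rewrite nth_default ?mul0r // (leq_trans s).
Qed.

Variable W : nat.
Hypothesis W0 : (0 < W)%N.
(** The parameter of the line from [z] to [h] is ['X^W]. For [W] a multiple of all weights,
    coefficients then occur only in degrees divisible by each weight. *)
Definition line p := mev (polyC \o u) (fun s => (z s)%:P + 'X^W * (h s)%:P) p.

Let line1 p := mev (polyC \o u) (fun s => (z s)%:P + 'X * (h s)%:P) p.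

Let lineE p : line p = line1 p \Po 'X^W.
Proof.
rewrite /line1 (mev_comp (polyC \o u) (comp_poly 'X^W)) /line (@mev_eqfun _ _ _ _ (comp_poly 'X^W \o (polyC \o u))).
  by apply: mev_eq => i /=; rewrite rmorphD rmorphM /= !comp_polyC comp_polyX.
by move=> x /=; rewrite comp_polyC.
Qed.

Let line_top D p : whomog (fun=> 1%N) D p -> top (line1 p) D (mev u h p).
Proof.
move=> /dhomogP hp; rewrite /line1 !mevE.
have tM M : M \in msupp p -> top (\prod_(i < n) ((z i)%:P + 'X * (h i)%:P) ^+ M i) D (\prod_(i < n) h i ^+ M i).
  move=> Mp; have <- : (\sum_(i < n) M i = D)%N by rewrite -(hp M Mp) /= /wdeg; apply: eq_bigr => i _; rewrite mul1n.
  apply: (big_ind3 top); first by split; rewrite ?size_poly1 // coefC.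
    by move=> *; exact: topM.
  move=> i _; elim: (M i) => [|e IH]; first by rewrite !expr0; split; rewrite ?size_poly1 // coefC.
    rewrite !exprS -add1n; apply: topM => //; split; last by rewrite coefD coefC coefXM coefC add0r.
    apply: leq_trans (size_polyD _ _) _; rewrite geq_max (leq_trans (size_polyC_leq1 _)) //=.
    apply: leq_trans (size_polyMleq _ _) _; rewrite size_polyX; apply: leq_trans (_ : (2 + 1).-1 <= _)%N => //.
    by rewrite -!subn1 leq_sub2r // leq_add2l size_polyC_leq1.
split.
  rewrite big_seq; apply: (big_ind (fun P : {poly R} => (size P <= D.+1)%N)); first by rewrite size_poly0.
    by move=> P Q sP sQ; apply: leq_trans (size_polyD _ _) _; rewrite geq_max sP.
  by move=> M /tM [s _] /=; rewrite mul_polyC; exact: leq_trans (size_scale_leq _ _) s.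
rewrite coef_sum big_seq [RHS]big_seq; apply: eq_bigr => M /tM [_ tE] /=.
by rewrite coefCM tE.
Qed.

Lemma line_size D p : whomog (fun=> 1%N) D p -> (size (line p) <= (W * D).+1)%N.
Proof.
move=> /line_top [s _]; apply/leq_sizeP => j lj; rewrite lineE coef_comp_poly_Xn //.
case: ifP => // /dvdnP [e eE]; rewrite nth_default // (leq_trans s) // eE mulnK //.
by move: lj; rewrite eE mulnC ltn_pmul2r.
Qed.

Lemma line_lead D p : whomog (fun=> 1%N) D p -> (line p)`_(W * D) = mev u h p.
Proof. by move=> /line_top [_ <-]; rewrite lineE coef_comp_poly_Xn // dvdn_mulr // mulKn. Qed.

Lemma line_low p : (line p)`_0 = mev u z p.
Proof.
have hE (P : {poly R}) : P`_0 = horner_eval (0 : R) P by rewrite /horner_eval horner_coef0.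
rewrite hE /line mev_comp (@mev_eqfun _ _ _ _ u) => [|x /=]; last by rewrite /horner_eval hornerC.
by apply: mev_eq => i /=; rewrite /horner_eval !hornerE expr0n (gtn_eqF W0) mul0r addr0.
Qed.

Lemma line_step p j : (line p)`_j != 0 -> (W %| j)%N.
Proof. by rewrite lineE coef_comp_poly_Xn //; case: ifP => // _; rewrite eqxx. Qed.

Lemma line_subst (N : nat) (Gr : 'I_N -> {mpoly k[n]}) g :
  mev (polyC \o u) (fun i => line (Gr i)) g = line (mev (@mpolyC n k) Gr g).
Proof.
pose phi : {rmorphism {mpoly k[n]} -> {poly R}} := mev (polyC \o u) (fun s => (z s)%:P + 'X^W * (h s)%:P).
have E : phi (mev (@mpolyC n k) Gr g) = mev (phi \o @mpolyC n k) (phi \o Gr) g by exact: mev_comp.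
by apply: etrans (esym E); apply: mev_eqfun => c; rewrite /phi /= mevC.
Qed.

Lemma line_curve (N e : nat) (w : 'I_N -> nat) (Gr : 'I_N -> {mpoly k[n]}) g :
  (forall i, whomog (fun=> 1%N) (w i * e) (Gr i)) -> mev (@mpolyC n k) Gr g = 0 ->
  exists A : 'I_N -> {poly R}, [/\ forall i, (size (A i) <= (W * e * w i).+1)%N,
    forall i, (A i)`_(W * e * w i) = mev u h (Gr i), forall i, (A i)`_0 = mev u z (Gr i),
    forall i j, (A i)`_j != 0 -> (W %| j)%N & mev (polyC \o u) A g = 0].
Proof.
move=> hG Gg; exists (fun i => line (Gr i)); split=> [i|i|i|i j|].
- by rewrite -mulnA (mulnC e); exact: line_size.
- by rewrite -mulnA (mulnC e); exact: line_lead.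
- exact: line_low.
- exact: line_step.
- by rewrite line_subst Gg /line rmorph0.
Qed.
End Line.

Section NotStablyRational.
Variables (l a b d m : nat) (F : closedFieldType) (f0 : {mpoly F[l.+2]}).
Hypothesis G : good_cover a b d m f0.
Hypothesis l_gt1 : (1 < l)%N.
Hypothesis dla : (l.+1 + a <= d)%N.
Hypothesis dbm : d = (b * m)%N.
Hypothesis m0 : (0 < m)%N.
Hypothesis d0 : (0 < d)%N.
Hypothesis a0 : (0 < a)%N.
Hypothesis b0 : (0 < b)%N.
Variable gp : generic_point a d m f0.
Variables (k : closedFieldType) (pl : place k F).
Hypothesis f0_prime : mprime (cyclic m f0).
Local Notation V := (vring pl).
Local Notation io := (pin pl).
Local Notation th := (pres pl).
Variable w0 : V.
Hypothesis w0n : w0 != 0.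
Hypothesis thw0 : th w0 = 0.
Variable fV : {mpoly V[l.+3]}.
Hypothesis fVm : ymonic m fV.
Hypothesis fVE : map_mpoly th fV = cyclic m f0.
Local Notation f := (map_mpoly io fV).
Local Notation w := (wtn a b : 'I_l.+3 -> nat).
Hypothesis f_homog : whomog w d f.

Lemma place_not_stably_rational : ~ stably_rational (hypersurface w f).
Proof.
have fm := ymonic_map io fVm.
have fp : mprime f by apply: (mprime_place fVm); rewrite fVE.
have ord0w : ord0 = widen_ord (leqnSn l.+2) ord0 :> 'I_l.+3 by exact: val_inj.
have w0E : w ord0 = 1%N by rewrite ord0w /wtn join_widen.
have w_gt0 i : (0 < w i)%N.
  by rewrite /wtn; have [->|[j ->]] := ord_widenP i; rewrite ?join_max // join_widen /wt1; case: ifP.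
have smallC (c : k) : (size (muni (c%:MP : {mpoly k[l.+3]})) <= m)%N.
  by rewrite muniC; apply: leq_trans (size_polyC_leq1 _) m0.
have nX0 : ~ mdvd f 'X_ord0.
  move=> dv; have := mdvd_small fm _ dv; rewrite ord0w muni_var (leq_trans (size_polyC_leq1 _) m0) => /(_ isT) /eqP.
  by rewrite (negPf (mvar_neq0 _ _)).
have fm' : ymonic m.-1.+1 f by rewrite prednK.
move=> /(stably_rational_retraction fm' fp f_homog w0E w_gt0 nX0) [r [e [H [Gr [zs [e0 hG Gf rel [nG0 G0z]]]]]]].
pose W := (a * b)%N; have W0 : (0 < W)%N by rewrite muln_gt0 a0.
have wW i : (w i %| W)%N.
  rewrite /wtn; have [->|[j ->]] := ord_widenP i; first by rewrite join_max dvdn_mull.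
  by rewrite join_widen /wt1; case: ifP => _; [exact: dvdn_mulr | exact: dvd1n].
(* The line joins the constant [zs] to [H], whose entries involve the variables of [X]. Its image
   under [Gr] runs from a constant point to a point that is, modulo [f], a weighted multiple of the
   generic one. *)
have [A0 [sA0 A0top A0low A0step A0eq]] :=
  line_curve (@mpolyC l.+3 k) (fun s => (zs s)%:MP) H W0 hG Gf.
have nf0 : nform f 0 = 0 := nform_dvd fm (mdvd0 f).
(* Coefficients are replaced by remainders modulo [f], so that a nonzero coefficient is nonzero on
   [X] and remains so after a primitive reduction. *)
have [A [AE sA]] : exists A : 'I_l.+3 -> {poly {mpoly k[l.+3]}},
    (forall i j, (A i)`_j = nform f (A0 i)`_j) /\ forall i, (size (A i) <= size (A0 i))%N.
  exists (fun i => map_poly (nform f) (A0 i)); split=> [i j|i]; last exact: size_poly.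
  exact: coef_map_id0.
have Alow i : (A i)`_0 = ((Gr i).@[zs])%:MP.
  rewrite AE A0low -(nform_id fm (smallC _)); congr (nform f _).
  by rewrite (meval_mev zs) (mev_comp idfun (@mpolyC l.+3 k)); exact: mev_eqfun.
have AA0 i j : mdvd f ((A0 i)`_j - (A i)`_j) by rewrite AE; exact: (nformP fm).
have cong (P Q P' Q' : {mpoly k[l.+3]}) : mdvd f (P - P') -> mdvd f (Q - Q') -> mdvd f (P * Q - P' * Q').
  move=> d1 d2; have -> : P * Q - P' * Q' = (P - P') * Q + P' * (Q - Q') by ring.
  by apply: mdvdD; [apply: mdvdMr | apply: mdvdMl].
have congX (P P' : {mpoly k[l.+3]}) s : mdvd f (P - P') -> mdvd f (P ^+ s - P' ^+ s).
  move=> dP; elim: s => [|s IH]; first by rewrite !expr0 subrr; exact: mdvd0.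
  by rewrite !exprS; exact: cong.
apply: (@zoom_absurd l a b d m F f0 G l_gt1 dla dbm m0 d0 a0 b0 gp k pl w0 w0n thw0 fV fVm fVE f_homog
  (W * e)%N A _ _ _ _ _ _ _ _ _ (mev (gp_base gp) (join_pt (gp_w gp) (gp_y gp)) \o map_mpoly th)) => //.
- by rewrite muln_gt0 W0.
- by move=> i j; rewrite AE; exact: (nform_size fm).
- by move=> i; apply: leq_trans (sA i) (sA0 i).
- move=> i j nz; apply: dvdn_trans (wW i) (A0step i j _).
  by apply: contra_neq nz => z; rewrite AE z nf0.
- move=> j; apply/(mdvd_coef f _).1.
  have -> : mev (polyC \o @mpolyC l.+3 k) A f = 0 - (mev (polyC \o @mpolyC l.+3 k) A0 f - mev (polyC \o @mpolyC l.+3 k) A f).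
    by rewrite A0eq !sub0r opprK.
  apply: mdvdB; first exact: mdvd0.
  by apply: mev_congr => i; apply/mdvd_coef => t; rewrite coefB.
- by move=> i; exists ((Gr i).@[zs]).
- by exists ord0; rewrite Alow mpolyC_eq0.
- move=> i; set L := (X in mdvd f X).
  have -> : L = (mev (@mpolyC _ k) H (Gr i) * 'X_ord0 ^+ w i - 'X_i * mev (@mpolyC _ k) H (Gr ord0) ^+ w i)
     - ((mev (@mpolyC _ k) H (Gr i) * 'X_ord0 ^+ w i - (A i)`_(W * e * w i) * 'X_ord0 ^+ w i) -
        ('X_i * mev (@mpolyC _ k) H (Gr ord0) ^+ w i - 'X_i * (A ord0)`_(W * e) ^+ w i)) by rewrite /L; ring.
  apply: mdvdB; first exact: rel.
  apply: mdvdB; apply: cong; rewrite ?subrr; try exact: mdvd0; first by rewrite -A0top.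
  by apply: congX; have := A0top ord0; rewrite w0E muln1 => <-.
- rewrite AE; apply: contra_not_neq nG0 => /(nform0_dvd fm).
  by have := A0top ord0; rewrite w0E muln1 => ->.
Qed.
End NotStablyRational.

(** * Very general coefficients *)

Lemma size_muni_mono (n : nat) (R : comNzRingType) (M : 'X_{1..n.+1}) :
  (size (muni ('X_[M] : {mpoly R[n.+1]})) <= (M ord_max).+1)%N.
Proof.
rewrite mpolyXE_id rmorph_prod big_ord_recr /=.
have -> : \prod_(i < n) muni ('X_(widen_ord (leqnSn n) i) ^+ M (widen_ord (leqnSn n) i) : {mpoly R[n.+1]}) =
    (\prod_(i < n) 'X_i ^+ M (widen_ord (leqnSn n) i))%:P.
  by rewrite rmorph_prod; apply: eq_bigr => i _ /=; rewrite !rmorphXn /= muni_var.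
rewrite rmorphXn /= muni_last mul_polyC; apply: leq_trans (size_scale_leq _ _) _.
by rewrite size_polyXn.
Qed.

Section Coefficients.
Variables (N d : nat) (w : 'I_N -> nat).
Hypothesis w_gt0 : forall i, (0 < w i)%N.

Definition monos : seq 'X_{1..N} :=
  [seq M <- [seq val M | M <- enum {: 'X_{1..N < d.+1}}] | wdeg w M == d].

Lemma mem_monos M : (M \in monos) = (wdeg w M == d).
Proof.
rewrite mem_filter; case: eqP => //= wM.
have lt : (mdeg M < d.+1)%N.
  by rewrite ltnS -wM mdegE /wdeg; apply: leq_sum => i _; rewrite leq_pmull.
by apply/mapP; exists (BMultinom lt); rewrite ?mem_enum.
Qed.

Lemma monos_uniq : uniq monos.
Proof. by rewrite filter_uniq // map_inj_uniq ?enum_uniq //; exact: val_inj. Qed.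

Definition mono (i : 'I_(size monos)) := nth 0%MM monos i.

Lemma mono_wdeg i : wdeg w (mono i) = d.
Proof. by apply/eqP; rewrite -mem_monos mem_nth. Qed.

Lemma mono_inj : injective mono.
Proof. by move=> i j /eqP; rewrite nth_uniq ?monos_uniq // => /eqP /val_inj. Qed.

Lemma mono_onto M : wdeg w M = d -> exists i, mono i = M.
Proof.
move=> wM; have Ms : M \in monos by rewrite mem_monos wM.
have lt : (index M monos < size monos)%N by rewrite index_mem.
by exists (Ordinal lt); rewrite /mono nth_index.
Qed.

Lemma coef_expand (R : comNzRingType) (c : 'I_(size monos) -> R) j :
  (\sum_i c i *: 'X_[mono i])@_(mono j) = c j.
Proof.
rewrite raddf_sum /= (bigD1 j) //= mcoeffZ mcoeffX eqxx mulr1 big1 ?addr0 // => i ij.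
by rewrite mcoeffZ mcoeffX (inj_eq mono_inj) (negPf ij) mulr0.
Qed.

Lemma expand_homog (k : fieldType) (c : 'I_(size monos) -> k) : whomog w d (\sum_i c i *: 'X_[mono i]).
Proof.
by apply: whomog_sum => i _; apply: whomogZ; rewrite -(mono_wdeg i); exact: whomogXm.
Qed.

Lemma whomog_expand (k : fieldType) (p : {mpoly k[N]}) : whomog w d p ->
  p = \sum_i p@_(mono i) *: 'X_[mono i].
Proof.
move=> /whomogP hp; apply/mpolyP => M; have [wM|wM] := eqVneq (wdeg w M) d.
  by have [i <-] := mono_onto wM; rewrite coef_expand.
have -> : p@_M = 0 by apply/eqP/negPn/negP => /hp /eqP; rewrite (negPf wM).
rewrite raddf_sum big1 //= => i _; rewrite mcoeffZ mcoeffX.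
by case: eqP => [E|]; rewrite ?mulr0 //; case/eqP: wM; rewrite -E mono_wdeg.
Qed.

Definition generic (k : fieldType) (p : {mpoly k[N]}) := forall Q : {mpoly int[size monos]},
  Q != 0 -> mev (intmul 1 : {rmorphism int -> k}) (fun i => p@_(mono i)) Q != 0.

(** There are countably many integral polynomials in the coefficients. A nonzero one remains nonzero
    over [k] in characteristic 0 and has a nonroot, so its zero set is a proper closed subset. *)
Lemma very_general_generic (k : closedFieldType) (Pr : {mpoly k[N]} -> Prop) : [pchar k] =i pred0 ->
  (forall p, whomog w d p -> generic p -> Pr p) -> very_general w d Pr.
Proof.
move=> ch0 h; pose r := size monos.
pose poly_of (s : seq ('X_{1..r} * int)) : {mpoly int[r]} := \sum_(t <- s) t.2 *: 'X_[t.1].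
(* The zero polynomial is replaced by 1, which has no zeros, so that every member of the enumeration
   gives a proper subset. *)
pose nz (Q : {mpoly int[r]}) := if Q == 0 then 1 else Q.
have nz0 Q : nz Q != 0 by rewrite /nz; case: (eqVneq Q 0) => [_|//]; rewrite oner_eq0.
pose Qj j := nz (if unpickle j is Some s then poly_of s else 0).
pose u : {rmorphism int -> k} := intmul 1.
pose Z j : set {mpoly k[N]} := [set p | whomog w d p /\ mev u (fun i => p@_(mono i)) (Qj j) = 0]%classic.
exists Z; split=> [j|p hp nZ]; last first.
  apply: h => // Q Q0; apply/eqP => E; apply: nZ.
  exists (pickle [seq (M, Q@_M) | M <- msupp Q]) => //; split=> //.
  rewrite /Qj pickleK; have -> : poly_of [seq (M, Q@_M) | M <- msupp Q] = Q.
    by rewrite /poly_of big_map -mpolyE.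
  by rewrite /nz (negPf Q0).
split.
  exists [set phi | phi = fun p : {mpoly k[N]} => mev u (fun i => p@_(mono i)) (Qj j)]%classic; split.
    move=> _ ->; exists r, mono, (map_mpoly u (Qj j)) => p.
    by rewrite meval_mev mev_map; apply: mev_eqfun.
  by apply/seteqP; split=> p [hp E]; split=> //; [move=> phi ->; exact: E | exact: (E _ erefl)].
split=> [p [] //|sub].
have u_inj : injective u.
  have nzN t : t.+1%:R != 0 :> k by rewrite ((pcharf0P k).1 ch0).
  apply: raddf_inj; case=> [[|t]|t] // /eqP; rewrite /u /=; first by rewrite (negPf (nzN t)).
  by rewrite NegzE mulrNz oppr_eq0 (negPf (nzN t)).
have F0 : map_mpoly u (Qj j) != 0.
  apply/eqP => E; case/eqP: (nz0 (if unpickle j is Some s then poly_of s else 0)).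
  by apply: (map_mpoly_inj u_inj); rewrite [RHS]rmorph0.
have [c nc] := mpoly_nonroot F0.
have [_] := sub (\sum_i c i *: 'X_[mono i]) (expand_homog c).
rewrite (_ : (fun i => _) = c); last by apply/funext => i; rewrite coef_expand.
move=> E; case/eqP: nc; rewrite -[RHS]E (meval_mev c) mev_map; exact: mev_eqfun.
Qed.
End Coefficients.

Lemma graph_partial_hom (A : comNzRingType) (k : fieldType) (F : closedFieldType)
    (g : {rmorphism A -> k}) (h : {rmorphism A -> F}) : (forall Q, g Q = 0 -> h Q = 0) ->
  partial_hom (fun x : k * F => exists2 Q, g Q = x.1 & h Q = x.2).
Proof.
move=> gh; split; last by move=> z [Q /= /gh Q0 <-].
split; first by exists 1; rewrite rmorph1.
  by move=> a b c e [Q /= <- <-] [Q' <- <-]; exists (Q - Q'); rewrite rmorphB.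
by move=> a b c e [Q /= <- <-] [Q' <- <-]; exists (Q * Q'); rewrite rmorphM.
Qed.

(** * Specialization of a generic equation *)

Section GenericPlace.
Variables (n d m : nat) (w : 'I_n.+1 -> nat).
Hypothesis w_gt0 : forall i, (0 < w i)%N.
Hypothesis dwm : d = (w ord_max * m)%N.
Variables (k F : closedFieldType) (f : {mpoly k[n.+1]}) (fb : {mpoly F[n.+1]}).
Hypothesis fh : whomog w d f.
Hypothesis fg : @generic _ d w k f.
Hypothesis fbh : whomog w d fb.
Local Notation Y := (U_(ord_max) *+ m)%MM.
Hypothesis fbY : fb@_Y = 1.

Lemma mono_top : exists i0, mono (d := d) (w := w) i0 = Y.
Proof.
apply: mono_onto => //; rewrite /wdeg (bigD1 ord_max) //= big1 ?addn0 => [|i ni].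
  by rewrite mulmnE mnm1E eqxx mul1n dwm.
by rewrite mulmnE mnm1E eq_sym (negPf ni) mul0n muln0.
Qed.

Lemma top_mono M : wdeg w M = d -> M != Y -> (M ord_max < m)%N.
Proof.
move=> wM MY; rewrite ltnNge; apply: contra MY => le.
have := wM; rewrite /wdeg (bigD1 ord_max) //= => E.
have : (\sum_(i | i != ord_max) w i * M i = 0)%N /\ (M ord_max = m)%N.
  have le' : (w ord_max * m <= w ord_max * M ord_max)%N by rewrite leq_mul2l le orbT.
  have e1 : (w ord_max * M ord_max = w ord_max * m)%N by move: E le'; rewrite dwm; move: (w ord_max * M _)%N (w ord_max * m)%N (\sum_(_ | _) _)%N; lia.
  split; first by apply: (@addnI (w ord_max * m)%N); rewrite addn0 -{1}e1 E dwm.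
  by apply/eqP; rewrite -(eqn_pmul2l (w_gt0 ord_max)) e1.
move=> [z Mm]; apply/eqP/mnmP => i; rewrite mulmnE mnm1E.
have [<-|ni] := eqVneq ord_max i; first by rewrite mul1n.
rewrite mul0n; apply/eqP; have /eqP := z; rewrite sum_nat_eq0 => /forallP /(_ i).
by rewrite eq_sym ni /= muln_eq0 eqn0Ngt w_gt0.
Qed.

Lemma top_coef_neq0 : f@_Y != 0.
Proof.
have [i0 <-] := mono_top; have := fg (mvar_neq0 int i0).
by rewrite mevX.
Qed.

(** Algebraic independence over the integers makes the assignment of the coefficients of [fb] to
    those of [f] a partial homomorphism, whatever the characteristic of [F]. The top coefficient of
    [fb] is 1, hence that of [f] is a unit and can be divided out. *)
Lemma generic_place : exists (pl : place k F) (fV : {mpoly (vring pl)[n.+1]}),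
  [/\ ymonic m fV, map_mpoly (pin pl) fV = (f@_Y)^-1 *: f & map_mpoly (pres pl) fV = fb].
Proof.
pose r := size (monos d w).
pose ek : {rmorphism {mpoly int[r]} -> k} := mev (intmul 1 : {rmorphism int -> k}) (fun i => f@_(mono i)).
pose eF : {rmorphism {mpoly int[r]} -> F} := mev (intmul 1 : {rmorphism int -> F}) (fun i => fb@_(mono i)).
pose S := fun x : k * F => exists2 Q, ek Q = x.1 & eF Q = x.2.
have pS : partial_hom S.
  apply: graph_partial_hom => Q Q0; have [->|/fg] := eqVneq Q 0; first exact: rmorph0.
  by rewrite [X in X != 0]Q0 eqxx.
have [pl plP] := partial_hom_place pS; exists pl.
have /choice [v vP] : forall i : 'I_r, exists v, pin pl v = f@_(mono i) /\ pres pl v = fb@_(mono i).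
  move=> i; have [|v v1 v2] := plP (f@_(mono i)) (fb@_(mono i)); last by exists v.
  by exists 'X_i; rewrite /= /ek /eF mevX.
have [i0 i0E] := mono_top.
have [t tv] : exists t, t * v i0 = 1 by apply: place_unit; rewrite (vP i0).2 i0E fbY oner_neq0.
pose fV : {mpoly (vring pl)[n.+1]} := \sum_i (t * v i) *: 'X_[mono i].
have tk : pin pl t = (f@_Y)^-1.
  have := congr1 (pin pl) tv; rewrite rmorphM rmorph1 (vP i0).1 i0E => E.
  by apply: (mulIf top_coef_neq0); rewrite E mulVf // top_coef_neq0.
have tF : pres pl t = 1.
  by have := congr1 (pres pl) tv; rewrite rmorphM rmorph1 (vP i0).2 i0E fbY mulr1.
have mapE (K : comNzRingType) (g : {rmorphism vring pl -> K}) :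
    map_mpoly g fV = \sum_i (g t * g (v i)) *: 'X_[mono i].
  rewrite /fV (raddf_sum (map_mpoly g)); apply: eq_bigr => i _ /=.
  by rewrite map_mpolyZ map_mpolyX rmorphM.
exists fV; split.
- have fVE : muni fV = 'X^m + muni (\sum_(i | i != i0) (t * v i) *: 'X_[mono i]).
    rewrite /fV (bigD1 i0) //= tv scale1r i0E raddfD /=; congr (_ + _).
    by rewrite -[in LHS]mpolyXn rmorphXn /= muni_last.
  have sz : (size (muni (\sum_(i | i != i0) (t * v i) *: 'X_[mono i] : {mpoly (vring pl)[n.+1]})) <= m)%N.
    rewrite raddf_sum /=; apply: (leq_trans (size_sum _ _ _)); apply/bigmax_leqP => i ni.
    rewrite -mul_mpolyC rmorphM /= muniC mul_polyC; apply: leq_trans (size_scale_leq _ _) _.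
    apply: leq_trans (size_muni_mono _ _) _; apply: top_mono; first exact: mono_wdeg.
    by rewrite -i0E (inj_eq (@mono_inj _ _ _)).
  split; first by rewrite fVE monicE lead_coefDl ?size_polyXn // lead_coefXn.
  by rewrite fVE size_polyDl size_polyXn.
- rewrite mapE [X in _ = _ *: X](whomog_expand w_gt0 fh) scaler_sumr; apply: eq_bigr => i _.
  by rewrite tk (vP i).1 scalerA.
- rewrite mapE [in RHS](whomog_expand w_gt0 fbh); apply: eq_bigr => i _.
  by rewrite tF mul1r (vP i).2.
Qed.
End GenericPlace.

Section CyclicWeights.
Variables (n m : nat) (F : fieldType) (w : 'I_n -> nat) (b : nat) (g : {mpoly F[n]}).

Let wdeg_widen M : wdeg (join_pt w b) (mnmwiden M) = wdeg w M.
Proof.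
rewrite /wdeg big_ord_recr /= mnmwiden_ordmax muln0 addn0.
by apply: eq_bigr => i _; rewrite mnmwiden_widen join_widen.
Qed.

Let mwiden_sum : mwiden g = \sum_(M <- msupp g) g@_M *: 'X_[mnmwiden M].
Proof.
by rewrite {1}[g]mpolyE (raddf_sum (@mwiden n F)); apply: eq_bigr => M _; rewrite /= mwidenZ mwidenX.
Qed.

Lemma whomog_mwiden d : whomog w d g -> whomog (join_pt w b) d (mwiden g).
Proof.
move=> /whomogP gh; rewrite mwiden_sum big_seq; apply: whomog_sum => M; rewrite mcoeff_msupp => Mg.
by apply: whomogZ; rewrite -(gh M Mg) -wdeg_widen; exact: whomogXm.
Qed.

Lemma whomog_cyclic d : whomog w d g -> d = (b * m)%N -> whomog (join_pt w b) d (cyclic m g).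
Proof.
move=> gh dE; apply: whomogB; last exact: whomog_mwiden.
by have := whomogXn m (@whomogX _ (join_pt w b) F ord_max); rewrite join_max -dE.
Qed.

Lemma cyclic_top : (0 < m)%N -> (cyclic m g)@_(U_(ord_max) *+ m) = 1.
Proof.
move=> m0; rewrite /cyclic mpolyXn mcoeffB mcoeffX eqxx mwiden_sum raddf_sum /= big1 ?subr0 // => M _.
rewrite mcoeffZ mcoeffX; case: eqP => [/mnmP /(_ ord_max)|]; rewrite ?mulr0 //.
by rewrite mnmwiden_ordmax mulmnE mnm1E eqxx mul1n => E; rewrite -E in m0.
Qed.
End CyclicWeights.

Lemma hypersurface_scale (k : fieldType) N (w : 'I_N -> nat) (c : k) (f : {mpoly k[N]}) : c != 0 ->
  hypersurface w (c *: f) = hypersurface w f.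
Proof.
move=> c0; rewrite /hypersurface; congr subspace; apply/funext => P; apply/propext.
split=> h x Px; have := h x Px; rewrite mevalZ; last by move->; rewrite mulr0.
by move/eqP; rewrite mulf_eq0 (negPf c0) => /eqP.
Qed.

Lemma weights_join n a b : weights a b = join_pt (wt1 a) b :> ('I_n.+3 -> nat).
Proof.
apply/funext => i; have [->|[j ->]] := ord_widenP i; rewrite ?join_max ?join_widen /weights /wt1 /=.
  by rewrite ltnNge leqnSn /= gtn_eqF.
have [->|ne] := eqVneq j ord_max; first by rewrite /= ltnn eqxx.
by case: ltnP => // le; case/eqP: ne; apply: ord_inj => /=; apply/eqP; rewrite eqn_leq le -ltnS ltn_ord.
Qed.

Lemma wt1_gt0 l a (i : 'I_l.+2) : (0 < a)%N -> (0 < wt1 a i)%N. Proof. by rewrite /wt1; case: ifP. Qed.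

Lemma wtn_gt0 l a b (i : 'I_l.+3) : (0 < a)%N -> (0 < b)%N -> (0 < wtn a b i)%N.
Proof.
by move=> a0 b0; rewrite /wtn; have [->|[j ->]] := ord_widenP i; rewrite ?join_max ?join_widen ?wt1_gt0.
Qed.

Lemma tofrac_inj (A : idomainType) : injective (@FracField.tofrac A).
Proof. by move=> x y /eqP; rewrite tofrac_eq => /eqP. Qed.

Lemma char_p_closure p : prime p -> exists F : closedFieldType, p \in [pchar F].
Proof.
move=> p_prime; have [K [FK _]] := countable_algebraic_closure 'F_p.
exists K; rewrite (fmorph_pchar FK); exact: pchar_Fp.
Qed.

Lemma generic_not_stably_rational (l a b d p : nat) (k : closedFieldType) (f : {mpoly k[l.+3]}) :
  [pchar k] =i pred0 -> (1 < l)%N -> (0 < a)%N -> (0 < b)%N -> (0 < d)%N -> coprime a b ->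
  (a %| d)%N -> (b %| d)%N -> (1 < d %/ a)%N -> prime p -> (p %| d %/ b)%N -> ~~ (p %| d %/ a)%N ->
  (l.+1 + a <= d)%N -> whomog (wtn a b) d f -> generic d (wtn a b) f ->
  ~ stably_rational (hypersurface (wtn a b) f).
Proof.
move=> ch0 l1 a0 b0 d0 ab ad bd; set e := (d %/ a)%N; set m := (d %/ b)%N => e1 pp pm pe dla fh fg.
have dae : d = (a * e)%N by rewrite mulnC divnK.
have dbm : d = (b * m)%N by rewrite mulnC divnK.
have m0 : (0 < m)%N by rewrite divn_gt0 // dvdn_leq.
have pa : (p %| a)%N.
  have : (p %| a * e)%N by rewrite -dae dbm dvdn_mull.
  by rewrite Euclid_dvdM // (negPf pe) orbF.
have [F pF] := char_p_closure pp.
(* At most one correction is present, chosen by [e] modulo 3 for the Hessian in characteristic 3.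
   When [c2] is nonzero, [e] is 1 modulo 3 and greater than 1, hence greater than 2. *)
pose c1 : F := if (e %% 3 == 2)%N then 1 else 0; pose c2 : F := if (e %% 3 == 1)%N then 1 else 0.
have dl : (l.+1 + a <= a * e)%N by rewrite -dae.
have G : good_cover a b (a * e) m (cover l a e c1 c2).
  apply: (cover_good pF) => //; first by rewrite -dae.
    rewrite /c2; have [h _|_ /eqP //] := eqVneq (e %% 3)%N 1%N.
    by move: e1 h; clear; lia.
  move=> [p3 _]; move: pe; rewrite p3 /dvdn /c1 /c2.
  have : (e %% 3 < 3)%N by rewrite ltn_mod.
  by case: (e %% 3)%N => [|[|[|//]]] //= _ _; [left | right].
rewrite -dae in G.
have d4 : (4 < a * e)%N by have := prime_gt1 pp; have := dvdn_leq a0 pa; move: dl l1; lia.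
have fp := @cover_prime l a e m F c1 c2 l1 m0 a0 e1 d4.
have e0F : e%:R != 0 :> F by rewrite -(dvdn_pcharf pF).
have fx : (cover l a e c1 c2)^`M(ord_max) != 0.
  (* Test on the axis of [x], where [e x^(e-1)] remains: the term in [c2] could only survive for
     [e = 2], and then [c2] is 0. *)
  pose q (i : 'I_l.+2) : {poly F} := if i == ord_max then 'X else 0.
  have := grad_x a e c1 c2 (@polyC F) q; rewrite /grad /q eqxx.
  have -> : (ord0 == ord_max :> 'I_l.+2) = false by [].
  have na : (a < d)%N by move: l1 dla; clear; lia.
  rewrite !expr0n -dae subn_eq0 leqNgt na /= mulr0 addr0 => E.
  apply/eqP => fx0; move: E; rewrite fx0 rmorph0.
  have -> : c2%:P * (2%:R * ('X * (d - 2 * a == 0)%N%:R)) =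
      'X * (if (d - 2 * a == 0)%N then 2%:R * c2%:P else 0) :> {poly F}.
    by case: eqP => _; rewrite ?mulr1 ?mulr0 //; ring.
  have [/eqP d2|_] := ifP; last first.
    by rewrite mulr0 addr0 => /esym /eqP; rewrite mulf_eq0 expf_eq0 polyX_eq0 andbF orbF -polyC_natr polyC_eq0 (negPf e0F).
  have e2 : e = 2%N by move: d2 dae e1 a0; clear; nia.
  have -> : c2 = 0 by rewrite /c2 e2.
  rewrite polyC0 !mulr0 addr0 => /esym /eqP.
  by rewrite mulf_eq0 expf_eq0 polyX_eq0 andbF orbF -polyC_natr polyC_eq0 (negPf e0F).
have [gp _] := generic_point_ex G m0 fp fx (@tofrac_inj _) (@tofrac_ex _).
have wh := whomog_cyclic (good_homog G) dbm.
have dwm : d = (wtn a b (ord_max : 'I_l.+3) * m)%N by rewrite /wtn join_max.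
have [pl [fV [fVm fVf fVE]]] := generic_place (fun i => wtn_gt0 i a0 b0) dwm fh fg wh (cyclic_top _ m0).
(* [p] is nonzero in characteristic 0 and reduces to 0. *)
pose w0 : vring pl := p%:R.
rewrite -(hypersurface_scale _ f (c := (f@_(U_(ord_max) *+ m))^-1)); last first.
  by rewrite invr_eq0; exact: (top_coef_neq0 (fun i => wtn_gt0 i a0 b0) dwm fg).
rewrite -fVf; apply: (place_not_stably_rational G l1 dla dbm m0 d0 a0 b0 gp (w0 := w0) fp _ _ fVm fVE).
- apply/eqP => w00; have := congr1 (pin pl) w00; rewrite rmorph_nat rmorph0 => /eqP.
  by rewrite ((pcharf0P k).1 ch0) eqn0Ngt prime_gt0.
- by rewrite rmorph_nat (pcharf0 pF).
- by rewrite fVf; exact: whomogZ.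
Qed.

(** * Normal form of a general equation *)

Section KillVariables.
Variables (i : nat).

(** The first [i] variables are set to 0 without changing the polynomial ring, so that the last
    variable and the maps of coefficients stay the same. *)
Definition kill n (R : comNzRingType) : {rmorphism {mpoly R[n]} -> {mpoly R[n]}} :=
  mev (@mpolyC n R) (fun j : 'I_n => if (j < i)%N then 0 else 'X_j).

Lemma kill_var n (R : comNzRingType) (j : 'I_n) :
  kill n R 'X_j = if (j < i)%N then 0 else 'X_j.
Proof. exact: mevX. Qed.

Lemma kill_map n (R S : comNzRingType) (u : {rmorphism R -> S}) (p : {mpoly R[n]}) :
  map_mpoly u (kill n R p) = kill n S (map_mpoly u p).
Proof.
apply: (mpoly_morph_eq (f := map_mpoly u \o kill n R) (g := kill n S \o map_mpoly u)) => [c|j] /=.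
  by rewrite /kill !mevC map_mpolyC mevC.
by rewrite map_mpoly_var !kill_var; case: ifP; rewrite ?rmorph0 ?map_mpoly_var.
Qed.

Lemma muni_kill n (R : comNzRingType) (p : {mpoly R[n.+1]}) : (i <= n)%N ->
  muni (kill n.+1 R p) = map_poly (kill n R) (muni p).
Proof.
move=> lei; apply: (mpoly_morph_eq (f := @muni n R \o kill n.+1 R) (g := map_poly (kill n R) \o @muni n R)) => [c|j] /=.
  by rewrite /kill mevC !muniC map_polyC /= mevC.
rewrite kill_var; have [->|[t ->]] := ord_widenP j.
  by rewrite ltnNge lei muni_last map_polyX.
by rewrite muni_var map_polyC /= kill_var; case: ifP; rewrite ?rmorph0 ?muni_var.
Qed.

Lemma kill_ymonic n m (R : comNzRingType) (p : {mpoly R[n.+1]}) : (i <= n)%N -> ymonic m p ->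
  ymonic m (kill n.+1 R p).
Proof.
move=> lei [mon sz]; rewrite /ymonic muni_kill //.
have lc : kill n R (lead_coef (muni p)) != 0 by rewrite (monicP mon) rmorph1 oner_neq0.
split; last by rewrite size_poly_eq.
by rewrite monicE lead_coef_map_eq // (monicP mon); apply/eqP; exact: rmorph1.
Qed.

Lemma kill_meval n (R : comNzRingType) (p : {mpoly R[n]}) x :
  (kill n R p).@[x] = p.@[fun j => if (j < i)%N then 0 else x j].
Proof.
apply: (mpoly_morph_eq (f := meval x \o kill n R) (g := meval _)) => [c|j] /=.
  by rewrite /kill mevC !mevalC.
by rewrite kill_var mevalXU; case: ifP; rewrite ?meval0 ?mevalXU.
Qed.

Lemma kill_cyclic n m (R : comNzRingType) (g : {mpoly R[n]}) : (i <= n)%N ->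
  kill n.+1 R (cyclic m g) = cyclic m (kill n R g).
Proof.
move=> lei; apply: (can_inj (@muniK _ _)).
by rewrite muni_kill // !muni_cyclic rmorphB /= map_polyXn map_polyC.
Qed.
End KillVariables.

Lemma closed_root_ex (k : closedFieldType) n (c : k) : (0 < n)%N -> exists x, x ^+ n = c.
Proof.
move=> n0; have [x xE] := @solve_monicpoly k n (fun j => if j == 0%N then c else 0) n0; exists x.
rewrite xE; case: n {xE} n0 => // n _; rewrite big_ord_recl /= expr0 mulr1 big1 ?addr0 // => j _.
by rewrite mul0r.
Qed.

Lemma mderiv_derivation n (R : comNzRingType) (i : 'I_n) : derivation (fun p : {mpoly R[n]} => p^`M(i)).
Proof. by split=> p q; rewrite ?mderivD ?mderivM //; ring. Qed.

Lemma wdegUn N (w : 'I_N -> nat) i c : wdeg w (U_(i) *+ c)%MM = (w i * c)%N.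
Proof.
rewrite /wdeg (bigD1 i) //= big1 ?addn0 => [|j ij]; first by rewrite mulmnE mnm1E eqxx mul1n.
by rewrite mulmnE mnm1E eq_sym (negPf ij) mul0n muln0.
Qed.

Lemma rmorph_meval n (R S : comNzRingType) (u : {rmorphism R -> S}) (p : {mpoly R[n]}) x :
  u p.@[x] = (map_mpoly u p).@[u \o x].
Proof. by rewrite !meval_mev mev_comp mev_map; exact: mev_eqfun. Qed.

Section GenericForm.
Variables (l a b d : nat) (k : closedFieldType).
Local Notation w := (wtn a b : 'I_l.+3 -> nat).
Local Notation e := (d %/ a)%N.
Local Notation m := (d %/ b)%N.
Local Notation Y := (U_(ord_max) *+ m)%MM.
Hypotheses (ch0 : [pchar k] =i pred0) (l0 : (0 < l)%N) (a0 : (0 < a)%N) (b0 : (0 < b)%N).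
Hypotheses (ad : (a %| d)%N) (bd : (b %| d)%N) (e1 : (1 < e)%N) (m1 : (1 < m)%N).
Hypothesis dl : (l.+1 + a <= d)%N.
Variable f : {mpoly k[l.+3]}.
Hypotheses (fh : whomog w d f) (fg : generic d w f).
Local Notation f1 := ((f@_Y)^-1 *: f).
Local Notation ww j := (widen_ord (leqnSn l.+2) j).

Let w_gt0 i : (0 < w i)%N. Proof. exact: wtn_gt0. Qed.
Let m0 : (0 < m)%N. Proof. exact: ltnW. Qed.
Let wmax : w ord_max = b. Proof. exact: join_max. Qed.
Let dwm : d = (w ord_max * m)%N. Proof. by rewrite wmax mulnC divnK. Qed.
Let dbm : d = (b * m)%N. Proof. by rewrite mulnC divnK. Qed.

Lemma w_dvd i : (w i %| d)%N.
Proof.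
rewrite /wtn; have [->|[j ->]] := ord_widenP i; rewrite ?join_max // join_widen /wt1.
by case: ifP; rewrite ?dvd1n.
Qed.

Lemma d_gt_w i : (1 < d %/ w i)%N.
Proof.
rewrite /wtn; have [->|[j ->]] := ord_widenP i; rewrite ?join_max // join_widen /wt1.
by case: ifP => _ //; rewrite divn1; move: dl l0; clear; lia.
Qed.

Lemma generic_coef_neq0 M : wdeg w M = d -> f@_M != 0.
Proof.
by move=> /(mono_onto w_gt0) [i0 <-]; have := fg (mvar_neq0 int i0); rewrite mevX.
Qed.

Lemma normal_ymonic : ymonic m f1.
Proof.
have fbh : whomog w d (cyclic m (0 : {mpoly k[l.+2]})) by apply: (whomog_cyclic _ dbm); exact: whomog0.
have [pl [fV [fVm <- _]]] := generic_place w_gt0 dwm fh fg fbh (cyclic_top _ m0).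
exact: ymonic_map.
Qed.

Lemma normal_homog : whomog w d f1. Proof. exact: whomogZ. Qed.

(** The variable of weight one in the binomial is the last such variable, of index [l]; as [i <= l],
    neither it nor [x] is killed. *)
Lemma normal_kill_prime i : (i <= l)%N -> mprime (kill i _ _ f1).
Proof.
move=> il; pose v : 'I_l.+2 := widen_ord (leqnSn l.+1) ord_max.
have vx : v != ord_max by rewrite -val_eqE /= ltn_eqF.
pose g : {mpoly k[l.+2]} := 'X_v ^+ (d - a) * 'X_ord_max.
have gh : whomog (wt1 a) d g.
  have dE : (d - a + a)%N = d by rewrite subnK //; move: dl; clear; lia.
  rewrite -[X in whomog _ X _]dE.
  apply: whomogM.
    have := whomogXn (d - a) (@whomogX _ (wt1 a) k v).
    have -> : wt1 a v = 1%N by rewrite /wt1 (negPf vx).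
    by rewrite mul1n.
  have := @whomogX _ (wt1 a) k (ord_max : 'I_l.+2).
  by have -> : wt1 a (ord_max : 'I_l.+2) = a by rewrite /wt1 eqxx.
have il2 : (i <= l.+2)%N by move: il; clear; lia.
have gK : kill i _ _ g = g.
  by rewrite rmorphM rmorphXn /= !kill_var /= ltnNge il /= ltnNge leqW.
have [pl [fV [fVm <- fVE]]] := generic_place w_gt0 dwm fh fg (whomog_cyclic gh dbm) (cyclic_top _ m0).
rewrite -kill_map; apply: mprime_place; first exact: kill_ymonic fVm.
by rewrite kill_map fVE kill_cyclic // gK; apply: binomial_prime.
Qed.

(** The place has residue field [k], of characteristic 0. A singular point is rescaled so that its
    coordinates are integral and one of them is 1, the powers [d / w_j] making coordinates of
    different weights comparable. It reduces to a singular point of the Fermat equation, which has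
    only the origin. *)
Lemma normal_smooth x : (forall j, f1^`M(j).@[x] = 0) -> forall i, x i = 0.
Proof.
move=> dx; apply: contrapT => /existsNP [i0 /eqP xi0].
pose fb : {mpoly k[l.+3]} := \sum_j 'X_j ^+ (d %/ w j).
have fbh : whomog w d fb.
  apply: whomog_sum => j _; have := whomogXn (d %/ w j) (@whomogX _ w k j).
  by rewrite mulnC divnK ?w_dvd.
have fbY : fb@_Y = 1.
  rewrite raddf_sum /= (bigD1 ord_max) //= wmax mpolyXn mcoeffX eqxx big1 ?addr0 // => j jm.
  rewrite mpolyXn mcoeffX; case: eqP => // /mnmP /(_ ord_max); rewrite !mulmnE !mnm1E eqxx (negPf jm).
  by rewrite mul0n mul1n => E; move: m0; rewrite -E.
have [pl [fV [fVm fVf fVE]]] := generic_place w_gt0 dwm fh fg fbh fbY.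
have [t [_ ut uP]] : exists t, [/\ t \in enum 'I_l.+3, x t ^+ (d %/ w t) != 0 &
    forall j, j \in enum 'I_l.+3 -> exists v, x j ^+ (d %/ w j) = x t ^+ (d %/ w t) * pin pl v].
  by apply: (@seq_dominant _ _ pl _ _ (fun j => x j ^+ (d %/ w j))); exists i0; rewrite ?mem_enum ?expf_neq0.
have xt : x t != 0 by apply: contraNneq ut => ->; rewrite expr0n gtn_eqF // (ltnW (d_gt_w t)).
have [c cE] := closed_root_ex (x t)^-1 (w_gt0 t).
have ct : c ^+ w t * x t = 1 by rewrite cE mulVf.
have /choice [z zP] : forall j, exists z, c ^+ w j * x j = pin pl z.
  move=> j; have [v vE] := uP j (mem_enum _ _).
  apply: (pin_root (n := d %/ w j) (v := v)); first exact: ltnW (d_gt_w j).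
  rewrite exprMn -exprM [(w j * _)%N]mulnC divnK ?w_dvd // vE.
  rewrite -[X in c ^+ X](divnK (w_dvd t)) mulnC exprM mulrA -exprMn ct expr1n mul1r //.
have dz j : (fV^`M(j)).@[z] = 0.
  apply: (@pin_inj _ _ pl); rewrite rmorph0 rmorph_meval -mderiv_map fVf.
  rewrite -[RHS](mulr0 (c ^+ (d - w j))) -(dx j) -(meval_worbit _ _ (whomog_mderiv j normal_homog)).
  by apply: meval_eq => i /=; rewrite zP.
have rz j : (pres pl (z j)) = 0.
  have := congr1 (pres pl) (dz j); rewrite rmorph0 rmorph_meval -mderiv_map fVE.
  rewrite (der_sum (mderiv_derivation k j)) (bigD1 j) //= big1 => [|i ij].
    rewrite addr0 (derX (mderiv_derivation k j)) mderiv_var eqxx mulr1 mevalMn mevalXn mevalXU -mulr_natr => /eqP.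
    rewrite mulf_eq0 ((pcharf0P k).1 ch0) expf_eq0 => /orP [/andP [_ /eqP //]|].
    by rewrite gtn_eqF // (ltnW (d_gt_w j)).
  by rewrite (derX (mderiv_derivation k j)) mderiv_var eq_sym (negPf ij) mulr0 mul0rn.
have zt : z t = 1 by apply: (@pin_inj _ _ pl); rewrite rmorph1 -zP.
by have := rz t; rewrite zt rmorph1 => /eqP; rewrite oner_eq0.
Qed.
End GenericForm.

(** * Local rings and coordinates *)

Section Germs.
Variables (k : closedFieldType) (n m d : nat) (w : 'I_n.+1 -> nat) (f : {mpoly k[n.+1]}).
Hypothesis fm : ymonic m.+1 f.
Hypothesis fp : mprime f.
Hypothesis fh : whomog w d f.
Local Notation X := (hypersurface w f).
Variables (P : X) (x0 : 'I_n.+1 -> k).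
Hypothesis Px0 : sval (sval P) x0.

Let fx0 : f.@[x0] = 0. Proof. exact: hyp_vanish Px0. Qed.

Definition germ_frac (phi : X -> k) e (g p : {mpoly k[n.+1]}) :=
  [/\ whomog w e g, whomog w e p, p.@[x0] != 0 &
      forall (Q : X) x, sval (sval Q) x -> p.@[x] != 0 -> phi Q = g.@[x] / p.@[x]].

Lemma stalk_frac phi : stalk P phi -> exists e g p, germ_frac phi e g p.
Proof.
move=> [U [oU UP rphi]]; have [e [g [p [hg hp pP pE]]]] := hyp_regular_frac oU rphi UP.
exists e, g, p; split=> // [|Q x Qx px]; first exact: pP.
by have [] := pE Q x Qx px.
Qed.

Lemma frac_regular phi e g p : germ_frac phi e g p ->
  regular X [set Q : X | nonzero_locus p (sval Q)]%classic phi.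
Proof.
move=> [hg hp px pE]; apply: regular_eq (hyp_frac_regular hg hp (fun _ h => h)) _.
  exact: hyp_basic_open hp.
move=> Q Qp; have [x Qx] := wpoint_ex (sval Q).
by rewrite (wfracE hg hp Qx) (pE _ _ Qx) //; exact: Qp.
Qed.

Lemma frac_stalk phi e g p : germ_frac phi e g p -> stalk P phi.
Proof.
move=> F; have [_ hp px _] := F; exists [set Q : X | nonzero_locus p (sval Q)]%classic; split.
- exact: hyp_basic_open hp.
- exact: nonzero_locusP hp Px0 px.
- exact: frac_regular F.
Qed.

Lemma wfrac_frac e g p : whomog w e g -> whomog w e p -> p.@[x0] != 0 ->
  germ_frac (fun Q : X => wfrac g p (sval Q)) e g p.
Proof. by move=> hg hp px; split=> // Q x Qx _; rewrite (wfracE hg hp Qx). Qed.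

Lemma cst_frac c : germ_frac (fun=> c) 0 c%:MP 1.
Proof.
by split; rewrite ?meval1 ?oner_neq0 //; [exact: whomogC | exact: dhomog1 | move=> *; rewrite mevalC meval1 divr1].
Qed.

Lemma frac_mul phi psi e g p e' g' p' : germ_frac phi e g p -> germ_frac psi e' g' p' ->
  germ_frac (fun Q => phi Q * psi Q) (e + e') (g * g') (p * p').
Proof.
move=> [hg hp px pE] [hg' hp' px' pE']; split; [exact: whomogM | exact: whomogM | by rewrite mevalM mulf_neq0|].
move=> Q x Qx; rewrite !mevalM mulf_eq0 negb_or => /andP [p1 p2].
by rewrite (pE _ _ Qx p1) (pE' _ _ Qx p2) mulf_div.
Qed.

Lemma frac_add phi psi e g p e' g' p' : germ_frac phi e g p -> germ_frac psi e' g' p' ->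
  germ_frac (fun Q => phi Q + psi Q) (e + e') (g * p' + g' * p) (p * p').
Proof.
move=> [hg hp px pE] [hg' hp' px' pE']; split; last first.
- move=> Q x Qx; rewrite mevalD !mevalM mulf_eq0 negb_or => /andP [p1 p2].
  by rewrite (pE _ _ Qx p1) (pE' _ _ Qx p2) addf_div.
- by rewrite mevalM mulf_neq0.
- exact: whomogM.
- by apply: whomogD; [|rewrite addnC]; exact: whomogM.
Qed.

Lemma germ_eq_dvd phi psi e g p e' g' p' : germ_frac phi e g p -> germ_frac psi e' g' p' ->
  germ_eq P phi psi -> mdvd f (g * p' - g' * p).
Proof.
move=> [hg hp px pE] [hg' hp' px' pE'] [U [oU UP UE]].
have [e1 [q [hq qP qU]]] := hyp_open_basic oU UP.
have [i xi] := rep_neq0 Px0.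
pose q1 := q * 'X_i * (p * p').
have q1x : q1.@[x0] != 0 by rewrite !mevalM mevalXU !mulf_neq0 //; exact: qP.
apply: (dense_dvd fm fp (point_ndvd fx0 q1x)) => x fx.
rewrite !mevalM mevalXU !mulf_eq0 !negb_or => /andP [/andP [qx xi0] /andP [p1 p2]].
have [Q Qx] := hyp_point_of fh (ex_intro _ i xi0) fx.
have := UE Q (qU _ _ Qx qx); rewrite (pE _ _ Qx p1) (pE' _ _ Qx p2) => /eqP.
by rewrite eqr_div // mevalB !mevalM => /eqP ->; rewrite subrr.
Qed.

Lemma germ_eq_stalk phi psi : germ_eq P phi psi -> stalk P phi -> stalk P psi.
Proof.
move=> [U [oU UP UE]] [V [oV VP rphi]]; exists (U `&` V)%classic; split=> //; first exact: zopenI.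
apply: regular_eq (regular_restrict oV (@subIsetr _ _ _) rphi) _; first exact: zopenI.
by move=> Q [UQ _]; exact: UE.
Qed.

(** Primes of the polynomial ring between [f] and the ideal of the vector [x0]. Homogeneity is not
    demanded, so that kernels of evaluations along arcs qualify. *)
Record prime_under (J : {mpoly k[n.+1]} -> Prop) := PrimeUnder {
  pu_dvd : forall g, mdvd f g -> J g;
  pu_add : forall g h, J g -> J h -> J (g + h);
  pu_mul : forall g h, J g -> J (h * g);
  pu_prime : forall g h, J (g * h) -> J g \/ J h;
  pu_point : forall g, J g -> g.@[x0] = 0
}.

Definition germ_ideal (J : {mpoly k[n.+1]} -> Prop) : set (X -> k) :=
  [set phi | exists e g p, germ_frac phi e g p /\ J g]%classic.

Section PrimeIdeal.
Variables (J : {mpoly k[n.+1]} -> Prop) (hJ : prime_under J).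

Let point_not p : p.@[x0] != 0 -> ~ J p.
Proof. by move=> px /(pu_point hJ) /eqP; rewrite (negPf px). Qed.

Lemma germ_ideal_eq phi psi e g p : germ_eq P phi psi -> germ_ideal J phi -> germ_frac psi e g p -> J g.
Proof.
move=> E [e' [g' [p' [F' Jg']]]] F; have [q qE] := germ_eq_dvd F' F E.
have : J (g * p').
  have -> : g * p' = p * g' - q * f by rewrite -qE; ring.
  by apply: (pu_add hJ); [exact: pu_mul | apply: (pu_dvd hJ); exists (- q); rewrite mulNr].
by move=> /(pu_prime hJ) [//|Jp]; case: (point_not _ Jp); have [] := F'.
Qed.

Lemma germ_ideal_all phi e g p : germ_ideal J phi -> germ_frac phi e g p -> J g.
Proof. by move=> I F; apply: germ_ideal_eq I F; exists setT; split=> //; exact: zopenT. Qed.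

Lemma germ_ideal_prime : prime_ideal P (germ_ideal J).
Proof.
split; first split.
- by move=> phi [e [g [p [F _]]]]; exact: frac_stalk F.
- move=> phi psi E I; have [e [g [p F]]] : exists e g p, germ_frac psi e g p.
    apply: stalk_frac; apply: (germ_eq_stalk E); case: I => [e [g [p [F _]]]]; exact: frac_stalk F.
  by exists e, g, p; split=> //; exact: germ_ideal_eq E I F.
- exists 0%N, 0%:MP, 1; split; first exact: cst_frac.
  by apply: (pu_dvd hJ); rewrite mpolyC0; exact: mdvd0.
- move=> phi psi [e [g [p [F Jg]]]] [e' [g' [p' [F' Jg']]]].
  exists (e + e')%N, (g * p' + g' * p), (p * p'); split; first exact: frac_add.
  by apply: (pu_add hJ); rewrite mulrC; exact: pu_mul.
- move=> phi psi /stalk_frac [e [g [p F]]] [e' [g' [p' [F' Jg']]]].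
  by exists (e + e')%N, (g * g'), (p * p'); split; [exact: frac_mul | exact: pu_mul].
- move=> I; apply: (point_not (p := 1)); first by rewrite meval1 oner_neq0.
  exact: germ_ideal_all I (cst_frac 1).
- move=> phi psi /stalk_frac [e [g [p F]]] /stalk_frac [e' [g' [p' F']]] I.
  have [Jg|Jg] := pu_prime hJ (germ_ideal_all I (frac_mul F F')); [left | right].
    by exists e, g, p.
  by exists e', g', p'.
Qed.
End PrimeIdeal.

Lemma germ_ideal_proper J J' e h p : prime_under J -> (forall g, J g -> J' g) ->
  whomog w e h -> whomog w e p -> p.@[x0] != 0 -> J' h -> ~ J h -> (germ_ideal J `<` germ_ideal J')%classic.
Proof.
move=> hJ JJ hh hp px J'h nJh; split; first by move=> phi [e' [g [q [F Jg]]]]; exists e', g, q; split=> //; exact: JJ.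
have F := wfrac_frac hh hp px.
move=> /(_ (fun Q => wfrac h p (sval Q))) sub; apply: nJh; apply: (germ_ideal_all hJ _ F).
by apply: sub; exists e, h, p.
Qed.
End Germs.

Lemma polyX_dvd (A : idomainType) (p : {poly A}) : p.[0] = 0 -> exists q, p = q * 'X.
Proof. by move=> /eqP /factor_theorem [q ->]; exists q; rewrite polyC0 subr0. Qed.

Lemma polyX_dvdM (A : idomainType) c s t (p q : {poly A}) : (s + t = c)%N -> mdvd 'X^c (p * q) ->
  mdvd 'X^s p \/ mdvd 'X^t q.
Proof.
elim: c s t p q => [|c IH] [|s] [|t] p q //; try by [left; exists p; rewrite expr0 mulr1 | right; exists q; rewrite expr0 mulr1].
rewrite addSn => -[stc] [r rE].
have cancel p' q' : p' * 'X * q' = p * q -> mdvd 'X^c (p' * q').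
  rewrite rE => E; exists r; apply: (mulIf (monic_neq0 (monicX A))).
  by rewrite mulrAC E exprSr mulrA.
have : (p * q).[0] = 0 by rewrite rE hornerM hornerXn expr0n mulr0.
rewrite hornerM => /eqP; rewrite mulf_eq0 => /orP [] /eqP /polyX_dvd [p' p'E].
  have [] := IH s t.+1 p' q stc (cancel _ _ (congr1 (fun z => z * q) (esym p'E))).
    by move=> [z zE]; left; exists z; rewrite p'E zE exprSr mulrA.
  by right.
have : mdvd 'X^c (p' * p) by apply: cancel; rewrite p'E; ring.
rewrite mulrC; move: stc; rewrite addnS -addSn => stc /(IH s.+1 t p p' stc) []; first by left.
by move=> [z zE]; right; exists z; rewrite p'E zE exprSr mulrA.
Qed.

Lemma mdvdXn_le (A : comNzRingType) s t (p : {poly A}) : (s <= t)%N -> mdvd 'X^t p -> mdvd 'X^s p.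
Proof. by move=> st [q ->]; exists (q * 'X^(t - s)); rewrite -mulrA -exprD subnK. Qed.

(** * Formal arcs through a point *)

Section Arcs.
Variables (N : nat) (k : fieldType) (A : idomainType) (u : {rmorphism k -> A}).
Variables (f L : {mpoly k[N]}) (x0 : 'I_N -> k) (r s : 'I_N) (v : 'I_N -> A).
Hypotheses (fx : f.@[x0] = 0) (Lx : L.@[x0] = 0) (rs : r != s).
Hypothesis minor : f^`M(r).@[x0] * L^`M(s).@[x0] - f^`M(s).@[x0] * L^`M(r).@[x0] != 0.
Local Notation uX := (@polyC A \o u : {rmorphism k -> {poly A}}).

Lemma arc_at0 (y : 'I_N -> {poly A}) g : (forall i, (y i).[0] = u (x0 i)) -> (mev uX y g).[0] = u g.@[x0].
Proof.
move=> y0; rewrite meval_mev mev_comp -[LHS]/(horner_eval 0 (mev uX y g)) mev_comp.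
rewrite (mev_eq _ _ y0); apply: mev_eqfun => c /=.
by rewrite /horner_eval hornerC.
Qed.

(** A formal arc is represented by polynomial truncations; at level [c] the equations hold modulo
    ['X^(c.+1)]. All coordinates but [r] and [s] move linearly with velocity [v]. *)
Definition arc_step (c : nat) (y : 'I_N -> {poly A}) :=
  [/\ forall i, (y i).[0] = u (x0 i),
      forall i, i != r -> i != s -> y i = (u (x0 i))%:P + v i *: 'X,
      mdvd 'X^(c.+1) (mev uX y f) & mdvd 'X^(c.+1) (mev uX y L)].

(** One Newton step: [al] and [be] solve, by Cramer's rule and the nonzero minor, the two linear
    equations that cancel the next coefficients of [f] and [L]. *)
Lemma arc_next c y : arc_step c y -> exists2 y', arc_step c.+1 y' &
  forall i, mdvd 'X^(c.+1) (y' i - y i).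
Proof.
move=> [y0 yv [F FE] [G GE]].
pose D := f^`M(r).@[x0] * L^`M(s).@[x0] - f^`M(s).@[x0] * L^`M(r).@[x0].
pose al := u D^-1 * (u f^`M(s).@[x0] * G.[0] - u L^`M(s).@[x0] * F.[0]).
pose be := u D^-1 * (u L^`M(r).@[x0] * F.[0] - u f^`M(r).@[x0] * G.[0]).
pose y' i := y i + (if i == r then al else if i == s then be else 0)%:P * 'X^(c.+1).
have y'0 i : (y' i).[0] = u (x0 i) by rewrite /y' hornerD hornerM hornerXn expr0n mulr0 addr0.
have solve g H : mev uX y g = H * 'X^(c.+1) -> H.[0] + al * u g^`M(r).@[x0] + be * u g^`M(s).@[x0] = 0 ->
    mdvd 'X^(c.+2) (mev uX y' g).
  move=> gH; have [q qE] := taylor1 uX y g; have [_ ->] := qE y'.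
  rewrite (bigD1 r) //= (bigD1 s) 1?eq_sym //= big1 ?addr0 => [|i /andP [ir iS]]; last first.
    by rewrite /y' (negPf ir) (negPf iS) polyC0 mul0r addr0 subrr mul0r.
  have yr : y' r - y r = al%:P * 'X^(c.+1) by rewrite /y' eqxx addrAC subrr add0r.
  have ys : y' s - y s = be%:P * 'X^(c.+1) by rewrite /y' eq_sym (negPf rs) eqxx addrAC subrr add0r.
  rewrite gH yr ys => E.
  have q0 i : ((q i).@[y']).[0] = u g^`M(i).@[x0].
    have [/(_ i) d1 _] := qE y; rewrite -(arc_at0 _ y0) -d1.
    have cg t : mdvd 'X (y' t - y t).
      by rewrite /y' addrAC subrr add0r exprSr; exists ((if t == r then al else if t == s then be else 0)%:P * 'X^c); rewrite mulrA.
    have := mev_congr idfun (q i) cg; rewrite -!meval_mev => -[z zE].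
    by apply/eqP; rewrite -subr_eq0 -hornerN -hornerD zE hornerM hornerX mulr0.
  have [z zE] : exists z, H + al%:P * (q r).@[y'] + be%:P * (q s).@[y'] = z * 'X.
    by apply: polyX_dvd; rewrite !hornerD !hornerM !hornerC !q0.
  by exists z; rewrite [X in _ = z * X]exprS mulrA -zE !mulrDl -addrA ![_%:P * 'X^_ * _]mulrAC.
have Dn : u D * u D^-1 = 1 by rewrite -rmorphM divff // rmorph1.
have cr (P Q R S G0 F0 d : A) : (P * S - Q * R) * d = 1 ->
    F0 + d * (Q * G0 - S * F0) * P + d * (R * F0 - P * G0) * Q = 0 /\
    G0 + d * (Q * G0 - S * F0) * R + d * (R * F0 - P * G0) * S = 0.
  move=> E; split; [transitivity (F0 * (1 - (P * S - Q * R) * d)) | transitivity (G0 * (1 - (P * S - Q * R) * d))]; by [ring | rewrite E subrr mulr0].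
have [] := cr (u f^`M(r).@[x0]) (u f^`M(s).@[x0]) (u L^`M(r).@[x0]) (u L^`M(s).@[x0]) G.[0] F.[0] (u D^-1).
  by rewrite -Dn /D rmorphB !rmorphM.
move=> E1 E2; exists y'; last first.
  by move=> i; rewrite /y' addrAC subrr add0r; exact: mdvdMl (ex_intro _ 1 (esym (mul1r _))).
split=> //.
- by move=> i ir iS; rewrite /y' (negPf ir) (negPf iS) polyC0 mul0r addr0 yv.
- exact: solve FE E1.
- exact: solve GE E2.
Qed.

Lemma arc_ex : exists y : nat -> 'I_N -> {poly A}, (forall c, arc_step c (y c)) /\
  forall c c' i, (c <= c')%N -> mdvd 'X^(c.+1) (y c' i - y c i).
Proof.
pose y0 i : {poly A} := (u (x0 i))%:P + v i *: 'X.
have y00 i : (y0 i).[0] = u (x0 i) by rewrite /y0 hornerD hornerC hornerZ hornerX mulr0 addr0.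
have s0 : arc_step 0 y0.
  by split=> //; rewrite expr1; [have [q ->] : exists q, mev uX y0 f = q * 'X by apply: polyX_dvd; rewrite (arc_at0 _ y00) fx rmorph0 |
    have [q ->] : exists q, mev uX y0 L = q * 'X by apply: polyX_dvd; rewrite (arc_at0 _ y00) Lx rmorph0]; exists q.
have /choice [nx nxP] : forall cy : nat * ('I_N -> {poly A}), exists y', arc_step cy.1 cy.2 ->
    arc_step cy.1.+1 y' /\ forall i, mdvd 'X^(cy.1.+1) (y' i - cy.2 i).
  move=> [c y] /=; have [h|h] := pselect (arc_step c y); last by exists y.
  by have [y' ? ?] := arc_next h; exists y'.
pose Y := fix Y c := if c is c'.+1 then nx (c', Y c') else y0.
have YP c : arc_step c (Y c) by elim: c => [//|c IH]; exact: (nxP (c, Y c) IH).1.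
exists Y; split=> // c c' i; elim: c' => [|c' IH]; first by rewrite leqn0 => /eqP ->; rewrite subrr; exact: mdvd0.
rewrite leq_eqVlt => /orP [/eqP ->|]; first by rewrite subrr; exact: mdvd0.
rewrite ltnS => le; have -> : Y c'.+1 i - Y c i = (Y c'.+1 i - Y c' i) + (Y c' i - Y c i) by ring.
by apply: mdvdD; [apply: (mdvdXn_le (t := c'.+1)); [by [] | exact: (nxP (c', Y c') (YP c')).2] | exact: IH].
Qed.
End Arcs.

Section ArcIdeal.
Variables (n : nat) (k : closedFieldType) (A : idomainType) (u : {rmorphism k -> A}) (sg : {rmorphism A -> A}).
Hypothesis sgu : forall c, sg (u c) = u c.
Variables (f L : {mpoly k[n.+1]}) (x0 : 'I_n.+1 -> k) (r s : 'I_n.+1) (v : 'I_n.+1 -> A).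
Variable y : nat -> 'I_n.+1 -> {poly A}.
Hypothesis yP : forall c, arc_step u f L x0 r s v c (y c).
Hypothesis y_le : forall c c' i, (c <= c')%N -> mdvd 'X^(c.+1) (y c' i - y c i).
Local Notation uX := (@polyC A \o u : {rmorphism k -> {poly A}}).

(** The polynomials that vanish along the arc after [sg] has specialized its velocities, expressed
    through truncations. *)
Definition arc_ideal g := forall c, mdvd 'X^c (map_poly sg (mev uX (y c) g)).

Let map_dvd c p : mdvd 'X^c p -> mdvd 'X^c (map_poly sg p).
Proof. by move=> [q ->]; exists (map_poly sg q); rewrite rmorphM /= map_polyXn. Qed.

Let arc_dvd g h : (forall c, mdvd 'X^c (mev uX (y c) h)) -> mdvd h g -> arc_ideal g.
Proof.
move=> hz [q ->] c; apply: map_dvd; rewrite (rmorphM (mev uX _)); apply: mdvdMl; exact: hz.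
Qed.

Let congr_arc g c c' : (c <= c')%N -> mdvd 'X^c (map_poly sg (mev uX (y c') g)) ->
  mdvd 'X^c (map_poly sg (mev uX (y c) g)).
Proof.
move=> le h; have cg : mdvd 'X^c (mev uX (y c') g - mev uX (y c) g).
  by apply: mev_congr => i; apply: (mdvdXn_le (t := c.+1)) => //; exact: y_le.
have := mdvdB h (map_dvd cg); rewrite -rmorphB.
by congr mdvd; congr map_poly; ring.
Qed.

Lemma arc_prime : prime_under f x0 arc_ideal.
Proof.
split.
- move=> g; apply: arc_dvd => c; have [_ _ h _] := yP c; exact: mdvdXn_le h.
- by move=> g h Jg Jh c; rewrite (rmorphD (mev uX _)) rmorphD; exact: mdvdD.
- by move=> g h Jg c; rewrite (rmorphM (mev uX _)) rmorphM; exact: mdvdMl.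
- move=> g h J; have [c1|] := pselect (arc_ideal g); [by left | move=> /existsNP [c1 n1]].
  right=> c2; have := J (c1 + c2)%N; rewrite (rmorphM (mev uX _)) rmorphM => /(polyX_dvdM erefl) [] dv.
    by case: n1; apply: congr_arc dv; exact: leq_addr.
  by apply: congr_arc dv; exact: leq_addl.
- move=> g /(_ 1%N) [q]; rewrite expr1 => qE; apply: (fmorph_inj u).
  have : (map_poly sg (mev uX (y 1) g)).[0] = 0 by rewrite qE hornerM hornerX mulr0.
  have [y0 _ _ _] := yP 1; rewrite -[X in _.[X]](rmorph0 sg) horner_map (arc_at0 _ y0) sgu => ->.
  by rewrite rmorph0.
Qed.

Lemma arc_L g : mdvd L g -> arc_ideal g.
Proof. by apply: arc_dvd => c; have [_ _ _ h] := yP c; exact: mdvdXn_le h. Qed.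

Lemma arc_coord j : j != r -> j != s -> arc_ideal ('X_j - (x0 j)%:MP) <-> sg (v j) = 0.
Proof.
move=> jr js.
have E c : map_poly sg (mev uX (y c) ('X_j - (x0 j)%:MP)) = (sg (v j))%:P * 'X.
  have [_ h _ _] := yP c; rewrite (rmorphB (mev uX _)) /= mevX mevC h // addrAC subrr add0r.
  by rewrite map_polyZ map_polyX mul_polyC.
split=> [/(_ 2) [q]|v0 c]; rewrite E; last by rewrite v0 mul0r; exact: mdvd0.
rewrite exprS expr1 mulrA => /(mulIf (monic_neq0 (monicX A))) /(congr1 (fun p => p.[0])).
by rewrite hornerC hornerM hornerX mulr0.
Qed.
End ArcIdeal.

Section RegularFunctions.
Variables (k : fieldType) (X : Defs.space k).

Lemma regular_poly N (U : set X) (xi : 'I_N -> X -> k) (H : {mpoly k[N]}) : zopen X U ->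
  (forall i, regular X U (xi i)) -> regular X U (fun Q => H.@[fun i => xi i Q]).
Proof.
move=> oU rxi; elim/mpoly_alg_ind: H => [c|i|g h rg rh|g h rg rh].
- by rewrite (_ : (fun Q => _) = fun=> c); [exact: regular_cst | apply/funext => Q; rewrite mevalC].
- by rewrite (_ : (fun Q => _) = xi i) //; apply/funext => Q; rewrite mevalXU.
- rewrite (_ : (fun Q => _) = fun Q => g.@[fun i => xi i Q] + h.@[fun i => xi i Q]); first exact: regularD.
  by apply/funext => Q; rewrite mevalD.
- rewrite (_ : (fun Q => _) = fun Q => g.@[fun i => xi i Q] * h.@[fun i => xi i Q]); first exact: regularM.
  by apply/funext => Q; rewrite mevalM.
Qed.
End RegularFunctions.

Lemma wpoint_scale (k : fieldType) N (w : 'I_N -> nat) (Q : wpoint k w) x (c : k) : c != 0 ->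
  sval Q x -> sval Q (fun i => c ^+ w i * x i).
Proof.
case: Q => B /= [z _ ->] c0 [t t0 ->]; exists (c * t); first by rewrite mulf_neq0.
by apply/funext => i; rewrite exprMn mulrA.
Qed.

Section Coordinates.
Variables (k : closedFieldType) (n m d e0 : nat) (w : 'I_n.+2 -> nat) (f : {mpoly k[n.+2]}).
Hypothesis fm : ymonic m.+1 f.
Hypothesis fp : mprime f.
Hypothesis fh : whomog w d f.
Hypothesis w_gt0 : forall i, (0 < w i)%N.
Local Notation X := (hypersurface w f).
Variables (M1 M2 : {mpoly k[n.+2]}) (r : 'I_n.+2) (s' : 'I_n.+1).
Hypotheses (M1h : whomog w e0.+1 M1) (M2h : whomog w e0 M2).
Local Notation s := (lift r s').
Local Notation L := (M1 - M2).

Definition free_var (i : 'I_n) : 'I_n.+2 := lift r (lift s' i).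
Definition coord_num j : {mpoly k[n.+2]} := 'X_j * M2 ^+ w j.
Definition coord j (Q : X) : k := wfrac (coord_num j) (M1 ^+ w j) (sval Q).
Definition coord_minor : {mpoly k[n.+2]} := f^`M(r) * L^`M(s) - f^`M(s) * L^`M(r).

(* A representative with [M1 x = M2 x]: the quotient [M1 / M2] of weight 1 is
   normalized to 1. *)
Definition normal_rep (P : X) x := [/\ sval (sval P) x, M1.@[x] = M2.@[x] & M1.@[x] != 0].

Lemma coord_num_homog j : whomog w (e0.+1 * w j) (coord_num j).
Proof. by rewrite mulSn; apply: whomogM; [exact: whomogX | exact: whomogXn]. Qed.

Lemma coordE j P x : sval (sval P) x -> coord j P = x j * M2.@[x] ^+ w j / M1.@[x] ^+ w j.
Proof.
move=> Px; rewrite /coord (wfracE (coord_num_homog j) (whomogXn _ M1h) Px).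
by rewrite mevalM mevalXU !mevalXn.
Qed.

Lemma normal_coord P x : normal_rep P x -> (fun j => coord j P) = x.
Proof.
move=> [Px M12 Mx]; apply/funext => j; rewrite (coordE j Px) -M12 -mulrA divff ?mulr1 //.
exact: expf_neq0.
Qed.

Lemma coord_normal P x : sval (sval P) x -> M1.@[x] != 0 -> M2.@[x] != 0 ->
  normal_rep P (fun j => coord j P).
Proof.
move=> Px m1 m2; have c0 : M2.@[x] / M1.@[x] != 0 by rewrite mulf_neq0 ?invr_eq0.
have E : (fun j => coord j P) = fun j => (M2.@[x] / M1.@[x]) ^+ w j * x j.
  by apply/funext => j; rewrite (coordE j Px) exprMn exprVn; ring.
split.
- by rewrite E; exact: wpoint_scale.
- rewrite E (meval_worbit _ _ M1h) (meval_worbit _ _ M2h) exprSr -!mulrA; congr (_ * _).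
  by rewrite mulVf // mulr1.
- by rewrite E (meval_worbit _ _ M1h) mulf_neq0 // expf_neq0.
Qed.

Lemma coord_regular (U : set X) j : zopen X U -> (forall P, U P -> nonzero_locus M1 (sval P)) ->
  regular X U (coord j).
Proof.
move=> oU UM; apply: (hyp_frac_regular (coord_num_homog j) (whomogXn _ M1h)).
by move=> P /UM h x Px; rewrite mevalXn expf_neq0 // h.
Qed.

Definition chart_set : set X :=
  [set P : X | nonzero_locus (M1 * M2) (sval P) /\ coord_minor.@[fun j => coord j P] != 0]%classic.

Let open0 : zopen X [set P : X | nonzero_locus (M1 * M2) (sval P)]%classic.
Proof. exact: hyp_basic_open (whomogM M1h M2h). Qed.

Let locM1 (P : X) : nonzero_locus (M1 * M2) (sval P) -> nonzero_locus M1 (sval P).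
Proof. by move=> h x Px; have := h x Px; rewrite mevalM mulf_eq0 negb_or => /andP []. Qed.

Lemma chart_open : zopen X chart_set.
Proof.
apply: zopen_neq0 => //; apply: regular_poly => // j.
by apply: coord_regular => // P; exact: locM1.
Qed.

Lemma chart_regular j : regular X chart_set (coord j).
Proof. by apply: coord_regular => [|P [/locM1]] //; exact: chart_open. Qed.

Lemma chart_normal P : chart_set P -> normal_rep P (fun j => coord j P).
Proof.
move=> [h _]; have [x Px] := wpoint_ex (sval P); have := h x Px; rewrite mevalM mulf_eq0 negb_or.
by move=> /andP [? ?]; exact: coord_normal Px _ _.
Qed.

Lemma normal_chart P x : normal_rep P x -> coord_minor.@[x] != 0 -> chart_set P.
Proof.
move=> nx mx; have [Px M12 Mx] := nx; split; last by rewrite (normal_coord nx).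
by apply: (nonzero_locusP (whomogM M1h M2h) Px); rewrite mevalM -M12 mulf_neq0.
Qed.

(** The numerator of [phi], [f] and [L] are expanded to first order at the point. On normalized
    representatives the last two vanish, and eliminating the increments along [r] and [s] leaves
    only the free ones. *)
Lemma chart_coordinates P : chart_set P -> local_coordinates P (fun i => coord (free_var i)).
Proof.
move=> UP; have nx := chart_normal UP; have [Px M12 Mx] := nx; have [_ mx] := UP.
set x0 := (fun j => coord j P) in Px M12 Mx mx nx *.
have Lx : L.@[x0] = 0 by rewrite mevalB M12 subrr.
have poly_stalk (U : set X) (H : {mpoly k[n.+2]}) : stalk P (fun Q => H.@[fun j => coord j Q]).
  exists chart_set; split=> //; first exact: chart_open.
  by apply: regular_poly; [exact: chart_open | exact: chart_regular].
split=> [i|phi [/stalk_frac h phi0]].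
  split; last by rewrite subrr.
  exists chart_set; split=> //; first exact: chart_open.
  by apply: regularD; [exact: chart_open | exact: chart_regular | exact: regular_cst chart_open].
have [e [g [p [hg hp px pE]]]] := h _ Px.
have gx : g.@[x0] = 0 by have := phi0; rewrite (pE P x0 Px px) => /eqP; rewrite mulf_eq0 invr_eq0 (negPf px) orbF => /eqP.
have [q qE] := taylor1 idfun x0 g; have [F FE] := taylor1 idfun x0 f; have [G GE] := taylor1 idfun x0 L.
pose D := F r * G s - F s * G r.
pose K i := q i * D - q r * (F i * G s - F s * G i) - q s * (F r * G i - G r * F i).
pose c i (Q : X) := (K (free_var i)).@[fun j => coord j Q] / (D * p).@[fun j => coord j Q].
have Dx : (D * p).@[x0] != 0.
  have [Fd _] := FE x0; have [Gd _] := GE x0.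
  move: mx; rewrite /coord_minor /D mevalM !mevalB !mevalM !Fd !Gd -!meval_mev => mx.
  by rewrite mulf_neq0.
have oD : zopen X [set Q | chart_set Q /\ (D * p).@[fun j => coord j Q] != 0]%classic.
  by apply: zopen_neq0; [exact: chart_open | apply: regular_poly; [exact: chart_open | exact: chart_regular]].
have cE i : stalk P (c i).
  exists [set Q | chart_set Q /\ (D * p).@[fun j => coord j Q] != 0]%classic; split=> //.
  apply: regularM => //.
    apply: (regular_restrict chart_open) => [Q []//|].
    by apply: regular_poly; [exact: chart_open | exact: chart_regular].
  apply: regularV => // [|Q [] //]; apply: (regular_restrict chart_open) => [Q []//|].
  by apply: regular_poly; [exact: chart_open | exact: chart_regular].
exists c; split=> //; exists [set Q | chart_set Q /\ (D * p).@[fun j => coord j Q] != 0]%classic; split=> //.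
move=> Q [UQ Dq]; have [Qx N12 Nx] := chart_normal UQ.
set z := (fun j => coord j Q) in Qx N12 Nx Dq *.
have tE j : coord j Q - coord j P = z j - x0 j by [].
have split2 (V : 'I_n.+2 -> k) : \sum_i V i = V r + (V s + \sum_i V (free_var i)).
  by rewrite (bigD1_ord r) //= (bigD1_ord s').
have [_ ge] := qE z; have [_ fe] := FE z; have [_ le] := GE z.
have fz : f.@[z] = 0 := hyp_vanish Qx; have fx : f.@[x0] = 0 := hyp_vanish Px.
move: ge fe le; rewrite -!meval_mev gx fz fx Lx mevalB N12 subrr !add0r !split2.
set T := \sum_i (z (free_var i) - x0 (free_var i)) * (q (free_var i)).@[z].
set TF := \sum_i (z (free_var i) - x0 (free_var i)) * (F (free_var i)).@[z].
set TG := \sum_i (z (free_var i) - x0 (free_var i)) * (G (free_var i)).@[z] => ge fe le.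
move: Dq; rewrite mevalM mulf_eq0 negb_or => /andP [dz pz].
rewrite (pE Q z Qx pz); apply: (mulIf dz); rewrite mulrAC.
have -> : (\sum_i c i Q * (coord (free_var i) Q - coord (free_var i) P)) * D.@[z] =
    (T * D.@[z] - (q r).@[z] * (TF * (G s).@[z] - (F s).@[z] * TG) - (q s).@[z] * ((F r).@[z] * TG - (G r).@[z] * TF)) / p.@[z].
  have lin (U V W a b c' e' g' h' D' : k) : U * D' - a * (V * c' - e' * W) - b * (g' * W - h' * V) =
      U * D' + V * (b * h' - a * c') + W * (a * e' - b * g') by ring.
  rewrite lin.
  have sl (V : 'I_n -> k) t : (\sum_i V i) * t = \sum_i V i * t by rewrite mulr_suml.
  rewrite /T /TF /TG !sl -!big_split /= sl; apply: eq_bigr => i _.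
  have KE t : (K t).@[z] = (q t).@[z] * D.@[z] - (q r).@[z] * ((F t).@[z] * (G s).@[z] - (F s).@[z] * (G t).@[z])
      - (q s).@[z] * ((F r).@[z] * (G t).@[z] - (G r).@[z] * (F t).@[z]).
    by rewrite /K !(mevalB, mevalM).
  have fld (qi Dd qr qs Fi Gs Fs Gi Fr Gr pp t : k) : pp != 0 -> Dd != 0 ->
      (qi * Dd - qr * (Fi * Gs - Fs * Gi) - qs * (Fr * Gi - Gr * Fi)) / (Dd * pp) * t * Dd =
      (t * qi * Dd + t * Fi * (qs * Gr - qr * Gs) + t * Gi * (qr * Fs - qs * Fr)) / pp.
    by move=> p0 d0; field; rewrite p0 d0.
  by rewrite /c -/z KE [(D * p).@[z]]mevalM tE; exact: fld.
congr (_ / _); rewrite ge /D mevalB !mevalM.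
have fin (a b qr qs Fr Fs Gr Gs U V W : k) : 0 = a * Fr + (b * Fs + V) -> 0 = a * Gr + (b * Gs + W) ->
    (a * qr + (b * qs + U)) * (Fr * Gs - Fs * Gr) =
    U * (Fr * Gs - Fs * Gr) - qr * (V * Gs - Fs * W) - qs * (Fr * W - Gr * V).
  move=> E1 E2; have -> : V = - (a * Fr + b * Fs) by apply: (addrI (a * Fr + b * Fs)); rewrite subrr -addrA.
  have -> : W = - (a * Gr + b * Gs) by apply: (addrI (a * Gr + b * Gs)); rewrite subrr -addrA.
  ring.
exact: fin.
Qed.
End Coordinates.

Section LocalChain.
Variables (k : closedFieldType) (n m d e0 : nat) (w : 'I_n.+2 -> nat) (f : {mpoly k[n.+2]}).
Hypothesis fm : ymonic m.+1 f.
Hypothesis fp : mprime f.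
Hypothesis fh : whomog w d f.
Local Notation X := (hypersurface w f).
Variables (M1 M2 : {mpoly k[n.+2]}) (r : 'I_n.+2) (s' : 'I_n.+1).
Hypotheses (M1h : whomog w e0.+1 M1) (M2h : whomog w e0 M2).
Variables (P : X) (x0 : 'I_n.+2 -> k).
Hypothesis Px : normal_rep M1 M2 P x0.
Hypothesis minor : (coord_minor f M1 M2 r s').@[x0] != 0.

Lemma kill_killS i (A : comNzRingType) (p : {mpoly A[n]}) :
  kill i.+1 n A (kill i n A p) = kill i.+1 n A p.
Proof.
apply: (mpoly_morph_eq (f := kill i.+1 n A \o kill i n A) (g := kill i.+1 n A)) => [c|j] /=.
  by rewrite /kill !mevC.
rewrite kill_var; case: ifP => // ji; rewrite rmorph0 kill_var ltnS.
by rewrite (ltnW ji).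
Qed.

(** The arc has independent velocities in the [n] free directions. Killing one more velocity
    enlarges the prime of functions vanishing along it: the coordinate in direction [i] enters at
    step [i + 1]. *)
Lemma local_chain : has_chain (@prime_ideal k X P) n.
Proof.
have [Px0 M12 Mx] := Px; have fx := hyp_vanish Px0.
have Lx : (M1 - M2).@[x0] = 0 by rewrite mevalB M12 subrr.
pose A : idomainType := {mpoly k[n]}; pose u : {rmorphism k -> A} := @mpolyC n k.
pose v j : A := if unlift r j is Some j' then if unlift s' j' is Some i then 'X_i else 0 else 0.
have vr : v r = 0 by rewrite /v unlift_none.
have vs : v (lift r s') = 0 by rewrite /v liftK unlift_none.
have vf i : v (free_var r s' i) = 'X_i by rewrite /v /free_var !liftK.
have mi : f^`M(r).@[x0] * (M1 - M2)^`M(lift r s').@[x0] - f^`M(lift r s').@[x0] * (M1 - M2)^`M(r).@[x0] != 0.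
  by move: minor; rewrite /coord_minor mevalB !mevalM.
have [y [yP y_le]] := arc_ex u v fx Lx (neq_lift r s') mi.
pose sg i : {rmorphism A -> A} := kill i n k.
have sgu i c : sg i (u c) = u c by rewrite /sg /u /kill /= mevC.
have Jp i := arc_prime (sgu i) yP y_le.
pose J i := arc_ideal u (sg i) y.
have JJ i g : J i g -> J i.+1 g.
  move=> h c; have [q qE] := h c; exists (map_poly (sg i.+1) q).
  have := congr1 (map_poly (sg i.+1)) qE; rewrite rmorphM /= map_polyXn -map_poly_comp.
  by move=> <-; apply: eq_map_poly => z; rewrite /= kill_killS.
exists (fun i => germ_ideal x0 (J i)); split=> i lt; first exact: (germ_ideal_prime fm fp fh Px0 (Jp i)).
pose j := free_var r s' (Ordinal lt).
have jr : j != r by rewrite eq_sym neq_lift.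
have js : j != lift r s' by rewrite /j /free_var (inj_eq (lift_inj (h := r))) eq_sym neq_lift.
(* The homogeneous numerator of [coord j - x0 j]. Modulo the equation [M1 = M2] of the arcs it is
   [X_j - x0 j] times a power of [M2], which is nonzero at the point. *)
pose h : {mpoly k[n.+2]} := coord_num w M2 j - x0 j *: M1 ^+ w j.
have hh : whomog w (e0.+1 * w j) h.
  by apply: whomogB; [exact: coord_num_homog | apply: whomogZ; exact: whomogXn].
have hE : h = M2 ^+ w j * ('X_j - (x0 j)%:MP) - (x0 j)%:MP * (M1 ^+ w j - M2 ^+ w j).
  by rewrite /h /coord_num -mul_mpolyC; move: ('X_j) ((x0 j)%:MP) (M1 ^+ _) (M2 ^+ _) => a b c e; ring.
have LJ i' : J i' ((x0 j)%:MP * (M1 ^+ w j - M2 ^+ w j)).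
  by apply: (arc_L (sg i') yP); rewrite subrXX; apply: mdvdMl; apply: mdvdMr; exists 1; rewrite mul1r.
have JX i' : J i' h <-> sg i' (v j) = 0.
  rewrite -(arc_coord (sg i') yP jr js); split=> [Jh|Jx].
    have : J i' (M2 ^+ w j * ('X_j - (x0 j)%:MP)).
      rewrite (_ : _ * _ = h + (x0 j)%:MP * (M1 ^+ w j - M2 ^+ w j)); last by rewrite hE subrK.
      exact: (pu_add (Jp i') Jh (LJ i')).
    move=> /(pu_prime (Jp i')) [/(pu_point (Jp i')) /eqP|//].
    by rewrite mevalXn -M12 expf_eq0 (negPf Mx) andbF.
  rewrite hE; apply: (pu_add (Jp i')); first exact: (pu_mul (Jp i') _ Jx).
  by rewrite -mulN1r; exact: (pu_mul (Jp i') _ (LJ i')).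
apply: (germ_ideal_proper fm fp fh Px0 (Jp i) (@JJ i) hh (whomogXn (w j) M1h)).
- by rewrite mevalXn expf_neq0.
- by apply/JX; rewrite vf /sg kill_var /= ltnSn.
- by move=> /JX; rewrite vf /sg kill_var /= ltnn => /eqP; rewrite (negPf (mvar_neq0 _ _)).
Qed.
End LocalChain.

Section Stalk.
Variables (k : fieldType) (X : Defs.space k) (P : X).

Lemma stalk_cst c : stalk P (fun=> c).
Proof. by exists setT; split=> //; [exact: zopenT | apply/regular_cst/zopenT]. Qed.

Lemma stalkD phi psi : stalk P phi -> stalk P psi -> stalk P (fun Q => phi Q + psi Q).
Proof.
move=> [U [oU UP rU]] [V [oV VP rV]]; have oUV := zopenI oU oV; exists (U `&` V)%classic; split=> //.
apply: regularD => //; first exact: (regular_restrict oU (@subIsetl _ _ _)).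
exact: (regular_restrict oV (@subIsetr _ _ _)).
Qed.

Lemma stalkM phi psi : stalk P phi -> stalk P psi -> stalk P (fun Q => phi Q * psi Q).
Proof.
move=> [U [oU UP rU]] [V [oV VP rV]]; have oUV := zopenI oU oV; exists (U `&` V)%classic; split=> //.
apply: regularM => //; first exact: (regular_restrict oU (@subIsetl _ _ _)).
exact: (regular_restrict oV (@subIsetr _ _ _)).
Qed.

Lemma stalk_poly N (phi : 'I_N -> X -> k) (H : {mpoly k[N]}) :
  (forall i, stalk P (phi i)) -> stalk P (fun Q => H.@[fun i => phi i Q]).
Proof.
move=> sp; elim/mpoly_alg_ind: H => [c|i|g h sg sh|g h sg sh].
- by rewrite (_ : (fun Q => _) = fun=> c); [exact: stalk_cst | apply/funext => Q; rewrite mevalC].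
- by rewrite (_ : (fun Q => _) = phi i) //; apply/funext => Q; rewrite mevalXU.
- rewrite (_ : (fun Q => _) = fun Q => g.@[fun i => phi i Q] + h.@[fun i => phi i Q]); first exact: stalkD.
  by apply/funext => Q; rewrite mevalD.
- rewrite (_ : (fun Q => _) = fun Q => g.@[fun i => phi i Q] * h.@[fun i => phi i Q]); first exact: stalkM.
  by apply/funext => Q; rewrite mevalM.
Qed.

Lemma prime_ideal_pow I phi psi s : prime_ideal P I -> stalk P phi -> stalk P psi -> ~ I phi ->
  I (fun Q => phi Q ^+ s * psi Q) -> I psi.
Proof.
move=> [hI n1 hp] sphi spsi nphi; elim: s => [|s IH].
  by rewrite (_ : (fun Q => _) = psi) //; apply/funext => Q; rewrite expr0 mul1r.
have sx : stalk P (fun Q => phi Q ^+ s * psi Q).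
  have := @stalk_poly 2 (fun i => if i == ord0 then phi else psi) ('X_ord0 ^+ s * 'X_ord_max).
  rewrite (_ : (fun Q => _) = fun Q => phi Q ^+ s * psi Q); last first.
    by apply/funext => Q; rewrite mevalM mevalXn !mevalXU.
  by apply=> i; case: ifP.
rewrite (_ : (fun Q => _) = fun Q => phi Q * (phi Q ^+ s * psi Q)); last first.
  by apply/funext => Q; rewrite exprS mulrA.
by move=> /(hp _ _ sphi sx) [//|/IH].
Qed.

(* If a nonzero polynomial vanishes on elements of the successive primes, then so
   does its trailing coefficient, modulo the next prime. *)
Lemma independent_chain r (Z : nat -> set (X -> k)) (phi : 'I_r -> X -> k) (H : {mpoly k[r]}) :
  (forall i, (i <= r)%N -> prime_ideal P (Z i)) -> (forall i, (i < r)%N -> (Z i `<=` Z i.+1)%classic) ->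
  (forall j : 'I_r, Z (r - j)%N (phi j) /\ ~ Z (r - j.+1)%N (phi j)) -> H != 0 ->
  ~ Z 0%N (fun Q => H.@[fun i => phi i Q]).
Proof.
elim: r Z phi H => [|r IH] Z phi H pZ sZ zphi H0 ZH.
  have [[_ _ _ _ mI] n1 _] := pZ 0%N isT.
  pose c := H@_0%MM; have HE : H = c%:MP.
    by apply/mpolyP => M; rewrite mcoeffC (_ : M = 0%MM) ?eqxx ?mulr1 //; apply/mnmP => -[].
  have c0 : c != 0 by apply: contraNneq H0 => c0; rewrite HE c0 mpolyC0.
  apply: n1; have := mI _ _ (stalk_cst c^-1) ZH.
  by congr (Z 0%N); apply/funext => Q; rewrite HE mevalC mulVf.
have sphi j : stalk P (phi j).
  by have [[sub _ _ _ _] _ _] := pZ (r.+1 - j)%N (leq_subr _ _); apply: sub; exact: (zphi j).1.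
have [s [q]] := multiplicity_XsubC (muni H) 0.
have mH : muni H != 0 by apply: contra_neq H0 => e; apply: muni_inj; rewrite e raddf0.
rewrite mH subr0 /= => q0 qE.
have HE : H = muniV q * 'X_ord_max ^+ s by rewrite -(muniK H) qE rmorphM rmorphXn /= muniVX.
have Zq : Z 0%N (fun Q => (muniV q).@[fun i => phi i Q]).
  apply: (prime_ideal_pow (s := s) (pZ 0%N isT) (sphi ord_max)); first exact: stalk_poly.
    by have [_] := zphi ord_max; rewrite subnn.
  by move: ZH; congr (Z 0%N); apply/funext => Q; rewrite HE mevalM mevalXn mevalXU mulrC.
have [q' q'E] : exists q', q = q' * 'X + (q.[0])%:P.
  have : root (q - (q.[0])%:P) 0 by rewrite /root !hornerE subrr.
  by move=> /factor_theorem [q' E]; exists q'; rewrite -[LHS](subrK (q.[0])%:P) E polyC0 subr0.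
have [[_ _ _ aI mI] _ _] := pZ 1%N isT.
apply: (IH (fun i => Z i.+1) (fun j => phi (widen_ord (leqnSn r) j)) q.[0]) => //.
- by move=> i le; exact: pZ.
- by move=> i lt; exact: sZ.
- move=> j; have := zphi (widen_ord (leqnSn r) j); rewrite /= subSn 1?ltnW // subSS.
  by rewrite subnSK.
have Z1phi : Z 1%N (phi ord_max) by have [] := zphi ord_max; rewrite subSnn.
have /= := aI _ _ (sZ 0%N isT _ Zq) (mI _ _ (stalk_poly (- muniV q') sphi) Z1phi).
congr (Z 1%N); apply/funext => Q; rewrite [in X in X + _]q'E rmorphD rmorphM /= muniVX muniVC.
rewrite mevalD mevalM mevalXU mevalN; rewrite addrC mulNr addrA addNr add0r.
by rewrite meval_muni muni_widen map_polyC /= hornerC.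
Qed.
End Stalk.

(** * Dimension *)

Section Dependence.
Variables (k : closedFieldType) (n m d : nat) (w : 'I_n.+2 -> nat) (f : {mpoly k[n.+2]}).
Hypothesis fh : whomog w d f.
Hypothesis w_gt0 : forall i, (0 < w i)%N.
Hypothesis dwm : d = (w ord_max * m.+1)%N.
Local Notation Y := (U_(ord_max) *+ m.+1)%MM.
Hypothesis fY : f@_Y = 1.

Section Reduced.
Variable D : nat.

Definition reduced := filter (fun M : 'X_{1..n.+2} => (M ord_max < m.+1)%N) (monos D w).

Definition red_mono (i : 'I_(size reduced)) := nth 0%MM reduced i.

Definition reducible g := exists c : 'I_(size reduced) -> k, mdvd f (g - \sum_i c i *: 'X_[red_mono i]).

Lemma reducible_sum (I : eqType) (s : seq I) (P : pred I) (F : I -> {mpoly k[n.+2]}) (c : I -> k) :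
  (forall i, i \in s -> P i -> reducible (F i)) -> reducible (\sum_(i <- s | P i) c i *: F i).
Proof.
elim: s => [|i s IH] h.
  by exists (fun=> 0); rewrite big_nil big1 ?subrr => [|i _]; [exact: mdvd0 | rewrite scale0r].
have [c1 d1] : reducible (\sum_(i <- s | P i) c i *: F i) by apply: IH => t ts; apply: h; rewrite inE ts orbT.
rewrite big_cons; case: ifP => Pi; last by exists c1.
have [c2 d2] := h i (mem_head _ _) Pi; exists (fun t => c i * c2 t + c1 t).
have -> : \sum_t (c i * c2 t + c1 t) *: 'X_[red_mono t] =
    c i *: \sum_t c2 t *: 'X_[red_mono t] + \sum_t c1 t *: 'X_[red_mono t] :> {mpoly k[n.+2]}.
  by rewrite scaler_sumr -big_split /=; apply: eq_bigr => t _; rewrite scalerDl scalerA.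
by rewrite opprD addrACA -scalerBr -mul_mpolyC; apply: mdvdD => //; exact: mdvdMl.
Qed.

(** The equation is monic in the last variable, and rewriting by it lowers the exponent of that
    variable. *)
Lemma reducible_mono M : wdeg w M = D -> reducible 'X_[M].
Proof.
have [t] := ubnP (M ord_max); elim: t M => // t IH M; rewrite ltnS => le wM.
have [lt|ge] := ltnP (M ord_max) m.+1.
  have Mr : M \in reduced by rewrite mem_filter lt mem_monos // wM /=.
  have li : (index M reduced < size reduced)%N by rewrite index_mem.
  exists (fun i => (i == Ordinal li)%:R); rewrite (bigD1 (Ordinal li)) //= eqxx scale1r big1 => [|i /negPf ->].
    by rewrite addr0 /red_mono nth_index // subrr; exact: mdvd0.
  by rewrite scale0r.
have YM : (Y <= M)%MM.
  apply/mnm_lepP => i; rewrite mulmnE mnm1E; case: eqP => [<-|_]; rewrite ?mul1n ?mul0n //.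
pose M' := (M - Y)%MM; have ME : (M' + Y)%MM = M by exact: submK.
have Yf : Y \in msupp f by rewrite mcoeff_msupp fY oner_neq0.
have [c dv] : reducible (\sum_(K <- msupp f | K != Y) (- f@_K) *: 'X_[M' + K]).
  apply: reducible_sum => K Kf KY.
  have wK : wdeg w K = d by move/whomogP: fh; apply; rewrite -mcoeff_msupp.
  have lt := top_mono w_gt0 dwm wK KY.
  apply: IH; last by rewrite -wM -ME !wdegD wK; congr (_ + _)%N; rewrite dwm wdegUn.
  apply: leq_trans le; rewrite -ME !mnmDE ltn_add2l (leq_trans lt) //.
  by rewrite mulmnE mnm1E eqxx mul1n.
exists c; have -> : 'X_[M] = 'X_[M'] * f + \sum_(K <- msupp f | K != Y) (- f@_K) *: 'X_[M' + K].
  have fE : f = 'X_[Y] + \sum_(K <- msupp f | K != Y) f@_K *: 'X_[K].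
    by rewrite {1}[f]mpolyE (bigD1_seq Y) ?msupp_uniq //= fY scale1r.
  rewrite [X in _ * X]fE mulrDr -mpolyXD ME -addrA mulr_sumr -big_split /= big1 ?addr0 // => K _.
  by rewrite -scalerAr -mpolyXD scaleNr subrr.
by rewrite -addrA; apply: mdvdD => //; apply: mdvdMl; exists 1; rewrite mul1r.
Qed.

Lemma reducible_homog g : whomog w D g -> reducible g.
Proof.
move=> /whomogP gh; rewrite [g]mpolyE; apply: reducible_sum => M; rewrite mcoeff_msupp => /gh wM _.
exact: reducible_mono.
Qed.

(** The exponent of the last variable takes [m + 1] values and those of [n] others at most [D + 1]
    each; the degree then determines the exponent of the first variable. *)
Lemma reduced_bound : (size reduced <= m.+1 * D.+1 ^ n)%N.
Proof.
pose v i : 'I_n.+2 := widen_ord (leqnSn n.+1) (lift ord0 i).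
pose h (M : 'X_{1..n.+2}) := (inord (M ord_max) : 'I_m.+1, [ffun i : 'I_n => inord (M (v i)) : 'I_D.+1]).
have rP M : M \in reduced -> [/\ wdeg w M = D, (M ord_max < m.+1)%N & forall i, (M i < D.+1)%N].
  rewrite mem_filter mem_monos // => /andP [lt /eqP wM]; split=> // i.
  rewrite ltnS -wM /wdeg (bigD1 i) //=; apply: leq_trans (leq_addr _ _).
  by rewrite leq_pmull.
have hi : {in reduced &, injective h}.
  move=> M M' /rP [wM lM bM] /rP [wM' lM' bM'] [/(congr1 val) /= e1 /ffunP e2].
  rewrite !inordK // in e1.
  have e3 i : M (v i) = M' (v i).
    by have := congr1 val (e2 i); rewrite !ffunE /= !inordK.
  have e4 i : i != ord0 -> M i = M' i.
    have [->|[j ->]] := ord_widenP i; first by [].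
    case: (unliftP ord0 j) => [t ->|-> /eqP []]; first by rewrite e3.
    exact: val_inj.
  apply/mnmP => i; have [->|/e4 //] := eqVneq i ord0.
  have := wM; rewrite -wM' /wdeg (bigD1 ord0) //= [in RHS](bigD1 ord0) //=.
  rewrite [in RHS](eq_bigr (fun i => w i * M i)%N) => [/addIn /eqP|t t0]; last by rewrite e4.
  by rewrite eqn_pmul2l // => /eqP.
have u : uniq [seq h M | M <- reduced].
  by rewrite map_inj_in_uniq // filter_uniq // monos_uniq.
rewrite -(size_map h) -(card_uniqP u) (leq_trans (max_card _)) //.
by rewrite card_prod card_ffun !card_ord.
Qed.
End Reduced.

Lemma left_kernel_ex (q c : nat) (A : 'M[k]_(q, c)) : (c < q)%N -> exists2 v : 'rV_q, v *m A = 0 & v != 0.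
Proof.
move=> lt; have /rowV0Pn [v vA v0] : kermx A != 0.
  by rewrite -mxrank_eq0 mxrank_ker subn_eq0 -ltnNge (leq_ltn_trans (rank_leq_col A)).
by exists v => //; apply/sub_kermxP.
Qed.

(** Products of [n + 1] fractions with exponents up to [T] number [(T+1)^(n+1)], while modulo [f]
    they lie in a space whose dimension grows like [T^n]. *)
Lemma algebraic_dependence D (g : 'I_n.+1 -> {mpoly k[n.+2]}) p :
  (forall i, whomog w D (g i)) -> whomog w D p ->
  exists2 H : {mpoly k[n.+1]}, H != 0 & forall x, f.@[x] = 0 -> p.@[x] != 0 ->
    H.@[fun i => (g i).@[x] / p.@[x]] = 0.
Proof.
(* [T] makes the bound [(m+1)(D'+1)^n] at most [T (T+1)^n], because
   [D' + 1 <= (D (n+1) + 1)(T + 1)]. *)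
move=> gh ph; pose T := (m.+1 * (D * n.+1 + 1) ^ n)%N.
pose KT : finType := {ffun 'I_n.+1 -> 'I_T.+1}.
pose D' := (n.+1 * (D * T))%N.
pose G (K : KT) := \prod_i (g i ^+ K i * p ^+ (T - K i)).
have Gh K : whomog w D' (G K).
  have -> : D' = (\sum_(i < n.+1) D * T)%N by rewrite sum_nat_const card_ord.
  apply: whomog_prod => i _; have KiT : (K i <= T)%N by rewrite -ltnS.
  rewrite -[X in whomog _ (D * X)%N _](subnKC KiT) mulnDr.
  by apply: whomogM; exact: whomogXn.
have /choice [c cP] := fun K => reducible_homog (Gh K).
pose A : 'M[k]_(#|KT|, size (reduced D')) := \matrix_(i, j) c (enum_val i) j.
have [|v vA v0] := @left_kernel_ex _ _ A.
  rewrite card_ffun !card_ord (leq_ltn_trans (reduced_bound D')) // expnS.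
  have leX s t u : (s <= t)%N -> (s ^ u <= t ^ u)%N by case: u => // u; rewrite leq_exp2r.
  have le : (D'.+1 <= (D * n.+1 + 1) * T.+1)%N by rewrite /D'; nia.
  apply: (@leq_ltn_trans (T * T.+1 ^ n)%N); last by rewrite ltn_pmul2r ?expn_gt0.
  by rewrite /T -mulnA leq_mul2l -expnMn; exact: leX le.
pose mon (K : KT) := [multinom (K t : nat) | t < n.+1].
have mon_inj : injective mon.
  move=> K K' /mnmP E; apply/ffunP => t; apply: ord_inj; have := E t; by rewrite !mnmE.
exists (\sum_i v 0 i *: 'X_[mon (enum_val i)]).
  have [i vi] : exists i, v 0 i != 0 by apply/rV0Pn.
  apply: contraNneq vi => /(congr1 (mcoeff (mon (enum_val i)))); rewrite mcoeff0 raddf_sum /= => <-.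
  rewrite (bigD1 i) //= mcoeffZ mcoeffX eqxx mulr1 big1 ?addr0 // => t ti.
  by rewrite mcoeffZ mcoeffX (inj_eq mon_inj) (inj_eq enum_val_inj) (negPf ti) mulr0.
move=> x fx px; apply: (mulIf (expf_neq0 (n.+1 * T) px)); rewrite mul0r.
have -> : (\sum_i v 0 i *: 'X_[mon (enum_val i)]).@[fun i => (g i).@[x] / p.@[x]] * p.@[x] ^+ (n.+1 * T) =
    (\sum_i v 0 i *: G (enum_val i)).@[x].
  rewrite !raddf_sum mulr_suml /=; apply: eq_bigr => i _; rewrite !mevalZ -mulrA; congr (_ * _).
  rewrite mevalX /mmap1 [in RHS]rmorph_prod /= mulnC exprM.
  rewrite -[X in (_ ^+ T) ^+ X](card_ord n.+1) -prodr_const -big_split /=; apply: eq_bigr => t _.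
  have KiT : (enum_val i t <= T)%N by rewrite -ltnS.
  have aux (s u : k) (q e : nat) : u != 0 -> (q <= e)%N -> (s / u) ^+ q * u ^+ e = s ^+ q * u ^+ (e - q).
    by move=> u0 qe; rewrite -[in LHS](subnKC qe) exprD mulrA -exprMn divfK.
  by rewrite mnmE mevalM !mevalXn aux.
have [q ->] : mdvd f (\sum_i v 0 i *: G (enum_val i)); last by rewrite mevalM fx mulr0.
have dv : mdvd f (\sum_i v 0 i *: (G (enum_val i) - \sum_j c (enum_val i) j *: 'X_[red_mono j])).
  by apply: mdvd_sum => i _; rewrite -mul_mpolyC; apply: mdvdMl.
move: dv; congr mdvd; under eq_bigr do rewrite scalerBr.
rewrite sumrB [X in _ - X](_ : _ = 0) ?subr0 //.
under eq_bigr do rewrite scaler_sumr.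
rewrite exchange_big big1 //= => j _; under eq_bigr do rewrite scalerA.
rewrite -scaler_suml (_ : \sum_i v 0 i * c (enum_val i) j = 0) ?scale0r //.
have := congr1 (fun B : 'M_(1, _) => B 0 j) vA; rewrite !mxE => E; rewrite -[RHS]E.
by apply: eq_bigr => i _; rewrite mxE.
Qed.

Section NoLongChain.
Variable P : hypersurface w f.

Lemma no_long_chain : ~ has_chain (@prime_ideal k _ P) n.+1.
Proof.
move=> [Z [pZ sZ]]; have [x0 Px0] := wpoint_ex (sval P).
have idx (j : 'I_n.+1) : (n.+1 - j)%N = (n - j).+1 by rewrite subSn // -ltnS.
have /choice [phi phiP] : forall j : 'I_n.+1, exists phi, Z (n.+1 - j)%N phi /\ ~ Z (n.+1 - j.+1)%N phi.
  move=> j; rewrite idx subSS; have [|_ h] := sZ (n - j)%N; first by rewrite ltnS leq_subr.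
  by apply: contrapT => no; apply: h => psi Zp; apply: contrapT => np; apply: no; exists psi.
have sphi j : stalk P (phi j).
  by have [[sub _ _ _ _] _ _] := pZ _ (leq_subr j n.+1); apply: sub; exact: (phiP j).1.
have /choice [egp egpP] : forall j, exists egp : nat * ({mpoly k[n.+2]} * {mpoly k[n.+2]}),
    germ_frac x0 (phi j) egp.1 egp.2.1 egp.2.2.
  by move=> j; have [e [g [p F]]] := stalk_frac Px0 (sphi j); exists (e, (g, p)).
pose p j := (egp j).2.2; pose pp := \prod_j p j.
pose g j := (egp j).2.1 * \prod_(i | i != j) p i.
pose D := (\sum_j (egp j).1)%N.
have pph : whomog w D pp by apply: whomog_prod => j _; have [] := egpP j.
have gh j : whomog w D (g j).
  rewrite /D (bigD1 j) //=; apply: whomogM; first by have [] := egpP j.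
  by apply: whomog_prod => i _; have [] := egpP i.
have [H H0 HE] := algebraic_dependence gh pph.
apply: (independent_chain pZ _ phiP H0).
  by move=> i lt; have [] := sZ i lt.
have [[_ eqI z0 _ _] _ _] := pZ 0%N isT; apply: eqI z0.
exists [set Q : hypersurface w f | nonzero_locus pp (sval Q)]%classic; split.
- exact: hyp_basic_open pph.
- apply: (nonzero_locusP pph Px0); rewrite rmorph_prod; apply/prodf_neq0 => j _.
  by have [] := egpP j.
- move=> Q Qp; have [x Qx] := wpoint_ex (sval Q); have px := Qp x Qx.
  rewrite -[LHS](HE x (hyp_vanish Qx) px); congr (H.@[_]); apply/funext => j.
  have [_ _ _ pE] := egpP j; rewrite (pE Q x Qx); last first.
    by move: px; rewrite rmorph_prod => /prodf_neq0; apply.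
  by apply: (mulIf px); rewrite divfK // /g meval_common_den // mulrC.
Qed.
End NoLongChain.
End Dependence.

Section Dimension.
Variables (k : closedFieldType) (n m d : nat) (w : 'I_n.+2 -> nat) (f : {mpoly k[n.+2]}).
Hypothesis fm : ymonic m.+1 f.
Hypothesis kp : forall i, (i < n)%N -> mprime (kill i _ _ f).
Hypothesis fh : whomog w d f.
Hypothesis w_gt0 : forall i, (0 < w i)%N.
Hypothesis n0 : (0 < n)%N.
Hypothesis unit_ratio : forall x, (exists i, x i != 0) -> f.@[x] = 0 -> exists e0 M1 M2,
  [/\ whomog w e0.+1 M1, whomog w e0 M2, M1.@[x] != 0 & M2.@[x] != 0].
Local Notation X := (hypersurface w f).
Local Notation widen := (widen_ord (leqnSn n.+1)).

Definition slice i : set X := fun P => forall x, sval (sval P) x -> forall j : 'I_n.+2, (j < i)%N -> x j = 0.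

Lemma slice_rep i (P : X) x : sval (sval P) x -> (forall j : 'I_n.+2, (j < i)%N -> x j = 0) -> slice i P.
Proof. by move=> Px x0 y Py j ji; have [c _ ->] := wpoint_rel Px Py; rewrite x0 // mulr0. Qed.

Lemma sliceS i P : slice i.+1 P -> slice i P.
Proof. by move=> h x Px j ji; apply: (h x Px j); exact: leqW. Qed.

Lemma slice_closed i : zclosed (slice i).
Proof.
apply: zopen_locally => P nP; have [x Px] := wpoint_ex (sval P).
have [j /not_implyP [ji xj]] : exists j : 'I_n.+2, ~ ((j < i)%N -> x j = 0).
  by apply/existsNP => h; apply: nP; exact: slice_rep Px h.
have hj := @whomogX _ w k j; exists [set Q : X | nonzero_locus 'X_j (sval Q)]%classic; split.
- exact: hyp_basic_open hj.
- by apply: (nonzero_locusP hj Px); rewrite mevalXU; apply/eqP.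
- move=> Q /= Qj h; have [y Qy] := wpoint_ex (sval Q).
  by have := Qj y Qy; rewrite mevalXU (h y Qy j ji) eqxx.
Qed.

Lemma slice_point (x : 'I_n.+1 -> k) i0 : x i0 != 0 ->
  exists (P : X) y, sval (sval P) (join_pt x y).
Proof.
move=> xi; have [mon sz] := fm.
have [y fy] : exists y, f.@[join_pt x y] = 0.
  have /closed_rootP [y] : size (map_poly (meval x) (muni f)) != 1%N.
    by rewrite size_map_poly_id0 ?sz // (monicP mon) meval1 oner_neq0.
  move=> /rootP ry; exists y; rewrite meval_muni join_max -[RHS]ry; congr _.[_].
  by apply: eq_map_poly => p; apply: meval_eq => j /=; rewrite join_widen.
have [|P Px] := hyp_point_of fh _ fy; last by exists P, y.
by exists (widen i0); rewrite join_widen.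
Qed.

Lemma slice_at (j : 'I_n.+1) : exists (P : X) x, [/\ sval (sval P) x, x (widen j) = 1 &
  forall i, i != j -> x (widen i) = 0].
Proof.
have [|P [y Px]] := @slice_point (fun i => (i == j)%:R) j; first by rewrite eqxx oner_neq0.
by exists P, (join_pt (fun i => (i == j)%:R) y); rewrite join_widen eqxx; split=> // i /negPf ij; rewrite join_widen ij.
Qed.

Lemma slice_in i (j : 'I_n.+1) : (i <= j)%N -> exists (P : X) x,
  [/\ slice i P, sval (sval P) x & x (widen j) = 1].
Proof.
move=> ij; have [P [x [Px x1 x0]]] := slice_at j; exists P, x; split=> //.
apply: (slice_rep Px) => t ti; have [E|[t' E]] := ord_widenP t; subst t.
  by move: ti; rewrite ltnNge (leq_trans ij) // ltnW // leqW // ltn_ord.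
rewrite x0 //; apply: contraTneq ti => ->; by rewrite -leqNgt.
Qed.

Lemma vanish_slice i e g : (i < n)%N -> whomog w e g ->
  (forall (P : X) x, slice i P -> sval (sval P) x -> g.@[x] = 0) -> mdvd (kill i _ _ f) (kill i _ _ g).
Proof.
move=> lt hg van; have fmi := kill_ymonic (leqW (ltnW lt)) fm.
apply: (vanish_dvd fmi (kp lt)) => x; rewrite !kill_meval; set z := (fun j => _) => fz.
have [[t zt]|z0] := pselect (exists t, z t != 0).
  have [P Pz] := hyp_point_of fh (ex_intro _ t zt) fz; apply: (van P z) => //.
  by apply: (slice_rep Pz) => j ji; rewrite /z ji.
(* The zero vector is on the cone but is not a point of [X]. There [g] vanishes in positive degree,
   and in degree 0 it has the same value as at a point of the slice. *)
have {}z0 : z = fun j => 0 ^+ w j * z j.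
  apply/funext => j; rewrite expr0n gtn_eqF // mul0r; apply/eqP/negPn/negP => zj; by apply: z0; exists j.
have zE y : g.@[z] = 0 ^+ e * g.@[y].
  rewrite -(meval_worbit _ _ hg) z0; apply: meval_eq => j; by rewrite expr0n gtn_eqF // !mul0r.
have [P [x1 [Pi Px1 _]]] := @slice_in i (Ordinal (leqW lt : (i < n.+1)%N)) (leqnn _).
by rewrite (zE x1) (van P) ?mulr0.
Qed.

Lemma closed_separate (Z : set X) P : zclosed Z -> ~ Z P -> exists e p, [/\ whomog w e p,
  forall x, sval (sval P) x -> p.@[x] != 0 & forall (Q : X) x, Z Q -> sval (sval Q) x -> p.@[x] = 0].
Proof.
move=> cZ nZ; have [e [p [hp pP pU]]] := hyp_open_basic cZ nZ; exists e, p; split=> // Q x ZQ Qx.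
by apply/eqP/negPn/negP => px; exact: (pU Q x Qx px).
Qed.

Lemma slice_irreducible i : (i < n)%N -> irreducible_closed (slice i).
Proof.
move=> lt; split; first exact: slice_closed.
  by have [P [x [Pi _ _]]] := @slice_in i (Ordinal (leqW lt : (i < n.+1)%N)) (leqnn _); exists P.
move=> A B cA cB sub; apply: contrapT => /not_orP [/existsNP [P /not_implyP [PZ PA]] /existsNP [Q /not_implyP [QZ QB]]].
have [e [p [hp pP pA]]] := closed_separate cA PA; have [e' [q [hq qQ qB]]] := closed_separate cB QB.
have : mdvd (kill i _ _ f) (kill i _ _ (p * q)).
  apply: (vanish_slice lt (whomogM hp hq)) => T x TZ Tx; rewrite mevalM.
  by have [TA|TB] := sub T TZ; [rewrite (pA T x) // mul0r | rewrite (qB T x) // mulr0].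
have kz g (T : X) x : slice i T -> sval (sval T) x -> mdvd (kill i _ _ f) (kill i _ _ g) -> g.@[x] = 0.
  move=> TZ Tx [h hE]; have xE : (fun j : 'I_n.+2 => if (j < i)%N then 0 else x j) = x.
    by apply/funext => j; case: ifP => // ji; rewrite (TZ x Tx).
  have := congr1 (meval x) hE; rewrite /= mevalM !kill_meval xE => ->.
  by rewrite (hyp_vanish Tx) mulr0.
rewrite rmorphM => /(kp lt) [dv|dv].
  by have [x Px] := wpoint_ex (sval P); have := pP x Px; rewrite (kz p P x PZ Px dv) eqxx.
by have [x Qx] := wpoint_ex (sval Q); have := qQ x Qx; rewrite (kz q Q x QZ Qx dv) eqxx.
Qed.

Lemma point_irreducible (P : X) : irreducible_closed [set P]%classic.
Proof.
split; last 1 first.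
- by move=> A B _ _ /(_ P erefl) [AP|BP]; [left | right] => _ ->.
- have [x Px] := wpoint_ex (sval P); have fx := hyp_vanish Px.
  have [e0 [M1 [M2 [h1 h2 x1 x2]]]] := unit_ratio (rep_neq0 Px) fx.
  have sep p e Q z : whomog w e p -> p.@[x] = 0 -> sval (sval Q) z -> p.@[z] != 0 ->
      exists V, [/\ zopen X V, V Q & (V `<=` ~` [set P])%classic].
    move=> hp px Qz pz; exists [set Q : X | nonzero_locus p (sval Q)]%classic; split.
    - exact: hyp_basic_open hp.
    - exact: nonzero_locusP hp Qz pz.
    - by move=> T /= Tp TP; have := Tp x; rewrite TP px eqxx => /(_ Px).
  apply: zopen_locally => Q nQ; have [z Qz] := wpoint_ex (sval Q).
  (* Where [M1] or [M2] vanishes, comparing [M1 * M2] with a power of one coordinate separates the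
     points; elsewhere a normalized coordinate does. *)
  have [M0|] := eqVneq (M1 * M2).@[z] 0.
    have [i zi] := rep_neq0 Qz; pose s := (e0.+1 + e0)%N.
    apply: (sep ((M1 * M2).@[x] ^+ w i *: 'X_i ^+ s - x i ^+ s *: (M1 * M2) ^+ w i) (w i * s)%N Q z) => //.
    + apply: whomogB; apply: whomogZ; first exact: whomogXn (whomogX _ _ _).
      by rewrite mulnC; apply: whomogXn; exact: whomogM.
    + by rewrite mevalB !mevalZ !mevalXn mevalXU mulrC subrr.
    + rewrite mevalB !mevalZ !mevalXn mevalXU M0 expr0n gtn_eqF // mulr0 subr0.
      by rewrite mulf_neq0 ?expf_neq0 // mevalM mulf_neq0.
  rewrite mevalM mulf_eq0 negb_or => /andP [z1 z2].
  have nP := coord_normal h1 h2 Px x1 x2; have nQ' := coord_normal h1 h2 Qz z1 z2.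
  have [j cj] : exists j, coord M1 M2 j P != coord M1 M2 j Q.
    apply: contrapT => h; apply: nQ; have [xP _ _] := nP; have [xQ _ _] := nQ'.
    apply: esym; apply: hyp_inj xP _; rewrite (_ : (fun j => _) = fun j => coord M1 M2 j Q) //.
    by apply/funext => j; apply/eqP/negPn/negP => ne; apply: h; exists j.
  have hc := coord_num_homog h2 j.
  apply: (sep (coord_num w M2 j - coord M1 M2 j P *: M1 ^+ w j) _ Q z) => //.
  + by apply: whomogB hc _; apply: whomogZ; exact: whomogXn.
  + by rewrite mevalB mevalZ (coordE h1 h2 j Px) mevalM !mevalXn mevalXU divfK ?subrr // expf_neq0.
  + apply: contra cj; rewrite mevalB mevalZ subr_eq0 mevalM !mevalXn mevalXU => /eqP E.
    by rewrite (coordE h1 h2 j Qz) E mulfK // expf_neq0.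
- by exists P.
Qed.

(** The smallest slice known to be irreducible, [slice (n - 1)], is a curve; a point on it completes
    the chain to length [n]. *)
Lemma slice_chain : has_chain (@irreducible_closed k X) n.
Proof.
have [P [x [Pn Px _]]] := @slice_in n ord_max (leqnn _).
exists (fun i => if i is i'.+1 then slice (n - i) else [set P]%classic); split=> [[|i] le|[|i] lt].
- exact: point_irreducible.
- by apply: slice_irreducible; rewrite ltn_subrL.
- split; first by move=> _ ->; apply: sliceS; rewrite subn1 prednK.
  have lt1 : (n - 1 < n.+1)%N by rewrite ltnS leq_subr.
  have [Q [y [Qi Qy y1]]] := @slice_in (n - 1) (Ordinal lt1) (leqnn _).
  move=> /(_ Q Qi) QP; have := Pn y; rewrite -QP => /(_ Qy (widen (Ordinal lt1))) /=.
  by rewrite y1 subn1 prednK // => /(_ (leqnn _)) /eqP; rewrite oner_eq0.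
- have E : (n - i.+1)%N = (n - i.+2).+1 by rewrite -subnSK.
  rewrite E; split; first exact: sliceS.
  have lt1 : (n - i.+2 < n.+1)%N by rewrite ltnS leq_subr.
  have [Q [y [Qi Qy y1]]] := @slice_in (n - i.+2) (Ordinal lt1) (leqnn _).
  move=> /(_ Q Qi) /(_ y Qy (widen (Ordinal lt1)) (leqnn _)) /eqP.
  by rewrite y1 oner_eq0.
Qed.

(** * From irreducible closed sets to primes of a local ring *)

Section VanishingPrimes.
Variables (P : X) (Z : set X).
Hypothesis Zi : irreducible_closed Z.
Hypothesis ZP : Z P.

Definition vanishing_ideal (Z : set X) : set (X -> k) :=
  [set phi | stalk P phi /\ exists U, [/\ zopen X U, U P & forall Q, U Q -> Z Q -> phi Q = 0]]%classic.

Lemma vanishing_prime : prime_ideal P (vanishing_ideal Z).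
Proof.
split; first split.
- by move=> phi [].
- move=> phi psi E [sp [U [oU UP Uz]]]; split; first exact: germ_eq_stalk E sp.
  have [V [oV VP VE]] := E; exists (U `&` V)%classic; split=> //; first exact: zopenI.
  by move=> Q [UQ VQ] ZQ; rewrite -VE // Uz.
- by split; [exact: stalk_cst | exists setT; split=> //; exact: zopenT].
- move=> phi psi [s1 [U [oU UP Uz]]] [s2 [V [oV VP Vz]]]; split; first exact: stalkD.
  exists (U `&` V)%classic; split=> //; first exact: zopenI.
  by move=> Q [UQ VQ] ZQ; rewrite Uz // Vz // addr0.
- move=> phi psi s1 [s2 [V [oV VP Vz]]]; split; first exact: stalkM.
  by exists V; split=> // Q VQ ZQ; rewrite Vz // mulr0.
- by move=> [_ [U [_ UP Uz]]]; have /eqP := Uz P UP ZP; rewrite oner_eq0.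
- move=> phi psi s1 s2 [_ [U [oU UP Uz]]].
  have [U1 [o1 P1 r1]] := s1; have [U2 [o2 P2 r2]] := s2.
  pose V := (U `&` (U1 `&` U2))%classic.
  have oV : zopen X V by apply: zopenI => //; exact: zopenI.
  have r1' : regular X V phi by apply: (regular_restrict o1 _ r1) => Q [_ []].
  have r2' : regular X V psi by apply: (regular_restrict o2 _ r2) => Q [_ []].
  have [_ _ irr] := Zi.
  have cl chi : regular X V chi -> zclosed (~` [set Q | V Q /\ chi Q != 0])%classic.
    by move=> r; rewrite /zclosed setCK; exact: zopen_neq0.
  have fin chi : stalk P chi -> (Z `<=` ~` [set Q | V Q /\ chi Q != 0])%classic -> vanishing_ideal Z chi.
    move=> sc sub; split=> //; exists V; split=> // Q VQ ZQ; apply/eqP/negPn/negP => cQ.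
    by apply: (sub Q ZQ).
  have [|sub|sub] := irr _ _ (cl _ r1') (cl _ r2').
  + move=> Q ZQ; have [VQ|nV] := pselect (V Q); last by left=> -[].
    have /eqP := Uz Q VQ.1 ZQ; rewrite mulf_eq0 => /orP [] /eqP z; [left | right] => -[_]; by rewrite z eqxx.
  + by left; exact: fin.
  + by right; exact: fin.
Qed.

(** Let the form [p] vanish on [Z'] and not on [Z]. Divided by a power of a coordinate that is
    nonzero at [P], a power of [p] gives a function in the larger ideal; if it vanished on [Z] near
    [P], irreducibility would spread the vanishing of [p] over [Z]. *)
Lemma vanishing_proper (Z' : set X) : zclosed Z' -> (Z' `<` Z)%classic ->
  (vanishing_ideal Z `<` vanishing_ideal Z')%classic.
Proof.
move=> cZ' [sub /existsNP [Q /not_implyP [ZQ nQ]]]; split.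
  by move=> phi [sp [U [oU UP Uz]]]; split=> //; exists U; split=> // T UT /sub; exact: Uz.
have [e [p [hp pQ pZ]]] := closed_separate cZ' nQ.
have [x Px] := wpoint_ex (sval P); have [i xi] := rep_neq0 Px.
have hi := @whomogX _ w k i.
have h1 := whomogXn (w i) hp; have h2 := whomogXn e hi; rewrite mulnC in h2.
have xe : ('X_i ^+ e : {mpoly k[n.+2]}).@[x] != 0 by rewrite mevalXn mevalXU expf_neq0.
have F := wfrac_frac f h1 h2 xe.
move=> /(_ (fun T => wfrac (p ^+ w i) ('X_i ^+ e) (sval T))) [].
  split; first by have := frac_stalk Px F.
  exists setT; split=> //; first exact: zopenT.
  move=> T _ ZT; have [y Ty] := wpoint_ex (sval T).
  by rewrite (wfracE h1 h2 Ty) mevalXn (pZ T y ZT Ty) expr0n gtn_eqF // mul0r.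
move=> _ [U [oU UP Uz]]; have [_ _ irr] := Zi.
have [e1 [q [hq qP qU]]] := hyp_open_basic oU UP.
have hqi := whomogM hq hi.
have cl g e2 : whomog w e2 g -> zclosed (~` [set T : X | nonzero_locus g (sval T)])%classic.
  by move=> hg; rewrite /zclosed setCK; exact: hyp_basic_open hg.
have [|s|s] := irr _ _ (cl _ _ hp) (cl _ _ hqi).
- move=> T ZT; have [y Ty] := wpoint_ex (sval T).
  have [g0|] := eqVneq (q * 'X_i).@[y] 0; first by right => /(_ y Ty); rewrite g0 eqxx.
  rewrite mevalM mevalXU mulf_eq0 negb_or => /andP [qy yi]; left => /(_ y Ty).
  have /eqP := Uz T (qU T y Ty qy) ZT; rewrite (wfracE h1 h2 Ty) mulf_eq0 invr_eq0 !mevalXn mevalXU.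
  by rewrite !expf_eq0 (negPf yi) andbF orbF => /andP [_ ->].
- exact: (s Q ZQ).
- apply: (s P ZP) => y Py; have := nonzero_locusP hi Px; rewrite mevalXU => /(_ xi y Py) yi.
  by rewrite mevalM mulf_neq0 // qP.
Qed.
End VanishingPrimes.

Hypothesis local_bound : forall P : X, ~ has_chain (@prime_ideal k X P) n.+1.

(** All members of a chain contain a point of the smallest one, and their ideals at that point form
    a reversed chain of primes of the same length. *)
Lemma hypersurface_dimension : dimension X n.
Proof.
split; first exact: slice_chain.
move=> [Z [iZ sZ]]; have [_ [P P0] _] := iZ 0%N isT.
have ZP i : (i <= n.+1)%N -> Z i P.
  by elim: i => [//|i IH] lt; have [sub _] := sZ i lt; apply: sub; apply: IH; exact: ltnW.
apply: (local_bound (P := P)); exists (fun i => vanishing_ideal P (Z (n.+1 - i)%N)); split=> i le.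
  by apply: vanishing_prime; [apply: iZ | apply: ZP]; exact: leq_subr.
apply: vanishing_proper.
- by apply: iZ; exact: leq_subr.
- by apply: ZP; exact: leq_subr.
- by have [] := iZ (n.+1 - i.+1)%N (leq_subr _ _).
- by rewrite -(subnSK le); apply: sZ; rewrite subSS ltnS leq_subr.
Qed.

Lemma hypersurface_irreducible : irreducible X.
Proof.
rewrite /irreducible (_ : setT = slice 0); first exact: slice_irreducible.
by apply/seteqP; split=> // P _ x Px j.
Qed.
End Dimension.

(** * The canonical bundle *)

Section FramedDeterminant.
Variables (k : fieldType) (n : nat) (E : 'cV[k]_n.+2) (v : 'rV[k]_n.+2).
Hypothesis E0 : E != 0.
Hypothesis vE : v *m E = 0.

(** In the application [E] is the Euler vector, [v] the gradient of the equation, [mu] a covector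
    with value 1 on [E], and the rows of [V] are differentials of functions: the determinant
    compares their wedge product with the Poincare residue. *)
Definition framed_det (mu : 'rV[k]_n.+2) (V : 'M[k]_(n, n.+2)) : k :=
  \det (col_mx mu (col_mx v V) : 'M_n.+2).

(** All rows of [V] and the row [v] kill [E]. If [mu] and [mu'] agree on [E], their difference gives
    a matrix with kernel vector [E], so the choice of [mu] does not matter. *)
Lemma framed_det_change mu mu' (A : 'M_n) (c : 'cV_n) (V : 'M_(n, n.+2)) :
  V *m E = 0 -> mu *m E = mu' *m E ->
  framed_det mu (A *m V + c *m v) = \det A * framed_det mu' V.
Proof.
move=> VE muE; transitivity (\det A * framed_det mu V).
  pose T : 'M_(1 + (1 + n)) := block_mx 1%:M 0 0 (block_mx 1%:M 0 c A).
  have dT : \det T = \det A by rewrite /T (@det_ublock _ 1 (1 + n)) det1 mul1r (@det_lblock _ 1 n) det1 mul1r.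
  rewrite -dT /framed_det -[RHS](@det_mulmx _ n.+2 T (col_mx mu (col_mx v V))); congr (\det _).
  apply: esym; rewrite /T; apply: etrans (@mul_block_col _ 1 (1 + n) 1 (1 + n) n.+2 _ _ _ _ _ _) _.
  rewrite !mul1mx !mul0mx addr0 add0r; congr col_mx.
  apply: etrans (@mul_block_col _ 1 n 1 n n.+2 _ _ _ _ _ _) _.
  by rewrite !mul1mx mul0mx addr0 addrC.
congr (_ * _); apply/eqP; rewrite -subr_eq0; apply/eqP.
have <- : framed_det (mu - mu') V = 0.
  apply: contraNeq E0 => d0; pose B : 'M[k]_n.+2 := (col_mx (mu - mu') (col_mx v V) : 'M_(1 + (1 + n), n.+2)).
  have Bu : B \in unitmx by rewrite unitmxE unitfE; exact: d0.
  rewrite -(mulKmx Bu E); have -> : B *m E = 0.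
    rewrite /B; apply: etrans (@mul_col_mx _ 1 (1 + n) n.+2 1 _ _ _) _.
    by rewrite mul_col_mx mulmxBl muE subrr vE VE !col_mx0.
  by rewrite mulmx0.
pose C (a : 'rV[k]_n.+2) : 'M[k]_n.+2 := (col_mx a (col_mx v V) : 'M_(1 + (1 + n), n.+2)).
have rE a : row ord0 (C a) = a.
  have o0 : ord0 = lshift (1 + n) (ord0 : 'I_1) :> 'I_(1 + (1 + n)) by exact: val_inj.
  by apply/rowP => j; rewrite mxE /C o0; exact: (@col_mxEu _ 1 (1 + n)).
have r'E a a' : row' ord0 (C a) = row' ord0 (C a').
  apply/matrixP => i j; rewrite [LHS]mxE [RHS]mxE.
  have -> : lift ord0 i = rshift 1 i :> 'I_(1 + (1 + n)) by exact: val_inj.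
  by rewrite /C; apply: etrans (@col_mxEd _ 1 (1 + n) n.+2 _ _ _ _) (esym (@col_mxEd _ 1 (1 + n) n.+2 _ _ _ _)).
rewrite -[framed_det mu V]/(\det (C mu)) -[framed_det mu' V]/(\det (C mu')) -[framed_det (mu - mu') V]/(\det (C (mu - mu'))).
rewrite [RHS](determinant_multilinear (B := C mu) (C := C mu') (i0 := ord0) (b := 1) (c := -1)).
- by rewrite mul1r mulN1r.
- by rewrite !rE scale1r scaleN1r.
- exact: r'E.
- exact: r'E.
Qed.
End FramedDeterminant.

Section Differentials.
Variables (k : closedFieldType) (n m d : nat) (w : 'I_n.+2 -> nat) (f : {mpoly k[n.+2]}).
Hypothesis fm : ymonic m.+1 f.
Hypothesis fp : mprime f.
Hypothesis fh : whomog w d f.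
Local Notation X := (hypersurface w f).
Local Notation vec := ('I_n.+2 -> k).

Definition gradient (g : {mpoly k[n.+2]}) (x : vec) : 'rV[k]_n.+2 := \row_j g^`M(j).@[x].
Definition euler_vec (x : vec) : 'cV[k]_n.+2 := \col_j ((w j)%:R * x j).
(** The quotient rule for [g / p], read as a covector on the affine cone. *)
Definition frac_diff (g p : {mpoly k[n.+2]}) (x : vec) : 'rV[k]_n.+2 :=
  p.@[x]^-1 *: (gradient g x - (g.@[x] / p.@[x]) *: gradient p x).

Lemma gradientD g h x : gradient (g + h) x = gradient g x + gradient h x.
Proof. by apply/rowP => j; rewrite !mxE mderivD mevalD. Qed.
Lemma gradientB g h x : gradient (g - h) x = gradient g x - gradient h x.
Proof. by apply/rowP => j; rewrite !mxE mderivB mevalB. Qed.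
Lemma gradientM g h x : gradient (g * h) x = h.@[x] *: gradient g x + g.@[x] *: gradient h x.
Proof. by apply/rowP => j; rewrite !mxE mderivM mevalD !mevalM mulrC. Qed.
Lemma gradientC c x : gradient c%:MP x = 0.
Proof. by apply/rowP => j; rewrite !mxE mderivC meval0. Qed.

Lemma gradient_euler e g x : whomog w e g -> gradient g x *m euler_vec x = (e%:R * g.@[x])%:M.
Proof.
move=> hg; apply/matrixP => i j; rewrite !ord1 !mxE mulr1n meval_mev -(euler idfun x hg).
by apply: eq_bigr => t _; rewrite !mxE meval_mev; ring.
Qed.

Section AtPoint.
Variables (P : X) (x : vec).
Hypothesis Px : sval (sval P) x.

(** A relation and not a function: fractions for the same germ have covectors that differ by
    multiples of the gradient of [f]. *)
Definition differential (phi : X -> k) v := exists e g p, germ_frac x phi e g p /\ v = frac_diff g p x.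

Lemma differential_ex phi : stalk P phi -> exists v, differential phi v.
Proof. by move=> /(stalk_frac Px) [e [g [p F]]]; exists (frac_diff g p x), e, g, p. Qed.

Lemma frac_value phi e g p : germ_frac x phi e g p -> g.@[x] / p.@[x] = phi P.
Proof. by move=> [_ _ px pE]; rewrite (pE P x Px px). Qed.

Lemma differential_euler phi v : differential phi v -> v *m euler_vec x = 0.
Proof.
move=> [e [g [p [[hg hp px _] ->]]]]; rewrite -scalemxAl mulmxBl -scalemxAl !(gradient_euler _ hg, gradient_euler _ hp).
rewrite -scale_scalar_mx; apply/matrixP => i j; rewrite !ord1 !mxE !mulr1n.
by field.
Qed.

Lemma differential_eq phi psi v u : germ_eq P phi psi -> differential phi v -> differential psi u ->
  exists c, v = u + c *: gradient f x.
Proof.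
move=> E [e [g [p [F ->]]]] [e' [g' [p' [F' ->]]]].
have [q qE] := germ_eq_dvd fm fp fh Px F F' E.
have fx := hyp_vanish Px; have [_ _ px _] := F; have [_ _ px' _] := F'.
have v1 := frac_value F; have v2 := frac_value F'.
have PQ : phi P = psi P by case: E => U [_ UP UE]; exact: UE.
exists (q.@[x] / (p.@[x] * p'.@[x])).
have := congr1 (fun h => gradient h x) qE; rewrite gradientB !gradientM fx scale0r add0r.
have gE : g.@[x] = psi P * p.@[x] by rewrite -PQ -v1 divfK.
have gE' : g'.@[x] = psi P * p'.@[x] by rewrite -v2 divfK.
rewrite /frac_diff v1 v2 PQ gE gE'.
move: (gradient g x) (gradient g' x) (gradient p x) (gradient p' x) (gradient f x) => G G' R R' D H.
have {}H : q.@[x] *: D = p'.@[x] *: G + (psi P * p.@[x]) *: R' - (p.@[x] *: G' + (psi P * p'.@[x]) *: R) by rewrite H.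
rewrite mulrC -scalerA H; apply/rowP => j; rewrite !mxE; move: (G 0 j) (G' 0 j) (R 0 j) (R' 0 j) => a b c c'.
by move: (psi P) px px'; move: (p.@[x]) (p'.@[x]) => s t z s0 t0; field; rewrite s0 t0.
Qed.

Lemma differentialC c : differential (fun=> c) 0.
Proof.
exists 0%N, c%:MP, 1; split; first exact: cst_frac.
by rewrite /frac_diff -mpolyC1 !gradientC scaler0 subr0 scaler0.
Qed.

Lemma differentialD phi psi v u : differential phi v -> differential psi u ->
  differential (fun Q => phi Q + psi Q) (v + u).
Proof.
move=> [e [g [p [F ->]]]] [e' [g' [p' [F' ->]]]]; have [_ _ px _] := F; have [_ _ px' _] := F'.
exists (e + e')%N, (g * p' + g' * p), (p * p'); split; first exact: frac_add.
rewrite /frac_diff !gradientD !gradientM mevalD !mevalM; apply/rowP => j; rewrite !mxE.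
by field; rewrite px px'.
Qed.

Lemma differentialM phi psi v u : differential phi v -> differential psi u ->
  differential (fun Q => phi Q * psi Q) (phi P *: u + psi P *: v).
Proof.
move=> [e [g [p [F ->]]]] [e' [g' [p' [F' ->]]]]; have [_ _ px _] := F; have [_ _ px' _] := F'.
exists (e + e')%N, (g * g'), (p * p'); split; first exact: frac_mul.
rewrite /frac_diff -(frac_value F) -(frac_value F') !gradientM !mevalM; apply/rowP => j; rewrite !mxE.
by field; rewrite px px'.
Qed.

Lemma differential_sum (I : Type) (s : seq I) (g h : I -> X -> k) (v u : I -> 'rV_n.+2) :
  (forall i, differential (g i) (v i)) -> (forall i, differential (h i) (u i)) ->
  differential (fun Q => \sum_(i <- s) g i Q * h i Q) (\sum_(i <- s) (g i P *: u i + h i P *: v i)).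
Proof.
move=> dg dh; elim: s => [|i s IH].
  by rewrite big_nil (_ : (fun Q => _) = fun=> 0); [exact: differentialC | apply/funext => Q; rewrite big_nil].
rewrite big_cons (_ : (fun Q => _) = fun Q => g i Q * h i Q + \sum_(j <- s) g j Q * h j Q).
  exact: differentialD (differentialM (dg i) (dh i)) IH.
by apply/funext => Q; rewrite big_cons.
Qed.

Lemma differential_sq phi v : maximal_ideal_sq P phi -> differential phi v -> exists c, v = c *: gradient f x.
Proof.
move=> [r [g [h [gh E]]]] dv.
have /choice [vg vgP] := fun i => differential_ex (gh i).1.1.
have /choice [vh vhP] := fun i => differential_ex (gh i).2.1.
have [c ->] := differential_eq E dv (differential_sum (index_enum _) vgP vhP); exists c.
by rewrite big1 ?add0r // => i _; rewrite (gh i).1.2 (gh i).2.2 !scale0r addr0.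
Qed.

Lemma coordinates_span (t : 'I_n -> X -> k) (V : 'M_(n, n.+2)) phi v : local_coordinates P t ->
  (forall i, differential (t i) (row i V)) -> differential phi v ->
  exists (a : 'rV_n) c, v = a *m V + c *: gradient f x.
Proof.
move=> [tm gen] dV dv.
have dphi : differential (fun Q => phi Q + - phi P) v by rewrite -[v]addr0; exact: differentialD (differentialC _).
have [|c [sc E]] := gen (fun Q => phi Q + - phi P).
  split; last by rewrite subrr.
  by have [e [g [p [F _]]]] := dphi; exact: frac_stalk F.
have /choice [u uP] := fun i => differential_ex (sc i).
have dt i : differential (fun Q => t i Q - t i P) (row i V).
  by rewrite -[row i V]addr0; exact: differentialD (differentialC _).
have [c0 ->] := differential_eq E dphi (differential_sum (index_enum _) uP dt).
exists (\row_i c i P), c0; congr (_ + _); rewrite mulmx_sum_row; apply: eq_bigr => i _.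
by rewrite subrr scale0r addr0 mxE.
Qed.

Lemma jacobian_differential (t u : 'I_n -> X -> k) (T U : 'M_(n, n.+2)) : local_coordinates P u ->
  (forall i, differential (t i) (row i T)) -> (forall i, differential (u i) (row i U)) ->
  exists c, T = jacobian P t u *m U + c *m gradient f x.
Proof.
move=> cu dT dU; have [um gen] := cu.
have st i : stalk P (t i) by have [e [g [p [F _]]]] := dT i; exact: frac_stalk F.
have : exists A : 'M[k]_n, forall i, maximal_ideal_sq P (fun Q =>
    t i Q - t i P - \sum_j A i j * (u j Q - u j P)).
  have /choice [c cP] : forall i, exists c : 'I_n -> X -> k, (forall j, stalk P (c j)) /\
      germ_eq P (fun Q => t i Q - t i P) (fun Q => \sum_j c j Q * (u j Q - u j P)).
    move=> i; apply: gen; split; last by rewrite subrr.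
    by apply: stalkD => //; exact: stalk_cst.
  exists (\matrix_(i, j) c i j P) => i; have [sc [W [oW WP WE]]] := cP i.
  exists n, (fun j Q => c i j Q - c i j P), (fun j Q => u j Q - u j P); split.
    move=> j; split; last exact: um.
    by split; [apply: stalkD => //; exact: stalk_cst | rewrite subrr].
  exists W; split=> // Q WQ; rewrite WE // -sumrB; apply: eq_bigr => j _.
  by rewrite mxE mulrBl.
move=> /(xgetPex 0); rewrite -/(jacobian P t u) => J.
have /choice [c cP] : forall i, exists c, row i T - \sum_j jacobian P t u i j *: row j U = c *: gradient f x.
  move=> i; apply: (differential_sq (J i)).
  have -> : (fun Q => t i Q - t i P - \sum_j jacobian P t u i j * (u j Q - u j P)) =
      fun Q => t i Q + - t i P + \sum_j - jacobian P t u i j * (u j Q - u j P).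
    by apply/funext => Q; rewrite -sumrN; congr (_ + _); apply: eq_bigr => j _; rewrite mulNr.
  rewrite -[row i T]addr0 -sumrN; apply: differentialD; first exact: differentialD (differentialC _).
  have dt j : differential (fun Q => u j Q - u j P) (row j U).
    by rewrite -[row j U]addr0; exact: differentialD (differentialC _).
  have := differential_sum (index_enum _) (fun j => differentialC (- jacobian P t u i j)) dt.
  congr differential; apply: eq_bigr => j _; by rewrite subrr scale0r addr0 scaleNr.
exists (\col_i c i); apply/row_matrixP => i.
rewrite -[LHS](subrK (\sum_j jacobian P t u i j *: row j U)) cP addrC linearD /= !row_mul.
congr (_ + _); first by rewrite mulmx_sum_row; apply: eq_bigr => j _; rewrite mxE.
by rewrite [row i _](_ : _ = (c i)%:M) ?mul_scalar_mx //; apply/matrixP => a b; rewrite !ord1 !mxE eqxx mulr1n.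
Qed.
End AtPoint.
End Differentials.

Lemma whomog_det (k : fieldType) (n : nat) (w r : 'I_n -> nat) (B : 'M[{mpoly k[n]}]_n) :
  (forall i j, whomog w (r i - w j) (B i j)) -> (forall i j, (r i < w j)%N -> B i j = 0) ->
  (\sum_i w i <= \sum_i r i)%N -> whomog w (\sum_i r i - \sum_i w i) (\det B).
Proof.
move=> Bh B0 le; rewrite /determinant; apply: whomog_sum => s _.
have {}Bh : whomog w (\sum_i r i - \sum_i w i) (\prod_i B i (s i)).
  have [/existsP [i lt]|/existsPn h] := boolP [exists i, (r i < w (s i))%N].
    have -> : \prod_i B i (s i) = 0 by apply/eqP/prodf_eq0; exists i => //; rewrite B0.
    exact: whomog0.
  have -> : (\sum_i r i - \sum_i w i = \sum_i (r i - w (s i)))%N.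
    rewrite [X in (_ - X)%N](reindex_inj (@perm_inj _ s)) /=.
    apply: (@addIn (\sum_i w (s i))); rewrite -big_split /= subnK.
      by apply: eq_bigr => i _; rewrite subnK // leqNgt h.
    by move: le; rewrite [X in (X <= _)%N](reindex_inj (@perm_inj _ s)).
  by apply: whomog_prod => i _.
by case: (odd_perm s); rewrite ?expr1 ?expr0 ?mulN1r ?mul1r //; exact: whomogN.
Qed.

Lemma det_low (R : comNzRingType) (n : nat) (w r : 'I_n -> nat) (B : 'M[R]_n) :
  (forall i j, (r i < w j)%N -> B i j = 0) -> (\sum_i r i < \sum_i w i)%N -> \det B = 0.
Proof.
move=> B0 lt; rewrite /determinant big1 // => s _.
have [/existsP [i ri]|/existsPn h] := boolP [exists i, (r i < w (s i))%N].
  by rewrite (bigD1 i) //= (B0 i (s i)) // mul0r mulr0.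
move: lt; rewrite [X in (_ < X)%N](reindex_inj (@perm_inj _ s)) ltnNge => /negP [].
by apply: leq_sum => i _; rewrite leqNgt h.
Qed.

Section Kappa.
Variables (k : closedFieldType) (n m d : nat) (w : 'I_n.+2 -> nat) (f : {mpoly k[n.+2]}).
Hypothesis fm : ymonic m.+1 f.
Hypothesis fp : mprime f.
Hypothesis fh : whomog w d f.
Hypothesis w_gt0 : forall i, (0 < w i)%N.
Hypothesis w_neq0 : forall i, (w i)%:R != 0 :> k.
Hypothesis unit_ratio : forall x, (exists i, x i != 0) -> f.@[x] = 0 -> exists e0 M1 M2,
  [/\ whomog w e0.+1 M1, whomog w e0 M2, M1.@[x] != 0 & M2.@[x] != 0].
Local Notation X := (hypersurface w f).
Local Notation vec := ('I_n.+2 -> k).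
Local Notation E := (euler_vec w).

Lemma gradientX g e (x : vec) : gradient (g ^+ e.+1) x = (e.+1%:R * g.@[x] ^+ e) *: gradient g x.
Proof.
apply/rowP => j; rewrite !mxE (derX (mderiv_derivation k j)) mevalMn mevalM mevalXn /=.
by rewrite -mulr_natr; ring.
Qed.

Lemma gradient_var j (x : vec) (z : 'cV[k]_n.+2) : gradient 'X_j x *m z = (z j 0)%:M.
Proof.
apply/matrixP => a b; rewrite !ord1 !mxE mulr1n (bigD1 j) //= big1 => [|i ij].
  by rewrite addr0 !mxE mderiv_var eqxx meval1 mul1r.
by rewrite !mxE mderiv_var (negPf ij) meval0 mul0r.
Qed.

Section Point.
Variables (P : X) (x : vec).
Hypothesis Px : sval (sval P) x.

Let fx : f.@[x] = 0. Proof. exact: hyp_vanish Px. Qed.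

Lemma euler_vec_neq0 : E x != 0.
Proof.
have [i xi] := rep_neq0 Px; apply: contraNneq xi => /colP /(_ i); rewrite !mxE => /eqP.
by rewrite mulf_eq0 (negPf (w_neq0 i)).
Qed.

Lemma gradient_f_euler : gradient f x *m E x = 0.
Proof. by rewrite (gradient_euler _ fh) fx mulr0 raddf0. Qed.

Definition kap_spec (t : 'I_n -> X -> k) c := exists V mu,
  [/\ forall i, differential x (t i) (row i V), mu *m E x = 1%:M & c = framed_det (gradient f x) mu V].

Lemma rows_euler (t : 'I_n -> X -> k) V : (forall i, differential x (t i) (row i V)) -> V *m E x = 0.
Proof. by move=> dV; apply/row_matrixP => i; rewrite row_mul (differential_euler (dV i)) row0. Qed.

Lemma kap_uniq t c c' : kap_spec t c -> kap_spec t c' -> c = c'.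
Proof.
move=> [V [mu [dV muE ->]]] [V' [mu' [dV' muE' ->]]].
have /choice [a aP] : forall i, exists a, row i V = row i V' + a *: gradient f x.
  move=> i; apply: (differential_eq fm fp fh Px _ (dV i) (dV' i)); exists setT; split=> //; exact: zopenT.
have -> : V = 1%:M *m V' + (\col_i a i) *m gradient f x.
  apply/row_matrixP => i; rewrite aP mul1mx linearD /= row_mul; congr (_ + _).
  by rewrite [row i (\col_i _)](_ : _ = (a i)%:M) ?mul_scalar_mx //; apply/matrixP => s t'; rewrite !ord1 !mxE eqxx mulr1n.
rewrite (framed_det_change euler_vec_neq0 gradient_f_euler _ _ (rows_euler dV') (etrans muE (esym muE'))).
by rewrite det1 mul1r.
Qed.

Lemma kap_change t u c c' : local_coordinates P u -> kap_spec t c -> kap_spec u c' ->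
  c = \det (jacobian P t u) * c'.
Proof.
move=> cu [V [mu [dV muE ->]]] [V' [mu' [dV' muE' ->]]].
have [a ->] := jacobian_differential fm fp fh Px cu dV dV'.
exact: (framed_det_change euler_vec_neq0 gradient_f_euler _ _ (rows_euler dV') (etrans muE (esym muE'))).
Qed.

(** A vector killed by all rows is killed by the differential of every regular function, since the
    [t i] are coordinates. Then it is a multiple of the Euler vector, on which [mu] is nonzero. *)
Lemma kap_neq0 t c : local_coordinates P t -> kap_spec t c -> c != 0.
Proof.
move=> ct [V [mu [dV muE ->]]]; apply/negP; rewrite /framed_det -det_tr => /det0P [v v0 vB].
pose z := v^T; have z0 : z != 0 by rewrite /z -(inj_eq (@trmx_inj _ _ _)) trmxK trmx0.
have : (col_mx mu (col_mx (gradient f x) V) : 'M_(1 + (1 + n), n.+2)) *m z = 0.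
  by apply: trmx_inj; rewrite trmx_mul trmxK trmx0.
rewrite !mul_col_mx => E0; have muz : mu *m z = 0 by have := congr1 usubmx E0; rewrite col_mxKu linear0.
have := congr1 dsubmx E0; rewrite col_mxKd linear0 => {}E0.
have fz : gradient f x *m z = 0 by have := congr1 usubmx E0; rewrite col_mxKu linear0.
have Vz : V *m z = 0 by have := congr1 dsubmx E0; rewrite col_mxKd linear0.
have kills e g p : whomog w e g -> whomog w e p -> p.@[x] != 0 ->
    gradient g x *m z = (g.@[x] / p.@[x]) *: (gradient p x *m z).
  move=> hg hp px; have F := wfrac_frac f hg hp px.
  have dF : differential x (fun Q : X => wfrac g p (sval Q)) (frac_diff g p x) by exists e, g, p.
  have [a [b ab]] := coordinates_span fm fp fh Px ct dV dF.
  have : frac_diff g p x *m z = 0 by rewrite ab mulmxDl -mulmxA Vz mulmx0 -scalemxAl fz scaler0 addr0.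
  rewrite /frac_diff -scalemxAl => /eqP; rewrite scaler_eq0 invr_eq0 (negPf px) /= mulmxBl -scalemxAl subr_eq0.
  by move=> /eqP.
have [e0 [M1 [M2 [h1 h2 x1 x2]]]] := unit_ratio (rep_neq0 Px) fx.
pose a1 := (gradient M1 x *m z) 0 0 / M1.@[x]; pose a2 := (gradient M2 x *m z) 0 0 / M2.@[x].
(* The functions [X_j / u^(w_j)] with [u = M1 / M2] determine each entry of [z] from its logarithmic
   effects [a1] and [a2] on the two forms. *)
have zE : z = (a1 - a2) *: E x.
  apply/colP => j; have xw : (M1 ^+ w j).@[x] != 0 by rewrite mevalXn expf_neq0.
  have := kills _ _ _ (coord_num_homog h2 j) (whomogXn (w j) h1) xw.
  have [e we] : exists e, w j = e.+1 by exists (w j).-1; rewrite prednK.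
  rewrite /coord_num we gradientM !gradientX mulmxDl -!scalemxAl gradient_var => H.
  rewrite [RHS]mxE [(E x) j 0]mxE we /a1 /a2; move: H; rewrite !mevalM !mevalXn mevalXU.
  move: (gradient M1 x *m z) (gradient M2 x *m z) (z j 0) (x j) => A1 A2 zj xj.
  move=> /(congr1 (fun B : 'M_1 => B 0 0)); rewrite !mxE mulr1n; move: (A1 0 0) (A2 0 0) => {}A1 {}A2.
  move: (M1.@[x]) (M2.@[x]) (e.+1%:R) x1 x2 => y1 y2 c1 n1 n2 H.
  apply: (mulfI (expf_neq0 e.+1 n2)); apply: (addIr (xj * (c1 * y2 ^+ e * A2))); rewrite H !exprS.
  by move: (y1 ^+ e) (y2 ^+ e) (expf_neq0 e n1) => s1 s2 s0; field; rewrite n1 n2 s0.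
case/eqP: z0; rewrite zE; move: muz; rewrite zE -scalemxAr muE => /(congr1 (fun B : 'M_1 => B 0 0)).
by rewrite !mxE mulr1 => ->; rewrite scale0r.
Qed.

Lemma kap_ex t : (forall i, stalk P (t i)) -> exists c, kap_spec t c.
Proof.
move=> st; have /choice [v vP] := fun i => differential_ex Px (st i).
have [j Ej] : exists j, E x j 0 != 0.
  apply: contrapT => h; case/eqP: euler_vec_neq0; apply/colP => j; rewrite [RHS]mxE.
  by apply/eqP/negPn/negP => nz; apply: h; exists j.
pose V : 'M_(n, n.+2) := \matrix_i v i; pose mu := (E x j 0)^-1 *: delta_mx (0 : 'I_1) j.
exists (framed_det (gradient f x) mu V), V, mu; split=> //; first by move=> i; rewrite rowK.
rewrite /mu -scalemxAl -rowE; apply/matrixP => s s'; rewrite !ord1 [LHS]mxE [X in _ * X]mxE mulVf //.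
by rewrite mxE.
Qed.
End Point.

(** The coefficient of the frame given by [t] with respect to the Poincare residue. It has weight
    [d] minus the sum of the weights, so it is evaluated at the chosen representative; its products
    with forms of the opposite weight are functions on [X]. *)
Definition kap (t : 'I_n -> X -> k) (P : X) : k :=
  xget 0 [set c | kap_spec (rep (sval P)) t c]%classic.

Lemma kapE t P c : kap_spec (rep (sval P)) t c -> kap t P = c.
Proof.
move=> h; have := @xgetPex _ 0 [set c | kap_spec (rep (sval P)) t c]%classic (ex_intro _ c h).
by move=> h'; apply: (kap_uniq (repP (sval P)) h' h).
Qed.

Section Regularity.
Variables (U : set X) (t : 'I_n -> X -> k) (M : {mpoly k[n.+2]}) (m0 D : nat).
Hypothesis m0_gt0 : (0 < m0)%N.
Hypothesis oU : zopen X U.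
Hypothesis rt : forall i, regular X U (t i).
Hypothesis Mh : whomog w D M.
Hypothesis DE : (D + m0 * d = m0 * \sum_i w i)%N.

Let pick2 (T : Type) (a b : T) (c : 'I_n -> T) (i : 'I_n.+2) : T :=
  if unlift ord0 i is Some i' then (if unlift ord0 i' is Some j then c j else b) else a.

Let sum2 (a b : nat) (c : 'I_n -> nat) : (\sum_i pick2 a b c i = a + (b + \sum_i c i))%N.
Proof.
rewrite big_ord_recl /pick2 unlift_none; congr (_ + _)%N.
rewrite big_ord_recl liftK unlift_none; congr (_ + _)%N.
by apply: eq_bigr => i _; rewrite !liftK.
Qed.

(** Locally all rows come from the quotient rule: for [M1 / M2] as a logarithmic differential, for
    [f / 1], and for fractions representing the [t i]. The first one has value 1 on the Euler vector
    because [M1 / M2] has weight 1, so it can serve as [mu]. *)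
Lemma canonical_section_regular : regular X U (fun P => M.@[rep (sval P)] * kap t P ^+ m0).
Proof.
apply: regular_local => P UP.
have /choice [egp egpP] : forall i, exists egp : nat * ({mpoly k[n.+2]} * {mpoly k[n.+2]}),
    [/\ whomog w egp.1 egp.2.1, whomog w egp.1 egp.2.2, forall x, sval (sval P) x -> egp.2.2.@[x] != 0 &
      forall (Q : X) x, sval (sval Q) x -> egp.2.2.@[x] != 0 -> U Q /\ t i Q = egp.2.1.@[x] / egp.2.2.@[x]].
  by move=> i; have [e [g [p h]]] := hyp_regular_frac oU (rt i) UP; exists (e, (g, p)).
have Px := repP (sval P).
have [e0 [M1 [M2 [h1 h2 x1 x2]]]] := unit_ratio (rep_neq0 Px) (hyp_vanish Px).
pose e i := (egp i).1; pose g i := (egp i).2.1; pose p i := (egp i).2.2.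
(* Numerators [G] and denominators [H] of the rows; [S] holds the factors by which the rows of the
   polynomial matrix [B] must be divided. *)
pose G := pick2 M1 f g; pose H := pick2 M2 1 p.
pose eG := pick2 e0.+1 d e; pose eH := pick2 e0 0%N e.
pose S := pick2 (M1 * M2) 1 (fun i => p i * p i); pose eS := pick2 (e0.+1 + e0)%N 0%N (fun i => e i + e i)%N.
have pk (T1 T2 : Type) (R : T1 -> T2 -> Prop) a1 a2 b1 b2 c1 c2 : R a1 b1 -> R a2 b2 ->
    (forall i, R (c1 i) (c2 i)) -> forall i, R (pick2 a1 a2 c1 i) (pick2 b1 b2 c2 i).
  by move=> ? ? ? i; rewrite /pick2; case: unlift => [i'|//]; case: unlift.
have Gh i : whomog w (eG i) (G i).
  by apply: (pk _ _ (fun e g => whomog w e g)) => // j; have [] := egpP j.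
have Hh i : whomog w (eH i) (H i).
  by apply: (pk _ _ (fun e g => whomog w e g)) => // [|j]; [exact: dhomog1 | have [] := egpP j].
have Sh i : whomog w (eS i) (S i).
  apply: (pk _ _ (fun e g => whomog w e g)) => // [||j]; [exact: whomogM | exact: dhomog1 |].
  by apply: whomogM; have [] := egpP j.
pose r i := (eG i + eH i)%N.
pose B : 'M[{mpoly k[n.+2]}]_n.+2 := \matrix_(i, j) (H i * (G i)^`M(j) - G i * (H i)^`M(j)).
have cross e1 e2 (q q' : {mpoly k[n.+2]}) j : whomog w e1 q -> whomog w e2 q' -> whomog w (e1 + e2 - w j) (q' * q^`M(j)).
  move=> hq hq'; have [lt|ge] := ltnP e1 (w j); first by rewrite (mderiv_low hq lt) mulr0; exact: whomog0.
  by rewrite addnC -addnBA //; apply: whomogM => //; exact: whomog_mderiv.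
have Bh i j : whomog w (r i - w j) (B i j).
  by rewrite mxE; apply: whomogB; [exact: cross | rewrite /r addnC; exact: cross].
have B0 i j : (r i < w j)%N -> B i j = 0.
  rewrite mxE /r => lt; rewrite (mderiv_low (Gh i)) ?(mderiv_low (Hh i)) ?mulr0 ?subrr //.
    by apply: leq_ltn_trans lt; exact: leq_addl.
  by apply: leq_ltn_trans lt; exact: leq_addr.
pose SS := \prod_i S i.
have SSh : whomog w (\sum_i eS i) SS by apply: whomog_prod.
have rS : (\sum_i r i = d + \sum_i eS i)%N.
  rewrite /r big_split /= /eG /eH /eS !sum2 big_split /=.
  by move: (\sum_(_ < _) _)%N => s; clear; lia.
have Nh : whomog w (\sum_i eS i * m0) (M * \det B ^+ m0).
  (* When the expected degree of the determinant is negative, some factor of each product vanishes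
     and the determinant is 0. *)
  have [le|lt] := leqP (\sum_i w i) (\sum_i r i).
    have -> : (\sum_i eS i * m0 = D + (\sum_i r i - \sum_i w i) * m0)%N.
      rewrite -big_distrl /=; move: DE le; rewrite rS.
      by move: (\sum_(_ < _) eS _)%N (\sum_(_ < _) w _)%N => s s'; clear; nia.
    by apply: whomogM => //; apply: whomogXn; exact: whomog_det.
  rewrite (@det_low _ _ w r) ?expr0n ?gtn_eqF // mulr0; exact: whomog0.
have Dh : whomog w (\sum_i eS i * m0) (SS ^+ m0) by rewrite -big_distrl; exact: whomogXn.
exists [set Q : X | nonzero_locus SS (sval Q)]%classic, (fun Q => wfrac (M * \det B ^+ m0) (SS ^+ m0) (sval Q)); split.
- exact: hyp_basic_open SSh.
- apply: (nonzero_locusP SSh Px); rewrite rmorph_prod; apply/prodf_neq0 => i _ /=.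
  apply: (pk _ unit (fun q _ => q.@[_] != 0) _ _ tt tt _ (fun=> tt)) => [||j].
  + by rewrite mevalM mulf_neq0.
  + by rewrite meval1 oner_neq0.
  + by have [_ _ h _] := egpP j; rewrite mevalM mulf_neq0 ?h.
- by apply: (hyp_frac_regular Nh Dh) => Q h x Qx; rewrite mevalXn expf_neq0 // h.
- move=> Q UQ SQ; have Qx := repP (sval Q); set x := rep (sval Q) in Qx *.
  have SSx := SQ x Qx; have Sx i : (S i).@[x] != 0 by move: SSx; rewrite rmorph_prod => /prodf_neq0; apply.
  pose C : 'M[k]_n.+2 := \matrix_(i, j) ((S i).@[x]^-1 * (B i j).@[x]).
  have detC : (\det B).@[x] = SS.@[x] * \det C.
    have -> : SS.@[x] = \det (diag_mx (\row_i (S i).@[x])).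
      by rewrite det_diag rmorph_prod; apply: eq_bigr => i _; rewrite mxE.
    rewrite -det_mulmx mul_diag_mx -[LHS](det_map_mx (meval x)); congr (\det _).
    by apply/matrixP => i j; rewrite !mxE mulVKf.
  suff -> : kap t Q = \det C.
    rewrite /wfrac -/x mevalM !mevalXn detC exprMn mulrCA mulrAC divff ?mul1r // expf_neq0 //.
  apply: kapE; rewrite -/x.
  pose C' : 'M[k]_(1 + (1 + n), n.+2) := C.
  exists (dsubmx (dsubmx C')), (usubmx C').
  have p0 (T : Type) a1 a2 (c0 : 'I_n -> T) : pick2 a1 a2 c0 ord0 = a1 by rewrite /pick2 unlift_none.
  have p1 (T : Type) a1 a2 (c0 : 'I_n -> T) : pick2 a1 a2 c0 (lift ord0 ord0) = a2.
    by rewrite /pick2 liftK unlift_none.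
  have pS (T : Type) a1 a2 (c0 : 'I_n -> T) i : pick2 a1 a2 c0 (lift ord0 (lift ord0 i)) = c0 i.
    by rewrite /pick2 !liftK.
  have C0 i j : usubmx C' i j = C ord0 j.
    by rewrite mxE; congr (C _ j); apply: ord_inj; rewrite /= ord1.
  have C1 i j : usubmx (dsubmx C') i j = C (lift ord0 ord0) j.
    by rewrite 2!mxE; congr (C _ j); apply: ord_inj; rewrite /= ord1.
  have CS i j : dsubmx (dsubmx C') i j = C (lift ord0 (lift ord0 i)) j.
    by rewrite 2!mxE; congr (C _ j); exact: ord_inj.
  split.
  + move=> i; have [hg hp _ pE] := egpP i.
    have px : (p i).@[x] != 0 by have := Sx (lift ord0 (lift ord0 i)); rewrite /S pS mevalM mulf_eq0 orbb.
    exists (e i), (g i), (p i); split; first by split=> // T y Ty py; have [] := pE T y Ty py.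
    apply/rowP => j; rewrite mxE CS !mxE /S /G /H !pS mevalB !mevalM.
    by move: px; move: (p i).@[x] => y py; field.
  + apply/matrixP => i j; rewrite !ord1 mxE [RHS]mxE eqxx.
    have := gradient_euler x h1; have := gradient_euler x h2.
    have := Sx ord0; rewrite /S p0 mevalM mulf_eq0 negb_or => /andP [y1 y2].
    move=> /(congr1 (fun B : 'M_1 => B 0 0)); rewrite !mxE !mulr1n => E2.
    move=> /(congr1 (fun B : 'M_1 => B 0 0)); rewrite !mxE !mulr1n => E1.
    have -> : \sum_j usubmx C' 0 j * E x j 0 = (M1.@[x] * M2.@[x])^-1 * (M2.@[x] * (\sum_j gradient M1 x 0 j * E x j 0)
        - M1.@[x] * (\sum_j gradient M2 x 0 j * E x j 0)).
      have msum (V : 'I_n.+2 -> k) c : c * (\sum_i V i) = \sum_i c * V i by rewrite mulr_sumr.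
      rewrite !msum -sumrB msum; apply: eq_bigr => t' _.
      by rewrite C0 !mxE /S /G /H !p0 mevalB !mevalM; ring.
    rewrite E1 E2 -natr1; move: (M1.@[x]) (M2.@[x]) y1 y2 => a1 a2 n1 n2.
    by field; rewrite n1 n2.
  + rewrite /framed_det; have -> : gradient f x = usubmx (dsubmx C').
      apply/rowP => j; rewrite C1 !mxE /S /G /H !p1 meval1 invr1 mul1r mevalB !mevalM meval1 mul1r.
      by rewrite -mpolyC1 mderivC meval0 mulr0 subr0.
    by rewrite vsubmxK vsubmxK.
Qed.
End Regularity.
End Kappa.

(** * The monomial embedding *)

Lemma sval_congr (k : fieldType) N (w : 'I_N -> nat) (Q : wpoint k w) x y : x =1 y -> sval Q x -> sval Q y.
Proof. by move=> /funext ->. Qed.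

Section MonomialEmbedding.
Variables (k : closedFieldType) (n d Dl N : nat) (w : 'I_n.+2 -> nat) (f : {mpoly k[n.+2]}).
Hypothesis fh : whomog w d f.
Hypothesis w_gt0 : forall i, (0 < w i)%N.
Hypothesis Dl0 : (0 < Dl)%N.
Hypothesis wDl : forall i, (w i %| Dl)%N.
Hypothesis wd : forall i, (w i %| d)%N.
Hypothesis dDl : (d <= Dl)%N.
Hypothesis axis_coef : forall i, w i != 1%N -> f@_(U_(i) *+ (d %/ w i)) != 0.
Hypothesis unit_monos : forall S : 'I_n.+2 -> Prop, (exists i, S i) ->
  (forall i, w i != 1%N -> exists2 j, j != i & S j) -> exists e0 (M1 M2 : 'X_{1..n.+2}),
  [/\ wdeg w M1 = e0.+1, wdeg w M2 = e0, forall i, (0 < M1 i)%N -> S i & forall i, (0 < M2 i)%N -> S i].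
Variable mo : 'I_N.+1 -> 'X_{1..n.+2}.
Hypothesis mo_wdeg : forall i, wdeg w (mo i) = Dl.
Hypothesis mo_inj : injective mo.
Hypothesis mo_onto : forall M, wdeg w M = Dl -> exists i, mo i = M.
Hypothesis decompose : forall l M, wdeg w M = (Dl * l)%N ->
  exists2 s : seq 'I_N.+1, size s = l & (\sum_(i <- s) mo i)%MM = M.
Local Notation X := (hypersurface w f).
Local Notation PP := (proj k N).
Local Notation "x ^^ M" := ('X_[M].@[x]) (at level 30).

Lemma monoE (x : 'I_n.+2 -> k) M : x ^^ M = \prod_i x i ^+ M i.
Proof. by rewrite mevalX. Qed.

Lemma monoD (x : 'I_n.+2 -> k) M K : x ^^ (M + K)%MM = x ^^ M * x ^^ K.
Proof. by rewrite mpolyXD mevalM. Qed.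

Lemma mono_seq (x : 'I_n.+2 -> k) (I : Type) (s : seq I) (F : I -> 'X_{1..n.+2}) :
  x ^^ (\sum_(i <- s) F i)%MM = \prod_(i <- s) x ^^ (F i).
Proof.
elim: s => [|i s IH]; first by rewrite !big_nil mpolyX0 meval1.
by rewrite !big_cons monoD IH.
Qed.

Lemma wdeg_sum (I : Type) (s : seq I) (F : I -> 'X_{1..n.+2}) :
  wdeg w (\sum_(i <- s) F i)%MM = (\sum_(i <- s) wdeg w (F i))%N.
Proof.
by elim: s => [|i s IH]; rewrite ?big_nil ?big_cons ?wdeg0 // wdegD IH.
Qed.

Lemma wdegMn M e : wdeg w (M *+ e)%MM = (wdeg w M * e)%N.
Proof. by rewrite /wdeg big_distrl; apply: eq_bigr => i _; rewrite mulmnE mulnA. Qed.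

Lemma mnm_expand (M : 'X_{1..n.+2}) e : (M *+ e)%MM = (\sum_i (U_(i) *+ e) *+ M i)%MM.
Proof.
apply/mnmP => j; rewrite mnm_sumE (bigD1 j) //= big1 ?addn0 => [|i ij].
  by rewrite !mulmnE mnm1E eqxx mul1n mulnC.
by rewrite !mulmnE mnm1E (negPf ij) !mul0n.
Qed.

(** The binomial equations of the toric variety parametrized by the monomials [mo]; [on_f] adds the
    linear equations given by the monomial multiples of [f] in degree [Dl]. *)
Definition toric (z : 'I_N.+1 -> k) := forall s t : seq 'I_N.+1, size s = size t ->
  (\sum_(i <- s) mo i)%MM = (\sum_(i <- t) mo i)%MM -> \prod_(i <- s) z i = \prod_(i <- t) z i.
Definition on_f (z : 'I_N.+1 -> k) := forall R, (wdeg w R + d = Dl)%N ->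
  \sum_i (f * 'X_[R])@_(mo i) * z i = 0.

Lemma mo_expand g (x : 'I_n.+2 -> k) : whomog w Dl g -> g.@[x] = \sum_i g@_(mo i) * x ^^ (mo i).
Proof.
move=> gh; have E : g = \sum_i g@_(mo i) *: 'X_[mo i].
  apply/mpolyP => M; rewrite raddf_sum /=; have [wM|wM] := eqVneq (wdeg w M) Dl.
    have [i <-] := mo_onto wM; rewrite (bigD1 i) //= mcoeffZ mcoeffX eqxx mulr1 big1 ?addr0 // => t ti.
    by rewrite mcoeffZ mcoeffX (inj_eq mo_inj) (negPf ti) mulr0.
  rewrite big1 => [|i _]; last by rewrite mcoeffZ mcoeffX; case: eqP => [E|]; rewrite ?mulr0 //; case/eqP: wM; rewrite -E mo_wdeg.
  by apply/eqP/negPn/negP => nz'; move/whomogP: gh => /(_ M nz') /eqP; rewrite (negPf wM).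
by rewrite {1}E raddf_sum; apply: eq_bigr => i _ /=; rewrite mevalZ.
Qed.

Section Reconstruction.
Variable z : 'I_N.+1 -> k.
Hypotheses (zt : toric z) (zf : on_f z) (z0 : exists i, z i != 0).

(** [z] extended multiplicatively to monomials of degree [Dl * l]; [toric] makes the value
    independent of the decomposition. *)
Definition zval l (M : 'X_{1..n.+2}) : k := xget 0 [set c | exists s : seq 'I_N.+1,
  [/\ size s = l, (\sum_(i <- s) mo i)%MM = M & c = \prod_(i <- s) z i]]%classic.

Lemma zvalE l M s : size s = l -> (\sum_(i <- s) mo i)%MM = M -> zval l M = \prod_(i <- s) z i.
Proof.
move=> sl sM; have [|t [tl tM E]] := @xgetPex _ 0 [set c | exists s : seq 'I_N.+1,
  [/\ size s = l, (\sum_(i <- s) mo i)%MM = M & c = \prod_(i <- s) z i]]%classic.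
  by exists (\prod_(i <- s) z i), s.
by rewrite [zval l M]E; apply: zt; rewrite ?sl ?sM.
Qed.

Lemma zvalD l l' M M' : wdeg w M = (Dl * l)%N -> wdeg w M' = (Dl * l')%N ->
  zval (l + l') (M + M')%MM = zval l M * zval l' M'.
Proof.
move=> /decompose [s sl sM] /decompose [t tl tM].
by rewrite (zvalE sl sM) (zvalE tl tM) (@zvalE _ _ (s ++ t)) ?size_cat ?sl ?tl ?big_cat ?sM ?tM.
Qed.

Lemma zval_sum (I : Type) (s : seq I) (l : I -> nat) (M : I -> 'X_{1..n.+2}) :
  (forall i, wdeg w (M i) = (Dl * l i)%N) ->
  zval (\sum_(i <- s) l i)%N (\sum_(i <- s) M i)%MM = \prod_(i <- s) zval (l i) (M i).
Proof.
move=> h; elim: s => [|i s IH]; first by rewrite !big_nil (@zvalE _ _ [::]) ?big_nil.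
rewrite !big_cons zvalD ?IH // wdeg_sum (eq_bigr (fun i => Dl * l i)%N) // big_distrr //=.
Qed.

Lemma zvalMn l M e : wdeg w M = (Dl * l)%N -> zval (l * e) (M *+ e)%MM = zval l M ^+ e.
Proof.
move=> wM; elim: e => [|e IH]; first by rewrite muln0 mulm0n (@zvalE _ _ [::]) ?big_nil.
by rewrite mulnS mulmS zvalD ?IH ?exprS // wdegMn wM mulnA.
Qed.

Lemma zval1 i : zval 1 (mo i) = z i.
Proof. by rewrite (@zvalE _ _ [:: i]) ?big_seq1. Qed.

Local Notation axis i := (zval (w i) (U_(i) *+ Dl)%MM).

Let axis_wdeg i : wdeg w (U_(i) *+ Dl)%MM = (Dl * w i)%N.
Proof. by rewrite wdegUn mulnC. Qed.

Lemma zval_axis l M : wdeg w M = l -> zval l (M *+ Dl)%MM = \prod_i axis i ^+ M i.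
Proof.
move=> wM; rewrite mnm_expand -wM /wdeg.
rewrite (zval_sum (index_enum _) (l := fun i => (w i * M i)%N)) => [|i]; last by rewrite wdegMn axis_wdeg mulnA.
by apply: eq_bigr => i _; rewrite zvalMn.
Qed.

Lemma z_axis i : z i ^+ Dl = \prod_j axis j ^+ mo i j.
Proof. by rewrite -(zval_axis (mo_wdeg i)) -zval1 -zvalMn ?mul1n ?mo_wdeg ?muln1. Qed.

Lemma axis_support i j : z i != 0 -> (0 < mo i j)%N -> axis j != 0.
Proof.
move=> zi mj; apply: contra zi => /eqP a0; have /eqP := z_axis i.
by rewrite (bigD1 j) //= a0 expr0n gtn_eqF // mul0r expf_eq0 Dl0.
Qed.

(** Otherwise the only nonzero coordinate of [z] is that of a pure power of [X_i0]. The equation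
    [on_f] excludes this, because [f] contains a pure power of [X_i0]. *)
Lemma axis_other i0 i : w i0 != 1%N -> z i != 0 -> exists2 j, j != i0 & axis j != 0.
Proof.
move=> wi zi; apply: contrapT => h.
have h' j : j != i0 -> axis j = 0 by move=> ji; apply/eqP/negPn/negP => a; apply: h; exists j.
pose q := (Dl %/ w i0)%N.
have single t : z t != 0 -> mo t = (U_(i0) *+ q)%MM.
  move=> nz; have mt j : j != i0 -> mo t j = 0%N.
    by move=> ji; apply/eqP/negPn/negP; rewrite -lt0n => /(axis_support nz); rewrite h' ?eqxx.
  apply/mnmP => j; rewrite mulmnE mnm1E; have [<-|ji] := eqVneq i0 j; last by rewrite mt 1?eq_sym.
  rewrite mul1n /q -(mo_wdeg t) /wdeg (bigD1 i0) //= big1 ?addn0 ?mulKn // => j1 ji.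
  by rewrite mt // muln0.
have R : (wdeg w (U_(i0) *+ ((Dl - d) %/ w i0))%MM + d = Dl)%N.
  by rewrite wdegUn mulnC divnK ?subnK // dvdn_sub.
have := zf R; rewrite (bigD1 i) //= big1 ?addr0 => [|t ti].
  apply/eqP; rewrite mulf_neq0 // (single i zi) (_ : U_(i0) *+ q = U_(i0) *+ (d %/ w i0) + U_(i0) *+ ((Dl - d) %/ w i0))%MM.
    by rewrite addmC mcoeffMX axis_coef.
  apply/mnmP => t; rewrite mnmDE !mulmnE -mulnDr; congr (_ * _)%N.
  by rewrite /q -divnDl // subnKC.
have [->|nz] := eqVneq (z t) 0; first by rewrite mulr0.
by case/eqP: ti; apply: mo_inj; rewrite (single t nz) (single i zi).
Qed.

(** Recovering [x] from its monomials of degree [Dl] needs no roots: two monomials [M1], [M2] of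
    consecutive degrees with nonzero values allow the normalization [u = M1 / M2 = 1]. *)
Lemma reconstruct : exists x c, [/\ exists i, x i != 0, f.@[x] = 0, c != 0 & forall i, z i = c * x ^^ (mo i)].
Proof.
have [i0 zi0] := z0.
have [|i wi|e0 [M1 [M2 [w1 w2 S1 S2]]]] := unit_monos (S := fun i => axis i != 0).
- apply: contrapT => h; case/eqP: (expf_neq0 Dl zi0); rewrite z_axis.
  have [j mj] : exists j, (0 < mo i0 j)%N.
    apply: contrapT => h'; move: Dl0; rewrite -(mo_wdeg i0) /wdeg big1 // => j _.
    by apply/eqP; rewrite muln_eq0 eqn0Ngt w_gt0 /= -leqn0 leqNgt; apply/negP => mj; apply: h'; exists j.
  rewrite (bigD1 j) //= (_ : axis j = 0) ?expr0n ?gtn_eqF ?mul0r //.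
  by apply/eqP/negPn/negP => a; apply: h; exists j.
- exact: axis_other wi zi0.
pose a1 := zval e0.+1 (M1 *+ Dl)%MM; pose a2 := zval e0 (M2 *+ Dl)%MM.
have nz M l : wdeg w M = l -> (forall i, (0 < M i)%N -> axis i != 0) -> zval l (M *+ Dl)%MM != 0.
  move=> wM SM; rewrite zval_axis //; apply/prodf_neq0 => i _.
  by have [/SM h|] := ltnP 0 (M i); [exact: expf_neq0 | rewrite leqn0 => /eqP ->; rewrite expr0 oner_neq0].
have a10 : a1 != 0 by exact: nz. have a20 : a2 != 0 by exact: nz.
(* [T i] is [X_i / u^(w_i)] multiplied by [M1^(Dl w_i)], which brings it into a degree where [zval]
   is defined; [x i] divides by the value of the latter. *)
pose T i := (U_(i) + M2 *+ w i + M1 *+ (Dl.-1 * w i))%MM.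
have Dp : Dl = Dl.-1.+1 by rewrite prednK.
have wT i : wdeg w (T i) = (Dl * (w i * e0.+1))%N.
  by rewrite /T !wdegD wdegU !wdegMn w1 w2 [in RHS]Dp; move: (Dl.-1) (w i) => s t; clear; lia.
pose x i := zval (w i * e0.+1) (T i) / a1 ^+ w i.
have xm M : wdeg w M = Dl -> x ^^ M = zval 1 M * (a2 / a1).
  move=> wM; rewrite monoE.
  have -> : \prod_i x i ^+ M i = (\prod_i zval (w i * e0.+1 * M i) (T i *+ M i)%MM) / a1 ^+ Dl.
    rewrite -wM /wdeg -prodrXr -prodfV -big_split /=; apply: eq_bigr => i _.
    by rewrite /x zvalMn // exprMn exprVn exprM.
  rewrite -(zval_sum (index_enum _) (l := fun i => (w i * e0.+1 * M i)%N)) => [|i]; last by rewrite wdegMn wT -mulnA.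
  have -> : (\sum_i T i *+ M i = M + (M2 *+ Dl + M1 *+ Dl *+ Dl.-1))%MM.
    apply/mnmP => j; rewrite mnm_sumE !mnmDE !mulmnE.
    have -> : (\sum_i (T i *+ M i)%MM j = \sum_i (U_(i)%MM j * M i + (M2 j * (w i * M i) + M1 j * Dl.-1 * (w i * M i))))%N.
      by apply: eq_bigr => i _; rewrite mulmnE !mnmDE !mulmnE; ring.
    rewrite !big_split -!big_distrr /= -[X in (M2 j * X)%N]/(wdeg w M) -[X in (_ * Dl.-1 * X)%N]/(wdeg w M) wM.
    rewrite (bigD1 j) //= mnm1E eqxx mul1n big1 ?addn0 => [|i ij]; last by rewrite mnm1E (negPf ij).
    by congr (_ + (_ + _))%N; rewrite -mulnA [(Dl.-1 * _)%N]mulnC mulnA.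
  have -> : (\sum_i w i * e0.+1 * M i = 1 + (e0 + e0.+1 * Dl.-1))%N.
    rewrite (eq_bigr (fun i => e0.+1 * (w i * M i))%N) => [|i _]; last by ring.
    by rewrite -big_distrr /= -/(wdeg w M) wM {1}Dp; move: (Dl.-1) => s; clear; lia.
  have d2 : wdeg w (M2 *+ Dl)%MM = (Dl * e0)%N by rewrite wdegMn w2 mulnC.
  have d1 : wdeg w (M1 *+ Dl)%MM = (Dl * e0.+1)%N by rewrite wdegMn w1 mulnC.
  have d3 : wdeg w (M1 *+ Dl *+ Dl.-1)%MM = (Dl * (e0.+1 * Dl.-1))%N by rewrite wdegMn d1 mulnA.
  rewrite zvalD ?muln1 //; last by rewrite wdegD d2 d3 mulnDr.
  rewrite zvalD // zvalMn // -/a1 -/a2 [in a1 ^+ Dl]Dp exprS; field.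
  by rewrite a10 expf_neq0.
have xE i : x ^^ (mo i) = z i * (a2 / a1) by rewrite xm ?mo_wdeg // zval1.
have c0 : a2 / a1 != 0 by rewrite mulf_neq0 ?invr_eq0.
have zE i : z i = (a2 / a1)^-1 * x ^^ (mo i) by rewrite xE mulrCA mulVf ?mulr1.
have [j xj] : exists j, x j != 0.
  apply: contrapT => h; case/eqP: zi0; rewrite zE monoE; apply/eqP; rewrite mulf_eq0; apply/orP; right.
  have [j mj] : exists j, (0 < mo i0 j)%N.
    apply: contrapT => h'; move: Dl0; rewrite -(mo_wdeg i0) /wdeg big1 // => j _.
    by apply/eqP; rewrite muln_eq0 eqn0Ngt w_gt0 /= -leqn0 leqNgt; apply/negP => mj; apply: h'; exists j.
  rewrite (bigD1 j) //= (_ : x j = 0) ?expr0n ?gtn_eqF ?mul0r ?eqxx //.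
  by apply/eqP/negPn/negP => a; apply: h; exists j.
exists x, (a2 / a1)^-1; split=> //; [by exists j | | by rewrite invr_eq0].
pose R := (U_(j) *+ ((Dl - d) %/ w j))%MM.
have wR : (wdeg w R + d = Dl)%N by rewrite wdegUn mulnC divnK ?subnK // dvdn_sub.
have gh : whomog w Dl (f * 'X_[R]).
  by rewrite -wR addnC; apply: whomogM => //; exact: whomogXm.
have gE := mo_expand x gh.
have : (f * 'X_[R]).@[x] = 0.
  rewrite gE; apply: (mulfI (_ : (a2 / a1)^-1 != 0)); first by rewrite invr_eq0.
  rewrite mulr0 -[RHS](zf wR) mulr_sumr; apply: eq_bigr => i _; by rewrite zE mulrCA.
rewrite mevalM => /eqP; rewrite mulf_eq0 => /orP [/eqP //|].
rewrite monoE prodf_seq_eq0 => /hasP [i _ /=]; rewrite expf_eq0 mulmnE mnm1E.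
by case: eqP => [<-|_]; rewrite ?mul0n // (negPf xj) andbF.
Qed.
End Reconstruction.

Lemma lift_poly D g : whomog w (Dl * D) g -> exists2 G : {mpoly k[N.+1]}, whomog (fun=> 1%N) D G &
  forall x, G.@[fun i => x ^^ (mo i)] = g.@[x].
Proof.
move=> /whomogP gh.
have /choice [s sP] : forall M, exists s : seq 'I_N.+1, g@_M != 0 -> size s = D /\ (\sum_(i <- s) mo i)%MM = M.
  move=> M; have [e|/gh /decompose [s sD sM]] := eqVneq g@_M 0; first by exists [::].
  by exists s.
exists (\sum_(M <- msupp g) g@_M *: \prod_(i <- s M) 'X_i).
  rewrite big_seq; apply: whomog_sum => M; rewrite mcoeff_msupp => /sP [sD _].
  apply: whomogZ; rewrite -sD -sum1_size.
  by apply: (@whomog_prod _ (fun=> 1%N) k _ _ _ _ (fun=> 1%N)) => i _; exact: (@whomogX _ (fun=> 1%N) k i).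
move=> x; rewrite [in RHS](mpolyE g) !raddf_sum; apply: eq_big_seq => M; rewrite mcoeff_msupp => /sP [_ sM] /=.
rewrite !mevalZ; congr (_ * _); rewrite -[in RHS]sM mono_seq rmorph_prod.
by apply: eq_bigr => i _; exact: mevalXU.
Qed.

Definition pull (G : {mpoly k[N.+1]}) : {mpoly k[n.+2]} := mev (@mpolyC n.+2 k) (fun i => 'X_[mo i]) G.

Lemma pull_meval G x : (pull G).@[x] = G.@[fun i => x ^^ (mo i)].
Proof.
apply: (mpoly_morph_eq (f := meval x \o mev (@mpolyC n.+2 k) (fun i => 'X_[mo i])) (g := meval _)) => [c|i] /=.
  by rewrite mevC !mevalC.
by rewrite mevX mevalXU.
Qed.

Lemma pull_homog D G : whomog (fun=> 1%N) D G -> whomog w (Dl * D) (pull G).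
Proof.
move=> /whomogP Gh; rewrite /pull mevE big_seq; apply: whomog_sum => M; rewrite mcoeff_msupp => /Gh <-.
rewrite mul_mpolyC; apply: whomogZ; rewrite /wdeg big_distrr.
apply: whomog_prod => i _; rewrite mul1n; apply: whomogXn; rewrite -(mo_wdeg i); exact: whomogXm.
Qed.

Lemma mono_scale (x : 'I_n.+2 -> k) c M : (fun i => c ^+ w i * x i : k) ^^ M = c ^+ wdeg w M * x ^^ M.
Proof. by rewrite (meval_worbit _ _ (whomogXm w k M)). Qed.

Lemma point_units (x : 'I_n.+2 -> k) : (exists i, x i != 0) -> f.@[x] = 0 -> exists e0 (M1 M2 : 'X_{1..n.+2}),
  [/\ wdeg w M1 = e0.+1, wdeg w M2 = e0, x ^^ M1 != 0 & x ^^ M2 != 0].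
Proof.
move=> [i0 xi0] fx; have [|i wi|e0 [M1 [M2 [w1 w2 S1 S2]]]] := unit_monos (S := fun i => x i != 0).
- by exists i0.
- apply: contrapT => h.
  have h' j : j != i -> x j = 0 by move=> ji; apply/eqP/negPn/negP => xj; apply: h; exists j.
  have xi : x i != 0 by have [<-//|/h' e] := eqVneq i0 i; rewrite e eqxx in xi0.
  have dw : (w i * (d %/ w i) = d)%N by rewrite mulnC divnK.
  have E : f.@[x] = f@_(U_(i) *+ (d %/ w i)) * x i ^+ (d %/ w i).
    rewrite mevalE; have xM M : wdeg w M = d -> M != (U_(i) *+ (d %/ w i))%MM -> \prod_j x j ^+ M j = 0.
      move=> wM ne; have [j ji mj] : exists2 j, j != i & (0 < M j)%N.
        apply: contrapT => no; case/eqP: ne; have mz j : j != i -> M j = 0%N.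
          by move=> ji; apply/eqP; rewrite -leqn0 leqNgt; apply/negP => mj; apply: no; exists j.
        apply/mnmP => j; rewrite mulmnE mnm1E; have [<-|ji] := eqVneq i j; last by rewrite mz 1?eq_sym.
        rewrite mul1n -wM /wdeg (bigD1 i) //= big1 ?addn0 ?mulKn // => j1 ji.
        by rewrite mz // muln0.
      by rewrite (bigD1 j) //= h' // expr0n gtn_eqF // mul0r.
    rewrite (bigD1_seq (U_(i) *+ (d %/ w i))%MM) ?msupp_uniq ?mcoeff_msupp ?axis_coef //= [X in _ + X]big_seq_cond [X in _ + X]big1 ?addr0.
      congr (_ * _); rewrite (bigD1 i) //= big1 => [|j ji]; first by rewrite mulr1 mulmnE mnm1E eqxx mul1n.
      by rewrite mulmnE mnm1E eq_sym (negPf ji) mul0n expr0.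
    by move=> M /andP [Mf ne]; rewrite xM ?mulr0 //; move/whomogP: fh; apply; rewrite -mcoeff_msupp.
  by move/eqP: fx; rewrite E mulf_eq0 (negPf (axis_coef wi)) expf_eq0 (negPf xi) andbF.
have nz (M : 'X_{1..n.+2}) : (forall i, (0 < M i)%N -> x i != 0) -> x ^^ M != 0.
  move=> SM; rewrite monoE; apply/prodf_neq0 => i _.
  by have [/SM h|] := ltnP 0 (M i); [exact: expf_neq0 | rewrite leqn0 => /eqP ->; rewrite expr0 oner_neq0].
by exists e0, M1, M2; split=> //; exact: nz.
Qed.

Lemma power_neq0 (x : 'I_n.+2 -> k) : (exists i, x i != 0) -> exists i, x ^^ (mo i) != 0.
Proof.
move=> [j xj]; have [|i iE] := @mo_onto (U_(j) *+ (Dl %/ w j))%MM; first by rewrite wdegUn mulnC divnK.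
exists i; rewrite iE monoE; apply/prodf_neq0 => t _; rewrite mulmnE mnm1E.
by have [<-|_] := eqVneq j t; rewrite ?mul0n ?expr0 ?oner_neq0 ?expf_neq0.
Qed.

Lemma embedding_ex : exists phi : X -> PP, forall P x, sval (sval P) x ->
  sval (phi P : wpoint k (fun=> 1%N)) (fun i => x ^^ (mo i)).
Proof.
have /choice [phi phiP] : forall P : X, exists Q : PP, sval Q (fun i => rep (sval P) ^^ (mo i)).
  by move=> P; apply: wpoint_of; apply: power_neq0; exact: rep_neq0 (repP _).
exists phi => P x Px; have [c c0 ->] := wpoint_rel (repP (sval P)) Px.
have cD : c ^+ Dl != 0 by rewrite expf_neq0.
apply: sval_congr (wpoint_scale cD (phiP P)) => i.
by rewrite expr1 mono_scale mo_wdeg.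
Qed.

Variable phi : X -> PP.
Hypothesis phiP : forall P x, sval (sval P) x -> sval (phi P : wpoint k (fun=> 1%N)) (fun i => x ^^ (mo i)).

Definition image_set : set PP := [set Q | forall z, sval (Q : wpoint k (fun=> 1%N)) z -> toric z /\ on_f z]%classic.

Lemma image_scale z (c : k) : toric z /\ on_f z -> toric (fun i => c * z i) /\ on_f (fun i => c * z i).
Proof.
move=> [tz fz]; split=> [s t st sE|R wR].
  by rewrite !big_split /= !big_const_seq !count_predT st (tz s t st sE).
by under eq_bigr do rewrite mulrCA; rewrite -mulr_sumr fz ?mulr0.
Qed.

Lemma image_rep (Q : PP) z : sval (Q : wpoint k (fun=> 1%N)) z -> toric z /\ on_f z -> image_set Q.
Proof.
move=> Qz h y Qy; have [c c0 ->] := wpoint_rel Qz Qy.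
exact: (image_scale (c ^+ 1) h).
Qed.

Lemma image_phi P : image_set (phi P).
Proof.
have Px := repP (sval P); apply: (image_rep (phiP Px)); split=> [s t st sE|R wR].
  by rewrite -!mono_seq sE.
rewrite -(mo_expand _ (_ : whomog w Dl (f * 'X_[R]))) ?mevalM ?(hyp_vanish Px) ?mul0r //.
by rewrite -wR addnC; apply: whomogM => //; exact: whomogXm.
Qed.

Lemma image_closed : zclosed image_set.
Proof.
apply: zopen_locally => Q nQ; have [z Qz] := wpoint_ex (Q : wpoint k (fun=> 1%N)).
have sep (G : {mpoly k[N.+1]}) D : whomog (fun=> 1%N) D G -> G.@[z] != 0 ->
    (forall y, toric y /\ on_f y -> G.@[y] = 0) -> exists V, [/\ zopen PP V, V Q & (V `<=` ~` image_set)%classic].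
  move=> hG Gz GA; exists (nonzero_locus G); split.
  - exact: basic_open hG.
  - exact: nonzero_locusP hG Qz Gz.
  - by move=> T GT AT; have [y Ty] := wpoint_ex (T : wpoint k (fun=> 1%N)); have := GT y Ty; rewrite GA ?eqxx //; exact: AT.
have ev (s : seq 'I_N.+1) y : (\prod_(i <- s) 'X_i : {mpoly k[N.+1]}).@[y] = \prod_(i <- s) y i.
  by rewrite rmorph_prod; apply: eq_bigr => i _; exact: mevalXU.
have [tz|nt] := pselect (toric z); last first.
  move: nt => /existsNP [s /existsNP [t /not_implyP [st /not_implyP [sE ne]]]].
  apply: (sep (\prod_(i <- s) 'X_i - \prod_(i <- t) 'X_i) (size s)).
  - have hp (q : seq 'I_N.+1) : whomog (fun=> 1%N) (size q) (\prod_(i <- q) 'X_i : {mpoly k[N.+1]}).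
      rewrite -sum1_size; apply: (@whomog_prod _ (fun=> 1%N) k _ _ _ _ (fun=> 1%N)) => i _.
      exact: (@whomogX _ (fun=> 1%N) k i).
    by apply: whomogB => //; rewrite st.
  - by rewrite mevalB !ev subr_eq0; apply/eqP.
  - by move=> y [ty _]; rewrite mevalB !ev (ty s t) ?subrr.
have [fz|nf] := pselect (on_f z); first by case: nQ; exact: image_rep Qz _.
move: nf => /existsNP [R /not_implyP [wR ne]].
apply: (sep (\sum_i (f * 'X_[R])@_(mo i) *: 'X_i) 1%N).
- by apply: whomog_sum => i _; apply: whomogZ; exact: (@whomogX _ (fun=> 1%N) k i).
- by rewrite raddf_sum; apply/eqP => E; apply: ne; rewrite -[RHS]E; apply: eq_bigr => i _ /=; rewrite mevalZ mevalXU.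
- move=> y [_ fy]; rewrite raddf_sum -[RHS](fy R wR); apply: eq_bigr => i _ /=; by rewrite mevalZ mevalXU.
Qed.

(** The normalized coordinates are quotients of monomials of equal degree divisible by [Dl], hence
    determined by the image point. *)
Lemma embedding_inj : injective phi.
Proof.
move=> P P' E; have Px := repP (sval P); have Px' := repP (sval P').
set x := rep (sval P) in Px; set x' := rep (sval P') in Px'.
have [c c0 cE] : exists2 c, c != 0 & forall i, x' ^^ (mo i) = c * x ^^ (mo i).
  have := phiP Px'; rewrite -E => h; have [c c0 cE] := wpoint_rel (phiP Px) h; exists c => // i.
  by have := congr1 (fun z => z i) cE; rewrite expr1.
have xK l K : wdeg w K = (Dl * l)%N -> x' ^^ K = c ^+ l * x ^^ K.
  move=> /decompose [s <- <-]; rewrite !mono_seq (eq_bigr _ (fun i _ => cE i)) big_split /=.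
  by rewrite big_const_seq count_predT -Monoid.iteropE.
have [e0 [M1 [M2 [w1 w2 x1 x2]]]] := point_units (rep_neq0 Px) (hyp_vanish Px).
have mM (y : 'I_n.+2 -> k) M e : y ^^ (M *+ e)%MM = (y ^^ M) ^+ e by rewrite -mpolyXn mevalXn.
have x'n M : x ^^ M != 0 -> x' ^^ M != 0.
  move=> nz; have := @xK (wdeg w M) (M *+ Dl)%MM; rewrite wdegMn mulnC => /(_ erefl); rewrite !mM => H.
  have : (x' ^^ M) ^+ Dl != 0 by rewrite H mulf_neq0 ?expf_neq0.
  by rewrite expf_eq0 Dl0.
have h1 : whomog w e0.+1 ('X_[M1] : {mpoly k[n.+2]}) by rewrite -w1; exact: whomogXm.
have h2 : whomog w e0 ('X_[M2] : {mpoly k[n.+2]}) by rewrite -w2; exact: whomogXm.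
have [n1 _ _] := coord_normal h1 h2 Px x1 x2.
have [n1' _ _] := coord_normal h1 h2 Px' (x'n _ x1) (x'n _ x2).
apply: hyp_inj n1 _; apply: sval_congr n1' => j.
rewrite (coordE h1 h2 j Px) (coordE h1 h2 j Px').
pose T := (U_(j) + M2 *+ w j + M1 *+ (Dl.-1 * w j))%MM.
have wT : wdeg w T = (Dl * (w j * e0.+1))%N.
  by rewrite /T !wdegD wdegU !wdegMn w1 w2 -[in RHS](prednK Dl0); move: (Dl.-1) (w j) => s t; clear; lia.
have w3 : wdeg w (M1 *+ (Dl * w j))%MM = (Dl * (w j * e0.+1))%N by rewrite wdegMn w1; ring.
have val (y : 'I_n.+2 -> k) : y ^^ M1 != 0 -> y j * (y ^^ M2) ^+ w j / (y ^^ M1) ^+ w j = (y ^^ T) / (y ^^ (M1 *+ (Dl * w j))%MM).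
  move=> ny; rewrite /T !monoD !mM mevalXU -[in RHS](prednK Dl0) mulSn exprD.
  by have := expf_neq0 (w j) ny; have := expf_neq0 (Dl.-1 * w j) ny; move: (_ ^+ (Dl.-1 * w j)) ((y ^^ M1) ^+ w j) => s t s0 t0; field; rewrite s0 t0.
rewrite !val ?x'n // (xK _ _ wT) (xK _ _ w3) -mulf_div divff ?mul1r //.
by rewrite expf_neq0.
Qed.

Lemma embedding_closed : closed_embedding phi.
Proof.
exists image_set; split; first exact: image_closed.
pose psi P : subspace image_set := exist _ (phi P) (@image_phi P).
have /choice [chi chiP] : forall Q : subspace image_set, exists P, phi P = sval Q.
  move=> [Q AQ] /=; have [z Qz] := wpoint_ex (Q : wpoint k (fun=> 1%N)); have [tz fz] := AQ z Qz.
  have [x [c [x0 fx c0 zE]]] := reconstruct tz fz (rep_neq0 Qz).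
  have [P Px] := hyp_point_of fh x0 fx; exists P.
  apply: (wpoint_inj (x := z)) => //; apply: sval_congr (wpoint_scale c0 (phiP Px)) => i.
  by rewrite expr1 zE.
have psiK : cancel psi chi by move=> P; apply: embedding_inj; rewrite chiP.
have chiK : cancel chi psi.
  by move=> Q; apply: eq_sig_hprop; [move=> ? ? ?; exact: Prop_irrelevance | exact: chiP].
have chiR Q x : sval (sval (chi Q)) x -> sval (sval Q : wpoint k (fun=> 1%N)) (fun i => x ^^ (mo i)).
  by move=> Qx; rewrite -chiP; exact: phiP.
suff [mpsi mchi] : morphism psi /\ morphism chi by exists psi; split=> //; split=> //; exists chi.
split; split.
- move=> U [O oO UE]; rewrite UE.
    apply: zopen_locally => P OP; have [D [G [hG GP GO]]] := open_basic oO OP.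
    have hg := pull_homog hG; exists [set T : X | nonzero_locus (pull G) (sval T)]%classic; split.
    + exact: hyp_basic_open hg.
    + by move=> x Px; rewrite pull_meval; apply: GP; exact: phiP.
    + move=> T GT; have [x Tx] := wpoint_ex (sval T).
      by apply: (GO (phi T) _ (phiP Tx)); rewrite -pull_meval; exact: GT.
- move=> U g [O oO UE]; rewrite UE => rg.
  apply: regular_local => P OP; have [O1 [g1 [oO1 O1P rg1 gE]]] := rg (psi P) OP.
  have oI := zopenI oO oO1.
  have [D [G [H [hG hH HP HE]]]] := regular_frac oI (regular_restrict oO1 (@subIsetr _ _ _) rg1) (conj OP O1P).
  have hg := pull_homog hG; have hh := pull_homog hH.
  exists [set T : X | nonzero_locus (pull H) (sval T)]%classic, (fun T => wfrac (pull G) (pull H) (sval T)); split.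
  + exact: hyp_basic_open hh.
  + by move=> x Px; rewrite pull_meval; apply: HP; exact: phiP.
  + exact: (hyp_frac_regular hg hh).
  + move=> T OT HT; have [x Tx] := wpoint_ex (sval T).
    have Hx : H.@[fun i => x ^^ (mo i)] != 0 by rewrite -pull_meval; exact: HT.
    have [[_ O1T] g1E] := HE (phi T) _ (phiP Tx) Hx.
    by rewrite /= gE // g1E (wfracE hg hh Tx) !pull_meval.
- move=> W oW.
    apply: zopen_locally => Q WQ; have [D [p [hp pQ pW]]] := hyp_open_basic oW WQ.
    (* The [Dl]-th power has degree divisible by [Dl], so it lifts to a form on the ambient
       projective space with the same zeros. *)
    have hpD := whomogXn Dl hp; rewrite mulnC in hpD.
    have [G hG GE] := lift_poly hpD.
    exists [set T : subspace image_set | nonzero_locus G (sval T)]%classic; split.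
    + by exists (nonzero_locus G) => //; exact: basic_open hG.
    + have [x Px] := wpoint_ex (sval (chi Q)); apply: (nonzero_locusP hG (chiR _ _ Px)).
      by rewrite GE mevalXn expf_neq0 // pQ.
    + move=> T GT; have [x Tx] := wpoint_ex (sval (chi T)); apply: (pW _ x Tx).
      by have := GT _ (chiR _ _ Tx); rewrite GE mevalXn expf_eq0 Dl0.
- move=> W g oW rg; intros Q WQ; have [D [g1 [p [hg hp pQ pE]]]] := hyp_regular_frac oW rg WQ.
  have hpD := whomogXn Dl hp; rewrite mulnC in hpD.
  have hgD : whomog w (Dl * D) (g1 * p ^+ Dl.-1).
    by rewrite -{1}(prednK Dl0) mulSn [(Dl.-1 * D)%N]mulnC; apply: whomogM => //; exact: whomogXn.
  have [G hG GE] := lift_poly hgD; have [H hH HE] := lift_poly hpD.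
  have [x Px] := wpoint_ex (sval (chi Q)).
  exists (nonzero_locus H), (wfrac G H); split.
  + exact: basic_open hH.
  + by apply: (nonzero_locusP hH (chiR _ _ Px)); rewrite HE mevalXn expf_neq0 // pQ.
  + exact: wfrac_regular hG hH (fun _ h => h).
  + move=> T WT HT; have [y Ty] := wpoint_ex (sval (chi T)).
    have py : p.@[y] != 0 by have := HT _ (chiR _ _ Ty); rewrite HE mevalXn expf_eq0 Dl0.
    have [_ /= ->] := pE _ y Ty py.
    rewrite (wfracE hG hH (chiR _ _ Ty)) GE HE mevalM !mevalXn -[in p.@[y] ^+ Dl](prednK Dl0) exprS.
    by have := expf_neq0 Dl.-1 py; move: (p.@[y] ^+ Dl.-1) => s s0; field; rewrite s0 py.
Qed.
End MonomialEmbedding.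

Section FanoHypersurface.
Variables (k : closedFieldType) (n m d : nat) (w : 'I_n.+2 -> nat) (f : {mpoly k[n.+2]}).
Hypothesis fm : ymonic m.+1 f.
Hypothesis kp : forall i, (i < n)%N -> mprime (kill i _ _ f).
Hypothesis fh : whomog w d f.
Hypothesis w_gt0 : forall i, (0 < w i)%N.
Hypothesis w_neq0 : forall i, (w i)%:R != 0 :> k.
Hypothesis n0 : (0 < n)%N.
Hypothesis d0 : (0 < d)%N.
Hypothesis dwm : d = (w ord_max * m.+1)%N.
Hypothesis fY : f@_(U_(ord_max) *+ m.+1) = 1.
Hypothesis smooth : forall x, (forall j, f^`M(j).@[x] = 0) -> forall i, x i = 0.
Hypothesis wd : forall i, (w i %| d)%N.
Hypothesis dw : (d < \sum_i w i)%N.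
Hypothesis axis_coef : forall i, w i != 1%N -> f@_(U_(i) *+ (d %/ w i)) != 0.
Hypothesis unit_monos : forall S : 'I_n.+2 -> Prop, (exists i, S i) ->
  (forall i, w i != 1%N -> exists2 j, j != i & S j) -> exists e0 (M1 M2 : 'X_{1..n.+2}),
  [/\ wdeg w M1 = e0.+1, wdeg w M2 = e0, forall i, (0 < M1 i)%N -> S i & forall i, (0 < M2 i)%N -> S i].
Local Notation Dl := (d * (\sum_i w i - d))%N.
Hypothesis divide : forall l M, wdeg w M = (Dl * l.+1)%N -> exists2 K, (K <= M)%MM & wdeg w K = Dl.
Local Notation X := (hypersurface w f).

Let fp : mprime f.
Proof.
have := kp n0; have -> // : kill 0 _ _ f = f.
by apply: (mpoly_morph_eq (f := kill 0 n.+2 k) (g := idfun)) => [c|j] /=; [exact: mevC | exact: mevX].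
Qed.

Lemma unit_ratio x : (exists i, x i != 0) -> f.@[x] = 0 -> exists e0 M1 M2,
  [/\ whomog w e0.+1 M1, whomog w e0 M2, M1.@[x] != 0 & M2.@[x] != 0].
Proof.
move=> x0 fx; have [e0 [M1 [M2 [w1 w2 n1 n2]]]] := point_units fh w_gt0 wd axis_coef unit_monos x0 fx.
by exists e0, 'X_[M1], 'X_[M2]; split=> //; [rewrite -w1 | rewrite -w2]; exact: whomogXm.
Qed.

(** If all minors vanish, the gradients of [f] and of [M1 - M2] are proportional. Contraction with
    the Euler vector gives 0 for [f] and the nonzero [M1] for the difference, as the degrees differ
    by 1. So the gradient of [f] is 0, against smoothness. *)
Lemma minor_ex (P : X) : exists e0 M1 M2 r s' x, [/\ whomog w e0.+1 M1, whomog w e0 M2,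
  normal_rep M1 M2 P x & (coord_minor f M1 M2 r s').@[x] != 0].
Proof.
have [z Pz] := wpoint_ex (sval P).
have [e0 [M1 [M2 [h1 h2 z1 z2]]]] := unit_ratio (rep_neq0 Pz) (hyp_vanish Pz).
have nx := coord_normal h1 h2 Pz z1 z2; have [Px M12 Mx] := nx.
set x := (fun j => _) in nx Px M12 Mx.
apply: contrapT => no; have [i xi] := rep_neq0 Px; case/eqP: xi; move: i; apply: smooth => r.
have minor0 s : f^`M(r).@[x] * (M1 - M2)^`M(s).@[x] = f^`M(s).@[x] * (M1 - M2)^`M(r).@[x].
  case: (unliftP r s) => [s' ->|->]; last by rewrite mulrC.
  apply/eqP; rewrite -subr_eq0; apply/negPn/negP => ne; apply: no; exists e0, M1, M2, r, s', x.
  by split=> //; rewrite /coord_minor mevalB !mevalM.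
have eul e g : whomog w e g -> \sum_s g^`M(s).@[x] * ((w s)%:R * x s) = e%:R * g.@[x].
  move=> hg; have := gradient_euler x hg => /(congr1 (fun B : 'M_1 => B 0 0)); rewrite !mxE mulr1n => <-.
  by apply: eq_bigr => s _; rewrite !mxE.
have LE : \sum_s (M1 - M2)^`M(s).@[x] * ((w s)%:R * x s) = M1.@[x].
  have -> : \sum_s (M1 - M2)^`M(s).@[x] * ((w s)%:R * x s) = \sum_s M1^`M(s).@[x] * ((w s)%:R * x s) - \sum_s M2^`M(s).@[x] * ((w s)%:R * x s).
    by rewrite -sumrB; apply: eq_bigr => s _; rewrite mderivB mevalB mulrBl.
  by rewrite (eul _ _ h1) (eul _ _ h2) M12 -natr1 mulrDl mul1r addrAC subrr add0r.
have msum (V : 'I_n.+2 -> k) c : c * (\sum_i V i) = \sum_i c * V i by rewrite mulr_sumr.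
apply: (mulIf Mx); rewrite mul0r -LE msum.
rewrite (eq_bigr (fun s => (M1 - M2)^`M(r).@[x] * (f^`M(s).@[x] * ((w s)%:R * x s)))) => [|s _].
  by rewrite -msum (eul _ _ fh) (hyp_vanish Px) !mulr0.
by apply: etrans (mulrA _ _ _) _; apply: etrans (congr1 (fun c => c * _) (minor0 s)) _; ring.
Qed.

Lemma chart_ex (P : X) : exists (U : set X) (t : 'I_n -> X -> k), [/\ zopen X U, U P,
  forall i, regular X U (t i) & forall Q, U Q -> local_coordinates Q t].
Proof.
have [e0 [M1 [M2 [r [s' [x [h1 h2 nx mx]]]]]]] := minor_ex P.
exists (chart_set M1 M2 r s'), (fun i => coord M1 M2 (free_var r s' i)); split.
- exact: chart_open h1 h2.
- by have := normal_chart h1 h2 nx mx.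
- by move=> i; exact: chart_regular h1 h2 _.
- by move=> Q UQ; have := chart_coordinates h1 h2 UQ.
Qed.

Let local_bound (P : X) : ~ has_chain (@prime_ideal k X P) n.+1.
Proof. exact: (no_long_chain fh w_gt0 dwm fY). Qed.

Lemma hypersurface_nonsingular : nonsingular X.
Proof.
move=> P; exists n; split; last first.
  have [U [t [_ UP _ /(_ P UP) ct]]] := chart_ex P; by exists (fun i Q => t i Q - t i P).
split=> //; have [e0 [M1 [M2 [r [s' [x [h1 h2 nx mx]]]]]]] := minor_ex P.
exact: (local_chain fm fp fh h1 h2 nx mx).
Qed.

Section Ample.

Let q0 : (0 < \sum_i w i - d)%N. Proof. by rewrite subn_gt0. Qed.
Let Dl0 : (0 < Dl)%N. Proof. by rewrite muln_gt0 d0. Qed.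
Let wDl i : (w i %| Dl)%N. Proof. by apply: dvdn_mulr. Qed.
Let dDl : (d <= Dl)%N. Proof. by rewrite leq_pmulr. Qed.

Lemma exponents_ex : exists N (mo : 'I_N.+1 -> 'X_{1..n.+2}), [/\ forall i, wdeg w (mo i) = Dl,
  injective mo & forall M, wdeg w M = Dl -> exists i, mo i = M].
Proof.
have w1 : wdeg w (U_(ord0) *+ (Dl %/ w ord0))%MM = Dl by rewrite wdegUn mulnC divnK.
have [i0 _] := mono_onto w_gt0 w1.
have rE : (size (monos Dl w)).-1.+1 = size (monos Dl w) by rewrite prednK // (leq_ltn_trans _ (ltn_ord i0)).
exists (size (monos Dl w)).-1, (fun i => mono (cast_ord rE i)); split.
- by move=> i; exact: mono_wdeg.
- by move=> i j /mono_inj /cast_ord_inj.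
- by move=> M /(mono_onto w_gt0) [i <-]; exists (cast_ord (esym rE) i); rewrite cast_ordKV.
Qed.

Lemma hypersurface_ample : ample (anticanonical_bundle X n).
Proof.
exists d => //; have [N [mo [mo_wdeg mo_inj mo_onto]]] := exponents_ex.
(* The coordinate ring is generated in degree [Dl]: monomials of that degree are split off one by
   one. *)
have decompose l M : wdeg w M = (Dl * l)%N -> exists2 s : seq 'I_N.+1, size s = l & (\sum_(i <- s) mo i)%MM = M.
  elim: l M => [|l IH] M wM.
    exists [::] => //; rewrite big_nil; apply/mnmP => i; rewrite mnm0E; apply/esym/eqP.
    by move: wM; rewrite muln0 /wdeg => /eqP; rewrite sum_nat_eq0 => /forallP /(_ i); rewrite muln_eq0 eqn0Ngt w_gt0.
  have [K KM wK] := divide wM; have [i iK] := mo_onto _ wK.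
  have [|s sl sM] := IH (M - K)%MM.
    apply: (@addIn Dl); rewrite -[in LHS]wK -wdegD submK // wM mulnS addnC //.
  by exists (i :: s); rewrite /= ?sl // big_cons sM iK addmC submK.
have [phi phiP] := embedding_ex f wDl mo_wdeg mo_onto.
pose c (Ut : chart_index (lb_power (anticanonical_bundle X n) d)) P := kap (sval Ut).2 P ^+ d.
pose s (j : 'I_N.+1) (Ut : chart_index (lb_power (anticanonical_bundle X n) d)) (P : X) : k :=
  'X_[mo j].@[rep (sval P)] * c Ut P.
have spec (Ut : chart_index (anticanonical_bundle X n)) P : (sval Ut).1 P ->
    local_coordinates P (sval Ut).2 /\ exists2 e, kap_spec (rep (sval P)) (sval Ut).2 e & e != 0.
  move=> UP; have [oU rt ct] := svalP Ut; have cP := ct P UP; split=> //.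
  have [|e he] := kap_ex w_neq0 (repP (sval P)) (t := (sval Ut).2); first by move=> i; exists (sval Ut).1.
  by exists e => //; exact: (kap_neq0 fm fp fh w_gt0 unit_ratio (repP _) cP he).
have kE t P e := @kapE _ _ _ _ _ _ fm fp fh w_neq0 t P e.
have Mh j : whomog w Dl ('X_[mo j] : {mpoly k[n.+2]}) by rewrite -(mo_wdeg j); exact: whomogXm.
(* The degree of a monomial cancels the weight of the [d] factors [kap]. *)
have DE : (Dl + d * d = d * \sum_i w i)%N by rewrite -mulnDr subnK // ltnW.
exists N, s, phi; split.
- move=> j; split=> [Ut|Ut Vu P UP VP].
    have [oU rt ct] := svalP Ut.
    exact: (canonical_section_regular fm fp fh w_neq0 unit_ratio d0 oU rt (Mh j) DE).
  have [cU [e he e0]] := spec Ut P UP; have [cV [e' he' e'0]] := spec Vu P VP.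
  rewrite /s /c (kE _ _ _ he) (kE _ _ _ he').
  have e'E : e' = \det (jacobian P (sval Vu).2 (sval Ut).2) * e := kap_change fm fp fh w_neq0 (repP _) cU he' he.
  have D0 : \det (jacobian P (sval Vu).2 (sval Ut).2) != 0 by move: e'0; rewrite e'E mulf_eq0 negb_or => /andP [].
  rewrite /= e'E exprMn exprVn mulrCA; congr (_ * _).
  by rewrite mulKf // expf_neq0.
- exact: (embedding_closed fh w_gt0 Dl0 wDl wd dDl axis_coef unit_monos mo_wdeg mo_inj mo_onto decompose phiP).
- move=> P; have [U [t [oU UP rt ct]]] := chart_ex P.
  by exists (exist _ (U, t) (And3 oU rt ct)).
- move=> P Ut UP; have [_ [e he e0]] := spec Ut P UP.
  apply: sval_congr (wpoint_scale (expf_neq0 d e0) (phiP P _ (repP (sval P)))) => j.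
  by rewrite expr1 /s /c (kE _ _ _ he) mulrC.
Qed.
End Ample.

Lemma hypersurface_Fano : nonsingular_Fano X n.
Proof.
split.
- exact: (hypersurface_irreducible fm kp fh w_gt0 n0).
- exact: (hypersurface_dimension fm kp fh w_gt0 n0 unit_ratio local_bound).
- exact: hypersurface_nonsingular.
- exact: hypersurface_ample.
Qed.
End FanoHypersurface.

(** * The weights 1, a, b *)

(** Variables of weight one are added one at a time, so no degree is skipped. *)
Lemma sub_monomial N (w : 'I_N -> nat) (M : 'X_{1..N}) q : (forall i, (0 < M i)%N -> w i = 1%N) ->
  (q <= wdeg w M)%N -> exists2 K, (K <= M)%MM & wdeg w K = q.
Proof.
move=> M1; elim: q => [_|q IH qM]; first by exists 0%MM; [apply/mnm_lepP => i; rewrite mnm0E | exact: wdeg0].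
have [K KM wK] := IH (ltnW qM); have [i Ki] : exists i, (K i < M i)%N.
  apply: contrapT => no; move: qM; rewrite -wK ltnNge /wdeg leq_sum // => i _.
  by rewrite leq_mul // leqNgt; apply/negP => lt; apply: no; exists i.
exists (K + U_(i))%MM.
  apply/mnm_lepP => j; rewrite mnmDE mnm1E; have [<-|_] := eqVneq i j; first by rewrite addn1.
  by rewrite addn0; move/mnm_lepP: KM.
by rewrite wdegD wK -[U_(i)%MM]mulm1n wdegUn muln1 M1 ?addn1 // (leq_ltn_trans _ Ki).
Qed.

Section TwoWeights.
Variables (l a b : nat).
Local Notation w := (wtn a b : 'I_l.+3 -> nat).
Local Notation iX := (widen_ord (leqnSn l.+2) ord_max).
Local Notation iY := (ord_max : 'I_l.+3).
Hypotheses (a0 : (0 < a)%N) (b0 : (0 < b)%N) (ab : coprime a b).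

Lemma wtnX : w iX = a. Proof. by rewrite /wtn join_widen /wt1 eqxx. Qed.
Lemma wtnY : w iY = b. Proof. exact: join_max. Qed.

Lemma wtn_cases (i : 'I_l.+3) : [\/ w i = 1%N, i = iX | i = iY].
Proof.
have [->|[j ->]] := ord_widenP i; first by apply: Or33.
have [->|ne] := eqVneq j ord_max; first by apply: Or32.
by apply: Or31; rewrite /wtn join_widen /wt1 (negPf ne).
Qed.

Lemma sum_wtn : (\sum_i w i = l.+1 + a + b)%N.
Proof.
rewrite big_ord_recr big_ord_recr /= wtnX wtnY; congr (_ + _ + _)%N.
rewrite (eq_bigr (fun=> 1%N)) => [|i _]; first by rewrite sum1_card card_ord.
rewrite /wtn join_widen /wt1 ifF //; apply/negbTE; rewrite -val_eqE /=.
by rewrite neq_ltn ltn_ord.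
Qed.

(** A variable of weight one in the support suffices. Otherwise the support is the pair of heavy
    variables, and a Bezout relation [u a = v b + 1] gives the powers of them to take. *)
Lemma unit_monos_ex (S : 'I_l.+3 -> Prop) : (exists i, S i) ->
  (forall i, w i != 1%N -> exists2 j, j != i & S j) -> exists e0 (M1 M2 : 'X_{1..l.+3}),
  [/\ wdeg w M1 = e0.+1, wdeg w M2 = e0, forall i, (0 < M1 i)%N -> S i & forall i, (0 < M2 i)%N -> S i].
Proof.
move=> [i Si] other; have supp j c : S j -> forall i, (0 < (U_(j) *+ c)%MM i)%N -> S i.
  by move=> Sj i'; rewrite mulmnE mnm1E; case: eqVneq => [<-|_] //; rewrite mul0n.
have [[j wj Sj]|no] := pselect (exists2 j, w j = 1%N & S j).
  exists 0%N, (U_(j) *+ 1)%MM, 0%MM; rewrite wdegUn wj wdeg0; split=> //; first exact: supp.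
  by move=> i'; rewrite mnm0E.
have only j : S j -> j = iX \/ j = iY.
  by case: (wtn_cases j) => [wj Sj||]; [case: no; exists j | left | right].
have [SX SY] : S iX /\ S iY.
  have wi : w i != 1%N by apply/eqP => wi; apply: no; exists i.
  have [j ji Sj] := other i wi.
  by case: (only _ Si) (only _ Sj) ji => Ei [] Ej; rewrite -?Ei -?Ej ?eqxx // Ei Ej eqxx.
case: (egcdnP b a0) => u v uv _; move: uv; rewrite (eqP ab : gcdn a b = 1%N) => uv.
exists (v * b)%N, (U_(iX) *+ u)%MM, (U_(iY) *+ v)%MM.
rewrite !wdegUn wtnX wtnY; split; [by rewrite mulnC uv addn1|by rewrite mulnC|exact: supp|exact: supp].
Qed.

(** If no pure power of degree [D] divides [M], each heavy variable contributes less than [D].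
    Beyond the case of degree [D] itself, the variables of weight one then have enough degree to
    complete the power of the first heavy variable to degree [D]. *)
Lemma divide_monomial D q M : (0 < D)%N -> (a %| D)%N -> (b %| D)%N -> wdeg w M = (D * q.+1)%N ->
  exists2 K, (K <= M)%MM & wdeg w K = D.
Proof.
move=> D0 aD bD wM.
have wD i : (w i %| D)%N by case: (wtn_cases i) => ->; rewrite ?dvd1n ?wtnX ?wtnY.
have w0 i : (0 < w i)%N by exact: wtn_gt0.
have [[i Di]|no] := pselect (exists i, (D <= w i * M i)%N).
  exists (U_(i) *+ (D %/ w i))%MM; last by rewrite wdegUn mulnC divnK.
  apply/mnm_lepP => j; rewrite mulmnE mnm1E; have [<-|_] := eqVneq i j; last by rewrite mul0n.
  by rewrite mul1n leq_divLR // mulnC.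
have small i : (w i * M i < D)%N by rewrite ltnNge; apply/negP => le; apply: no; exists i.
case: q wM => [wM|q wM]; first by exists M; rewrite ?lepm_refl // wM muln1.
have XY : (iX == iY) = false by rewrite -val_eqE /= ltn_eqF.
have YX : (iY == iX) = false by rewrite eq_sym.
set MX := (U_(iX) *+ M iX)%MM; set MY := (U_(iY) *+ M iY)%MM.
have XYM : (MX + MY <= M)%MM.
  apply/mnm_lepP => i; rewrite mnmDE !mulmnE !mnm1E; have [<-|_] := eqVneq iX i.
    by rewrite YX mul0n addn0 mul1n.
  by have [<-|_] := eqVneq iY i; rewrite !mul0n ?mul1n.
have wXY : (wdeg w (M - (MX + MY)) + (a * M iX + b * M iY) = D * q.+2)%N.
  by rewrite -wM -[in RHS](submK XYM) !wdegD !wdegUn wtnX wtnY.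
have [i|//|K KM wK] := @sub_monomial _ w (M - (MX + MY))%MM (D - a * M iX).
- case: (wtn_cases i) => [//|->|->]; rewrite mnmBE mnmDE !mulmnE !mnm1E eqxx ?XY ?YX.
    by rewrite mul0n addn0 mul1n subnn.
  by rewrite mul0n add0n mul1n subnn.
- move: wXY (small iX) (small iY); rewrite wtnX wtnY; move: (a * _)%N (b * _)%N (wdeg _ _) => A B W; clear.
  by rewrite !mulnS; lia.
exists (K + MX)%MM.
  apply/mnm_lepP => i; have := mnm_lepP KM i; have := mnm_lepP XYM i.
  by rewrite mnmBE !mnmDE; lia.
by rewrite wdegD wK wdegUn wtnX subnK // ltnW // -wtnX.
Qed.
End TwoWeights.

Section GenericFano.
Variables (l a b d : nat) (k : closedFieldType) (f : {mpoly k[l.+3]}).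
Local Notation w := (wtn a b : 'I_l.+3 -> nat).

Lemma generic_Fano : [pchar k] =i pred0 -> (0 < l)%N -> (0 < a)%N -> (0 < b)%N -> (0 < d)%N -> coprime a b ->
  (a %| d)%N -> (b %| d)%N -> (1 < d %/ a)%N -> (1 < d %/ b)%N ->
  (l.+1 + a <= d)%N -> (d < l.+1 + a + b)%N -> whomog w d f -> generic d w f ->
  nonsingular_Fano (hypersurface w f) l.+1.
Proof.
move=> ch0 l0 a0 b0 d0 ab ad bd e1 m1 dl dlt fh fg.
pose Y : 'X_{1..l.+3} := (U_(ord_max) *+ (d %/ b))%MM.
have w_gt0 (i : 'I_l.+3) : (0 < w i)%N by exact: wtn_gt0.
have wd (i : 'I_l.+3) : (w i %| d)%N by exact: w_dvd.
have c0 M : wdeg w M = d -> f@_M != 0 by exact: generic_coef_neq0.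
have fY : f@_Y != 0 by apply: c0; rewrite wdegUn wtnY mulnC divnK.
have cM M : wdeg w M = d -> ((f@_Y)^-1 *: f)@_M != 0 by move=> wM; rewrite mcoeffZ; apply: mulf_neq0; [rewrite invr_eq0 | exact: c0].
rewrite -(hypersurface_scale w f (c := (f@_Y)^-1)) ?invr_eq0 //.
have mE : (d %/ b).-1.+1 = (d %/ b)%N by rewrite prednK // ltnW.
apply: (@hypersurface_Fano k l.+1 (d %/ b).-1 d w) => //.
- rewrite mE; exact: (normal_ymonic a0 b0).
- by move=> i il; apply: (normal_kill_prime a0 b0).
- exact: normal_homog.
- by move=> i; rewrite (pcharf0P k).1 // -lt0n.
- by rewrite mE wtnY mulnC divnK.
- by rewrite mE mcoeffZ mulVf.
- by move=> x; apply: (normal_smooth ch0 l0 a0 b0).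
- by rewrite sum_wtn.
- by move=> i _; apply: cM; rewrite wdegUn mulnC divnK.
- exact: unit_monos_ex.
- move=> q M; apply: divide_monomial => //; rewrite ?muln_gt0 ?d0 ?subn_gt0 ?sum_wtn //; exact: dvdn_mulr.
Qed.
End GenericFano.

Theorem theorem1p3 (R : realType) (n a b d : nat) :
  (3 <= n)%N -> (0 < a)%N -> (0 < b)%N -> (0 < d)%N ->
  coprime a b ->
  (a %| d)%N -> (b %| d)%N -> (2 <= d %/ a)%N -> (2 <= d %/ b)%N ->
  (exists p : nat, [/\ prime p, (p %| d %/ b)%N & ~~ (p %| d %/ a)%N]) ->
  (n + a <= d)%N -> (d < n + a + b)%N ->
  very_general (weights a b) d (fun f : {mpoly R[i][n.+2]} =>
    let X := hypersurface (weights a b) f in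
    nonsingular_Fano X n /\ ~ stably_rational X).
Proof.
(* From here on [n = l + 1], where [l] is the degree of the differential form on the cover. *)
move=> n3 a0 b0 d0 ab ad bd e1 m1 [p [pp pm pe]] dl dlt; case: n n3 dl dlt => // l l2 dl dlt.
have ch0 : [pchar R[i]] =i pred0 by exact: Num.Theory.pchar_num.
have -> : weights a b = wtn a b :> ('I_l.+3 -> nat) by rewrite weights_join.
apply: (very_general_generic _ ch0) => [i|f fh fg]; [exact: wtn_gt0 | split].
  by apply: generic_Fano fh fg => //; exact: ltnW.
exact: (generic_not_stably_rational ch0 l2 a0 b0 d0 ab ad bd e1 pp pm pe dl fh fg).
Qed.
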